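(* Assume that $a=0$, $b>0$ and $\lambda\equiv0$ (purely Gaussian case), and let $X^*$ be the integrated supOU process with generating quadruple $(0,b,0,\pi)$, $\pi\neq0$. 1. If $m_{-2}(\pi)=\int_{(0,\infty)}x^{-2}\pi(dx)<\infty$, then $$\limsup_{t\to\infty}\frac{|X^*(t)|}{\sqrt{2b\,m_{-2}(\pi)\,t\log\log t}}=1\quad\text{almost surely.}$$ 2. If $\pi$ has a density $p$ such that $p(x)\sim\alpha\,\ell(x^{-1})x^\alpha$ as $x\downarrow0$ for some $\alpha\in(0,1)$ and some $\ell$ slowly varying at infinity, then $$\limsup_{t\to\infty}\frac{|X^*(t)|}{\widetilde\sigma\,\ell(t)^{1/2}\,t^{1-\alpha/2}\sqrt{2\log\log t}}=1\quad\text{almost surely,}$$ where $\widetilde\sigma^2=b\,\frac{\Gamma(1+\alpha)}{(2-\alpha)(1-\alpha)}$.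
   Context: Let $\pi$ be a measure on $(0,\infty)$ with $m_{-1}(\pi)=\int_{(0,\infty)}x^{-1}\pi(dx)<\infty$. Let $\Lambda$ be the homogeneous Gaussian independently scattered random measure on $(0,\infty)\times\mathbb R$ with generating quadruple $(0,b,0,\pi)$: for disjoint bounded Borel sets $A_1,A_2,\dots$ the variables $\Lambda(A_1),\Lambda(A_2),\dots$ are independent, and for bounded Borel $A$, $\log\mathbf E e^{i\theta\Lambda(A)}=-\tfrac{b\theta^2}{2}(\pi\times\mathrm{Leb})(A)$. The supOU process is $X(t)=\int\!\!\int_{(0,\infty)\times(-\infty,t]}e^{-x(t-s)}\Lambda(dx,ds)$, $t\in\mathbb R$, taken in a measurable modification. The integrated supOU process is $X^*(t)=\int_0^tX(u)\,du$, $t\ge0$; a.s. $X^*(t)=\int\!\!\int_{(0,\infty)\times\mathbb R}f_t(x,s)\Lambda(dx,ds)$, where $f_t(x,s)=x^{-1}(1-e^{-xt})e^{xs}$ for $s\le0$ and $f_t(x,s)=x^{-1}(1-e^{-x(t-s)})\mathbf 1(s\le t)$ for $s>0$. *)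

(* Defs.v *)
From HB Require Import structures.
From mathcomp Require Import all_boot all_order all_algebra.
From mathcomp Require Import finmap complex.
From mathcomp Require Import all_classical all_reals all_analysis.

Set Implicit Arguments.
Unset Strict Implicit.
Unset Printing Implicit Defensive.

Import Order.TTheory GRing.Theory Num.Theory.
Import numFieldNormedType.Exports HBSimple.

Local Open Scope classical_set_scope.
Local Open Scope ring_scope.

Section RandomVariables.
Context {d : measure_display} {T : measurableType d} {R : realType}.
Variable P : probability T R.

Definition mutually_independent (X : nat -> {RV P >-> R}) : Prop :=
  forall (J : {fset nat}) (B : nat -> set R), (forall i, measurable (B i)) ->
    P (\bigcap_(i in [set` J]) X i @^-1` B i) =
    (\prod_(i <- J) P (X i @^-1` B i))%E.

(* E exp(i theta Y) = E cos(theta Y) + i E sin(theta Y) *)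
Definition charfun (Y : T -> R) (theta : R) : R[i] :=
  Complex (\int[P]_w cos (theta * Y w)) (\int[P]_w sin (theta * Y w)).

Definition cvg_in_probability (Y : nat -> T -> R) (Z : T -> R) : Prop :=
  forall e : R, 0 < e ->
    P [set w | e <= `|Y n w - Z w|] @[n --> \oo] --> 0%E.

End RandomVariables.

(* A measure on (0, +oo) is encoded as a Borel measure on R that does not
   charge ]-oo, 0]. *)
Definition on_half_line {R : realType}
    (pi : {measure set R -> \bar R}) : Prop :=
  pi [set x : R | x <= 0] = 0%E.

Definition moment {R : realType}
    (pi : {measure set R -> \bar R}) (k : int) : \bar R :=
  (\int[pi]_(x in `]0%R, +oo[) (x ^ k)%R%:E)%E.

Definition bounded_borel {R : realType} (A : set (R * R)) : Prop :=
  [/\ measurable A, A `<=` `]0, +oo[ `*` [set: R] & bounded_set A].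

Section RandomMeasure.
Context {d : measure_display} {T : measurableType d} {R : realType}.
Variable P : probability T R.
Variable pi : {measure set R -> \bar R}.

(* The random measure only matters on bounded Borel subsets of (0, +oo) x R;
   its values on other sets are unspecified. *)
Implicit Type Lambda : set (R * R) -> {RV P >-> R}.

Definition independently_scattered_random_measure Lambda : Prop :=
  (forall A : nat -> set (R * R), (forall n, bounded_borel (A n)) ->
     trivIset setT A -> mutually_independent (fun n => Lambda (A n))) /\
  (forall A : nat -> set (R * R), (forall n, bounded_borel (A n)) ->
     trivIset setT A -> bounded_borel (\bigcup_n A n) ->
     {ae P, forall w, [series Lambda (A n) w]_n @ \oo -->
                      (Lambda (\bigcup_n A n) w : R)}).

(* generating quadruple (0, b, 0, pi) *)
Definition gaussian_random_measure (b : R) Lambda : Prop :=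
  independently_scattered_random_measure Lambda /\
  forall A, bounded_borel A -> forall theta : R,
    charfun P (Lambda A) theta =
    (expR (- (b * theta ^+ 2 / 2) * fine ((pi \x lebesgue_measure) A)%E))%:C%C.

(* The integral over A of a simple function vanishing outside a bounded Borel
   set: the level set of the value 0 may be unbounded, but its weight is 0. *)
Definition simple_stoch_integral Lambda (f : {sfun (R * R)%type >-> R})
    (A : set (R * R)) (w : T) : R :=
  \sum_(c \in range f) c * Lambda (A `&` f @^-1` [set c]) w.

(* f is Lambda-integrable in the sense of Rajput and Rosinski, and Y is a
   version of its integral. The control measure is b (pi x Leb), which has the
   same null sets as pi x Leb when b > 0. *)
Definition is_stoch_integral Lambda (f : R * R -> R) (Y : T -> R) : Prop :=
  exists f_ : nat -> {sfun (R * R)%type >-> R},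
    [/\ forall n, bounded_borel (f_ n @^-1` [set~ 0]),
        {ae (pi \x lebesgue_measure)%E, forall z, f_ n z @[n --> \oo] --> f z},
        forall A, measurable A -> exists Z : {RV P >-> R},
          cvg_in_probability P (fun n => simple_stoch_integral Lambda (f_ n) A) Z
      & cvg_in_probability P
          (fun n => simple_stoch_integral Lambda (f_ n) setT) Y].

Definition supOU_kernel (t : R) (z : R * R) : R :=
  expR (- (z.1 * (t - z.2))) * \1_(`]0, +oo[ `*` `]-oo, t]) z.

Definition supOU Lambda (X : R -> T -> R) : Prop :=
  measurable_fun [set: R * T] (fun z => X z.1 z.2) /\
  forall t, is_stoch_integral Lambda (supOU_kernel t) (X t).

End RandomMeasure.

Definition integrated_process {T : Type} {R : realType} (X : R -> T -> R)
    (t : R) (w : T) : R :=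
  \int[lebesgue_measure]_(u in `[0, t]) X u w.

Definition has_density {R : realType}
    (pi : {measure set R -> \bar R}) (p : R -> R) : Prop :=
  [/\ measurable_fun (`]0, +oo[ : set R) p, forall x, 0 < x -> 0 <= p x
    & forall A : set R, measurable A -> A `<=` `]0, +oo[ ->
        pi A = (\int[lebesgue_measure]_(x in A) (p x)%:E)%E].

Definition slowly_varying {R : realType} (ell : R -> R) : Prop :=
  (exists M : R, measurable_fun (`[M, +oo[ : set R) ell /\ forall t, M <= t -> 0 < ell t) /\
  forall c : R, 0 < c -> ell (c * t) / ell t @[t --> +oo] --> (1 : R).

Definition Gamma {R : realType} (a : R) : R :=
  \int[lebesgue_measure]_(x in `]0, +oo[) (x `^ (a - 1) * expR (- x)).

Definition limsup_pinfty {R : realType} (f : R -> R) : \bar R :=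
  limf_esup (EFin \o f) (pinfty_nbhs R).

(* Main.v *)
Require Import Defs.
From HB Require Import structures.
From mathcomp Require Import all_boot all_order all_algebra.
From mathcomp Require Import zify ring lra finmap.
From mathcomp Require Import all_classical all_reals all_analysis measurable_realfun.
Import Order.TTheory GRing.Theory Num.Theory.
Import numFieldNormedType.Exports HBSimple HBNNSimple.
Local Open Scope classical_set_scope.
Local Open Scope ring_scope.

Set Implicit Arguments.
Unset Strict Implicit.
Unset Printing Implicit Defensive.

(** [X*] is a centred Gaussian process with stationary increments, and
    [E (X* t - X* s)^2 = V |t - s|], where
    [V t = b * int x^-3 (x t - 1 + exp (- x t)) pi(dx)].  The function [V]
    satisfies [V (s t) <= s V t] for [s <= 1], [V t - V (t - s) <= 2 (s / t) V t],
    and [V t <= C (t / s)^(2 - gam) V s] for large [s <= t].  These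
    properties alone yield the law of the iterated logarithm with normalization
    [sqrt (2 V t log log t)].
    Upper half: the oscillation over a geometric block [[t, (1 + dl) t]] is
    controlled by dyadic chaining and Gaussian tails, and Borel-Cantelli applies.
    Lower half: along [t_n = exp (A n log n)] the normalized variables [Z_n] are
    nearly uncorrelated, by the growth condition on [V].  Instead of
    the events [Z_n >= a_n] one sums the smooth bumps [exp (- s^2 (Z_n - a_n)^2 / 2)],
    whose means and covariances are explicit Fourier integrals; by Chebyshev's
    inequality the sum is almost surely infinite, so [Z_n] is infinitely often
    close to [a_n].
    The two cases differ only in the asymptotics of [V]: dominated convergence
    gives [V t ~ b m_{-2}(pi) t] in the first one, and, with Potter bounds,
    [V t ~ sigma^2 ell(t) t^(2 - alpha)] in the second one.

    Gaussianity of [X*]: independent scattering gives the characteristic function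
    of integrals of simple functions; [L^2] limits then show that linear
    combinations of values of [X] are Gaussian with covariance
    [r h = (b / 2) int x^-1 exp (- x |h|) pi(dx)], and [X*] is an [L^1] limit of
    Riemann sums. *)

(** * Measure-theoretic and differential preliminaries *)

(** The data give independence only for events and the law of [Lambda] only one set at a time. Being
    centred Gaussian is therefore encoded as an identity for [E cos (th Y + c)], and moments, tails
    and means of test functions are all derived from it by superposing cosines with a normal weight;
    no inversion or uniqueness theorem intervenes. The same choice shapes the lower half. Indicators
    of [Z_n >= a_n] would require a comparison of joint densities, whereas a Gaussian bump has a
    Gaussian Fourier transform, and its covariance is bounded by the correlation itself, uniformly
    in the levels [a_n]. The means are at least of order [1/n] and the correlations at most of order
    [n^-3], so the variance of the partial sums stays comparable with their mean. For the stochastic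
    integral only convergence in probability is available. Variances of Gaussian variables converge
    along such limits, which gives back the mean-square theory and the isometry. The exponent [gam]
    is 1 in the first case and [alpha / 2] in the second, where half of [alpha] pays for the Potter
    bounds. *)

Section density.
Context d (T : measurableType d) (R : realType).
Variables (mu nu : {measure set T -> \bar R}) (D : set T) (h : T -> R).
Hypothesis mD : measurable D.
Hypothesis mh : measurable_fun D h.
Hypothesis h0 : forall x, D x -> 0 <= h x.
Hypothesis nuE : forall A, measurable A -> A `<=` D ->
  nu A = (\int[mu]_(x in A) (h x)%:E)%E.

(** Monotone approximation by simple functions on both sides reduces the change of measure to
    indicators, where it is the hypothesis [nuE]. It serves for the normal law and for the density
    of [pi] near 0. *)
Lemma ge0_integral_density (f : T -> R) : measurable_fun D f ->
  (forall x, D x -> 0 <= f x) ->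
  (\int[nu]_(x in D) (f x)%:E = \int[mu]_(x in D) (f x * h x)%:E)%E.
Proof.
move=> mf f0.
have mEf : measurable_fun D (fun x => (f x)%:E) by exact/measurable_EFinP.
have Ef0 : forall x, D x -> (0 <= (f x)%:E)%E by move=> x Dx; rewrite lee_fin f0.
pose g := nnsfun_approx mD mEf.
have gf x : D x -> EFin \o g ^~ x @ \oo --> (f x)%:E.
  by move=> Dx; exact: (cvg_nnsfun_approx mD mEf Ef0 Dx).
have gnd x : D x -> nondecreasing_seq (fun n => (g n x)%:E).
  by move=> Dx m n mn; rewrite lee_fin; exact/lefP/nd_nnsfun_approx.
have H1 : (\int[nu]_(x in D) (g n x)%:E @[n --> \oo] -->
          \int[nu]_(x in D) (f x)%:E)%E.
  have -> : (\int[nu]_(x in D) (f x)%:E =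
     \int[nu]_(x in D) (fun x => limn (fun n => (g n x)%:E)) x)%E.
    by apply: eq_integral => x /set_mem Dx; apply/esym/cvg_lim => //; exact: gf.
  apply: cvg_monotone_convergence => //.
  - by move=> n; apply/measurable_EFinP; exact: measurable_funTS.
  - by move=> n x _; rewrite lee_fin.
have H2 : (\int[mu]_(x in D) (g n x * h x)%:E @[n --> \oo] -->
          \int[mu]_(x in D) (f x * h x)%:E)%E.
  have -> : (\int[mu]_(x in D) (f x * h x)%:E =
     \int[mu]_(x in D) (fun x => limn (fun n => (g n x * h x)%:E)) x)%E.
    apply: eq_integral => x /set_mem Dx; apply/esym/cvg_lim => //.
    under eq_fun do rewrite EFinM.
    by rewrite EFinM; apply: cvgeZr => //; exact: gf.
  apply: cvg_monotone_convergence => //.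
  - move=> n; apply/measurable_EFinP; apply: measurable_funM => //.
    exact: measurable_funTS.
  - by move=> n x Dx; rewrite lee_fin mulr_ge0// h0.
  - by move=> x Dx m n mn; rewrite lee_fin ler_wpM2r ?h0// -lee_fin; exact: gnd.
suff E n : (\int[nu]_(x in D) (g n x)%:E = \int[mu]_(x in D) (g n x * h x)%:E)%E.
  move: H1; under eq_fun do rewrite E; move=> H1.
  exact: (cvg_unique _ H1 H2).

have gE x : (g n x)%:E = (\sum_(y \in range (g n)) (y * \1_(g n @^-1` [set y]) x)%:E)%E.
  by rewrite fsumEFin// [in LHS]fimfunE.
have mgn y : measurable (g n @^-1` [set y]) by [].
have y0 y x : 0 <= y * \1_(g n @^-1` [set y]) x.
  rewrite -lee_fin; exact: nnfun_muleindic_ge0.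
transitivity (\sum_(y \in range (g n))
    \int[nu]_(x in D) (y * \1_(g n @^-1` [set y]) x)%:E)%E.
  under eq_integral do rewrite gE.
  rewrite ge0_integral_fsum// => [y|y x _]; last by rewrite lee_fin.
  by apply/measurable_EFinP; apply: measurable_funM => //; apply: measurable_funTS.
transitivity (\sum_(y \in range (g n))
    \int[mu]_(x in D) (y * \1_(g n @^-1` [set y]) x * h x)%:E)%E; last first.
  rewrite -ge0_integral_fsum//; last 2 first.
  - move=> y; apply/measurable_EFinP; apply: measurable_funM => //.
    by apply: measurable_funM => //; apply: measurable_funTS.
  - by move=> y x Dx; rewrite lee_fin mulr_ge0// h0.
  apply: eq_integral => x /set_mem Dx; 
  transitivity ((g n x)%:E * (h x)%:E)%E; last by rewrite -EFinM.
  rewrite gE ge0_mule_fsuml; last by move=> y; rewrite lee_fin.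
  by apply: eq_fsbigr => y _; rewrite -EFinM.
apply: eq_fsbigr => y /set_mem[z _ <-]; set A := _ @^-1` _.
have mA : measurable A by exact: mgn.
under eq_integral do rewrite EFinM.
under [RHS]eq_integral do rewrite -mulrA EFinM.
rewrite !ge0_integralZl//; last first.
- by rewrite lee_fin.
- exact/measurable_EFinP/measurable_funTS.
- by rewrite lee_fin.
- by move=> x Dx; rewrite lee_fin mulr_ge0// h0.
- by apply/measurable_EFinP/measurable_funM => //; exact: measurable_funTS.
congr (_ * _)%E; rewrite integral_indic// setIC nuE//; last exact: measurableI.
rewrite integral_mkcondr; apply: eq_integral => x /set_mem Dx.
by rewrite patchE indicE; case: ifP; rewrite ?mul1r ?mul0r.
Qed.
End density.

Section integrable_real.
Context d (T : measurableType d) (R : realType).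
Variables (mu : {measure set T -> \bar R}) (D : set T).
Hypothesis mD : measurable D.
Implicit Types f g : T -> R.

Lemma integrableZR k f : mu.-integrable D (EFin \o f) ->
  mu.-integrable D (EFin \o (fun x => k * f x)).
Proof. by move=> If; rewrite /comp; under eq_fun do rewrite EFinM; exact: integrableZl. Qed.

Lemma integrableDR f g : mu.-integrable D (EFin \o f) ->
  mu.-integrable D (EFin \o g) -> mu.-integrable D (EFin \o (fun x => f x + g x)).
Proof. by move=> If Ig; rewrite /comp; under eq_fun do rewrite EFinD; exact: integrableD. Qed.

Lemma integrableBR f g : mu.-integrable D (EFin \o f) ->
  mu.-integrable D (EFin \o g) -> mu.-integrable D (EFin \o (fun x => f x - g x)).
Proof. by move=> If Ig; rewrite /comp; under eq_fun do rewrite EFinB; exact: integrableB. Qed.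

End integrable_real.

Lemma cvgn_unique (R : realType) (u : nat -> R) (a b : R) :
  u n @[n --> \oo] --> a -> u n @[n --> \oo] --> b -> a = b.
Proof. by move=> ua ub; exact: (cvg_unique _ ua ub). Qed.

Lemma cvgn_expR (R : realType) (u : nat -> R) (a : R) :
  u n @[n --> \oo] --> a -> expR (u n) @[n --> \oo] --> expR a.
Proof. by move=> ua; apply: (cvg_comp u expR ua); exact: continuous_expR. Qed.

Section bounded.
Context d (T : measurableType d) (R : realType).
Variable P : probability T R.

Lemma bounded_integrable (f : T -> R) (M : R) : measurable_fun setT f ->
  (forall w, `|f w| <= M) -> P.-integrable setT (EFin \o f).
Proof.
move=> mf fM; apply: measurable_bounded_integrable => //.
  by rewrite (le_lt_trans (probability_le1 _ _))// ltry.
exists M; split; first exact: num_real.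
by move=> x Mx w _ /=; rewrite (le_trans (fM w))// ltW.
Qed.

Lemma Rintegral_cstT (c : R) : \int[P]_w c = c.
Proof. rewrite Rintegral_cst//. transitivity (c * 1); last by rewrite mulr1.
congr (_ * _); exact: (congr1 fine (probability_setT P)).
Qed.

Lemma Rintegral_bounded (f : T -> R) (M : R) : measurable_fun setT f ->
  (forall w, `|f w| <= M) -> `|\int[P]_w f w| <= M.
Proof.
move=> mf fM; have If := bounded_integrable mf fM.
apply: le_trans (le_normr_Rintegral _ If) _ => //.
rewrite -[leRHS]Rintegral_cstT; apply: le_Rintegral => //.
  apply: (@bounded_integrable _ M); first exact: measurableT_comp.
  by move=> w; rewrite normr_id.
by apply: (@bounded_integrable _ `|M|) => // w.
Qed.

End bounded.

Section bounded_fubini.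
Context d1 d2 (T1 : measurableType d1) (T2 : measurableType d2) (R : realType).
Variables (P : probability T1 R) (Q : probability T2 R).

Lemma bounded_Fubini (f : T1 * T2 -> R) (M : R) : measurable_fun setT f ->
  (forall z, `|f z| <= M) ->
  \int[P]_x (\int[Q]_y f (x, y)) = \int[Q]_y (\int[P]_x f (x, y)).
Proof.
move=> mf fM.
have If : (P \x Q)%E.-integrable setT (EFin \o f).
  exact: bounded_integrable mf fM.
have := integral12_prod_meas1 If; rewrite -(integral21_prod_meas1 If).
rewrite /fubini_F /fubini_G => E.
rewrite /Rintegral; congr fine.
have m1 x : Q.-integrable setT (EFin \o (fun y => f (x, y))).
  apply: (@bounded_integrable _ _ _ _ _ M) => //.
  exact: measurableT_comp mf (pair1_measurable x).
have m2 y : P.-integrable setT (EFin \o (fun x => f (x, y))).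
  apply: (@bounded_integrable _ _ _ _ _ M) => //.
  exact: measurableT_comp mf (pair2_measurable y).
transitivity (\int[P]_x \int[Q]_y (EFin \o f) (x, y))%E.
  by apply: eq_integral => x _; rewrite fineK//; apply: integrable_fin_num (m1 x).
rewrite E; apply: eq_integral => y _; rewrite fineK//.
by apply: integrable_fin_num (m2 y).
Qed.

Lemma measurable_bounded_fubini_F (f : T1 * T2 -> R) (M : R) :
  measurable_fun setT f -> (forall z, `|f z| <= M) ->
  measurable_fun setT (fun x => \int[Q]_y f (x, y)).
Proof.
move=> mf fM.
have If : (P \x Q)%E.-integrable setT (EFin \o f).
  exact: bounded_integrable mf fM.
have := measurable_fubini_F If.
by move=> /(measurableT_comp (@fine_measurable R _ measurableT)).
Qed.

End bounded_fubini.

Section pointwise_derivatives.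
Context (R : realType).
Implicit Types (f g : R -> R) (x a b c : R).

(* A non-class copy of [is_derive], so that [apply:] does not trigger instance
   resolution on the premises of the rules below. *)
Definition has_deriv f x a : Prop := is_derive x 1 f a.

Lemma deriv_ext f g x a b : has_deriv f x a -> f =1 g -> a = b -> has_deriv g x b.
Proof. by move=> H /funext <- <-. Qed.

Lemma deriv_cst c x : has_deriv (fun=> c) x 0.
Proof. exact: is_derive_cst. Qed.

Lemma deriv_id x : has_deriv (fun y => y) x 1.
Proof. exact: is_derive_id. Qed.

Lemma derivD f g x a b : has_deriv f x a -> has_deriv g x b ->
  has_deriv (fun y => f y + g y) x (a + b).
Proof. by move=> Hf Hg; exact: (is_deriveD Hf Hg). Qed.

Lemma derivN f x a : has_deriv f x a -> has_deriv (fun y => - f y) x (- a).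
Proof. by move=> Hf; exact: (is_deriveN Hf). Qed.

Lemma derivB f g x a b : has_deriv f x a -> has_deriv g x b ->
  has_deriv (fun y => f y - g y) x (a - b).
Proof. by move=> Hf Hg; apply: derivD => //; apply: derivN. Qed.

Lemma derivM f g x a b : has_deriv f x a -> has_deriv g x b ->
  has_deriv (fun y => f y * g y) x (a * g x + f x * b).
Proof.
move=> Hf Hg; apply: deriv_ext (is_deriveM Hf Hg) _ _ => //=.
by rewrite /GRing.scale/= addrC mulrC.
Qed.

Lemma derivZ c f x a : has_deriv f x a -> has_deriv (fun y => c * f y) x (c * a).
Proof.
move=> Hf; apply: deriv_ext (derivM (deriv_cst c x) Hf) _ _ => //.
by rewrite mul0r add0r.
Qed.

Lemma derivZr c f x a : has_deriv f x a -> has_deriv (fun y => f y * c) x (a * c).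
Proof.
move=> Hf; apply: deriv_ext (derivM Hf (deriv_cst c x)) _ _ => //.
by rewrite mulr0 addr0.
Qed.

Lemma deriv_comp f g x a b : has_deriv f (g x) a -> has_deriv g x b ->
  has_deriv (fun y => f (g y)) x (a * b).
Proof. by move=> Hf Hg; exact: (is_derive1_comp Hf Hg). Qed.

Lemma deriv_expR f x a : has_deriv f x a ->
  has_deriv (fun y => expR (f y)) x (expR (f x) * a).
Proof. by move=> Hf; apply: deriv_comp => //; exact: is_derive_expR. Qed.

Lemma deriv_cos f x a : has_deriv f x a ->
  has_deriv (fun y => cos (f y)) x (- sin (f x) * a).
Proof. by move=> Hf; apply: (@deriv_comp (@cos R)) => //; exact: is_derive_cos. Qed.

Lemma deriv_sin f x a : has_deriv f x a ->
  has_deriv (fun y => sin (f y)) x (cos (f x) * a).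
Proof. by move=> Hf; apply: (@deriv_comp (@sin R)) => //; exact: is_derive_sin. Qed.

Lemma deriv_sqr x : has_deriv (fun y => y ^+ 2) x (2 * x).
Proof.
apply: deriv_ext (derivM (deriv_id x) (deriv_id x)) _ _ => [y|]; first by rewrite expr2.
by rewrite mul1r mulr1 mulr_natl mulr2n.
Qed.

Lemma deriv_continuous f x a : has_deriv f x a -> {for x, continuous f}.
Proof. move=> H; apply: differentiable_continuous; apply/derivable1_diffP.
exact: (@ex_derive _ _ _ _ _ _ _ H). Qed.

Lemma FTC_deriv (f F : R -> R) (a b : R) : a <= b ->
  (forall x, a <= x <= b -> has_deriv F x (f x)) ->
  (forall x, a <= x <= b -> {for x, continuous f}) ->
  (\int[lebesgue_measure]_(x in `[a, b]) (f x)%:E = (F b - F a)%:E)%E.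
Proof.
rewrite le_eqVlt => /predU1P[->|ab] dF cf.
  by rewrite set_itv1 integral_set1 subrr.
rewrite (@continuous_FTC2 _ f F)//.
- apply: continuous_in_subspaceT => x; rewrite inE/= in_itv/= => xab; exact: cf.
- split.
  + move=> x; rewrite in_itv/= => /andP[ax xb].
    by apply: ex_derive; apply: dF; rewrite !ltW.
  + by apply: cvg_at_right_filter; apply: (@deriv_continuous _ _ (f a)); apply: dF; rewrite lexx ltW.
  + by apply: cvg_at_left_filter; apply: (@deriv_continuous _ _ (f b)); apply: dF; rewrite lexx ltW.
- move=> x; rewrite in_itv/= => /andP[ax xb]; rewrite derive1E.
  by apply: (@derive_val _ _ _ _ _ _ _ (dF x _)); rewrite !ltW.
Qed.

End pointwise_derivatives.

Section dominated.
Context d (T : measurableType d) (R : realType).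
Variable mu : {measure set T -> \bar R}.

Lemma Rdominated_cvg (D : set T) (f_ : nat -> T -> R) (f g : T -> R) :
  measurable D -> (forall n, measurable_fun D (f_ n)) -> measurable_fun D f ->
  (forall x, D x -> f_ n x @[n --> \oo] --> f x) ->
  mu.-integrable D (EFin \o g) ->
  (forall n x, D x -> `|f_ n x| <= g x) ->
  \int[mu]_(x in D) f_ n x @[n --> \oo] --> \int[mu]_(x in D) f x.
Proof.
move=> mD mf_ mf ff Ig fg.
have fle x : D x -> `|f x| <= g x.
  move=> Dx; have /cvg_norm := ff x Dx.
  by move=> H; apply: (cvgr_to_le H); apply: nearW => n; exact: fg.
have If : mu.-integrable D (EFin \o f).
  apply: le_integrable Ig => //; first exact/measurable_EFinP.
  by move=> x Dx; rewrite lee_fin (le_trans (fle _ Dx))// ler_norm.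
apply: fine_cvg; rewrite fineK; last exact: integrable_fin_num.
apply: (@dominated_cvg _ _ _ _ _ mD (fun n x => (f_ n x)%:E) _ (EFin \o g)) => //.
- by move=> n; exact/measurable_EFinP.
- by move=> x Dx; apply: cvg_EFin; [exact: nearW|exact: ff].
Qed.

End dominated.

(** * Centred Gaussian variables and their Fourier transforms *)

Section normal_fourier.
Context (R : realType).
Local Notation mu := (@lebesgue_measure R).

(** The integrals over [[-n, n]] are [F n - F (- n)] and tend to 0; dominated convergence identifies
    their limit with the integral over the line. *)
Lemma Rintegral_deriv_eq0 (f F : R -> R) : (forall x : R, has_deriv F x (f x)) ->
  continuous f -> mu.-integrable setT (EFin \o f) ->
  F x @[x --> +oo] --> (0 : R) -> F x @[x --> -oo] --> (0 : R) ->
  \int[mu]_x f x = 0.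
Proof.
move=> dF cf If Fy FNy.
have mf : measurable_fun setT f by exact: continuous_measurable_fun.
pose D (n : nat) := `[- n%:R, n%:R : R]%classic.
have H1 : \int[mu]_x (f x * \1_(D n) x) @[n --> \oo] --> \int[mu]_x f x.
  apply: (@Rdominated_cvg _ _ _ mu setT _ f (fun x => `|f x|)) => //.
  - by move=> n; apply: measurable_funM; [exact: mf|apply: measurable_indic; exact: measurable_itv].
  - move=> x _; apply: cvg_near_cst.
    near=> n; rewrite indicE mem_set ?mulr1// /D/= in_itv/=.
    have : `|x| <= n%:R by near: n; exact: nbhs_infty_ger.
    by rewrite ler_norml.
  - exact: integrable_norm.
  - by move=> n x _; rewrite normrM ler_piMr// indicE; case: (_ \in _); rewrite ?normr1 ?normr0.
have H2 n : \int[mu]_x (f x * \1_(D n) x) = F n%:R - F (- n%:R).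
  have n0 : - n%:R <= n%:R :> R by rewrite (@le_trans _ _ 0)// oppr_le0.
  have := @FTC_deriv _ f F _ _ n0 (fun x _ => dF x) (fun x _ => @cf x).
  move/(congr1 fine) => /= <-.
  rewrite [RHS](@Rintegral_mkcond _ _ _ mu); congr fine.
  by apply: eq_integral => x _; rewrite patchE indicE; case: ifP; rewrite ?mulr1 ?mulr0.
have H3 : \int[mu]_x (f x * \1_(D n) x) @[n --> \oo] --> (0 - 0 : R).
  under eq_fun do rewrite H2.
  apply: cvgB; first exact: (cvg_comp _ _ (@cvgr_idn R) Fy).
  apply: (cvg_comp (fun n : nat => - n%:R : R) F _ FNy).
  by apply/cvgNrNy; exact: cvgr_idn.
by rewrite (cvg_unique _ H1 H3)// subrr.
Unshelve. all: end_near. Qed.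

Variable s : R.
Hypothesis s0 : 0 < s.
Let s_neq0 : s != 0. Proof. by rewrite gt_eqF. Qed.

Let pdf : R -> R := normal_pdf 0 s.

Let pdfE x : pdf x = normal_peak s * expR (- x ^+ 2 / (s ^+ 2 *+ 2)).
Proof. by rewrite /pdf normal_pdfE// /normal_fun subr0. Qed.

Let pdf_ge0 x : 0 <= pdf x. Proof. exact: normal_pdf_ge0. Qed.

Let Ipdf : mu.-integrable setT (EFin \o pdf).
Proof. exact: integrable_normal_pdf. Qed.

Let mpdf : measurable_fun setT pdf. Proof. exact: measurable_normal_pdf. Qed.

Let dpdf (x : R) : has_deriv pdf x (- (x / s ^+ 2) * pdf x).
Proof.
apply: (deriv_ext (derivZ (normal_peak s) (deriv_expR (derivZr (s ^+ 2 *+ 2)^-1 (derivN (deriv_sqr x)))))).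
- by move=> y; rewrite pdfE.
- rewrite pdfE; field.
  by rewrite s_neq0.
Qed.

(* [1 + z <= exp z] and AM-GM *)
Let xpdf_le x : `|x| * pdf x <= 2 * s * (normal_peak s / normal_peak (2 * s)) * normal_pdf 0 (2 * s) x.
Proof.
have s20 : 2 * s != 0 by rewrite mulf_neq0.
rewrite normal_pdfE// /normal_fun subr0 pdfE.
have p0 : normal_peak (2 * s) != 0 by rewrite gt_eqF// normal_peak_gt0.
rewrite [leRHS](_ : _ = normal_peak s * (2 * s * expR (- x ^+ 2 / ((2 * s) ^+ 2 *+ 2)))); last first.
  by field; rewrite p0.
rewrite mulrCA ler_pM2l ?normal_peak_gt0//.
(* A quarter of the exponent is that of the normal density of width [2 s]; the other three quarters
   absorb the factor [|x|]. *)
rewrite (_ : - x ^+ 2 / (s ^+ 2 *+ 2) = - x ^+ 2 / ((2 * s) ^+ 2 *+ 2) - 3 * (x ^+ 2 / (8 * s ^+ 2))); last first.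
  by field; rewrite s_neq0.
rewrite expRD mulrCA [leRHS]mulrC ler_pM2l ?expR_gt0//.
rewrite expRN -[leLHS]/(_ / _) ler_pdivrMr ?expR_gt0//.
apply: (@le_trans _ _ (2 * s * (1 + 3 * (x ^+ 2 / (8 * s ^+ 2))))); last first.
  by rewrite ler_pM2l ?mulr_gt0// expR_ge1Dx.
rewrite (_ : 2 * s * _ = 2 * s + (3 / 4) * (`|x| ^+ 2 / s)); last first.
  by rewrite real_normK ?num_real//; field.
rewrite -subr_ge0 (_ : _ - _ = (3 / 4 * (`|x| - (2 / 3) * s) ^+ 2 + (5 / 3) * s ^+ 2) / s); last by field.
apply: divr_ge0; last exact: ltW.
by apply: addr_ge0; apply: mulr_ge0; rewrite ?sqr_ge0//; lra.
Qed.

Let Ixpdf : mu.-integrable setT (EFin \o (fun x => `|x| * pdf x)).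
Proof.
pose C := 2 * s * (normal_peak s / normal_peak (2 * s)).
apply: (@le_integrable _ _ _ mu setT measurableT _ (fun x => (C * normal_pdf 0 (2 * s) x)%:E)).
- by apply/measurable_EFinP; apply: measurable_funM; [exact: normr_measurable|exact: mpdf].
- move=> x _ /=; rewrite lee_fin ger0_norm ?mulr_ge0//.
  by rewrite (le_trans _ (ler_norm _))//; exact: xpdf_le.
- under eq_fun do rewrite EFinM.
  by apply: integrableZl => //; exact: integrable_normal_pdf.
Qed.

Let mcosM y : measurable_fun setT (fun x : R => cos (y * x)).
Proof. by apply: continuous_measurable_fun => x; apply: continuous_comp; [apply: mulrl_continuous|apply: continuous_cos]. Qed.

Let msinM y : measurable_fun setT (fun x : R => sin (y * x)).
Proof. by apply: continuous_measurable_fun => x; apply: continuous_comp; [apply: mulrl_continuous|apply: continuous_sin]. Qed.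

Let cos_le1n (x : R) : `|cos x| <= 1.
Proof. by rewrite ler_norml cos_geN1 cos_le1. Qed.

Let sin_le1n (x : R) : `|sin x| <= 1.
Proof. by rewrite ler_norml sin_geN1 sin_le1. Qed.

Let Icos y : mu.-integrable setT (EFin \o (fun x => cos (y * x) * pdf x)).
Proof.
apply: (le_integrable _ _ _ Ipdf) => //.
  by apply/measurable_EFinP; apply: measurable_funM; [exact: mcosM|exact: mpdf].
by move=> x _ /=; rewrite lee_fin normrM ler_piMl.
Qed.

Let Isin y : mu.-integrable setT (EFin \o (fun x => x * sin (y * x) * pdf x)).
Proof.
apply: (le_integrable _ _ _ Ixpdf) => //.
  apply/measurable_EFinP; apply: measurable_funM; last exact: mpdf.
  by apply: measurable_funM; [exact: measurable_id|exact: msinM].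
move=> x _ /=; rewrite lee_fin -mulrA !normrM normr_id mulrCA.
by rewrite ler_piMl// mulr_ge0.
Qed.

Let F y := \int[mu]_x (cos (y * x) * pdf x).

Let dF (y : R) : has_deriv F y (- \int[mu]_x (x * sin (y * x) * pdf x)).
Proof.
have dc (x z : R) : has_deriv (fun z => cos (z * x) * pdf x) z (- (x * sin (z * x) * pdf x)).
  apply: (deriv_ext (derivZr (pdf x) (deriv_cos (derivZr x (deriv_id z))))).
  - by [].
  - by rewrite /=; ring.
have yI : `]y - 1, y + 1[%classic y by rewrite /= in_itv/= ltrDl gtrBl ltr01.
have pE z x : partial1of2 (fun z x => cos (z * x) * pdf x) z x = - (x * sin (z * x) * pdf x).
  by rewrite partial1of2E; exact: (@derive_val _ _ _ _ _ _ _ (dc x z)).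
have ub : forall z x : R, `]y - 1, y + 1[%classic z -> [set: R] x ->
    `|partial1of2 (fun z x => cos (z * x) * pdf x) z x| <= `|x| * pdf x.
  move=> z x _ _; rewrite pE normrN !normrM (ger0_norm (pdf_ge0 _)) ler_wpM2r//.
  by rewrite ler_piMr.
have D1 : derivable F y 1.
  apply: (@derivable_under_integral R _ _ mu (fun z x => cos (z * x) * pdf x) setT measurableT y (y - 1) (y + 1) yI _ _ (fun x => `|x| * pdf x)) => //.
  by move=> x; rewrite mulr_ge0.
have D2 := @differentiation_under_integral R _ _ mu (fun z x => cos (z * x) * pdf x) setT measurableT y (y - 1) (y + 1) yI (fun z _ => Icos z) (fun z x _ _ => @ex_derive _ _ _ _ _ _ _ (dc x z)) (fun x => `|x| * pdf x) (fun x => mulr_ge0 (normr_ge0 x) (pdf_ge0 x)) Ixpdf ub.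
apply: DeriveDef => //.
rewrite -derive1E D2 -mulN1r -RintegralZl//.
by apply: eq_Rintegral => x _; rewrite pE mulN1r.
Qed.

Let sin_bnd (y : R) : pdf x * sin (y * x) @[x --> +oo] --> (0 : R) /\
  pdf x * sin (y * x) @[x --> -oo] --> (0 : R).
Proof.
have Hb x : 1 <= `|x| -> `|pdf x * sin (y * x)| <= (normal_peak s * (s ^+ 2 *+ 2)) / `|x|.
  move=> x1; have x0 : 0 < `|x| by exact: lt_le_trans x1.
  rewrite normrM (ger0_norm (pdf_ge0 _)).
  apply: (@le_trans _ _ (pdf x)); first by rewrite ler_piMr.
  rewrite pdfE -mulrA ler_pM2l ?normal_peak_gt0//.
  have e0 : 0 < s ^+ 2 *+ 2 by rewrite mulrn_wgt0// exprn_gt0.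
  rewrite mulNr expRN ler_pdivlMr//.
  rewrite mulrC ler_pdivrMr ?expR_gt0//.
  apply: (@le_trans _ _ (s ^+ 2 *+ 2 * (1 + x ^+ 2 / (s ^+ 2 *+ 2)))); last first.
    by rewrite ler_pM2l// expR_ge1Dx.
  rewrite mulrDr mulr1 mulrCA divff ?gt_eqF// mulr1.
  apply: (@le_trans _ _ (x ^+ 2)); last by rewrite lerDr ltW.
  by rewrite -[leRHS]real_normK ?num_real// expr2 ler_peMl// ltW.
split.
- apply/cvgr0Pnorm_le => e e0; near=> x.
  have x1 : 1 <= `|x|.
    apply: le_trans (ler_norm _); near: x; apply: nbhs_pinfty_ge; exact: num_real.
  rewrite (le_trans (Hb _ x1))// ler_pdivrMr ?(lt_le_trans ltr01)// -ler_pdivrMl//.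
  apply: le_trans (ler_norm _); near: x; apply: nbhs_pinfty_ge; exact: num_real.
- apply/cvgr0Pnorm_le => e e0; near=> x.
  have x1 : 1 <= `|x|.
    rewrite -normrN; apply: le_trans (ler_norm _); rewrite lerNr; near: x; apply: nbhs_ninfty_le; exact: num_real.
  rewrite (le_trans (Hb _ x1))// ler_pdivrMr ?(lt_le_trans ltr01)// -ler_pdivrMl//.
  rewrite -normrN; apply: le_trans (ler_norm _); rewrite lerNr; near: x; apply: nbhs_ninfty_le; exact: num_real.
Unshelve. all: end_near. Qed.

(** Stein's identity: [f] is the derivative of [pdf x * sin (y x)], which vanishes at both
    infinities, so its integral is 0. *)
Let F_ibp y : \int[mu]_x (x * sin (y * x) * pdf x) = s ^+ 2 * (y * F y).
Proof.
pose f x := - (s ^+ 2)^-1 * (x * sin (y * x) * pdf x) + y * (cos (y * x) * pdf x).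
have If1 : mu.-integrable setT (EFin \o (fun x => - (s ^+ 2)^-1 * (x * sin (y * x) * pdf x))).
  by rewrite /comp; under eq_fun do rewrite EFinM; apply: integrableZl => //; exact: Isin.
have If2 : mu.-integrable setT (EFin \o (fun x => y * (cos (y * x) * pdf x))).
  by rewrite /comp; under eq_fun do rewrite EFinM; apply: integrableZl => //; exact: Icos.
have H : \int[mu]_x f x = 0.
  have [b1 b2] := sin_bnd y.
  apply: (Rintegral_deriv_eq0 _ _ _ b1 b2).
  - move=> x; apply: (deriv_ext (derivM (dpdf x) (deriv_sin (derivZ y (deriv_id x))))).
    + by [].
    + by rewrite /f /=; field; rewrite s_neq0.
  - have cp : continuous pdf by apply: continuous_normal_pdf.
    have cm : continuous (fun x : R => y * x) by move=> x; apply: mulrl_continuous.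
    move=> x; apply: cvgD; apply: cvgM; try exact: cvg_cst.
      apply: cvgM; last exact: cp.
      apply: cvgM; first exact: cvg_id.
      by apply: (continuous_comp (cm x)); exact: continuous_sin.
    apply: cvgM; last exact: cp.
    by apply: (continuous_comp (cm x)); exact: continuous_cos.
  - by rewrite /f /comp; under eq_fun do rewrite EFinD; apply: integrableD.
move: H; rewrite RintegralD// !RintegralZl// -/(F y) => H.
have -> : \int[mu]_x (x * sin (y * x) * pdf x) = s ^+ 2 * (y * F y) - s ^+ 2 * (- (s ^+ 2)^-1 * \int[mu]_x (x * sin (y * x) * pdf x) + y * F y).
  by field.
by rewrite H mulr0 subr0.
Qed.

(** The transform [F] solves [F' = - s^2 y F]; hence [G] has zero derivative and keeps its value 1
    at 0. *)
Lemma normal_cos y : \int[mu]_x (cos (y * x) * normal_pdf 0 s x) = expR (- (s ^+ 2 * y ^+ 2 / 2)).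
Proof.
rewrite -/(F y).
pose G y := F y * expR (s ^+ 2 * y ^+ 2 / 2).
have dG (z : R) : has_deriv G z 0.
  apply: (deriv_ext (derivM (dF z) (deriv_expR (derivZr 2^-1 (derivZ (s ^+ 2) (deriv_sqr z)))))).
  - by [].
  - by rewrite F_ibp /=; field.
have := is_derive_0_is_cst y 0 dG; rewrite /G expr0n/= mulr0 mul0r expR0 mulr1.
have -> : F 0 = 1.
  rewrite /F /Rintegral; under eq_integral do rewrite mul0r cos0 mul1r.
  by rewrite integral_normal_pdf.
move=> H; apply: (mulIf (lt0r_neq0 (expR_gt0 (s ^+ 2 * y ^+ 2 / 2)))).
by rewrite H -expRD addNr expR0.
Qed.

End normal_fourier.

(** * Elementary bounds for cosine, sine and exponential *)

Section trigo_bounds.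
Context (R : realType).
Implicit Types x y : R.

Lemma cos_norm_le1 x : `|cos x| <= 1.
Proof. by rewrite ler_norml cos_geN1 cos_le1. Qed.

Lemma sin_norm_le1 x : `|sin x| <= 1.
Proof. by rewrite ler_norml sin_geN1 sin_le1. Qed.

Lemma cos_lip x y : `|cos x - cos y| <= `|x - y|.
Proof.
wlog xy : x y / y <= x.
  move=> H; have [xy|/ltW xy] := leP y x; first exact: H.
  by rewrite distrC [leRHS]distrC H.
move: xy; rewrite le_eqVlt => /predU1P[->|xy]; first by rewrite !subrr normr0.
have [|c _ ->] := @MVT R (@cos R) (fun z => - sin z) y x xy (fun z _ => is_derive_cos z).
  by apply: continuous_subspaceT; exact: continuous_cos.
by rewrite normrM normrN ler_piMl// sin_norm_le1.
Qed.

Lemma sin_le_norm x : `|sin x| <= `|x|.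
Proof.
rewrite -cosBpihalf; have := cos_lip (x - pi / 2) (- (pi / 2)).
by rewrite cosN cos_pihalf subr0 opprK subrK.
Qed.

Lemma onem_cosE x : 1 - cos x = 2 * sin (x / 2) ^+ 2.
Proof.
have xE : x = (x / 2) *+ 2 by rewrite -mulr_natr divfK.
rewrite {1}xE cos_mulr2n -mulr_natr.
by rewrite cos2sin2; ring.
Qed.

Lemma onem_cos_le x : 1 - cos x <= x ^+ 2 / 2.
Proof.
rewrite onem_cosE (_ : x ^+ 2 / 2 = 2 * (x / 2) ^+ 2); last by field.
by rewrite ler_pM2l// -[leLHS]real_normK ?num_real// -[leRHS]real_normK ?num_real// lerXn2r ?nnegrE// sin_le_norm.
Qed.

(** Twice the squared sine of the half angle, with the derivative of [sin] at 0. Under an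
    expectation it extracts the second moment from the characteristic function near 0. *)
Lemma onem_cos_scaled_cvg y :
  2 * n.+1%:R ^+ 2 * (1 - cos (n.+1%:R^-1 * y)) @[n --> \oo] --> (y ^+ 2 : R).
Proof.
have H : n.+1%:R * sin (n.+1%:R^-1 * (y / 2)) @[n --> \oo] --> (y / 2 : R).
  have d : has_deriv (fun h : R => sin (h * (y / 2))) 0 (y / 2).
    apply: (deriv_ext (deriv_sin (derivZr (y / 2) (deriv_id 0)))) => //=.
    by rewrite mul0r cos0 !mul1r.
  have [dd /esym E] := d.
  have : h^-1 *: (((fun h : R => sin (h * (y / 2))) \o shift 0) h%:A - sin (0 * (y / 2))) @[h --> 0^'] --> (y / 2 : R).
    by rewrite [X in _ --> X]E; exact: dd.
  move/cvgr_dnbhsP => /(_ (fun n => n.+1%:R^-1)) H.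
  have {}H := H (conj (fun n => lt0r_neq0 _) _).
  apply: cvg_trans; last apply: H => //.
    apply: near_eq_cvg; apply: nearW => n /=.
    by rewrite mul0r sin0 subr0 invrK addr0 /GRing.scale/= mulr1.
  exact: cvg_harmonic.
have -> : y ^+ 2 = 4 * (y / 2 * (y / 2)) by field.
have E n : 2 * n.+1%:R ^+ 2 * (1 - cos (n.+1%:R^-1 * y)) =
   4 * ((n.+1%:R * sin (n.+1%:R^-1 * (y / 2))) * (n.+1%:R * sin (n.+1%:R^-1 * (y / 2)))).
  by rewrite onem_cosE -[_^-1 * y / 2]mulrA; ring.
under eq_fun do rewrite E.
by apply: cvgM; [exact: cvg_cst|apply: cvgM].
Qed.

Lemma onem_expRN_bound (u : R) : 0 <= u -> u - u ^+ 2 <= 1 - expR (- u) <= u.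
Proof.
move=> u0; apply/andP; split; last by have := expR_ge1Dx (- u); lra.
have e0 := expR_gt0 (- u).
have : (1 + u) * expR (- u) <= 1.
  apply: (@le_trans _ _ (expR u * expR (- u))); last by rewrite -expRD subrr expR0.
  by rewrite ler_pM2r// expR_ge1Dx.
move: (expR (- u)) e0 => e e0 h.
have u1 : 0 < 1 + u by lra.
rewrite -(ler_pM2l u1).
have : 0 <= u ^+ 3 by rewrite exprn_ge0.
nra.
Qed.

Lemma onem_expRN_scaled_cvg (v : R) : 0 <= v ->
  2 * n.+1%:R ^+ 2 * (1 - expR (- (v * n.+1%:R^-1 ^+ 2 / 2))) @[n --> \oo] --> v.
Proof.
move=> v0.
apply: (@squeeze_cvgr _ _ _ _ (fun n => v - v ^+ 2 / 2 * n.+1%:R^-1) (fun=> v)).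
- apply: nearW => n /=.
  have n0 : (0 : R) < n.+1%:R by [].
  set N := n.+1%:R.
  have u0 : 0 <= v * N^-1 ^+ 2 / 2 by rewrite divr_ge0// mulr_ge0// sqr_ge0.
  have /andP[l r] := onem_expRN_bound u0.
  have N2 : 0 < 2 * N ^+ 2 by rewrite mulr_gt0// exprn_gt0.
  apply/andP; split.
    apply: le_trans (_ : 2 * N ^+ 2 * (v * N^-1 ^+ 2 / 2 - (v * N^-1 ^+ 2 / 2) ^+ 2) <= _); last by rewrite ler_pM2l.
    rewrite [leRHS](_ : _ = v - v ^+ 2 / 2 * (N^-1 * N^-1)); last by field; rewrite gt_eqF.
    rewrite lerD2l lerN2 ler_wpM2l ?divr_ge0 ?sqr_ge0//.
    by rewrite ler_piMl ?invr_ge0 ?(ltW n0)// invf_le1// ler1n.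
  apply: le_trans (_ : 2 * N ^+ 2 * (v * N^-1 ^+ 2 / 2) <= _); first by rewrite ler_pM2l.
  by rewrite le_eqVlt [X in X == _](_ : _ = v) ?eqxx//; field; rewrite gt_eqF.
- rewrite -[X in _ --> X](subr0 v) -(mulr0 (v ^+ 2 / 2)).
  apply: cvgB; first exact: cvg_cst.
  by apply: cvgM; [exact: cvg_cst|exact: cvg_harmonic].
- exact: cvg_cst.
Qed.

End trigo_bounds.

(** * Centred Gaussian laws through their cosine transforms *)

Section gauss.
Context d (T : measurableType d) (R : realType).
Variable P : probability T R.
Local Notation mu := (@lebesgue_measure R).

(* [Y] is centred Gaussian with variance [v]; the phase [c] encodes both the
   real and the imaginary part of the characteristic function. *)
Definition is_gauss (Y : T -> R) (v : R) : Prop :=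
  measurable_fun setT Y /\
  forall th c, \int[P]_w cos (th * Y w + c) = cos c * expR (- (v * th ^+ 2 / 2)).

Lemma measurable_cos_aff (Y : T -> R) (th c : R) : measurable_fun setT Y ->
  measurable_fun setT (fun w => cos (th * Y w + c)).
Proof.
move=> mY; apply: measurableT_comp; first exact: continuous_measurable_fun (@continuous_cos R).
by apply: measurable_funD => //; apply: measurable_funM.
Qed.

Lemma integrable_cos (Y : T -> R) : measurable_fun setT Y ->
  P.-integrable setT (EFin \o (fun w => cos (Y w))).
Proof.
move=> mY; apply: (@bounded_integrable _ _ _ P _ 1); last by move=> w; exact: cos_norm_le1.
by apply: measurableT_comp => //; exact: continuous_measurable_fun (@continuous_cos R).
Qed.

Lemma gauss_ge0 Y v : is_gauss Y v -> 0 <= v.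
Proof.
move=> [mY /(_ 1 0)]; rewrite cos0 mul1r expr1n mulr1 => E.
have := Rintegral_bounded P (measurable_cos_aff 1 0 mY) (fun w => cos_norm_le1 _).
rewrite E ger0_norm ?expR_ge0// expR_le1 oppr_le0 => h; lra.
Qed.

Lemma gaussZ Y v (k : R) : is_gauss Y v -> is_gauss (fun w => k * Y w) (k ^+ 2 * v).
Proof.
move=> [mY gY]; split; first exact: measurable_funM.
move=> th c; under eq_Rintegral do rewrite mulrA.
by rewrite gY; congr (_ * expR _); ring.
Qed.

Lemma gauss_unique Y v v' : is_gauss Y v -> is_gauss Y v' -> v = v'.
Proof.
move=> [_ /(_ 1 0) E] [_ /(_ 1 0)]; rewrite E cos0 !mul1r expr1n !mulr1 => /expR_inj; lra.
Qed.

Lemma Rintegral_normal_prob (s M : R) (f : R -> R) : measurable_fun setT f ->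
  (forall x, `|f x| <= M) ->
  \int[normal_prob 0 s]_x f x = \int[mu]_x (f x * normal_pdf 0 s x).
Proof.
move=> mf fM.
(* The density lemma handles nonnegative integrands only; the bound makes [M + f] nonnegative, and
   the constant is cancelled at the end. *)
have b1 (x : R) : 0 <= M + f x by have := fM x; rewrite ler_norml => /andP[? _]; lra.
have mf1 : measurable_fun setT (fun x : R => M + f x) by exact: measurable_funD.
have := @ge0_integral_density _ _ _ mu (normal_prob (0 : R) s) setT (normal_pdf 0 s) measurableT
   (measurable_normal_pdf 0 s) (fun x _ => normal_pdf_ge0 0 s x) (fun A _ _ => erefl)
   (fun x => M + f x) mf1 (fun x _ => b1 x).
move/(congr1 fine); rewrite -![fine _]/(Rintegral _ _ _) => E.
have IM : (normal_prob (0 : R) s).-integrable setT (EFin \o (fun=> M)).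
  by apply: (@bounded_integrable _ _ _ _ _ `|M|).
have If : (normal_prob (0 : R) s).-integrable setT (EFin \o f).
  exact: (@bounded_integrable _ _ _ _ _ M).
have Ip : mu.-integrable setT (EFin \o normal_pdf 0 s) by exact: integrable_normal_pdf.
have IMp : mu.-integrable setT (EFin \o (fun x => M * normal_pdf 0 s x)).
  by rewrite /comp; under eq_fun do rewrite EFinM; exact: integrableZl.
have Ifp : mu.-integrable setT (EFin \o (fun x => f x * normal_pdf 0 s x)).
  apply: (le_integrable _ _ _ IMp) => //.
    by apply/measurable_EFinP; apply: measurable_funM; [exact: mf|exact: measurable_normal_pdf].
  move=> x _ /=; rewrite lee_fin !normrM ler_wpM2r// (le_trans (fM x))// ler_norm//.
have IM1 : \int[mu]_x (M * normal_pdf 0 s x) = M.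
  by rewrite RintegralZl// [X in _ * X]/Rintegral integral_normal_pdf mulr1.
move: E; rewrite RintegralD// Rintegral_cstT => E.
apply: (addrI M); rewrite E -[in RHS]IM1 -RintegralD//.
by apply: eq_Rintegral => x _; rewrite mulrDl.
Qed.

Lemma normal_prob_cos (s y : R) : 0 < s ->
  \int[normal_prob 0 s]_th cos (th * y) = expR (- (s ^+ 2 * y ^+ 2 / 2)).
Proof.
move=> s0; rewrite -normal_cos// (@Rintegral_normal_prob s 1).
- by apply: eq_Rintegral => x _; rewrite mulrC [x * y]mulrC mulrC.
- by apply: measurableT_comp; [exact: continuous_measurable_fun (@continuous_cos R)|exact: measurable_funM].
- by move=> x; exact: cos_norm_le1.
Qed.

Lemma normal_peak_div (s q : R) : 0 < q -> normal_peak (s / q) = q * normal_peak s.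
Proof.
move=> q0; rewrite /normal_peak.
have -> : (s / q) ^+ 2 * pi *+ 2 = (s ^+ 2 * pi *+ 2) * (q^-1) ^+ 2 by ring.
rewrite sqrtrM; last by rewrite mulrn_wge0// mulr_ge0 ?sqr_ge0// pi_ge0.
by rewrite sqrtr_sqr ger0_norm ?invr_ge0 ?ltW// invfM invrK mulrC.
Qed.

(* The test functions [y |-> exp (- s^2 (y - a)^2 / 2)] are superpositions of
   cosines, so their expectations are determined by the characteristic function. *)
Lemma gauss_bump_fourier (s a v : R) Y : 0 < s -> is_gauss Y v ->
  \int[P]_w expR (- (s ^+ 2 * (Y w - a) ^+ 2 / 2)) =
  \int[normal_prob 0 s]_th (cos (th * a) * expR (- (v * th ^+ 2 / 2))).
Proof.
move=> s0 [mY gY].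
under eq_Rintegral do rewrite -normal_prob_cos//.
pose f (z : T * R) := cos (z.2 * (Y z.1 - a)).
have mf : measurable_fun setT f.
  apply: measurableT_comp; first exact: continuous_measurable_fun (@continuous_cos R).
  apply: measurable_funM => //; apply: measurable_funB => //.
  exact: measurableT_comp.
rewrite (@bounded_Fubini _ _ _ _ R P (normal_prob 0 s) f 1 mf (fun z => cos_norm_le1 _)).
apply: eq_Rintegral => th _; rewrite -[cos (th * a)]cosN -gY.
by apply: eq_Rintegral => w _; rewrite /f/=; congr cos; ring.
Qed.

(** The damping factor times the normal density of width [s] is [1 / q] times the normal density of
    width [s / q], where [q^2 = 1 + v s^2]; the integral is then a plain normal cosine transform. *)
Lemma normal_damped_cos (s a v : R) : 0 < s -> 0 <= v ->
  \int[normal_prob 0 s]_th (cos (th * a) * expR (- (v * th ^+ 2 / 2))) =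
  (Num.sqrt (1 + v * s ^+ 2))^-1 * expR (- (s ^+ 2 * a ^+ 2 / (2 * (1 + v * s ^+ 2)))).
Proof.
move=> s0 v0.
pose q := Num.sqrt (1 + v * s ^+ 2).
have q20 : 0 < 1 + v * s ^+ 2 by rewrite ltr_pwDl// mulr_ge0// sqr_ge0.
have q0 : 0 < q by rewrite sqrtr_gt0.
have q2 : q ^+ 2 = 1 + v * s ^+ 2 by rewrite sqr_sqrtr// ltW.
have s'0 : 0 < s / q by rewrite divr_gt0.
have := normal_prob_cos a s'0.
rewrite (_ : (s / q) ^+ 2 * a ^+ 2 / 2 = s ^+ 2 * a ^+ 2 / (2 * (1 + v * s ^+ 2))); last first.
  by rewrite -q2; field; rewrite gt_eqF.
move=> <-; rewrite -/q.
have mc : measurable_fun setT (fun th : R => cos (th * a)).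
  by apply: measurableT_comp; [exact: continuous_measurable_fun (@continuous_cos R)|exact: measurable_funM].
have me : measurable_fun setT (fun th : R => expR (- (v * th ^+ 2 / 2))).
  apply: measurableT_comp => //; apply: measurableT_comp => //.
  by apply: measurable_funM => //; apply: measurable_funM => //; exact: measurable_funX.
rewrite (@Rintegral_normal_prob s 1); last 2 first.
- exact: measurable_funM.
- move=> x; rewrite normrM mulr_ile1// ?cos_norm_le1//.
  by rewrite ger0_norm ?expR_ge0// expR_le1 oppr_le0 divr_ge0// mulr_ge0// sqr_ge0.
rewrite (@Rintegral_normal_prob (s / q) 1 _ mc (fun x => cos_norm_le1 _)).
rewrite -RintegralZl//.
  apply: eq_Rintegral => x _; rewrite !normal_pdfE ?gt_eqF// normal_peak_div//.
  rewrite /normal_fun subr0.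
  rewrite [RHS](_ : _ = cos (x * a) * (normal_peak s * expR (- x ^+ 2 / ((s / q) ^+ 2 *+ 2)))); last first.
    by field; rewrite gt_eqF.
  rewrite -mulrA; congr (_ * _).
  rewrite mulrCA; congr (_ * _); rewrite -expRD; congr expR.
  rewrite (_ : v = (q ^+ 2 - 1) / s ^+ 2); last by rewrite q2; field; rewrite gt_eqF.
  by field; rewrite !gt_eqF.
apply: (@le_integrable _ _ _ mu setT measurableT _ (EFin \o normal_pdf 0 (s / q))).
- by apply/measurable_EFinP; apply: measurable_funM; [exact: mc|exact: measurable_normal_pdf].
- by move=> x _ /=; rewrite lee_fin normrM ler_piMl// cos_norm_le1.
- exact: integrable_normal_pdf.
Qed.

Lemma gauss_bump (s a v : R) Y : 0 < s -> is_gauss Y v ->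
  \int[P]_w expR (- (s ^+ 2 * (Y w - a) ^+ 2 / 2)) =
  (Num.sqrt (1 + v * s ^+ 2))^-1 * expR (- (s ^+ 2 * a ^+ 2 / (2 * (1 + v * s ^+ 2)))).
Proof.
move=> s0 gY; rewrite (gauss_bump_fourier _ s0 gY) normal_damped_cos//.
exact: gauss_ge0 gY.
Qed.

Lemma integral_shifted_gauss (m q : R) : 0 < q ->
  (\int[mu]_a (expR (- ((a - m) ^+ 2 / (2 * q ^+ 2))))%:E = ((normal_peak q)^-1)%:E)%E.
Proof.
move=> q0; have p0 := normal_peak_gt0 (lt0r_neq0 q0).
transitivity (\int[mu]_a ((normal_peak q)^-1%:E * (normal_pdf m q a)%:E))%E.
  apply: eq_integral => a _; rewrite -EFinM normal_pdfE ?gt_eqF//= mulKf ?gt_eqF//.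
  by rewrite /normal_fun; congr (expR _)%:E; field; rewrite gt_eqF.
rewrite ge0_integralZl_EFin//.
- by rewrite integral_normal_pdf mule1.
- by move=> a _; rewrite lee_fin normal_pdf_ge0.
- by apply/measurable_EFinP; exact: measurable_normal_pdf.
- by rewrite invr_ge0 ltW.
Qed.

(** Tonelli for [exp (l a) exp (- (Y - a)^2 / 2)]: integrating over [a] first gives a constant times
    [exp (l Y)], while integrating over the sample space first is [gauss_bump] with [s = 1]. This
    passes from cosines to real exponentials without analytic continuation. *)
Lemma gauss_mgf (l v : R) Y : is_gauss Y v ->
  (\int[P]_w (expR (l * Y w))%:E = (expR (l ^+ 2 * v / 2))%:E)%E.
Proof.
move=> gY; have [mY _] := gY; have v0 := gauss_ge0 gY.
pose f (z : T * R) := (expR (l * z.2) * expR (- (1 ^+ 2 * (Y z.1 - z.2) ^+ 2 / 2)))%:E.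
have mf : measurable_fun setT f.
  apply/measurable_EFinP; apply: measurable_funM.
    by apply: measurableT_comp => //; exact: measurable_funM.
  apply: measurableT_comp => //; apply: measurableT_comp => //.
  apply: measurable_funM => //; apply: measurable_funM => //.
  apply: measurable_funX; apply: measurable_funB => //.
  exact: measurableT_comp.
have f0 z : (0 <= f z)%E by rewrite lee_fin mulr_ge0 ?expR_ge0.
have := @fubini_tonelli _ _ _ _ R P mu f mf f0.
pose p := (@normal_peak R 1)^-1.
have p0 : 0 < p by rewrite invr_gt0 normal_peak_gt0.
have meY : measurable_fun setT (fun w => expR (l * Y w)).
  by apply: measurableT_comp => //; exact: measurable_funM.
have -> : (\int[P]_w \int[mu]_a f (w, a) =
   (p * expR (l ^+ 2 / 2))%:E * \int[P]_w (expR (l * Y w))%:E)%E.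
  rewrite -ge0_integralZl_EFin//.
  - apply: eq_integral => w _.
    transitivity (\int[mu]_a ((expR (l * Y w + l ^+ 2 / 2))%:E * (expR (- ((a - (Y w + l)) ^+ 2 / (2 * 1 ^+ 2))))%:E))%E.
      apply: eq_integral => a _; rewrite /f -EFinM -!expRD; congr (expR _)%:E => /=.
      by field.
    rewrite ge0_integralZl_EFin//.
    + rewrite integral_shifted_gauss// -/p -!EFinM; congr (_%:E).
      by rewrite expRD; ring.
    + apply/measurable_EFinP; apply: measurableT_comp => //; apply: measurableT_comp => //.
      by apply: measurable_funM => //; apply: measurable_funX; exact: measurable_funB.
  - exact/measurable_EFinP.
  - by rewrite mulr_ge0// ?expR_ge0// ltW.
pose q := Num.sqrt (1 + v).
have q0 : 0 < q by rewrite sqrtr_gt0; lra.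
have q2 : q ^+ 2 = 1 + v by rewrite sqr_sqrtr//; lra.
have -> : (\int[mu]_a \int[P]_w f (w, a) = (p * expR (l ^+ 2 * (1 + v) / 2))%:E)%E.
  transitivity (\int[mu]_a ((q^-1 * expR (l ^+ 2 * (1 + v) / 2))%:E * (expR (- ((a - (1 + v) * l) ^+ 2 / (2 * q ^+ 2))))%:E))%E.
    apply: eq_integral => a _; rewrite /f.
    have E := gauss_bump a ltr01 gY.
    have Ib : P.-integrable setT (EFin \o (fun w => expR (- (1 ^+ 2 * (Y w - a) ^+ 2 / 2)))).
      apply: (@bounded_integrable _ _ _ _ _ 1).
        apply: measurableT_comp => //; apply: measurableT_comp => //.
        apply: measurable_funM => //; apply: measurable_funM => //.
        by apply: measurable_funX; exact: measurable_funB.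
      move=> w; rewrite ger0_norm ?expR_ge0// expR_le1 oppr_le0 divr_ge0//.
      by rewrite mulr_ge0 ?sqr_ge0.
    under eq_integral do rewrite EFinM.
    rewrite /= integralZl//.
    rewrite -[X in (_ * X)%E]fineK; last exact: (integrable_fin_num measurableT Ib).
    rewrite -/(Rintegral _ _ _) E -!EFinM !expr1n !mulr1 -/q; congr (_%:E).
    rewrite mulrCA -[RHS]mulrA; congr (_ * _); rewrite -!expRD; congr expR.
    by rewrite q2 mul1r; field; lra.
  rewrite ge0_integralZl_EFin//.
  - rewrite integral_shifted_gauss//.
    have := normal_peak_div 1 (q := q^-1); rewrite invrK mul1r => -> //; last by rewrite invr_gt0.
    by rewrite invfM invrK -/p -EFinM; congr (_%:E); field; rewrite gt_eqF.
  - apply/measurable_EFinP; apply: measurableT_comp => //; apply: measurableT_comp => //.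
    by apply: measurable_funM => //; apply: measurable_funX; exact: measurable_funB.
  - by rewrite mulr_ge0 ?expR_ge0// invr_ge0 ltW.
have C0 : 0 < p * expR (l ^+ 2 / 2) by rewrite mulr_gt0 ?expR_gt0.
have -> : p * expR (l ^+ 2 * (1 + v) / 2) = (p * expR (l ^+ 2 / 2)) * expR (l ^+ 2 * v / 2).
  by rewrite -[RHS]mulrA -expRD; congr (_ * expR _); field.
(* [I] is not yet known to be finite; infinite values contradict the finite product with a positive
   constant. *)
rewrite EFinM; move: (\int[P]_w _)%E => I.
case: I => [r| |]; rewrite -?EFinM.
- by move=> [] /(mulfI (lt0r_neq0 C0)) ->.
- by rewrite gt0_muley ?lte_fin.
- by rewrite gt0_muleNy ?lte_fin.
Qed.

End gauss.

(** * Tails, second moments and limits in probability of Gaussian variables *)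

Section gauss_estimates.
Context d (T : measurableType d) (R : realType).
Variable P : probability T R.
Local Notation mu := (@lebesgue_measure R).
Local Notation is_gauss := (is_gauss P).

(** Chernoff's bound with the optimal parameter [l = x / v]. *)
Lemma gauss_tail_ge (v x : R) Y : is_gauss Y v -> 0 < v -> 0 <= x ->
  (P [set w | (x <= Y w)%R] <= (expR (- (x ^+ 2 / (2 * v))))%:E)%E.
Proof.
move=> gY v0 x0; have [mY _] := gY.
pose l := x / v.
have l0 : 0 <= l by rewrite divr_ge0// ltW.
have mA : measurable [set w | (x <= Y w)%R].
  by rewrite -[X in measurable X]setTI; exact: measurable_fun_le.
have H : ((expR (l * x))%:E * P [set w | (x <= Y w)%R] <= (expR (l ^+ 2 * v / 2))%:E)%E.
  rewrite -(gauss_mgf l gY).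
  rewrite -[X in P X]setIT -integral_indic// -ge0_integralZl_EFin ?expR_ge0//; last first.
    by apply/measurable_EFinP; exact: measurable_indic.
  apply: ge0_le_integral => //.
  - apply: emeasurable_funM => //.
    by apply/measurable_EFinP; exact: measurable_indic.
  - apply/measurable_EFinP; apply: measurableT_comp => //.
    exact: measurable_funM.
  - move=> w _; rewrite -EFinM lee_fin indicE; case: (boolP (w \in _)).
      by rewrite inE/= => xY; rewrite mulr1 ler_expR ler_wpM2l.
    by rewrite mulr0 expR_ge0.
have e0 := expR_gt0 (l * x).
have [r rE] : exists r, P [set w | (x <= Y w)%R] = r%:E.
  by exists (fine (P [set w | (x <= Y w)%R])); rewrite fineK// fin_num_measure.
move: H; rewrite rE -EFinM !lee_fin -ler_pdivlMl// -expRN -expRD => /le_trans; apply.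
by rewrite ler_expR /l le_eqVlt; apply/orP; left; apply/eqP; field; rewrite gt_eqF.
Qed.

Lemma gauss_tail (v x : R) Y : is_gauss Y v -> 0 < v -> 0 <= x ->
  (P [set w | (x <= `|Y w|)%R] <= (2 * expR (- (x ^+ 2 / (2 * v))))%:E)%E.
Proof.
move=> gY v0 x0; have [mY _] := gY.
have gN : is_gauss (fun w => - Y w) v.
  have := gaussZ (-1) gY; rewrite sqrrN expr1n mul1r.
  by under eq_fun do rewrite mulN1r.
have [mN _] := gN.
have -> : [set w | (x <= `|Y w|)%R] = [set w | (x <= Y w)%R] `|` [set w | (x <= - Y w)%R].
  apply/seteqP; split => w /=; first by rewrite ler_normr => /orP.
  by move=> h; rewrite ler_normr; apply/orP.
apply: le_trans (measureU2 _ _ _) _.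
- by rewrite -[X in measurable X]setTI; exact: measurable_fun_le.
- by rewrite -[X in measurable X]setTI; exact: measurable_fun_le.
rewrite mulr_natl mulr2n EFinD; apply: leeD; exact: gauss_tail_ge.
Qed.

Lemma sqr_le_expR (y : R) : y ^+ 2 <= 2 * (expR (1 * y) + expR (-1 * y)).
Proof.
have H (z : R) : 0 <= z -> z ^+ 2 <= 2 * expR z.
  move=> z0; have := @expR_ge1Dxn R z 1 z0; rewrite /= -[2`!]/2%N => h.
  by move: h; set e := expR z; move: (e) => {}e; nra.
have e1 := expR_gt0 (1 * y); have e2 := expR_gt0 (-1 * y).
have [y0|/ltW y0] := leP 0 y.
  by have := H y y0; rewrite mul1r => h; move: (expR (-1 * y)) e2 h; rewrite ?mul1r; move: (expR y) => a b *; lra.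
have := H (- y); rewrite sqrrN oppr_ge0 mulN1r => /(_ y0) h.
by move: (expR (1 * y)) e1 h => a b; move: (expR (- y)) => c h; lra.
Qed.

Lemma gauss_integrable_sqr v Y : is_gauss Y v ->
  P.-integrable setT (EFin \o (fun w => Y w ^+ 2)).
Proof.
move=> gY; have [mY _] := gY.
have I (l : R) : P.-integrable setT (EFin \o (fun w => expR (l * Y w))).
  apply/integrableP; split.
    by apply/measurable_EFinP; apply: measurableT_comp => //; exact: measurable_funM.
  under eq_integral do rewrite /= ger0_norm ?expR_ge0//.
  by rewrite (gauss_mgf l gY) ltry.
have I2 : P.-integrable setT (EFin \o (fun w => 2 * (expR (1 * Y w) + expR (-1 * Y w)))).
  rewrite /comp; under eq_fun do rewrite EFinM [X in (_ * X)%E]EFinD.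
  by apply: integrableZl => //; apply: integrableD => //; exact: I.
apply: (le_integrable _ _ _ I2) => //.
  by apply/measurable_EFinP; exact: measurable_funX.
by move=> w _ /=; rewrite lee_fin ger0_norm ?sqr_ge0// (le_trans (sqr_le_expR _))// ler_norm.
Qed.

(** The quantity [2 N^2 (1 - E cos (Y / N))] has two limits: the second moment by dominated
    convergence, and [v] by the explicit transform. *)
Lemma gauss_variance v Y : is_gauss Y v -> \int[P]_w (Y w ^+ 2) = v.
Proof.
move=> gY; have [mY gE] := gY; have v0 := gauss_ge0 gY.
pose f (n : nat) w := 2 * n.+1%:R ^+ 2 * (1 - cos (n.+1%:R^-1 * Y w)).
have mc (n : nat) : measurable_fun setT (fun w => cos (n.+1%:R^-1 * Y w)).
  by have := measurable_cos_aff n.+1%:R^-1 0 mY; under eq_fun do rewrite addr0.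
have H1 : \int[P]_w f n w @[n --> \oo] --> \int[P]_w (Y w ^+ 2).
  apply: (@Rdominated_cvg _ _ _ P setT f _ (fun w => Y w ^+ 2)) => //.
  - by move=> n; apply: measurable_funM => //; exact: measurable_funB.
  - exact: measurable_funX.
  - by move=> w _; exact: onem_cos_scaled_cvg.
  - exact: gauss_integrable_sqr gY.
  - move=> n w _; have c1 := cos_le1 (n.+1%:R^-1 * Y w).
    have n0 : (0 : R) < n.+1%:R by [].
    rewrite /f ger0_norm; last by rewrite !mulr_ge0// ?subr_ge0// ltW.
    apply: le_trans (_ : 2 * n.+1%:R ^+ 2 * ((n.+1%:R^-1 * Y w) ^+ 2 / 2) <= _).
      by rewrite ler_pM2l ?onem_cos_le// mulr_gt0// exprn_gt0.
    by rewrite le_eqVlt; apply/orP; left; apply/eqP; move: (n.+1%:R) n0 => N N0; field; rewrite gt_eqF.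
have H2 n : \int[P]_w f n w = 2 * n.+1%:R ^+ 2 * (1 - expR (- (v * n.+1%:R^-1 ^+ 2 / 2))).
  have Ic : P.-integrable setT (EFin \o (fun w => cos (n.+1%:R^-1 * Y w))).
    by apply: (@bounded_integrable _ _ _ _ _ 1) => // w; exact: cos_norm_le1.
  have I1 : P.-integrable setT (EFin \o (fun=> 1 : R)).
    by apply: (@bounded_integrable _ _ _ _ _ `|1|).
  rewrite /f RintegralZl//.
    rewrite RintegralB// Rintegral_cstT; congr (_ * (_ - _)).
    by have := gE n.+1%:R^-1 0; rewrite cos0 mul1r => <-; apply: eq_Rintegral => w _; rewrite addr0.
  by rewrite /comp; under eq_fun do rewrite EFinB; exact: integrableB.
apply: (cvgn_unique H1).
under eq_fun do rewrite H2; exact: onem_expRN_scaled_cvg.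
Qed.

Lemma measurable_norm_ge (Y : T -> R) (e : R) : measurable_fun setT Y ->
  measurable [set w | e <= `|Y w|].
Proof.
move=> mY; rewrite -[X in measurable X]setTI; apply: measurable_fun_le => //.
exact: measurableT_comp.
Qed.

Lemma cvg_in_probability_cos (Y_ : nat -> T -> R) (Y : T -> R) (th c : R) :
  (forall n, measurable_fun setT (Y_ n)) -> measurable_fun setT Y ->
  cvg_in_probability P Y_ Y ->
  \int[P]_w cos (th * Y_ n w + c) @[n --> \oo] --> \int[P]_w cos (th * Y w + c).
Proof.
move=> mY_ mY cY; apply/cvgrPdist_le => e e0.
(* Where the two variables differ by less than [h], the Lipschitz bound costs at most [e / 2];
   elsewhere the difference is at most 2, on an event of probability at most [e / 4]. *)
pose h := e / 2 / (`|th| + 1).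
have h0 : 0 < h by rewrite !divr_gt0// ltr_wpDl.
have := cY h h0 => /fine_cvgP[ffin /cvgr0Pnorm_le/(_ (e / 4))].
have e40 : 0 < e / 4 by lra.
move=> /(_ e40) Hn; near=> n.
have Pn : `|fine (P [set w | h <= `|Y_ n w - Y w|])| <= e / 4 by near: n.
have mD : measurable_fun setT (fun w => Y_ n w - Y w) by exact: measurable_funB.
have mA := measurable_norm_ge h mD.
have mc : measurable_fun setT (fun w => cos (th * Y w + c)) by exact: measurable_cos_aff.
have mcn : measurable_fun setT (fun w => cos (th * Y_ n w + c)) by exact: measurable_cos_aff.
have Ic : P.-integrable setT (EFin \o (fun w => cos (th * Y w + c))).
  by apply: (@bounded_integrable _ _ _ _ _ 1) => // w; exact: cos_norm_le1.
have Icn : P.-integrable setT (EFin \o (fun w => cos (th * Y_ n w + c))).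
  by apply: (@bounded_integrable _ _ _ _ _ 1) => // w; exact: cos_norm_le1.
rewrite distrC -RintegralB//.
apply: le_trans (le_normr_Rintegral _ _) _ => //.
  by rewrite /comp; under eq_fun do rewrite EFinB; exact: integrableB.
pose A := [set w | h <= `|Y_ n w - Y w|].
have IA : P.-integrable setT (EFin \o (\1_A : T -> R)).
  by apply: (@bounded_integrable _ _ _ _ _ 1) => // w; rewrite indicE; case: (_ \in _); rewrite ?normr1 ?normr0.
apply: (@le_trans _ _ (\int[P]_w (e / 2 + 2 * \1_A w))).
  apply: le_Rintegral => //.
  - apply: (@bounded_integrable _ _ _ _ _ 2).
      by apply: measurableT_comp => //; exact: measurable_funB.
    move=> w; rewrite normr_id (le_trans (ler_normB _ _))//.
    by rewrite (_ : 2 = 1 + 1)// lerD// cos_norm_le1.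
  - apply: integrableDR => //; last exact: integrableZR.
    by apply: (@bounded_integrable _ _ _ _ _ `|e / 2|).
  - move=> w _; rewrite indicE; have [wA|wA] := boolP (w \in A).
      rewrite mulr1 (le_trans (ler_normB _ _))//.
      have := cos_norm_le1 (th * Y w + c); have := cos_norm_le1 (th * Y_ n w + c); lra.
    rewrite mulr0 addr0 (le_trans (cos_lip _ _))//.
    rewrite (_ : _ - _ = th * (Y_ n w - Y w)); last by ring.
    have : `|Y_ n w - Y w| <= h.
      by move: wA; rewrite notin_setE/= => /negP; rewrite -ltNge => /ltW.
    rewrite normrM => /(ler_wpM2l (normr_ge0 th)) /le_trans; apply.
    rewrite /h mulrA ler_pdivrMr ?ltr_wpDl// mulrDr mulr1 mulrC lerDl; lra.
rewrite RintegralD//; last 2 first.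
- by apply: (@bounded_integrable _ _ _ _ _ `|e / 2|).
- exact: integrableZR.
rewrite Rintegral_cstT RintegralZl//.
have -> : \int[P]_w \1_A w = fine (P A) by rewrite /Rintegral integral_indic// setIT.
by have := le_trans (ler_norm _) Pn; rewrite -/A; lra.
Unshelve. all: end_near. Qed.

Lemma gauss_cvg_in_probability (Y_ : nat -> T -> R) (v_ : nat -> R) (Y : T -> R) (v : R) :
  (forall n, is_gauss (Y_ n) (v_ n)) -> measurable_fun setT Y ->
  cvg_in_probability P Y_ Y -> v_ n @[n --> \oo] --> v -> is_gauss Y v.
Proof.
move=> g_ mY cY cv; split => // th c.
have H := @cvg_in_probability_cos _ _ th c (fun n => (g_ n).1) mY cY.
apply: (cvgn_unique H).
under eq_fun do rewrite (g_ _).2.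
apply: cvgM; first exact: cvg_cst.
apply: cvgn_expR.
by apply: cvgN; apply: cvgM; [apply: cvgM => //; exact: cvg_cst|exact: cvg_cst].
Qed.

End gauss_estimates.

Lemma measurable_cosf d (U : measurableType d) (R : realType) (f : U -> R) :
  measurable_fun setT f -> measurable_fun setT (fun u => cos (f u)).
Proof. by move=> mf; apply: measurableT_comp => //; exact: continuous_measurable_fun (@continuous_cos R). Qed.

(** * Covariance of Gaussian bumps of a correlated pair *)

Section bump_covariance.
Context d (T : measurableType d) (R : realType).
Variable P : probability T R.
Local Notation is_gauss := (is_gauss P).

Definition bump (s y : R) := expR (- (s ^+ 2 * y ^+ 2 / 2)).

Lemma expR_diff_le (t : R) : `|expR t - 1| <= `|t| * expR `|t|.
Proof.
have [t0|t0] := leP 0 t.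
  rewrite !ger0_norm// ?subr_ge0 -?expR0 ?ler_expR//.
  have h : 1 - expR (- t) <= t by have := expR_ge1Dx (- t); lra.
  have := ler_wpM2r (expR_ge0 t) h; rewrite mulrBl mul1r -expRD addNr expR0//.
rewrite ler0_norm ?subr_le0 -?expR0 ?ler_expR ?(ltW t0)// expR0.
rewrite ltr0_norm//; have h1 := expR_ge1Dx t; have h2 := expR_ge1Dx (- t).
by move: (expR (- t)) h2 (expR t) h1 => a ha b hb; nra.
Qed.

(** With [q = th^2 + ps^2] the exponents differ by at most [|rho| q / 2 <= q / 4]. The difference is
    thus at most [|rho| (q / 2) exp (- q / 4)], and [(q / 2) exp (- q / 4) <= 1]. *)
Lemma damped_diff_le (rho th ps : R) : `|rho| <= 1 / 2 ->
  `|expR (- ((th ^+ 2 + 2 * rho * th * ps + ps ^+ 2) / 2)) -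
    expR (- ((th ^+ 2 + ps ^+ 2) / 2))| <= `|rho|.
Proof.
move=> r2; pose q := th ^+ 2 + ps ^+ 2; pose t := - (rho * th * ps).
have q0 : 0 <= q by rewrite addr_ge0 ?sqr_ge0.
have t_le : `|th * ps| <= q / 2.
  rewrite normrM /q -(real_normK (num_real th)) -(real_normK (num_real ps)).
  have := sqr_ge0 (`|th| - `|ps|); move: `|th| `|ps| => a b; nra.
have r0 := normr_ge0 rho.
have tq : `|t| <= `|rho| * (q / 2).
  by rewrite /t normrN -mulrA normrM ler_wpM2l.
have tq4 : `|t| <= q / 4 by move: tq r2 r0; move: `|t| `|rho| => a b *; nra.
rewrite (_ : - ((th ^+ 2 + 2 * rho * th * ps + ps ^+ 2) / 2) = - (q / 2) + t); last by rewrite /t /q; field.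
rewrite expRD -/q -[X in _ - X]mulr1 -mulrBr normrM (ger0_norm (expR_ge0 _)).
apply: (@le_trans _ _ (expR (- (q / 2)) * (`|rho| * (q / 2) * expR (q / 4)))).
  rewrite ler_pM2l ?expR_gt0// (le_trans (expR_diff_le _))// ler_pM ?expR_ge0//.
  by rewrite ler_expR.
rewrite (_ : - (q / 2) = - (q / 4) + - (q / 4)); last by field.
have -> : expR (- (q / 4) + - (q / 4)) * (`|rho| * (q / 2) * expR (q / 4)) = `|rho| * ((q / 2) * expR (- (q / 4))).
  rewrite expRD [LHS](_ : _ = `|rho| * ((q / 2) * expR (- (q / 4))) * (expR (- (q / 4)) * expR (q / 4))); last by ring.
  by rewrite -expRD addNr expR0 mulr1.
rewrite ler_piMr// expRN ler_pdivrMr ?expR_gt0// mul1r.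
rewrite (_ : q / 4 = q / 8 + q / 8); last by field.
rewrite expRD; have := expR_ge1Dx (q / 8); move: (expR (q / 8)) => e he.
by have := sqr_ge0 (q / 8 - 1); nra.
Qed.

(* With [|rho| <= 1/2] the integrand of the Fourier representation of the
   covariance is bounded by [|rho|] itself, because [x exp (- x)] is bounded. *)
Lemma bump_covariance_le (s a a' rho : R) (Z Z' : T -> R) : 0 < s ->
  measurable_fun setT Z -> measurable_fun setT Z' ->
  (forall al be, is_gauss (fun w => al * Z w + be * Z' w)
      (al ^+ 2 + 2 * rho * al * be + be ^+ 2)) -> `|rho| <= 1 / 2 ->
  `|\int[P]_w (bump s (Z w - a) * bump s (Z' w - a')) -
    (\int[P]_w bump s (Z w - a)) * (\int[P]_w bump s (Z' w - a'))| <= `|rho|.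
Proof.
move=> s0 mZ mZ' GZ r2; pose g := bump s; rewrite -/g.
pose N : probability (measurableTypeR R) R := normal_prob (0 : R) s.
have gE y : g y = \int[N]_th cos (th * y) by rewrite /g /bump /N normal_prob_cos.
have gZ : is_gauss Z 1.
  have := GZ 1 0; rewrite !mulr0 expr0n/= expr1n !addr0.
  by under eq_fun do rewrite mul1r mul0r addr0.
have gZ' : is_gauss Z' 1.
  have := GZ 0 1; rewrite !mulr0 mul0r expr0n/= expr1n !add0r.
  by under eq_fun do rewrite mul0r mul1r add0r.
have g_norm y : `|g y| <= 1.
  rewrite ger0_norm ?expR_ge0// expR_le1 oppr_le0 divr_ge0// mulr_ge0// sqr_ge0//.
have mg : measurable_fun setT g.
  apply: measurableT_comp => //; apply: measurableT_comp => //.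
  by apply: measurable_funM => //; apply: measurable_funM => //; exact: measurable_funX.
have mZa : measurable_fun setT (fun w => Z w - a) by exact: measurable_funB.
have mZa' : measurable_fun setT (fun w => Z' w - a') by exact: measurable_funB.
have norm_cosM (x y : R) : `|y| <= 1 -> `|cos x * y| <= 1.
  by move=> y1; rewrite normrM mulr_ile1// cos_norm_le1.
(* The product formula makes [K] the mean of the product of the two shifted cosines: [th Z + ps Z']
   and [th Z - ps Z'] are both Gaussian by [GZ]. *)
pose K th ps := 2^-1 * (cos (th * a + ps * a') * expR (- ((th ^+ 2 + 2 * rho * th * ps + ps ^+ 2) / 2)) +
  cos (th * a - ps * a') * expR (- ((th ^+ 2 + 2 * rho * th * (- ps) + (- ps) ^+ 2) / 2))).
have EK th ps : \int[P]_w (cos (th * (Z w - a)) * cos (ps * (Z' w - a'))) = K th ps.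
  have E (be : R) : \int[P]_w cos (1 * (th * Z w + be * Z' w) + - (th * a + be * a')) =
      cos (th * a + be * a') * expR (- ((th ^+ 2 + 2 * rho * th * be + be ^+ 2) / 2)).
    by rewrite (GZ th be).2 cosN expr1n mulr1.
  have Ib (be : R) : P.-integrable setT (EFin \o (fun w => cos (1 * (th * Z w + be * Z' w) + - (th * a + be * a')))).
    by apply: integrable_cos; apply: measurable_funD => //; apply: measurable_funM => //; exact: (GZ th be).1.
  rewrite /K -(E ps) -[th * a - ps * a']/(th * a + - (ps * a')) -mulNr -(E (- ps)).
  rewrite -RintegralD// -RintegralZl//; last exact: integrableDR.
  apply: eq_Rintegral => w _.
  rewrite (_ : 1 * (th * Z w + ps * Z' w) + - (th * a + ps * a') = th * (Z w - a) + ps * (Z' w - a')); last by ring.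
  rewrite (_ : 1 * (th * Z w + - ps * Z' w) + - (th * a + - ps * a') = th * (Z w - a) - ps * (Z' w - a')); last by ring.
  by rewrite cosB cosD; field.
have mK2 : measurable_fun setT (fun z : R * R => K z.1 z.2).
  have m1 : measurable_fun setT (fun z : R * R => z.1) by exact: measurable_fst.
  have m2 : measurable_fun setT (fun z : R * R => z.2) by exact: measurable_snd.
  have mN2 : measurable_fun setT (fun z : R * R => - z.2) by exact: measurableT_comp.
  rewrite /K; apply: measurable_funM => //.
  apply: measurable_funD; apply: measurable_funM.
  - by apply: measurable_cosf; apply: measurable_funD; exact: measurable_funM.
  - apply: measurableT_comp => //; apply: measurableT_comp => //; apply: measurable_funM => //.
    by apply: measurable_funD; [apply: measurable_funD; [exact: measurable_funX|apply: measurable_funM => //; exact: measurable_funM]|exact: measurable_funX].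
  - by apply: measurable_cosf; apply: measurable_funB; exact: measurable_funM.
  - apply: measurableT_comp => //; apply: measurableT_comp => //; apply: measurable_funM => //.
    by apply: measurable_funD; [apply: measurable_funD; [exact: measurable_funX|apply: measurable_funM => //; exact: measurable_funM]|exact: measurable_funX].
have K_norm th ps : `|K th ps| <= 1.
  rewrite -EK; apply: Rintegral_bounded; first by apply: measurable_funM; apply: measurable_cosf; exact: measurable_funM.
  by move=> w; rewrite norm_cosM// cos_norm_le1.
have mK th : measurable_fun setT (fun ps => K th ps) by exact: measurableT_comp mK2 (pair1_measurable th).
have EGG : \int[P]_w (g (Z w - a) * g (Z' w - a')) = \int[N]_th \int[N]_ps K th ps.
  transitivity (\int[P]_w \int[N]_th (cos (th * (Z w - a)) * g (Z' w - a'))).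
    apply: eq_Rintegral => w _; rewrite {1}gE RintegralZr//.
    by apply: integrable_cos; exact: measurable_funM.
  pose f (z : T * R) := cos (z.2 * (Z z.1 - a)) * g (Z' z.1 - a').
  rewrite (@bounded_Fubini _ _ _ _ R P N f 1); last 2 first.
  - apply: measurable_funM.
      by apply: measurable_cosf; apply: measurable_funM => //; exact: measurableT_comp mZa _.
    by apply: measurableT_comp mg _; exact: measurableT_comp mZa' _.
  - by move=> z; rewrite norm_cosM.
  apply: eq_Rintegral => th _.
  transitivity (\int[P]_w \int[N]_ps (cos (th * (Z w - a)) * cos (ps * (Z' w - a')))).
    apply: eq_Rintegral => w _; rewrite /f/= {1}gE RintegralZl//.
    by apply: integrable_cos; exact: measurable_funM.
  pose f2 (z : T * R) := cos (th * (Z z.1 - a)) * cos (z.2 * (Z' z.1 - a')).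
  rewrite (@bounded_Fubini _ _ _ _ R P N f2 1); last 2 first.
  - apply: measurable_funM; apply: measurable_cosf.
      by apply: measurable_funM => //; exact: measurableT_comp mZa _.
    by apply: measurable_funM => //; exact: measurableT_comp mZa' _.
  - by move=> z; rewrite norm_cosM// cos_norm_le1.
  by apply: eq_Rintegral => ps _; exact: EK.
pose k (b x : R) := cos (x * b) * expR (- (1 * x ^+ 2 / 2)).
have mk b : measurable_fun setT (k b).
  apply: measurable_funM; first by apply: measurable_cosf; exact: measurable_funM.
  apply: measurableT_comp => //; apply: measurableT_comp => //.
  by apply: measurable_funM => //; apply: measurable_funM => //; exact: measurable_funX.
have k_norm b x : `|k b x| <= 1.
  by rewrite norm_cosM// ger0_norm ?expR_ge0// expR_le1 oppr_le0 divr_ge0// mulr_ge0// sqr_ge0.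
have EZ : \int[P]_w g (Z w - a) = \int[N]_th k a th by exact: gauss_bump_fourier.
have EZ' : \int[P]_w g (Z' w - a') = \int[N]_ps k a' ps by exact: gauss_bump_fourier.
have Ik b : N.-integrable setT (EFin \o k b).
  by apply: (@bounded_integrable _ _ _ N _ 1); [exact: mk|exact: k_norm].
have IK th : N.-integrable setT (EFin \o K th).
  by apply: (@bounded_integrable _ _ _ N _ 1); [exact: mK|exact: K_norm].
have EGEG : (\int[P]_w g (Z w - a)) * (\int[P]_w g (Z' w - a')) = \int[N]_th \int[N]_ps (k a th * k a' ps).
  rewrite EZ EZ' -RintegralZr//.
  by apply: eq_Rintegral => th _; rewrite RintegralZl.
have mIK : measurable_fun setT (fun th => \int[N]_ps K th ps).
  by apply: (@measurable_bounded_fubini_F _ _ _ _ R N N _ 1 mK2) => z; exact: K_norm.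
have I1 : N.-integrable setT (EFin \o (fun th => \int[N]_ps K th ps)).
  apply: (@bounded_integrable _ _ _ N _ 1); first exact: mIK.
  by move=> th; apply: Rintegral_bounded; [exact: mK|exact: K_norm].
have I2 : N.-integrable setT (EFin \o (fun th => \int[N]_ps (k a th * k a' ps))).
  have -> : (fun th => \int[N]_ps (k a th * k a' ps)) = (fun th => (\int[N]_ps k a' ps) * k a th).
    by apply/funext => th; rewrite RintegralZl// mulrC.
  exact: integrableZR.
rewrite EGG EGEG -RintegralB//.
apply: Rintegral_bounded.
  apply: measurable_funB => //.
  by apply/measurable_EFinP; exact: measurable_int I2.
move=> th; rewrite -RintegralB//; last exact: integrableZR.
apply: Rintegral_bounded.
  by apply: measurable_funB; [exact: mK|apply: measurable_funM; [exact: measurable_cst|exact: mk]].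
move=> ps.
have -> : K th ps - k a th * k a' ps = 2^-1 * (
    cos (th * a + ps * a') * (expR (- ((th ^+ 2 + 2 * rho * th * ps + ps ^+ 2) / 2)) - expR (- ((th ^+ 2 + ps ^+ 2) / 2)))
  + cos (th * a - ps * a') * (expR (- ((th ^+ 2 + 2 * rho * th * (- ps) + (- ps) ^+ 2) / 2)) - expR (- ((th ^+ 2 + (- ps) ^+ 2) / 2)))).
  rewrite /K /k sqrrN.
  rewrite (_ : - ((th ^+ 2 + ps ^+ 2) / 2) = - (1 * th ^+ 2 / 2) + - (1 * ps ^+ 2 / 2)); last by field.
  by rewrite expRD cosD cosB; field.
rewrite normrM ger0_norm ?invr_ge0// ler_pdivrMl// (_ : 2 * `|rho| = `|rho| + `|rho|); last by ring.
apply: le_trans (ler_normD _ _) _.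
by apply: lerD; rewrite normrM -[leRHS]mul1r ler_pM ?cos_norm_le1//; exact: damped_diff_le.
Qed.

End bump_covariance.

(** * Law of the iterated logarithm for Gaussian processes *)

Section series_bounds.
Context (R : realType).
Implicit Types (u : nat -> R) (C a x : R).

Lemma nneseries_le_bound (u : nat -> \bar R) C : (forall n, 0 <= u n)%E ->
  (forall N, (\sum_(0 <= n < N) u n <= C%:E)%E) -> (\sum_(0 <= n <oo) u n <= C%:E)%E.
Proof.
move=> u0 uC; apply: lime_le; first by apply: is_cvg_nneseries => n _ _; exact: u0.
exact: nearW.
Qed.

Lemma onem_ln_ge (x : R) : 0 < x -> 1 - x^-1 <= ln x.
Proof.
move=> x0; have := @le_ln1Dx R (x^-1 - 1).
rewrite addrCA subrr addr0 lnV ?posrE// => h; have : -1 < x^-1 - 1.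
  by rewrite ltrBDl subrr invr_gt0.
by move/h => {}h; lra.
Qed.

(* Telescoping of [n^(-b)] with [b = a - 1]. *)
Lemma zeta_partial_le a : 1 < a -> forall N,
  \sum_(0 <= n < N) expR (- (a * ln n.+1%:R)) <= 1 + (a - 1)^-1 :> R.
Proof.
move=> a1 N; set b := a - 1; have b0 : 0 < b by rewrite subr_gt0.
suff H : \sum_(0 <= n < N.+1) expR (- (a * ln n.+1%:R)) <=
    1 + b^-1 * (1 - expR (- (b * ln N.+1%:R))) :> R.
  apply: le_trans (_ : _ <= \sum_(0 <= n < N.+1) expR (- (a * ln n.+1%:R)) :> R) _.
    by rewrite big_nat_recr//= lerDl expR_ge0.
  by rewrite (le_trans H)// lerD2l ler_piMr ?invr_ge0 ?(ltW b0)// gerBl expR_ge0.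
elim: N => [|N IH].
  by rewrite big_nat1 ln1 !mulr0 oppr0 expR0 subrr mulr0 addr0.
rewrite big_nat_recr//= (le_trans (lerD IH (lexx _)))// -addrA lerD2l -lerBrDl -mulrBr.
rewrite (_ : _ - _ - _ = expR (- (b * ln N.+1%:R)) - expR (- (b * ln N.+2%:R))); last by ring.
rewrite ler_pdivlMl//.
set x : R := N.+1%:R; set y : R := N.+2%:R.
have x0 : 0 < x by []. have y0 : 0 < y by [].
have yx : y = x + 1 by rewrite /y -natr1.
have h : y^-1 <= ln y - ln x.
  have := @onem_ln_ge (y / x); rewrite divr_gt0// => /(_ isT).
  rewrite ln_div ?posrE// invf_div; apply: le_trans.
  by rewrite le_eqVlt; apply/orP; left; apply/eqP; rewrite yx; move: x0; clear; move: x => x x0; field; lra.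
have -> : expR (- (a * ln y)) = expR (- (b * ln y)) * y^-1.
  have -> : y^-1 = expR (- ln y) by rewrite expRN lnK ?posrE.
  by rewrite -expRD; congr expR; rewrite /b; ring.
have -> : expR (- (b * ln x)) = expR (- (b * ln y)) * expR (b * (ln y - ln x)).
  by rewrite -expRD; congr expR; ring.
rewrite mulrCA -[X in _ <= _ - X]mulr1 -mulrBr ler_pM2l ?expR_gt0//.
by rewrite lerBrDl (le_trans _ (expR_ge1Dx _))// lerD2l ler_pM2l.
Qed.

Lemma harmonic_unbounded C : exists N, C <= \sum_(0 <= n < N) n.+2%:R^-1 :> R.
Proof.
suff [N HN] : exists N, C + 1 <= \sum_(0 <= n < N) n.+1%:R^-1 :> R.
  case: N HN => [|N] HN; first by exists 0%N; move: HN; rewrite !big_nil; lra.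
  by exists N; move: HN; rewrite big_nat_recl//= invr1; lra.
have nd : {homo (fun N => \sum_(0 <= n < N) (harmonic n : R)) : m n / (m <= n)%N >-> m <= n}.
  by apply: nondecreasing_series => n _ _; exact: harmonic_ge0.
apply: contrapT => /forallNP H; apply: (@dvg_harmonic R).
apply: nondecreasing_is_cvgn => //; exists (C + 1) => _ [N _ <-].
by have /negP := H N; rewrite -ltNge => /ltW.
Qed.

End series_bounds.

(** * Borel-Cantelli, chaining and a second-moment divergence criterion *)

Section borel_cantelli_real.
Context d (T : measurableType d) (R : realType).
Variable P : probability T R.

Lemma ae_eventually_not (F : nat -> set T) (u : nat -> R) (C : R) :
  (forall n, measurable (F n)) -> (forall n, (P (F n) <= (u n)%:E)%E) ->
  (forall N, \sum_(0 <= n < N) u n <= C) ->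
  {ae P, forall w, \forall n \near \oo, ~ F n w}.
Proof.
move=> mF Pu uC.
have mL : measurable (lim_sup_set F).
  by apply: bigcap_measurable => // k _; apply: bigcup_measurable.
have H : P (lim_sup_set F) = 0%E.
  apply: lim_sup_set_cvg0 => //; apply: (@le_lt_trans _ _ C%:E); last exact: ltry.
  apply: nneseries_le_bound => // N.
  apply: (@le_trans _ _ (\sum_(0 <= n < N) (u n)%:E)%E); first by apply: lee_sum => n _; exact: Pu.
  by rewrite sumEFin lee_fin.
exists (lim_sup_set F); split => // w /= nw n _ /=.
apply: contrapT => /= nF; apply: nw.
exists n => // m /= nm Fm; apply: nF.
by exists m.
Qed.

End borel_cantelli_real.

Section dyadic_chaining.
Context (R : realType).

(* The weights [(3/4)^k / 4] sum to 1, and the square of the weight at level [k]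
   still beats the variance factor [2^-k] of the increments at that level. *)
Lemma dyadic_chaining (f : R -> R) (c : R) : 0 <= c -> continuous f ->
  (forall k j, (j < 2 ^ k)%N ->
     `|f (j.+1%:R / 2 ^+ k) - f (j%:R / 2 ^+ k)| <= c * ((3 / 4) ^+ k / 4)) ->
  forall u, 0 <= u <= 1 -> `|f u - f 0| <= c.
Proof.
move=> c0 cf H.
(* The weights up to level [m] sum to [1 - (3/4)^(m+1)]. An even numerator already belongs to the
   previous level; an odd one is a single increment away from an even one. *)
have D m : forall j, (j <= 2 ^ m)%N -> `|f (j%:R / 2 ^+ m) - f 0| <= c * (1 - (3 / 4) ^+ m.+1).
  elim: m => [|m IH] j.
    rewrite expn0; case: j => [|[|//]] _.
      by rewrite mul0r subrr normr0 mulr_ge0// expr1; lra.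
    have := H 0%N 0%N isT; rewrite mul0r => /le_trans; apply.
    by rewrite expr1 expr0 ler_wpM2l//; lra.
  have q : (3 / 4 : R) ^+ m.+2 = (3 / 4) ^+ m.+1 * (3 / 4) by rewrite exprSr.
  have e0 : 0 <= (3 / 4 : R) ^+ m.+1 by rewrite exprn_ge0.
  have half (i : nat) : (i.*2)%:R / 2 ^+ m.+1 = i%:R / 2 ^+ m :> R.
    by rewrite -mul2n natrM exprS -mulf_div divff// mul1r.
  have dy (i : nat) : (i <= 2 ^ m)%N -> `|f ((i.*2)%:R / 2 ^+ m.+1) - f 0| <= c * (1 - (3 / 4) ^+ m.+1).
    by move=> im; rewrite half; exact: IH.
  rewrite -[j]odd_double_half; case: (odd j) => /=; rewrite ?add1n ?add0n => jm.
    have jm1 : (j./2.*2 < 2 ^ m.+1)%N by [].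
    have jm2 : (j./2 <= 2 ^ m)%N.
      by move: jm1; rewrite expnS mul2n ltn_double => /ltnW.
    have h1 := H m.+1 _ jm1; have h2 := dy _ jm2.
    rewrite (_ : f _ - f 0 = (f (j./2.*2.+1%:R / 2 ^+ m.+1) - f (j./2.*2%:R / 2 ^+ m.+1)) + (f (j./2.*2%:R / 2 ^+ m.+1) - f 0)); last by ring.
    apply: le_trans (ler_normD _ _) _.
    apply: le_trans (lerD h1 h2) _; rewrite q -mulrDr ler_wpM2l//; lra.
  have jm2 : (j./2 <= 2 ^ m)%N by move: jm; rewrite expnS mul2n leq_double.
  apply: le_trans (dy _ jm2) _; rewrite q ler_wpM2l//; lra.
move=> u /andP[u0 u1].
pose j m := Num.truncn (u * 2 ^+ m).
have p0 m : (0 : R) < 2 ^+ m by rewrite exprn_gt0.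
have jle m : (j m)%:R / 2 ^+ m <= u by rewrite ler_pdivrMr// truncn_le// mulr_ge0// ltW.
have jgt m : u - (2 ^+ m)^-1 <= (j m)%:R / 2 ^+ m.
  rewrite ler_pdivlMr// mulrBl mulVf ?gt_eqF// lerBlDr.
  by rewrite natr1 ltW// truncnS_gt.
have j2 m : (j m <= 2 ^ m)%N.
  rewrite -(ler_nat R) natrX; apply: le_trans (_ : u * 2 ^+ m <= _).
    by rewrite truncn_le// mulr_ge0// ltW.
  by rewrite ler_piMl// ltW.
have cj : (j m)%:R / 2 ^+ m @[m --> \oo] --> u.
  apply: (@squeeze_cvgr _ _ _ _ (fun m => u - (2 ^+ m)^-1) (fun=> u)).
  - by apply: nearW => m; rewrite jle jgt.
  - rewrite -[X in _ --> X]subr0; apply: cvgB; first exact: cvg_cst.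
    under eq_fun do rewrite -exprVn.
    by apply: cvg_expr; rewrite ger0_norm; lra.
  - exact: cvg_cst.
have cfj : `|f ((j m)%:R / 2 ^+ m) - f 0| @[m --> \oo] --> `|f u - f 0|.
  apply: cvg_norm; apply: cvgB; last exact: cvg_cst.
  by apply: (cvg_comp _ f cj); exact: cf.
apply: (cvgr_to_le cfj); apply: nearW => m.
apply: le_trans (D m _ (j2 m)) _; by rewrite ler_piMr// gerBl exprn_ge0.
Qed.

End dyadic_chaining.

Section second_moment.
Context d (T : measurableType d) (R : realType).
Variable P : probability T R.

(* Chebyshev's inequality for the partial sums: their variance grows at most
   like their mean. *)
Lemma ae_series_unbounded (W : nat -> T -> R) (r : nat -> R) (C : R) :
  (forall n, measurable_fun setT (W n)) -> (forall n w, 0 <= W n w <= 1) ->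
  (forall m n, (m < n)%N ->
    `|\int[P]_w (W m w * W n w) - (\int[P]_w W m w) * (\int[P]_w W n w)| <= r n) ->
  (forall N, \sum_(0 <= n < N) n%:R * r n <= C) ->
  (forall K, exists N, K <= \sum_(0 <= n < N) \int[P]_w W n w) ->
  {ae P, forall w, forall K, exists N, K <= \sum_(0 <= n < N) W n w}.
Proof.
move=> mW W01 cov rC div.
have W_norm n w : `|W n w| <= 1 by have /andP[h1 h2] := W01 n w; rewrite ger0_norm.
have IW n : P.-integrable setT (EFin \o W n) by exact: (@bounded_integrable _ _ _ P _ 1).
pose e n := \int[P]_w W n w.
have e0 n : 0 <= e n by apply: Rintegral_ge0 => w _; have /andP[] := W01 n w.
have e1 n : e n <= 1 by rewrite (le_trans (ler_norm _))// Rintegral_bounded.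
pose S N w := \sum_(0 <= n < N) W n w.
pose m N := \sum_(0 <= n < N) e n.
have mS N : measurable_fun setT (S N) by exact: measurable_sum.
have SN N w : `|S N w - m N| <= N%:R.
  rewrite /S /m -sumrB (le_trans (ler_norm_sum _ _ _))//.
  rewrite -[N in N%:R]subn0 -[leRHS]mulr1 mulr_natl -sumr_const_nat.
  apply: ler_sum => n _; have /andP[h1 h2] := W01 n w; have := e0 n; have := e1 n.
  by rewrite ler_norml => *; apply/andP; split; lra.
have mD N : measurable_fun setT (fun w => S N w - m N) by exact: measurable_funB.
have ID N : P.-integrable setT (EFin \o (fun w => S N w - m N)).
  exact: (@bounded_integrable _ _ _ P _ N%:R).
have ID2 N : P.-integrable setT (EFin \o (fun w => (S N w - m N) ^+ 2)).
  apply: (@bounded_integrable _ _ _ P _ (N%:R ^+ 2)); first exact: measurable_funX.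
  by move=> w; rewrite normrX lerXn2r ?nnegrE.
pose v N := \int[P]_w (S N w - m N) ^+ 2.
(* Adding [W N] to the sum adds its variance, at most [e N] because values in [[0, 1]] satisfy
   [W^2 <= W], and twice its covariance with the earlier terms, at most [N r_N]. *)
have v_le N : v N <= m N + 2 * \sum_(0 <= n < N) n%:R * r n.
  elim: N => [|N IH].
    rewrite /v /S /m; under eq_Rintegral do rewrite !big_nil subrr expr0n/=.
    by rewrite Rintegral_cstT !big_nil mulr0 addr0.
  have mWe : measurable_fun setT (fun w => W N w - e N) by exact: measurable_funB.
  have We w : `|W N w - e N| <= 1.
    have /andP[h1 h2] := W01 N w; have := e0 N; have := e1 N.
    by rewrite ler_norml => *; apply/andP; split; lra.
  have I1 : P.-integrable setT (EFin \o (fun w => (S N w - m N) * (W N w - e N))).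
    apply: (@bounded_integrable _ _ _ P _ N%:R); first exact: measurable_funM.
    by move=> w; rewrite normrM -[leRHS]mulr1 ler_pM.
  have I2 : P.-integrable setT (EFin \o (fun w => (W N w - e N) ^+ 2)).
    apply: (@bounded_integrable _ _ _ P _ 1); first exact: measurable_funX.
    by move=> w; rewrite normrX exprn_ile1.
  have -> : v N.+1 = v N + 2 * (\int[P]_w ((S N w - m N) * (W N w - e N))) + \int[P]_w (W N w - e N) ^+ 2.
    rewrite -RintegralZl// -RintegralD//; last exact: integrableZR.
    rewrite -RintegralD//; last by apply: integrableDR => //; exact: integrableZR.
    apply: eq_Rintegral => w _; rewrite /S /m !big_nat_recr//=; ring.
  have H1 : \int[P]_w (W N w - e N) ^+ 2 <= e N.
    apply: le_trans (_ : \int[P]_w (W N w - 2 * e N * W N w + e N ^+ 2) <= _).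
      apply: le_Rintegral => //.
        apply: integrableDR => //; first by apply: integrableBR => //; exact: integrableZR.
        by apply: (@bounded_integrable _ _ _ P _ `|e N ^+ 2|).
      move=> w _; have /andP[h1 h2] := W01 N w; nra.
    rewrite RintegralD//; last 2 first.
    - by apply: integrableBR => //; exact: integrableZR.
    - by apply: (@bounded_integrable _ _ _ P _ `|e N ^+ 2|).
    rewrite RintegralB//; last exact: integrableZR.
    rewrite RintegralZl// Rintegral_cstT -/(e N).
    by have := sqr_ge0 (e N); nra.
  have H2 : \int[P]_w ((S N w - m N) * (W N w - e N)) <= N%:R * r N.
    have -> : \int[P]_w ((S N w - m N) * (W N w - e N)) =
        \sum_(0 <= n < N) (\int[P]_w (W n w * W N w) - e n * e N).
      have IWW n : P.-integrable setT (EFin \o (fun w => W n w * W N w)).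
        apply: (@bounded_integrable _ _ _ P _ 1); first exact: measurable_funM.
        by move=> w; rewrite normrM mulr_ile1.
      have IWe n : P.-integrable setT (EFin \o (fun w => (W n w - e n) * (W N w - e N))).
        apply: (@bounded_integrable _ _ _ P _ 1).
          by apply: measurable_funM => //; exact: measurable_funB.
        move=> w; rewrite normrM mulr_ile1//.
        have /andP[h1 h2] := W01 n w; have := e0 n; have := e1 n.
        by rewrite ler_norml => *; apply/andP; split; lra.
      transitivity (\sum_(0 <= n < N) \int[P]_w ((W n w - e n) * (W N w - e N))).
        rewrite -[RHS]/(\sum_(0 <= n < N) fine _).
        transitivity (fine (\sum_(0 <= n < N) \int[P]_w ((W n w - e n) * (W N w - e N))%:E)%E); last first.
          rewrite sum_fine//; move=> n _; exact: (integrable_fin_num measurableT (IWe n)).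
        rewrite -integral_sum//; congr fine; apply: eq_integral => w _.
        by rewrite sumEFin -mulr_suml /S /m -sumrB.
      apply: eq_bigr => n _.
      transitivity (\int[P]_w (W n w * W N w - e N * W n w - e n * W N w + e n * e N)).
        by apply: eq_Rintegral => w _; ring.
      rewrite RintegralD//; last 2 first.
      - by apply: integrableBR => //; [apply: integrableBR => //|]; exact: integrableZR.
      - by apply: (@bounded_integrable _ _ _ P _ `|e n * e N|).
      rewrite RintegralB//; last 2 first.
      - by apply: integrableBR => //; exact: integrableZR.
      - exact: integrableZR.
      rewrite RintegralB//; last exact: integrableZR.
      by rewrite Rintegral_cstT !RintegralZl// -/(e n) -/(e N); ring.
    rewrite mulr_natl -[N in _ *+ N]subn0 -sumr_const_nat.
    rewrite !big_nat; apply: ler_sum => n /andP[_ nN].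
    exact: le_trans (ler_norm _) (cov _ _ nN).
  rewrite /m !big_nat_recr//= -/(m N).
  move: IH; move: (\sum_(0 <= n < N) _) => Z IH.
  rewrite mulrDr; move: H1 H2 IH; move: (\int[P]_w _) (\int[P]_w _) => a c; move: (v N) (m N) (e N) (N%:R * r N) => *; lra.
have NK K : P [set w | forall N, S N w <= K] = 0%E.
  have mA N : measurable [set w | S N w <= K].
    by rewrite -[X in measurable X]setTI; exact: measurable_fun_le.
  have mAA : measurable [set w | forall N, S N w <= K].
    rewrite (_ : [set w | _] = \bigcap_N [set w | S N w <= K]); first exact: bigcap_measurable.
    by apply/seteqP; split => w /= h N; [move=> _; exact: h|exact: h].
  have [p pE] : exists p, P [set w | forall N, S N w <= K] = p%:E.
    by exists (fine (P [set w | forall N, S N w <= K])); rewrite fineK// fin_num_measure.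
  have p0 : 0 <= p by rewrite -lee_fin -pE.
  rewrite pE; congr (_%:E); apply/eqP; rewrite eq_le p0 andbT leNgt; apply/negP => pp.
  (* On the event [S N <= K] the deviation from the mean is at least [m N - K]. *)
  have key N : K < m N -> p * (m N - K) ^+ 2 <= m N + 2 * C.
    move=> KN; rewrite -lee_fin EFinM -pE.
    apply: (@le_trans _ _ (\int[P]_w ((S N w - m N) ^+ 2)%:E)%E).
      set A := [set w | _].
      rewrite muleC -[A]setIT -integral_indic// -ge0_integralZl_EFin ?sqr_ge0//; last first.
        by apply/measurable_EFinP; exact: measurable_indic.
      apply: ge0_le_integral => //.
      - by move=> w _; rewrite mule_ge0 ?lee_fin ?sqr_ge0.
      - apply: emeasurable_funM => //.
        by apply/measurable_EFinP; exact: measurable_indic.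
      - by apply/measurable_EFinP; exact: measurable_funX.
      - move=> w _; rewrite -EFinM lee_fin indicE; case: (boolP (w \in A)).
          by rewrite inE/= => /(_ N) h; rewrite mulr1; nra.
        by rewrite mulr0 sqr_ge0.
    rewrite -[leLHS]fineK; last exact: (integrable_fin_num measurableT (ID2 N)).
    by rewrite lee_fin (le_trans (v_le N))// lerD2l ler_pM2l.
  (* With [x = m N - K] this choice forces [p x > 4] and [x >= |K| + 2 |C| + 2], hence
     [p x^2 > 4 x > x + K + 2 C], against [key]. *)
  have [N HN] := div (K + `|K| + 2 * `|C| + 2 + 4 / p).
  have := key N; rewrite -/(m N) in HN.
  have h1 := ler_norm K; have h1' := ler_norm (- K); rewrite normrN in h1'.
  have h2 := ler_norm C; have h4 := normr_ge0 C; have h5 := normr_ge0 K.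
  have h3 : 0 < 4 / p by rewrite divr_gt0.
  have KN : K < m N by lra.
  move=> /(_ KN); apply/negP; rewrite -ltNge.
  set x := m N - K.
  have x1 : `|K| + 2 * `|C| + 2 + 4 / p <= x by rewrite /x; lra.
  have px : 4 < p * x by rewrite -ltr_pdivrMl// mulrC; lra.
  have -> : m N = x + K by rewrite /x subrK.
  have : 4 * x < p * x ^+ 2 by rewrite expr2 mulrA ltr_pM2r//; lra.
  lra.
have : {ae P, forall w, forall k : nat, ~ (forall N, S N w <= k%:R)}.
  apply/ae_foralln => k; exists [set w | forall N, S N w <= k%:R]; split => //.
  - rewrite (_ : [set w | _] = \bigcap_N [set w | S N w <= k%:R]).
      by apply: bigcap_measurable => // N _; rewrite -[X in measurable X]setTI; exact: measurable_fun_le.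
    by apply/seteqP; split => w /= h N; [move=> _; exact: h|exact: h].
  - exact: NK.
  - by move=> w /= /contrapT.
apply: filterS => w H K.
have /existsNP[N HN] := H (Num.truncn `|K|).+1.
exists N; apply/ltW.
apply: le_lt_trans (ler_norm K) _.
apply: lt_trans (truncnS_gt _) _.
by rewrite ltNge; apply/negP.
Qed.

End second_moment.

Lemma shifted_pred a b k : (a + b < k)%N ->
  [/\ (b <= k.-1 - a)%N, (a + (k.-1 - a) = k.-1)%N & (a + (k.-1 - a).+1 = k)%N].
Proof. by move=> h; split; lia. Qed.

Lemma shifted_le_mul a b : ((a + b).+2 <= a.+1 * b.+2)%N.
Proof. by nia. Qed.

Lemma sqrt_variance_le (R : realType) (v y e l : R) : 0 <= v -> 0 < y -> 0 < e ->
  l <= (1 + e) * y ->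
  Num.sqrt (2 * v * l) <= Num.sqrt v * (Num.sqrt (2 * y) * (1 + e)).
Proof.
move=> v0 y0 e0 ly.
have e1 : 0 <= 1 + e by lra.
have -> : Num.sqrt v * (Num.sqrt (2 * y) * (1 + e)) = Num.sqrt (v * (2 * y * (1 + e) ^+ 2)).
  rewrite (@sqrtrM _ v)// (@sqrtrM _ (2 * y) ((1 + e) ^+ 2)); last by rewrite mulr_ge0// ltW.
  by rewrite sqrtr_sqr ger0_norm.
rewrite ler_wsqrtr// [leLHS](_ : _ = v * (2 * l)); last by ring.
by rewrite ler_wpM2l//; nra.
Qed.

Lemma onem_triple_le (R : realType) (e z : R) : 0 < e -> 0 <= z ->
  (1 - 3 * e) * (z * (1 + e)) <= (1 - 2 * e) * z.
Proof.
move=> e0 z0; rewrite [leLHS](_ : _ = ((1 - 3 * e) * (1 + e)) * z); last by ring.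
by rewrite ler_wpM2r//; nra.
Qed.

Lemma frac_cube_le (R : realType) (a x y : R) : 0 <= a -> a <= y -> 0 < y -> y <= x ->
  a * x ^- 3 <= y ^- 2.
Proof.
move=> a0 ay y0 yx; have x0 := lt_le_trans y0 yx.
have x3 : 0 < x ^+ 3 by exact: exprn_gt0.
have y2 : 0 < y ^+ 2 by exact: exprn_gt0.
rewrite ler_pdivrMr// mulrC ler_pdivlMr// exprS.
apply: ler_pM => //; [exact: ltW|exact: le_trans yx|].
by apply: ler_pM => //; exact: ltW.
Qed.

Lemma measurable_bump (R : realType) (s : R) : measurable_fun setT (bump s).
Proof.
apply: measurableT_comp => //; apply: measurableT_comp => //.
by apply: measurable_funM => //; apply: measurable_funM => //; exact: measurable_funX.
Qed.

(** * The two halves of the law of the iterated logarithm *)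

Section gaussian_lil.
Context d (T : measurableType d) (R : realType).
Variable P : probability T R.
Variables (Y : R -> T -> R) (V : R -> R).
Hypothesis Y_gauss : forall s t a b : R, 0 <= s -> 0 <= t ->
  is_gauss P (fun w => a * Y s w + b * Y t w)
    (a ^+ 2 * V s + b ^+ 2 * V t + a * b * (V s + V t - V `|t - s|)).
Hypothesis V_gt0 : forall t : R, 0 < t -> 0 < V t.
Hypothesis V_scale : forall s t : R, 0 <= s <= 1 -> 0 <= t -> V (s * t) <= s * V t.
Hypothesis V_incr : forall s t : R, 0 < s -> s <= t -> V t - V (t - s) <= 2 * (s / t) * V t.
Variables (gam C0 t0 : R).
Hypotheses (gam_gt0 : 0 < gam) (C0_gt0 : 0 < C0).
Hypothesis V_growth : forall s t : R, t0 <= s -> s <= t -> V t <= C0 * (t / s) `^ (2 - gam) * V s.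
Hypothesis Y_cont : {ae P, forall w, continuous (fun t => Y t w)}.

Let phi t := Num.sqrt (2 * V t * ln (ln t)).

(** The combination [Y 0 - Y 0] vanishes identically, while its prescribed variance is [V 0]. *)
Let V0 : V 0 = 0.
Proof.
have [m1 H1] := @Y_gauss 0 0 1 (-1) (lexx _) (lexx _).
have h1 : is_gauss P (fun w => 1 * Y 0 w + -1 * Y 0 w) 0.
  split => // th c.
  have -> : (fun w => cos (th * (1 * Y 0 w + -1 * Y 0 w) + c)) = (fun=> cos c).
    by apply/funext => w; congr cos; ring.
  by rewrite Rintegral_cstT mul0r mul0r oppr0 expR0 mulr1.
have := gauss_unique h1 (conj m1 H1); rewrite subrr normr0; lra.
Qed.

(** Scaling by [s / t <= 1] gives [V s <= (s / t) V t]. *)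
Let V_mono s t : 0 <= s -> s <= t -> V s <= V t.
Proof.
move=> s0 st; have [t_eq|t_neq] := eqVneq t 0.
  by have -> : s = t by apply/eqP; rewrite eq_le st t_eq.
have t_gt0 : 0 < t by rewrite lt0r t_neq (le_trans s0).
have st1 : 0 <= s / t <= 1 by rewrite divr_ge0 ?(ltW t_gt0)//= ler_pdivrMr// mul1r.
have := V_scale st1 (ltW t_gt0); rewrite divfK// => /le_trans; apply.
by rewrite ler_piMl ?(ltW (V_gt0 _))//; have /andP[] := st1.
Qed.

Let mY t : 0 <= t -> measurable_fun setT (Y t).
Proof.
move=> t_ge0; have [+ _] := Y_gauss 1 0 t_ge0 t_ge0.
by under eq_fun do rewrite mul1r mul0r addr0.
Qed.

Let gaussY t : 0 <= t -> is_gauss P (Y t) (V t).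
Proof.
move=> t_ge0; have := Y_gauss 1 0 t_ge0 t_ge0.
under eq_fun do rewrite mul1r mul0r addr0.
by rewrite expr1n mul1r expr0n/= mul0r addr0 mulr0 mul0r addr0.
Qed.

Let gaussYB s t : 0 <= s -> 0 <= t -> is_gauss P (fun w => Y t w - Y s w) (V `|t - s|).
Proof.
move=> s_ge0 t_ge0; have := Y_gauss (-1) 1 s_ge0 t_ge0.
have -> : (fun w => -1 * Y s w + 1 * Y t w) = (fun w => Y t w - Y s w).
  by apply/funext => w; ring.
by rewrite (_ : _ + _ * (V s + V t - _) = V `|t - s|)//; ring.
Qed.

Let phi_sqr t : 0 <= V t -> 0 <= ln (ln t) -> phi t ^+ 2 = 2 * V t * ln (ln t).
Proof. by move=> v l; rewrite sqr_sqrtr// mulr_ge0// mulr_ge0. Qed.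

Let V_ge0 t : 0 <= t -> 0 <= V t.
Proof. by rewrite le_eqVlt => /predU1P[<-|/V_gt0/ltW//]; rewrite V0. Qed.

Let phi_mono s t : 0 <= s -> s <= t -> 0 <= ln (ln s) -> ln (ln s) <= ln (ln t) -> phi s <= phi t.
Proof.
move=> s_ge0 st l0 lst; rewrite ler_wsqrtr// ler_pM// ?mulr_ge0// ?V_ge0//.
by rewrite ler_pM2l// V_mono.
Qed.

(** In units of [phi t] a Gaussian tail becomes a power of [ln t], with an exponent that gains the
    factor [V t / v] when the variance [v] is small compared with [V t]. *)
Let tail_phi (Z : T -> R) v t k : is_gauss P Z v -> 0 < t -> 0 < v -> v <= V t ->
  0 <= ln (ln t) -> 0 <= k ->
  (P [set w | (k * phi t <= `|Z w|)%R] <= (2 * expR (- (k ^+ 2 * (V t / v) * ln (ln t))))%:E)%E.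
Proof.
move=> gZ t_gt0 v0 vV l0 k0.
have := gauss_tail gZ v0 (mulr_ge0 k0 (sqrtr_ge0 (2 * V t * ln (ln t)))).
rewrite -/(phi t) exprMn phi_sqr ?V_ge0 ?(ltW t_gt0)//.
rewrite (_ : k ^+ 2 * (2 * V t * ln (ln t)) / (2 * v) = k ^+ 2 * (V t / v) * ln (ln t))//.
by field; rewrite gt_eqF.
Qed.

(* Increments over the block [t, (1 + dl) t]: at dyadic level [k] the variance is
   at most [2^-k dl V t], whereas the threshold is [ep (3/4)^k / 4] times [phi t]. *)
Let block_oscillation (ep dl t : R) : 0 < ep -> 0 < dl -> dl <= 1 ->
  32 * 16 * dl <= ep ^+ 2 -> 0 < t -> 1 <= ln (ln t) ->
  let B := \bigcup_k \bigcup_(j < 2 ^ k)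
    [set w | ep * ((3 / 4) ^+ k / 4) * phi t <=
      `|Y (t + dl * t * (j.+1%:R / 2 ^+ k)) w - Y (t + dl * t * (j%:R / 2 ^+ k)) w|] in
  measurable B /\ (P B <= (4 * expR (- (2 * ln (ln t))))%:E)%E.
Proof.
move=> ep0 dl0 dl1 epdl t_gt0 l1 B.
have pt k (j : nat) : 0 <= t + dl * t * (j%:R / 2 ^+ k).
  by rewrite addr_ge0 ?mulr_ge0 ?divr_ge0 ?exprn_ge0// ?ltW.
have mI k j : measurable [set w | ep * ((3 / 4) ^+ k / 4) * phi t <=
      `|Y (t + dl * t * (j.+1%:R / 2 ^+ k)) w - Y (t + dl * t * (j%:R / 2 ^+ k)) w|].
  by apply: measurable_norm_ge; apply: measurable_funB; exact: mY.
have mC k : measurable (\bigcup_(j < 2 ^ k)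
    [set w | ep * ((3 / 4) ^+ k / 4) * phi t <=
      `|Y (t + dl * t * (j.+1%:R / 2 ^+ k)) w - Y (t + dl * t * (j%:R / 2 ^+ k)) w|]).
  by apply: bigcup_measurable => j _; exact: mI.
have mB : measurable B by apply: bigcup_measurable => k _; exact: mC.
split => //.
set L := ln (ln t) in l1 *.
have L0 : 0 <= L by lra.
have PI k j : (P [set w | (ep * ((3 / 4) ^+ k / 4) * phi t <=
      `|Y (t + dl * t * (j.+1%:R / 2 ^+ k)) w - Y (t + dl * t * (j%:R / 2 ^+ k)) w|)%R] <=
      (2 * expR (- (2 * L)) * 4^-1 ^+ k)%:E)%E.
  have k2 : (0 : R) < 2 ^+ k by rewrite exprn_gt0.
  have k2' : (2 ^+ k)^-1 <= 1 :> R by rewrite invf_le1// exprn_ege1// ler1n.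
  have kV : (0 : R) <= (2 ^+ k)^-1 by rewrite invr_ge0 ltW.
  pose v := V (dl * t / 2 ^+ k).
  have v_gt0 : 0 < v by rewrite V_gt0// divr_gt0// mulr_gt0.
  have v_le : v <= dl / 2 ^+ k * V t.
    rewrite /v (_ : dl * t / 2 ^+ k = dl / 2 ^+ k * t); last by ring.
    apply: V_scale; last exact: ltW.
    by apply/andP; split; [exact: divr_ge0 (ltW dl0) (ltW k2)|exact: mulr_ile1 (ltW dl0) kV dl1 k2'].
  have Vt := V_gt0 t_gt0.
  have g := gaussYB (pt k j) (pt k j.+1).
  rewrite (_ : `|_ - _| = dl * t / 2 ^+ k) in g; last first.
    rewrite -natr1 (_ : _ - _ = dl * t / 2 ^+ k); last by field; rewrite gt_eqF.
    by rewrite ger0_norm// divr_ge0// ?mulr_ge0// ltW.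
  have w0 : 0 <= ep * ((3 / 4) ^+ k / 4) by rewrite !mulr_ge0 ?exprn_ge0// ltW.
  apply: le_trans (tail_phi g t_gt0 v_gt0 _ L0 w0) _.
    by rewrite (le_trans v_le)// ler_piMl ?(ltW Vt)//; exact: mulr_ile1 (ltW dl0) kV dl1 k2'.
  rewrite lee_fin -[leRHS]mulrA ler_pM2l// -/L -/v.
  (* The growth factor is [(3/4)^2 * 2 = 9/8]: squared weight times inverse variance. The constant
     32 is what [32 * 16 * dl <= ep^2] leaves after the square of the factor [1/4] of the weight. *)
  have h1 : 32 * (9 / 8) ^+ k <= (ep * ((3 / 4) ^+ k / 4)) ^+ 2 * (V t / v).
    have hV : 2 ^+ k / dl <= V t / v.
      by rewrite ler_pdivlMr// mulrC -ler_pdivlMr ?divr_gt0// invf_div mulrC.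
    apply: le_trans (_ : (ep * ((3 / 4) ^+ k / 4)) ^+ 2 * (2 ^+ k / dl) <= _); last first.
      by rewrite ler_wpM2l// sqr_ge0.
    have -> : (ep * ((3 / 4) ^+ k / 4)) ^+ 2 * (2 ^+ k / dl) = ep ^+ 2 / (16 * dl) * (9 / 8) ^+ k.
      have -> : (9 / 8 : R) ^+ k = ((3 / 4) ^+ k) ^+ 2 * 2 ^+ k.
        by rewrite -exprM mulnC exprM -exprMn; congr (_ ^+ _); field.
      by field; rewrite gt_eqF.
    rewrite ler_pM2r ?exprn_gt0// ler_pdivlMr ?mulr_gt0//; lra.
  have h2 : 1 + k%:R / 8 <= (9 / 8 : R) ^+ k.
    elim: (k) => [|n IH]; first by rewrite expr0 mul0r addr0.
    rewrite exprSr -natr1; have n0 : (0 : R) <= n%:R by [].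
    by move: IH; move: ((9 / 8) ^+ n) (n%:R : R) n0 => a b *; nra.
  (* Since [L >= 1], the exponent is at least [2 L + 2 k]. The factor [exp (- 2 k) <= 4^-k] pays for
     the [2^k] increments of the level and still leaves [2^-k], summable over the levels. *)
  apply: (@le_trans _ _ (expR (- (2 * L) + - (2 * k%:R)))).
    rewrite ler_expR -opprD lerN2.
    apply: le_trans (_ : 32 * (1 + k%:R / 8) * L <= _); last first.
      by rewrite ler_wpM2r// (le_trans _ h1)// ler_pM2l.
    have k0 : (0 : R) <= k%:R by [].
    by move: (k%:R : R) k0 => x x0; nra.
  rewrite expRD ler_pM2l ?expR_gt0//.
  have -> : expR (- (2 * k%:R)) = expR (-2) ^+ k :> R.
    by rewrite -expRM_natl; congr expR; rewrite mulrN mulrC.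
  rewrite lerXn2r ?nnegrE ?expR_ge0 ?invr_ge0//.
  rewrite expRN lef_pV2 ?posrE ?expR_gt0//.
  rewrite (_ : 2 = 1 + 1 :> R)// expRD; have := expR_ge1Dx (1 : R).
  by move: (expR 1) => e he; nra.
have PC k : (P (\bigcup_(j < 2 ^ k)
    [set w | (ep * ((3 / 4) ^+ k / 4) * phi t <=
      `|Y (t + dl * t * (j.+1%:R / 2 ^+ k)) w - Y (t + dl * t * (j%:R / 2 ^+ k)) w|)%R]) <=
      (2 * expR (- (2 * L)) * 2^-1 ^+ k)%:E)%E.
  apply: (@le_trans _ _ (\sum_(j < 2 ^ k) (2 * expR (- (2 * L)) * 4^-1 ^+ k)%:E)%E); last first.
    rewrite sumEFin lee_fin sumr_const card_ord -[leLHS]mulr_natr natrX -[leLHS]mulrA -exprMn.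
    by rewrite (_ : 4^-1 * 2 = 2^-1 :> R)//; field.
  rewrite bigcup_mkord.
  have := @Boole_inequality _ _ _ P _ (2 ^ k)%N (fun i _ => mI k i).
  move=> /le_trans; apply.
  by apply: lee_sum => j _; exact: PI.
apply: le_trans (measure_sigma_subadditive _ mC mB _) _ => //.
apply: nneseries_le_bound => // N.
apply: (@le_trans _ _ (\sum_(0 <= k < N) (2 * expR (- (2 * L)) * 2^-1 ^+ k)%:E)%E).
  by apply: lee_sum => k _; exact: PC.
rewrite sumEFin lee_fin -mulr_sumr (_ : 4 = 2 * 2 :> R); last by ring.
rewrite -mulrA [leRHS](_ : _ = 2 * expR (- (2 * L)) * 2); last by ring.
rewrite ler_pM2l ?mulr_gt0 ?expR_gt0//.
suff -> : \sum_(0 <= k < N) 2^-1 ^+ k = 2 - 2 * 2^-1 ^+ N :> R.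
  by rewrite gerBl mulr_ge0// exprn_ge0.
elim: N => [|n IH]; first by rewrite big_nil expr0; ring.
by rewrite big_nat_recr//= IH exprSr; field.
Qed.

(** Half of [ep] is spent at the grid points [t n = (1 + dl)^(N0 + n)], where the tail exponent
    [(1 + e2)^2 > 1] makes the series converge, and half on the oscillation inside the block that
    follows. *)
Let gaussian_lil_upper ep : 0 < ep ->
  {ae P, forall w, \forall t \near +oo, `|Y t w| <= (1 + ep) * phi t}.
Proof.
move=> ep0; pose e2 := ep / 2; have e20 : 0 < e2 by rewrite divr_gt0.
pose dl := Num.min 1 (e2 ^+ 2 / (32 * 16)).
have dl0 : 0 < dl by rewrite lt_min ltr01 divr_gt0 ?exprn_gt0 ?mulr_gt0.
have dl1 : dl <= 1 by rewrite ge_min lexx.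
have dle : 32 * 16 * dl <= e2 ^+ 2.
  have : dl <= e2 ^+ 2 / (32 * 16) by rewrite ge_min lexx orbT.
  by rewrite ler_pdivlMr ?mulr_gt0// mulrC.
pose q := 1 + dl; have q1 : 1 < q by rewrite /q ltrDl.
have q0 : 0 < q by lra.
have lq0 : 0 < ln q by rewrite ln_gt0.
(* from [N0] on, [ln (ln (q ^ n)) >= 1] *)
pose N0 := (Num.truncn (expR 1 / ln q)).+1.
pose t n := q ^+ (N0 + n).
have lnt n : ln (t n) = (N0 + n)%:R * ln q by rewrite /t lnXn// mulr_natl.
have N0q : expR 1 <= N0%:R * ln q by rewrite -ler_pdivrMr// ltW// truncnS_gt.
have lnt_ge n : expR 1 <= ln (t n).
  by rewrite lnt (le_trans N0q)// ler_wpM2r ?(ltW lq0)// ler_nat leq_addr.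
have lnt_gt0 n : 0 < ln (t n) by rewrite (lt_le_trans (expR_gt0 1)).
have L1 n : 1 <= ln (ln (t n)).
  by rewrite -{1}[1](@expRK R) ler_ln ?posrE ?expR_gt0.
have t_gt0 n : 0 < t n by rewrite exprn_gt0.
have LE n : ln (ln (t n)) = ln (N0 + n)%:R + ln (ln q).
  by rewrite lnt lnM ?posrE// ltr0n addSn.
have ln_le n : ln n.+1%:R <= ln (N0 + n)%:R :> R.
  by rewrite ler_ln ?posrE ?ltr0n// ler_nat addSn ltnS leq_addl.
(* [ln (ln (t n))] is [ln (N0 + n)] plus a constant, so the bound is a constant times [n.+1^-a]. *)
have decay a n : 1 < a -> expR (- (a * ln (ln (t n)))) <= expR (- (a * ln (ln q))) * expR (- (a * ln n.+1%:R)).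
  move=> a1; rewrite -expRD ler_expR LE -opprD lerN2 -mulrDr addrC ler_pM2l ?lerD2r//; lra.
pose A n := [set w | (1 + e2) * phi (t n) <= `|Y (t n) w|].
have mA n : measurable (A n) by apply: measurable_norm_ge; exact: mY (ltW (t_gt0 n)).
have H1 : {ae P, forall w, \forall n \near \oo, ~ A n w}.
  pose a := (1 + e2) ^+ 2; have a1 : 1 < a by rewrite /a; nra.
  apply: (@ae_eventually_not _ _ _ P A (fun n => 2 * expR (- (a * ln (ln q))) * expR (- (a * ln n.+1%:R)))
    (2 * expR (- (a * ln (ln q))) * (1 + (a - 1)^-1))) => //.
  - move=> n; have Vn := V_gt0 (t_gt0 n).
    apply: le_trans (tail_phi (gaussY (ltW (t_gt0 n))) (t_gt0 n) Vn (lexx _) _ _) _.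
    + by rewrite (le_trans ler01).
    + by rewrite addr_ge0// ltW.
    + by rewrite divff ?gt_eqF// mulr1 lee_fin -mulrA ler_pM2l// decay.
  - by move=> N; rewrite -mulr_sumr ler_pM2l ?mulr_gt0 ?expR_gt0// zeta_partial_le.
pose B n := \bigcup_k \bigcup_(j < 2 ^ k)
    [set w | e2 * ((3 / 4) ^+ k / 4) * phi (t n) <=
      `|Y (t n + dl * t n * (j.+1%:R / 2 ^+ k)) w - Y (t n + dl * t n * (j%:R / 2 ^+ k)) w|].
have H2 : {ae P, forall w, \forall n \near \oo, ~ B n w}.
  apply: (@ae_eventually_not _ _ _ P B (fun n => 4 * expR (- (2 * ln (ln q))) * expR (- (2 * ln n.+1%:R)))
    (4 * expR (- (2 * ln (ln q))) * (1 + (2 - 1)^-1))).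
  - by move=> n; have [] := block_oscillation e20 dl0 dl1 dle (t_gt0 n) (L1 n).
  - move=> n; have [_ +] := block_oscillation e20 dl0 dl1 dle (t_gt0 n) (L1 n).
    move=> /le_trans; apply; rewrite lee_fin -mulrA ler_pM2l// decay// ltr1n//.
  - by move=> N; rewrite -mulr_sumr ler_pM2l ?mulr_gt0 ?expR_gt0// zeta_partial_le// ltr1n.
apply: filterS3 H1 H2 Y_cont => w HA HB cY.
have [M _ HM] : \forall n \near \oo, ~ A n w /\ ~ B n w.
  by near=> n; split; near: n.
near=> u.
have uM : q ^+ (N0 + M) <= u by near: u; apply: nbhs_pinfty_ge; exact: num_real.
(* The least [k] with [u < q^k] exceeds [N0 + M], and its predecessor indexes the block containing
   [u]. *)
have [n Mn /andP[tu ut]] : exists2 n, (M <= n)%N & t n <= u < t n.+1.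
  have ex : exists k, u < q ^+ k.
    exists (Num.truncn (`|u| / ln q)).+1.
    have -> : q ^+ (Num.truncn (`|u| / ln q)).+1 = expR ((Num.truncn (`|u| / ln q)).+1%:R * ln q).
      by rewrite mulr_natl -lnXn// lnK// posrE exprn_gt0.
    apply: lt_le_trans (expR_ge1Dx _); apply: le_lt_trans (ler_norm _) _.
    by rewrite ltr_wpDl// -ltr_pdivrMr// truncnS_gt.
  have [k uk kmin] := ex_minnP ex.
  have Mk : (N0 + M < k)%N.
    rewrite ltnNge; apply/negP => kM; move: uk; rewrite ltNge (le_trans _ uM)//.
    by rewrite ler_weXn2l// ltW.
  have [h1 kE kE'] := shifted_pred Mk.
  exists (k.-1 - N0)%N => //.
  rewrite /t kE kE' uk andbT leNgt; apply/negP => /kmin.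
  by rewrite -{1}kE' addnS kE ltnn.
have [nA nB] := HM n Mn.
have pn : 0 <= phi (t n) by exact: sqrtr_ge0.
have osc : `|Y u w - Y (t n) w| <= e2 * phi (t n).
  pose f x := Y (t n + dl * t n * x) w.
  have := @dyadic_chaining R f (e2 * phi (t n)) _ _ _ ((u - t n) / (dl * t n)).
  have dt0 : 0 < dl * t n by rewrite mulr_gt0.
  rewrite /f mulr0 addr0 mulrCA divff ?gt_eqF// mulr1 addrCA subrr addr0; apply.
  - by rewrite mulr_ge0// ltW.
  - move=> x; apply: (@continuous_comp _ _ _ (fun x : R => t n + dl * t n * x) (fun z => Y z w)); last exact: cY.
    by apply: cvgD; [exact: cvg_cst|apply: cvgM; [exact: cvg_cst|exact: cvg_id]].
  - move=> k j jk; rewrite leNgt; apply/negP => h; apply: nB.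
    by exists k => //; exists j => //=; rewrite mulrAC ltW.
  - rewrite divr_ge0 ?(ltW dt0) ?subr_ge0//= ler_pdivrMr// mul1r lerBlDl.
    by move: ut => /ltW; rewrite /t addnS exprSr mulrDr mulr1 mulrC.
have Yn : `|Y (t n) w| <= (1 + e2) * phi (t n).
  by rewrite leNgt; apply/negP => /ltW.
have pu : phi (t n) <= phi u.
  apply: phi_mono => //; first exact: ltW.
    by rewrite (le_trans ler01).
  rewrite ler_ln ?posrE ?(lt_le_trans (lnt_gt0 n))// ler_ln ?posrE// (lt_le_trans (t_gt0 n))//.
apply: (@le_trans _ _ ((1 + ep) * phi (t n))); last by rewrite ler_pM2l ?addr_gt0.
rewrite -[Y u w](subrK (Y (t n) w)) (le_trans (ler_normD _ _))//.
rewrite (_ : 1 + ep = e2 + (1 + e2)); last by rewrite /e2; field.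
by rewrite mulrDl lerD.
Unshelve. all: end_near. Qed.

Let gaussian_lil_lower ep : 0 < ep < 1 ->
  {ae P, forall w, forall M, exists t, M <= t /\ (1 - ep) * phi t <= `|Y t w|}.
Proof.
move=> /andP[ep0 ep1]; pose e := ep / 3; have e0 : 0 < e by rewrite divr_gt0.
have epE : ep = 3 * e by rewrite /e; field.
(* For [m < n] the ratio [tau n / tau m] will be at least [x n ^ A], and the squared correlation at
   most a constant times its power [- gam]; so [A gam >= 6] yields correlations of order
   [x n ^ -3]. *)
pose A := (Num.truncn (6 / gam)).+1.
have Agam : 6 <= A%:R * gam by rewrite -ler_pdivrMr// ltW// truncnS_gt.
pose x n : R := n.+2%:R.
have x2 n : 2 <= x n by rewrite ler_nat.
have x0 n : 0 < x n by rewrite ltr0n.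
have lnx0 n : 0 < ln (x n) by rewrite ln_gt0// (lt_le_trans _ (x2 n))// ltr1n.
have x_mono m n : (m <= n)%N -> x m <= x n by move=> mn; rewrite ler_nat.
pose tau n := (x n ^+ n.+2) ^+ A.
have tau0 n : 0 < tau n by rewrite !exprn_gt0.
have ln_tau n : ln (tau n) = A%:R * (x n * ln (x n)).
  rewrite /tau lnXn ?exprn_gt0// lnXn// -[LHS]mulr_natl; congr (_ * _).
  by rewrite -[LHS]mulr_natl.
have x_tau n : x n <= tau n.
  have x1 : 1 <= x n by rewrite (le_trans _ (x2 n))// ler1n.
  have h : x n <= x n ^+ n.+2 by rewrite -[leLHS]expr1 ler_weXn2l.
  apply: (le_trans h); rewrite -[leLHS]expr1 ler_weXn2l//.
  exact: le_trans h.
have tau_ratio m n : (m < n)%N -> x n ^+ A <= tau n / tau m.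
  move=> mn; rewrite ler_pdivlMr// /tau -exprMn.
  have xm0 := ltW (x0 m); have xn0 := ltW (x0 n).
  have x1 : 1 <= x n by rewrite (le_trans _ (x2 n))// ler1n.
  have p1 : 0 <= x n * x m ^+ m.+2 by exact: mulr_ge0 xn0 (exprn_ge0 _ xm0).
  have p2 : 0 <= x n ^+ n.+2 by exact: exprn_ge0.
  apply: (@lerXn2r _ A _ _ p1 p2).
  apply: (@le_trans _ _ (x n * x n ^+ m.+2)).
    by apply: ler_wpM2l => //; apply: lerXn2r => //; rewrite x_mono// ltnW.
  by rewrite -exprS ler_weXn2l.
(* In [rho] the numerator is at most [3 (tau m / tau n) V (tau n)]: 2 from [V_incr] and 1 from
   [V_scale]. Over the factor 2 of the denominator this is [3 / 2]; [sqrt C0] enters when [V_growth]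
   compares [V (tau n)] with [V (tau m)]. *)
pose c := 3 / 2 * Num.sqrt C0.
have c0 : 0 < c by rewrite mulr_gt0// ?sqrtr_gt0.
pose rho m n := (V (tau m) + V (tau n) - V `|tau n - tau m|) / (2 * Num.sqrt (V (tau m) * V (tau n))).
have rho_le m n : (m < n)%N -> t0 <= x m -> `|rho m n| <= c * x n ^- 3.
  move=> mn tm.
  have Vm := V_gt0 (tau0 m); have Vn := V_gt0 (tau0 n).
  have ratio := tau_ratio _ _ mn.
  have x1 : 1 <= x n by rewrite (le_trans _ (x2 n))// ler1n.
  have tmn : tau m <= tau n.
    by rewrite -[leLHS]mul1r -ler_pdivlMr// (le_trans _ ratio)// exprn_ege1.
  pose lam := ln (tau n / tau m).
  have q0 : 0 < tau n / tau m by rewrite divr_gt0.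
  have lam_ge : A%:R * ln (x n) <= lam.
    by rewrite mulr_natl -lnXn// ler_ln// posrE exprn_gt0.
  have rE : tau m / tau n = expR (- lam) by rewrite expRN /lam lnK ?posrE// invf_div.
  have growth := V_growth (le_trans tm (x_tau m)) tmn.
  rewrite /powR gt_eqF// -/lam in growth.
  have incr := V_incr (tau0 m) tmn.
  rewrite rE in incr.
  have sc : V (tau m) <= expR (- lam) * V (tau n).
    rewrite -rE -{1}(divfK (lt0r_neq0 (tau0 n)) (tau m)); apply: V_scale; last exact: ltW.
    by rewrite (divr_ge0 (ltW (tau0 m)) (ltW (tau0 n)))/= ler_pdivrMr// mul1r.
  have dmono : V (tau n - tau m) <= V (tau n).
    by apply: V_mono; rewrite ?subr_ge0// gerBl ltW.
  have aE : `|tau n - tau m| = tau n - tau m by rewrite ger0_norm// subr_ge0.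
  rewrite /rho aE; set num := _ - V _.
  have num0 : 0 <= num by rewrite /num; move: dmono Vm Vn; move: (V _) (V _) (V _) => *; lra.
  have num_le : num <= 3 * expR (- lam) * V (tau n) by rewrite /num; move: incr sc; move: (V _) (V _) (V _) (expR _) => *; lra.
  have sV : 0 < 2 * Num.sqrt (V (tau m) * V (tau n)) by rewrite mulr_gt0// sqrtr_gt0 mulr_gt0.
  rewrite ger0_norm ?divr_ge0 ?(ltW sV)//.
  rewrite -(@ler_pXn2r _ 2) ?nnegrE ?divr_ge0 ?mulr_ge0 ?(ltW sV) ?(ltW c0) ?invr_ge0 ?exprn_ge0 ?(ltW (x0 _))//.
  rewrite expr_div_n exprMn sqr_sqrtr ?mulr_ge0 ?(ltW Vm) ?(ltW Vn)//.
  rewrite ler_pdivrMr ?mulr_gt0 ?exprn_gt0//.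
  apply: (@le_trans _ _ ((3 * expR (- lam) * V (tau n)) ^+ 2)).
    by rewrite lerXn2r ?nnegrE// (le_trans num0).
  have -> : (c * x n ^- 3) ^+ 2 = 9 / 4 * C0 * (x n ^+ 6)^-1.
    rewrite exprMn /c exprMn sqr_sqrtr ?(ltW C0_gt0)// -exprVn -exprM exprVn.
    by congr (_ * _ * _); field.
  have x6 : expR (- (gam * lam)) <= (x n ^+ 6)^-1.
    have -> : (x n ^+ 6)^-1 = expR (- (6 * ln (x n))).
      by rewrite mulr_natl -lnXn// expRN lnK// posrE exprn_gt0.
    rewrite ler_expR lerN2; apply: (@le_trans _ _ (gam * (A%:R * ln (x n)))).
      by rewrite mulrA ler_pM2r// mulrC.
    by rewrite ler_pM2l.
  apply: (@le_trans _ _ (9 / 4 * C0 * expR (- (gam * lam)) * (2 ^+ 2 * (V (tau m) * V (tau n))))); last first.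
    by rewrite ler_pM2r ?mulr_gt0 ?exprn_gt0// ler_pM2l ?mulr_gt0.
  have -> : expR (- (gam * lam)) = expR (- lam) ^+ 2 * expR ((2 - gam) * lam).
    by rewrite expr2 -!expRD; congr expR; ring.
  rewrite !exprMn [leRHS](_ : _ = 3 ^+ 2 * expR (- lam) ^+ 2 * V (tau n) * (C0 * expR ((2 - gam) * lam) * V (tau m))); last by field.
  rewrite [V (tau n) ^+ 2]expr2 [leLHS]mulrA; apply: ler_wpM2l growth.
  by apply: mulr_ge0 (ltW Vn); rewrite -exprMn sqr_ge0.
(* Dropping the first indices puts all times in the range of [V_growth] and makes [c x^-3 <= 1/2],
   as the covariance bound requires. *)
pose n0 := (Num.truncn (`|t0| + 2 * c)).+1.
have xn0 n : `|t0| + 2 * c <= x (n0 + n)%N.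
  by apply: ltW; apply: lt_le_trans (truncnS_gt _) _; rewrite ler_nat -/n0 -addn2 -addnA leq_addr.
pose k n := (n0 + n)%N.
have nk n : (n.+1 <= (k n).+2)%N by rewrite leqW// ltnS leq_addl.
have t0x n : t0 <= x (k n) by have := xn0 n; have := ler_norm t0; rewrite /k; lra.
(* A miss of the centre by [e sqrt (2 y)], [y = ln (x (k n))], then makes the bump at most
   [exp (- 4 y)], which is summable. *)
have [s [s0 sE]] : exists s : R, 0 < s /\ s = 2 / e by exists (2 / e); rewrite divr_gt0.
pose a n := (1 - e) * Num.sqrt (2 * ln (x (k n))).
pose Z n w := (Num.sqrt (V (tau (k n))))^-1 * Y (tau (k n)) w.
have sV n : 0 < Num.sqrt (V (tau (k n))) by rewrite sqrtr_gt0 V_gt0.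
have sV2 n : Num.sqrt (V (tau (k n))) ^+ 2 = V (tau (k n)) by rewrite sqr_sqrtr// ltW// V_gt0.
have mZ n : measurable_fun setT (Z n) by apply: measurable_funM => //; exact: mY (ltW (tau0 _)).
have gZ n : is_gauss P (Z n) 1.
  have := gaussZ (Num.sqrt (V (tau (k n))))^-1 (gaussY (ltW (tau0 (k n)))).
  by rewrite exprVn sV2 mulVf// gt_eqF// V_gt0.
pose W n w := bump s (Z n w - a n).
have mW n : measurable_fun setT (W n).
  by apply: measurableT_comp; [exact: measurable_bump|exact: measurable_funB].
have W01 n w : 0 <= W n w <= 1.
  by rewrite expR_ge0 expR_le1 oppr_le0 divr_ge0// mulr_ge0 ?sqr_ge0.
have xk3 n : c * x (k n) ^- 3 <= 1 / 2.
  have x1 : 1 <= x (k n) by rewrite (le_trans _ (x2 _))// ler1n.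
  rewrite ler_pdivrMr ?exprn_gt0//.
  have : x (k n) <= x (k n) ^+ 3 by rewrite -[leLHS]expr1 ler_weXn2l.
  by have := xn0 n; have := normr_ge0 t0; rewrite -/(k n); lra.
have covW m n : (m < n)%N ->
    `|\int[P]_w (W m w * W n w) - (\int[P]_w W m w) * (\int[P]_w W n w)| <= c * x (k n) ^- 3.
  move=> mn; have kmn : (k m < k n)%N by rewrite /k ltn_add2l.
  have rle := rho_le _ _ kmn (t0x m).
  apply: le_trans (rle); apply: bump_covariance_le => //; last exact: le_trans rle (xk3 n).
  move=> al be.
  have := Y_gauss (al / Num.sqrt (V (tau (k m)))) (be / Num.sqrt (V (tau (k n)))) (ltW (tau0 (k m))) (ltW (tau0 (k n))).
  have sm := sV m; have sn := sV n.
  rewrite (_ : _ + _ + _ = al ^+ 2 + 2 * rho (k m) (k n) * al * be + be ^+ 2).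
    by move=> [h1 h2]; have E : (fun w => al / Num.sqrt (V (tau (k m))) * Y (tau (k m)) w + be / Num.sqrt (V (tau (k n))) * Y (tau (k n)) w) = (fun w => al * Z m w + be * Z n w);
      [by apply/funext => w; rewrite /Z; ring|rewrite -E; split].
  rewrite /rho sqrtrM ?(ltW (V_gt0 (tau0 _)))//.
  move: sm sn (sV2 m) (sV2 n).
  move: (Num.sqrt (V (tau (k m)))) (Num.sqrt (V (tau (k n)))) => S1 S2 S10 S20 <- <-.
  by field; rewrite !gt_eqF.
have sumC N : \sum_(0 <= n < N) n%:R * (c * x (k n) ^- 3) <= c * (1 + (2 - 1)^-1).
  apply: le_trans (_ : \sum_(0 <= n < N) c * expR (- (2 * ln n.+1%:R)) <= _).
    apply: ler_sum => n _; rewrite mulrCA ler_pM2l//.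
    have -> : expR (- (2 * ln n.+1%:R)) = (n.+1%:R ^+ 2)^-1 :> R.
      by rewrite mulr_natl -lnXn ?ltr0n// expRN lnK// posrE exprn_gt0// ltr0n.
    have n1 : (0 : R) < n.+1%:R by [].
    have nx : n.+1%:R <= x (k n) by rewrite /x ler_nat nk.
    by apply: frac_cube_le => //; rewrite ler_nat.
  by rewrite -mulr_sumr ler_pM2l// zeta_partial_le// ltr1n.
pose kap := (Num.sqrt (1 + 1 * s ^+ 2))^-1.
have kap0 : 0 < kap by rewrite invr_gt0 sqrtr_gt0 ltr_pwDl// mulr_ge0// sqr_ge0.
(* The exponent of the mean is [s^2 (1 - e)^2 / (1 + s^2)] times [ln x], and this factor is at most
   1. *)
have EW n : kap * (x (k n))^-1 <= \int[P]_w W n w.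
  rewrite /W /bump (gauss_bump _ s0 (gZ n)) -/kap ler_pM2l//.
  rewrite -{1}(lnK (x0 (k n) : x (k n) \in Num.pos)) -expRN ler_expR lerN2.
  have -> : a n ^+ 2 = (1 - e) ^+ 2 * (2 * ln (x (k n))).
    by rewrite /a exprMn sqr_sqrtr ?mulr_ge0 ?(ltW (lnx0 _)).
  have l0 := lnx0 (k n).
  have q0 : 0 < 1 + 1 * s ^+ 2 by rewrite ltr_pwDl// mul1r sqr_ge0.
  rewrite ler_pdivrMr ?mulr_gt0//.
  have e1 : (1 - e) ^+ 2 <= 1 by move: e0 ep1; rewrite epE => h1 h2; nra.
  have s2 : 0 <= s ^+ 2 by exact: sqr_ge0.
  apply: (@le_trans _ _ (s ^+ 2 * (1 * (2 * ln (x (k n)))))).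
    by rewrite ler_wpM2l// ler_wpM2r// mulr_ge0// ltW.
  by move: (s ^+ 2) s2 (ln (x (k n))) l0 => *; nra.
have divW K : exists N, K <= \sum_(0 <= n < N) \int[P]_w W n w.
  have [N HN] := harmonic_unbounded (K * (n0.+1%:R / kap)).
  exists N; apply: (@le_trans _ _ (\sum_(0 <= n < N) (kap / n0.+1%:R) * n.+2%:R^-1)).
    have h : 0 < kap / n0.+1%:R by rewrite divr_gt0.
    by rewrite -mulr_sumr -ler_pdivrMl// invf_div mulrC.
  apply: ler_sum => n _; apply: le_trans (EW n); rewrite -mulrA ler_pM2l//.
  rewrite -invfM lef_pV2 ?posrE ?mulr_gt0//.
  by rewrite /x /k -natrM ler_nat shifted_le_mul.
have := ae_series_unbounded mW W01 covW sumC divW.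
apply: filterS => w Hw M.
apply: contrapT => /forallNP HM.
(* Beyond [B] the times exceed [M], and the lower-order terms [ln A + ln y] of
   [ln (ln tau) = ln A + y + ln y] are at most [e y]. *)
pose B := `|M| + expR ((ln A%:R - ln (e / 2)) / (e / 2)).
pose n1 := (Num.truncn B).+1.
have Wsmall n : (n1 <= n)%N -> W n w <= expR (- (2 * ln n.+1%:R)).
  move=> nn1.
  have xB : B <= x (k n).
    by apply: ltW; apply: lt_le_trans (truncnS_gt _) _; rewrite ler_nat -/n1 (leq_trans nn1)// (leq_trans (leqnSn n))// nk.
  have /not_andP := HM (tau (k n)).
  have Mx : M <= tau (k n).
    apply: le_trans (x_tau _); apply: le_trans xB; apply: le_trans (ler_norm _) _.
    by rewrite lerDl expR_ge0.
  case => [//|/negP]; rewrite -ltNge => Ylt.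
  set y := ln (x (k n)); have y0 : 0 < y by exact: lnx0.
  have yB : ln A%:R - ln (e / 2) <= (e / 2) * y.
    rewrite -ler_pdivrMl ?divr_gt0// mulrC -(expRK (_ / _)) /y ler_ln ?posrE ?expR_gt0//.
    by apply: le_trans xB; rewrite lerDr.
  have A0 : (0 : R) < A%:R by [].
  have LE : ln (ln (tau (k n))) = ln A%:R + (y + ln y).
    rewrite ln_tau -/y lnM ?posrE ?mulr_gt0//.
    by rewrite lnM ?posrE.
  have lny : ln y <= e / 2 * y - ln (e / 2).
    have := @le_ln1Dx R (e / 2 * y - 1); rewrite addrCA subrr addr0.
    have ey : 0 < e / 2 * y by rewrite mulr_gt0// divr_gt0.
    rewrite lnM ?posrE ?divr_gt0// => h; have : -1 < e / 2 * y - 1 by lra.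
    by move=> /h; lra.
  have Lle : ln (ln (tau (k n))) <= (1 + e) * y by rewrite LE; lra.
  (* A path below [(1 - 3 e) phi] keeps [Z n] below [(1 - 3 e) (1 + e) sqrt (2 y) <= (1 - 2 e) sqrt
     (2 y)], a distance [e sqrt (2 y)] short of the centre [a n]. *)
  have Zlt : Z n w <= (1 - 2 * e) * Num.sqrt (2 * y).
    rewrite /Z ler_pdivrMl//; apply: le_trans (ler_norm _) _; apply: (le_trans (ltW Ylt)).
    have ph : phi (tau (k n)) <= Num.sqrt (V (tau (k n))) * (Num.sqrt (2 * y) * (1 + e)).
      by apply: sqrt_variance_le => //; exact: ltW (V_gt0 _).
    apply: (@le_trans _ _ ((1 - ep) * (Num.sqrt (V (tau (k n))) * (Num.sqrt (2 * y) * (1 + e))))).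
      by rewrite ler_wpM2l//; lra.
    rewrite mulrCA ler_pM2l// epE; apply: onem_triple_le => //; exact: sqrtr_ge0.
  rewrite /W /bump ler_expR lerN2.
  have za : e * Num.sqrt (2 * y) <= a n - Z n w by rewrite /a -/y; lra.
  have sy := sqrtr_ge0 (2 * y).
  have za2 : e ^+ 2 * (2 * y) <= (Z n w - a n) ^+ 2.
    rewrite -(sqr_sqrtr (_ : 0 <= 2 * y)); last by rewrite mulr_ge0// ltW.
    have ey : 0 <= e * Num.sqrt (2 * y) by rewrite mulr_ge0// ltW.
    by rewrite -exprMn -[leRHS]sqrrN opprB lerXn2r ?nnegrE// (le_trans ey).
  apply: (@le_trans _ _ (s ^+ 2 * (e ^+ 2 * (2 * y)) / 2)); last first.
    by rewrite ler_pM2r ?invr_gt0// ler_pM2l// exprn_gt0.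
  rewrite sE [leRHS](_ : _ = 4 * y); last by field; rewrite gt_eqF.
  have : ln n.+1%:R <= y by rewrite ler_ln ?posrE// ler_nat nk.
  lra.
(* The first [n1] bumps contribute at most 1 each and the others at most 2 together, so a partial
   sum above [n1 + 3] is contradictory. *)
have [N HN] := Hw (n1%:R + 3).
have : \sum_(0 <= n < N) W n w <= n1%:R + 2.
  apply: (@le_trans _ _ (\sum_(0 <= n < N) ((n < n1)%:R + expR (- (2 * ln n.+1%:R))))).
    apply: ler_sum => n _; case: ltnP => nn1 /=.
      by have /andP[_ h] := W01 n w; rewrite (le_trans h)// lerDl expR_ge0.
    by rewrite add0r Wsmall.
  rewrite big_split/= lerD//.
    rewrite -natr_sum ler_nat; apply: leq_trans (_ : (\sum_(0 <= n < maxn N n1) (n < n1) <= _)%N).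
      by rewrite [leqRHS](big_cat_nat _ (n := N)) ?leq_maxl//= leq_addr.
    rewrite (big_cat_nat _ (n := n1)) ?leq_maxr//=.
    rewrite [X in (_ + X)%N]big1_seq ?addn0.
      by rewrite (leq_trans (leq_sum _ (fun n _ => leq_b1 _)))// sum_nat_const_nat muln1 subn0.
    by move=> n /andP[_]; rewrite mem_index_iota leqNgt => /andP[/negbTE ->].
  have h2 : 1 < 2 :> R by rewrite ltr1n.
  have := zeta_partial_le h2 N; rewrite (_ : 2 - 1 = 1 :> R); last by ring.
  by rewrite invr1.
lra.
Qed.

(** Taking [ep = 1 / (k + 2)] keeps the exceptional sets countable in number. The upper half
    exhibits a neighbourhood of infinity on which the ratio is at most [1 + e]; by the lower half
    every such neighbourhood contains a time with ratio at least [1 - e]. *)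
Theorem gaussian_lil (psi : R -> R) :
  (\forall t \near +oo, 0 < psi t) ->
  phi t / psi t @[t --> +oo] --> (1 : R) ->
  {ae P, forall w, limsup_pinfty (fun t => `|Y t w| / psi t) = 1%E}.
Proof.
move=> psi0 psi1.
have ep0 k : (0 : R) < k.+2%:R^-1 by rewrite invr_gt0.
have ep1 k : 0 < (k.+2%:R^-1 : R) < 1 by rewrite ep0/= invf_lt1// ltr1n.
have U : {ae P, forall w, forall k, \forall t \near +oo, `|Y t w| <= (1 + k.+2%:R^-1) * phi t}.
  by apply/ae_foralln => k; exact: gaussian_lil_upper.
have L : {ae P, forall w, forall k : nat, forall M, exists t, M <= t /\ (1 - k.+2%:R^-1) * phi t <= `|Y t w|}.
  by apply/ae_foralln => k; exact: gaussian_lil_lower.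
apply: filterS2 U L => w Uw Lw.
have small (z : R) : 0 < z -> exists k, (k.+2%:R^-1 : R) <= z.
  move=> z0; exists (Num.truncn z^-1); rewrite -[leRHS]invrK lef_pV2 ?posrE ?invr_gt0//.
  by rewrite (le_trans (ltW (truncnS_gt _)))// ler_nat.
rewrite /limsup_pinfty /limf_esup; apply/eqP; rewrite eq_le; apply/andP; split.
- apply/lee_addgt0Pr => e e0.
  have [|k hk] := small (Num.min 1 (e / 4)); first by rewrite lt_min ltr01 divr_gt0.
  apply: (@le_trans _ _ (ereal_sup [set ((EFin \o (fun t => `|Y t w| / psi t)) x) | x in [set t | `|Y t w| / psi t <= 1 + e]])).
    apply: ereal_inf_lbound; exists [set t | `|Y t w| / psi t <= 1 + e] => //.
    have e1 : 1 < 1 + e / 4 by rewrite ltrDl divr_gt0.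
    have h1 : \forall t \near +oo, phi t / psi t <= 1 + e / 4 by exact: (cvgr_le (1 : R) psi1 _ e1).
    near=> t => /=.
    have pt : 0 < psi t by near: t.
    have ut : `|Y t w| <= (1 + k.+2%:R^-1) * phi t by near: t; exact: Uw.
    have rt : phi t / psi t <= 1 + e / 4 by near: t.
    apply: (@le_trans _ _ ((1 + k.+2%:R^-1) * (phi t / psi t))).
      by rewrite mulrA ler_pM2r ?invr_gt0.
    move: hk; rewrite le_min => /andP[hk1 hk2].
    have p0 : 0 <= phi t / psi t by rewrite divr_ge0 ?sqrtr_ge0// ltW.
    have hk0 := ep0 k; move: hk0 hk1 hk2 p0 rt; move: (k.+2%:R^-1) (phi t / psi t) => a r *; nra.
  by apply: ge_ereal_sup => _ [t /= ht <-]; rewrite -EFinD lee_fin.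
- apply: le_ereal_inf_tmp => _ [A FA <-].
  apply/lee_subgt0Pr => e e0.
  have [|k hk] := small (Num.min 1 (e / 4)); first by rewrite lt_min ltr01 divr_gt0.
  have e1 : 1 - e / 4 < 1 by rewrite gtrBl divr_gt0.
  have h1 : \forall t \near +oo, 1 - e / 4 <= phi t / psi t by exact: (cvgr_ge (1 : R) psi1 _ e1).
  have [M [_ HM]] : \forall t \near +oo, [/\ A t, 0 < psi t & 1 - e / 4 <= phi t / psi t].
    by near=> t; split; near: t.
  have [t [Mt lt]] := Lw k (M + 1).
  have [At pt rt] := HM t (lt_le_trans (ltr_pwDr ltr01 (lexx M)) Mt).
  apply: (@le_trans _ _ (`|Y t w| / psi t)%:E); last by apply: ereal_sup_ubound; exists t.
  rewrite -EFinB lee_fin.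
  apply: (@le_trans _ _ ((1 - k.+2%:R^-1) * (phi t / psi t))); last first.
    by rewrite mulrA ler_pM2r ?invr_gt0.
  move: hk; rewrite le_min => /andP[hk1 hk2].
  have p0 : 0 <= phi t / psi t by rewrite divr_ge0 ?sqrtr_ge0// ltW.
  have hk0 := ep0 k; move: hk0 hk1 hk2 p0 rt; move: (k.+2%:R^-1) (phi t / psi t) => a r *; nra.
Unshelve. all: end_near. Qed.

End gaussian_lil.

(** * The variance function *)

Section kernel.
Context {R : realType}.
Implicit Types (x y z s t u : R).

(* [x^-2 kern (x t)] is the integral of [(1 - exp (- x u)) / x] over [0 <= u <= t]. *)
Definition kern y := y - 1 + expR (- y).

Lemma measurable_kern : measurable_fun [set: R] kern.
Proof.
apply: measurable_funD; first exact: measurable_funB.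
by apply: measurableT_comp => //; exact: measurable_funN.
Qed.

Lemma kern_ge0 y : 0 <= kern y.
Proof. by rewrite /kern; have := expR_ge1Dx (- y); lra. Qed.

Lemma kern_gt0 y : y != 0 -> 0 < kern y.
Proof. by move=> y0; rewrite /kern; have := @expR_gt1Dx R (- y); rewrite oppr_eq0 y0 => /(_ isT); lra. Qed.

Lemma kern_le y : 0 <= y -> kern y <= y.
Proof. by move=> y0; rewrite /kern; have : expR (- y) <= 1; [by rewrite expR_le1 oppr_le0|lra]. Qed.

Lemma kern_le_sqr y : 0 <= y -> kern y <= y ^+ 2.
Proof. by move=> y0; rewrite /kern; have /andP[] := onem_expRN_bound y0; lra. Qed.

(** Convexity with [kern 0 = 0]: the tangent of [exp (- _)] at [s y] is compared with its values at
    0 and at [y], with weights [1 - s] and [s]. *)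
Lemma kern_scale s y : 0 <= s <= 1 -> 0 <= y -> kern (s * y) <= s * kern y.
Proof.
move=> /andP[s0 s1] y0; rewrite /kern.
have e0 := expR_gt0 (- (s * y)).
have h1 : expR (- (s * y)) * (1 + s * y) <= 1.
  rewrite -[leRHS](expRxMexpNx_1 (s * y)) mulrC ler_pM2r//; exact: expR_ge1Dx.
have h2 : expR (- (s * y)) * (1 - (1 - s) * y) <= expR (- y).
  rewrite (_ : - y = - (s * y) + (- ((1 - s) * y))); last by ring.
  rewrite expRD ler_pM2l//; have := expR_ge1Dx (- ((1 - s) * y)); lra.
move: h1 h2; move: (expR (- (s * y))) (expR (- y)) e0 => a c a0 h1 h2.
have : s * (a * (1 - (1 - s) * y)) <= s * c by rewrite ler_wpM2l.
have : (1 - s) * (a * (1 + s * y)) <= (1 - s) * 1 by rewrite ler_wpM2l// subr_ge0.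
nra.
Qed.

(* y(1-e^{-y}) <= 2 kern y, i.e. (1+u)e^{-u} >= (1-u)e^u with y = 2u *)
Lemma kern_ge y : 0 <= y -> y * (1 - expR (- y)) <= 2 * kern y.
Proof.
move=> y0; rewrite /kern.
suff : 0 <= (y + 2) * expR (- y) + (y - 2) by lra.
pose F u := (u + 2) * expR (- u) + (u - 2).
pose f u := 1 - (u + 1) * expR (- u).
have dF (u : R) : has_deriv F u (f u).
  apply: deriv_ext (derivD (derivM (derivD (deriv_id u) (deriv_cst 2 u))
    (deriv_expR (derivN (deriv_id u)))) (derivB (deriv_id u) (deriv_cst 2 u))) _ _ => //.
  by rewrite /f; ring.
have f0 u : 0 <= f u.
  rewrite /f subr_ge0 -[leRHS](expRxMexpNx_1 u) ler_pM2r ?expR_gt0//.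
  by rewrite addrC; exact: expR_ge1Dx.
have cf : continuous f.
  move=> u; apply: (@deriv_continuous _ f _ _ (derivB (deriv_cst 1 u) (derivM (derivD (deriv_id u) (deriv_cst 1 u))
    (deriv_expR (derivN (deriv_id u)))))).
have := FTC_deriv y0 (fun u _ => dF u) (fun u _ => cf u).
have -> : F 0 = 0 by rewrite /F oppr0 expR0; ring.
rewrite subr0 => E; rewrite -lee_fin -[X in (_ <= X)%E]/((F y)%:E) -E.
by apply: integral_ge0 => u _; rewrite lee_fin.
Qed.

(** Convexity bounds the increment by [z] times the slope at [y], and [kern_ge] bounds [y] times
    this slope by [2 kern y]. *)
Lemma kern_incr y z : 0 < y -> 0 <= z <= y ->
  kern y - kern (y - z) <= 2 * (z / y) * kern y.
Proof.
move=> y0 /andP[z0 zy].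
have h : kern y - kern (y - z) <= z * (1 - expR (- y)).
  rewrite /kern.
  have : expR (- y) * (1 + z) <= expR (- (y - z)).
    by rewrite opprB (addrC z) expRD ler_pM2l ?expR_gt0//; exact: expR_ge1Dx.
  lra.
apply: le_trans h _; have := kern_ge (ltW y0).
rewrite (_ : 2 * (z / y) * _ = (z / y) * (2 * kern y)); last by ring.
move=> h; apply: le_trans (ler_wpM2l _ h); last by rewrite divr_ge0// ltW.
by rewrite mulrA divfK ?gt_eqF.
Qed.

End kernel.

Section half_line.
Context {R : realType}.
Local Notation D := (`]0, +oo[%classic : set R).

Lemma half_line_gt0 (x : R) : D x -> 0 < x.
Proof. by rewrite /= in_itv/= andbT. Qed.

Lemma gt0_half_line (x : R) : 0 < x -> D x.
Proof. by rewrite /= in_itv/= andbT. Qed.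

Lemma measurable_half_lineV : measurable_fun D (fun x : R => x^-1).
Proof.
apply: eq_measurable_fun (measurable_funS measurableT (@subsetT _ _) (measurable_powR (-1))) => //.
by move=> x /[!inE] /half_line_gt0/ltW x0; rewrite powR_inv1.
Qed.

Lemma measurable_half_lineX n : measurable_fun D (fun x : R => x^-1 ^+ n).
Proof. exact: measurable_funX measurable_half_lineV. Qed.

End half_line.

(** * Finiteness, scaling and increments of the variance *)

Section variance_function.
Context {R : realType}.
Variables (pi : {measure set R -> \bar R}) (b : R).
Hypotheses (pi_half_line : on_half_line pi) (pi_neq0 : pi [set: R] <> 0%E)
  (m1 : (moment pi (-1) < +oo)%E) (b0 : 0 < b).
Local Notation D := (`]0, +oo[%classic : set R).

Lemma moment_natN (n : nat) : moment pi (- (n : int)) = (\int[pi]_(x in D) (x^-1 ^+ n)%:E)%E.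
Proof.
by apply: eq_integral => x xD; rewrite -exprnN exprVn.
Qed.

Lemma integrable_moment (n : nat) : (moment pi (- (n : int)) < +oo)%E ->
  pi.-integrable D (EFin \o (fun x => x^-1 ^+ n)).
Proof.
rewrite moment_natN => mn; apply/integrableP; split.
  by apply/measurable_EFinP; exact: measurable_half_lineX.
rewrite (eq_integral (fun x : R => (x^-1 ^+ n)%:E))// => x /[!inE] /half_line_gt0 x0.
by rewrite /= ger0_norm// exprn_ge0// invr_ge0 ltW.
Qed.

Lemma integrableV : pi.-integrable D (EFin \o (fun x => x^-1)).
Proof. exact: (@integrable_moment 1 m1). Qed.

Definition vint (t x : R) := x^-1 ^+ 3 * kern (x * t).

Lemma measurable_vint t : measurable_fun D (vint t).
Proof.
apply: measurable_funM; first exact: measurable_half_lineX.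
by apply: (measurableT_comp measurable_kern) => //; exact: measurable_funM.
Qed.

Lemma vint_ge0 t x : D x -> 0 <= vint t x.
Proof. by move=> /half_line_gt0 x0; rewrite mulr_ge0 ?kern_ge0// exprn_ge0// invr_ge0 ltW. Qed.

(** The quadratic bound on [kern]: it makes the variance finite under the first inverse moment
    alone. *)
Lemma vint_le1 t x : 0 <= t -> D x -> vint t x <= t ^+ 2 * x^-1.
Proof.
move=> t0 /half_line_gt0 x0; rewrite /vint.
have /(ler_wpM2l (_ : 0 <= x^-1 ^+ 3)) : kern (x * t) <= (x * t) ^+ 2.
  by apply: kern_le_sqr; rewrite mulr_ge0// ltW.
move=> /(_ ltac:(by rewrite exprn_ge0// invr_ge0 ltW)) /le_trans; apply.
by rewrite le_eqVlt; apply/orP; left; apply/eqP; field; rewrite gt_eqF.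
Qed.

(** The linear bound on [kern]: it dominates [vint t x / t] when [m_{-2}] is finite, and controls
    the part of [pi] away from 0 in the regularly varying case. *)
Lemma vint_le2 t x : 0 <= t -> D x -> vint t x <= t * x^-1 ^+ 2.
Proof.
move=> t0 /half_line_gt0 x0; rewrite /vint.
have /(ler_wpM2l (_ : 0 <= x^-1 ^+ 3)) : kern (x * t) <= (x * t).
  by apply: kern_le; rewrite mulr_ge0// ltW.
move=> /(_ ltac:(by rewrite exprn_ge0// invr_ge0 ltW)) /le_trans; apply.
by rewrite le_eqVlt; apply/orP; left; apply/eqP; field; rewrite gt_eqF.
Qed.

Lemma integrable_vint t : 0 <= t -> pi.-integrable D (EFin \o vint t).
Proof.
move=> t0; apply: (@le_integrable _ _ _ _ _ _ _ (EFin \o (fun x => t ^+ 2 * x^-1))) => //.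
- by apply/measurable_EFinP; exact: measurable_vint.
- move=> x Dx; rewrite lee_fin /= !ger0_norm ?vint_ge0//; first exact: vint_le1.
  by rewrite mulr_ge0 ?sqr_ge0// invr_ge0 ltW// half_line_gt0.
- by apply: integrableZR => //; exact: integrableV.
Qed.

(* The variance of [X* t]. *)
Definition supvar (t : R) := b * \int[pi]_(x in D) vint t x.

Lemma half_line_neq0 : pi D <> 0%E.
Proof.
move=> piD; apply: pi_neq0; apply/eqP; rewrite eq_le measure_ge0 andbT.
rewrite (_ : setT = [set x : R | x <= 0] `|` D); last first.
  by apply/seteqP; split=> // x _; have [x0|x0] := leP x 0; [left|right; rewrite /= in_itv/= x0].
have mN : measurable [set x : R | x <= 0].
  by rewrite (_ : [set x | _] = `]-oo, 0]%classic).
apply: le_trans (measureU2 _ _ _) _ => //.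
apply: (@le_trans _ _ (0 + 0)%E); last by rewrite adde0.
apply: leeD; first exact: (eq_ind_r (fun u => (u <= 0)%E) (lexx _) pi_half_line).
exact: (eq_ind_r (fun u => (u <= 0)%E) (lexx _) piD).
Qed.

(** A zero integral would make [f] vanish almost everywhere on the half-line, which carries positive
    mass. *)
Lemma half_line_integral_gt0 (f : R -> R) : pi.-integrable D (EFin \o f) ->
  (forall x, D x -> 0 < f x) -> 0 < \int[pi]_(x in D) f x.
Proof.
move=> If f0; rewrite lt0r; apply/andP; split; last first.
  by apply: Rintegral_ge0 => x Dx; rewrite ltW// f0.
apply/eqP => E; apply: half_line_neq0.
have mf : measurable_fun D (EFin \o f) by apply: measurable_int If.
have : (\int[pi]_(x in D) `|(EFin \o f) x| = 0)%E.
  rewrite (eq_integral (EFin \o f)); last first.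
    by move=> x /[!inE] Dx; rewrite /= gtr0_norm// f0.
  have := integrable_fin_num (_ : measurable D) If => /(_ ltac:(by [])).
  by move=> /fineK <-; rewrite -[X in X%:E]/(\int[pi]_(x in D) f x) E.
move=> /(ae_eq_integral_abs pi _ mf) => /(_ ltac:(by [])).
case=> N [mN N0 HN]; apply/eqP; rewrite eq_le measure_ge0 andbT -N0.
apply: le_measure; rewrite ?inE// => x Dx; apply: HN => /= /(_ Dx) [] fx.
by have := f0 x Dx; rewrite fx ltxx.
Qed.

Lemma supvar_gt0 t : 0 < t -> 0 < supvar t.
Proof.
move=> t0; rewrite mulr_gt0//; apply: half_line_integral_gt0; first exact: integrable_vint (ltW t0).
move=> x /half_line_gt0 x0; rewrite mulr_gt0// ?exprn_gt0 ?invr_gt0//.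
by rewrite kern_gt0// mulf_neq0 ?gt_eqF.
Qed.

Lemma supvar_scale s t : 0 <= s <= 1 -> 0 <= t -> supvar (s * t) <= s * supvar t.
Proof.
move=> /andP[s0 s1] t0; rewrite /supvar mulrCA ler_pM2l//.
have st0 : 0 <= s * t by rewrite mulr_ge0.
rewrite -RintegralZl//; last exact: integrable_vint.
apply: le_Rintegral => //; first exact: integrable_vint.
  by apply: integrableZR => //; exact: integrable_vint.
move=> x /half_line_gt0 x0; rewrite /vint [leRHS]mulrCA ler_wpM2l//.
  by rewrite exprn_ge0// invr_ge0 ltW.
by rewrite mulrCA; apply: kern_scale; rewrite ?s0// mulr_ge0// ltW.
Qed.

Lemma supvar_incr s t : 0 < s -> s <= t ->
  supvar t - supvar (t - s) <= 2 * (s / t) * supvar t.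
Proof.
move=> s0 st; have t0 := lt_le_trans s0 st.
have ts0 : 0 <= t - s by rewrite subr_ge0.
rewrite /supvar mulrCA -mulrBr ler_pM2l//.
rewrite -RintegralZl//; last exact: integrable_vint (ltW t0).
rewrite -RintegralB//; [|exact: integrable_vint (ltW t0)|exact: integrable_vint].
apply: le_Rintegral => //.
- by apply: integrableBR => //; apply: integrable_vint => //; exact: ltW.
- by apply: integrableZR => //; exact: integrable_vint (ltW t0).
move=> x /half_line_gt0 x0; rewrite /vint -mulrBr mulrCA ler_wpM2l//.
  by rewrite exprn_ge0// invr_ge0 ltW.
rewrite mulrBr (_ : s / t = (x * s) / (x * t)); last first.
  by field; rewrite !gt_eqF.
apply: kern_incr; first exact: mulr_gt0.
by rewrite mulr_ge0 ?ler_pM2l ?st// ltW.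
Qed.

End variance_function.

Lemma Rdominated_cvg_pinfty d (T : measurableType d) (R : realType)
    (mu : {measure set T -> \bar R}) (D : set T) (f_ : R -> T -> R) (f g : T -> R) (t0 : R) :
  measurable D -> (forall t, t0 <= t -> measurable_fun D (f_ t)) -> measurable_fun D f ->
  (forall x, D x -> f_ t x @[t --> +oo] --> f x) ->
  mu.-integrable D (EFin \o g) ->
  (forall t x, t0 <= t -> D x -> `|f_ t x| <= g x) ->
  \int[mu]_(x in D) f_ t x @[t --> +oo] --> \int[mu]_(x in D) f x.
Proof.
move=> mD mf_ mf ff Ig fg; apply/cvg_pinftyP => u uy.
(* Replacing [u n] by [max t0 (u n)] leaves the tail of the sequence unchanged and puts every term
   in the range of the hypotheses. *)
have ut : \forall n \near \oo, t0 <= u n by move/cvgryPge : uy; exact.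
apply: (@cvg_trans _ (\int[mu]_(x in D) f_ (Num.max t0 (u n)) x @[n --> \oo])).
  apply: near_eq_cvg; near=> n; congr (Rintegral _ _ (f_ _)).
  by rewrite max_r//; near: n.
apply: (@Rdominated_cvg _ _ _ mu D _ f g) => //.
- by move=> n; apply: mf_; rewrite le_max lexx.
- move=> x Dx; have /cvg_pinftyP := ff x Dx => /(_ (fun n => Num.max t0 (u n))); apply.
  by apply/cvgryPge => A; near=> n; rewrite le_max; apply/orP; right; near: n; move/cvgryPge : uy; exact.
- by move=> n x Dx; apply: fg => //; rewrite le_max lexx.
Unshelve. all: end_near. Qed.

Lemma lnln_gt0 (R : realType) (t : R) : expR 1 < t -> 0 < ln (ln t).
Proof.
move=> t1; have t0 := lt_trans (expR_gt0 1) t1.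
by rewrite ln_gt0// -(expRK 1) ltr_ln ?posrE ?expR_gt0.
Qed.

Section normalization.
Context {R : realType}.
Variables (V A : R -> R).
Hypothesis A_gt0 : \forall t \near +oo, 0 < A t.

(* Valid also where [ln (ln t)] is negative: both square roots then vanish. *)
Lemma lil_scale_cvg : V t / A t @[t --> +oo] --> (1 : R) ->
  Num.sqrt (2 * V t * ln (ln t)) / Num.sqrt (2 * A t * ln (ln t)) @[t --> +oo] --> (1 : R).
Proof.
move=> VA.
have : Num.sqrt (V t / A t) @[t --> +oo] --> (1 : R).
  by rewrite -[X in _ --> X]sqrtr1; apply: (cvg_comp _ _ VA); exact: sqrt_continuous.
apply: cvg_trans; apply: near_eq_cvg; near=> t.
have At : 0 < A t by near: t.
have Lt : 0 < ln (ln t).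
  by apply: lnln_gt0; near: t; exact: nbhs_pinfty_gt.
have Vt : 0 <= V t.
  have : 0 <= V t / A t.
    by near: t; apply: (cvgr_ge (1 : R) VA); exact: ltr01.
  by rewrite pmulr_lge0// invr_gt0.
rewrite -sqrtrV; last by rewrite !mulr_ge0// ltW.
rewrite -sqrtrM; last by rewrite !mulr_ge0// ltW.
congr Num.sqrt; field; by rewrite !gt_eqF.
Unshelve. all: end_near. Qed.

Lemma lil_scale_gt0 : \forall t \near +oo, 0 < Num.sqrt (2 * A t * ln (ln t)).
Proof.
near=> t.
have At : 0 < A t by near: t.
rewrite sqrtr_gt0 !mulr_gt0//.
by apply: lnln_gt0; near: t; exact: nbhs_pinfty_gt.
Unshelve. all: end_near. Qed.

End normalization.

(** * Linear growth of the variance when [m_{-2}] is finite *)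

Section finite_second_moment.
Context {R : realType}.
Variables (pi : {measure set R -> \bar R}) (b : R).
Hypotheses (pi_half_line : on_half_line pi) (pi_neq0 : pi [set: R] <> 0%E)
  (m1 : (moment pi (-1) < +oo)%E) (b0 : 0 < b) (m2 : (moment pi (-2) < +oo)%E).
Local Notation D := (`]0, +oo[%classic : set R).

Lemma moment2_Rintegral : fine (moment pi (-2)) = \int[pi]_(x in D) (x^-1 ^+ 2).
Proof. by rewrite (moment_natN pi 2). Qed.

Lemma moment2_gt0 : 0 < fine (moment pi (-2)).
Proof.
rewrite moment2_Rintegral; apply: half_line_integral_gt0 => //.
  exact: (@integrable_moment _ pi 2 m2).
by move=> x /half_line_gt0 x0; rewrite exprn_gt0// invr_gt0.
Qed.

(** Pointwise [x^-2 - vint t x / t] lies between 0 and [x^-3 / t], and [x^-2] dominates. *)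
Lemma supvar_linear_cvg : supvar pi b t / t @[t --> +oo] --> b * fine (moment pi (-2)).
Proof.
rewrite moment2_Rintegral.
have : b * \int[pi]_(x in D) (vint t x / t) @[t --> +oo] --> b * \int[pi]_(x in D) (x^-1 ^+ 2).
  apply: cvgM; first exact: cvg_cst.
  apply: (@Rdominated_cvg_pinfty _ _ R pi D (fun t x => vint t x / t) (fun x => x^-1 ^+ 2) (fun x => x^-1 ^+ 2) 1) => //.
  - by move=> t _; apply: measurable_funM => //; exact: measurable_vint.
  - exact: measurable_half_lineX.
  - move=> x /[dup] Dx /half_line_gt0 x0; apply/cvgrPdist_le => e e0.
    near=> t.
    have t0 : 0 < t by near: t; exact: nbhs_pinfty_gt.
    rewrite /vint (_ : _ - _ = (x^-1 ^+ 3 * (1 - expR (- (x * t)))) / t); last first.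
      by rewrite /kern; field; rewrite !gt_eqF.
    have c0 : 0 < x^-1 ^+ 3 by rewrite exprn_gt0// invr_gt0.
    have [e1 e2] : 0 <= 1 - expR (- (x * t)) /\ 1 - expR (- (x * t)) <= 1.
      by rewrite subr_ge0 expR_le1 oppr_le0 mulr_ge0// ?(ltW x0) ?(ltW t0)// gerBl expR_ge0.
    rewrite ger0_norm; last by rewrite mulr_ge0 ?invr_ge0 ?(ltW t0)// mulr_ge0// ltW.
    rewrite ler_pdivrMr//; apply: (@le_trans _ _ (x^-1 ^+ 3 * 1)); first by rewrite ler_pM2l.
    by rewrite mulr1 mulrC -ler_pdivrMr//; near: t; exact: nbhs_pinfty_ge.
  - exact: (@integrable_moment _ pi 2 m2).
  - move=> t x t1 Dx; have t0 : 0 < t := lt_le_trans ltr01 t1.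
    rewrite ger0_norm; last by rewrite divr_ge0 ?vint_ge0// ltW.
    by rewrite ler_pdivrMr// mulrC; apply: vint_le2 => //; exact: ltW.
apply: cvg_trans; apply: near_eq_cvg; near=> t.
have t0 : 0 < t by near: t; exact: nbhs_pinfty_gt.
rewrite /supvar -mulrA; congr (_ * _); rewrite mulrC -RintegralZl//.
  by apply: eq_Rintegral => x _; rewrite mulrC.
by apply: integrable_vint => //; exact: ltW.
Unshelve. all: end_near. Qed.

(** Eventually the variance at [t] lies between [L t / 2] and [2 L t]; the quotient of the two
    constants is 4, and [gam] is 1. *)
Lemma supvar_growth_linear : exists t0 : R, forall s t, t0 <= s -> s <= t ->
  supvar pi b t <= 4 * (t / s) `^ (2 - 1) * supvar pi b s.
Proof.
pose L := b * fine (moment pi (-2)); have L0 : 0 < L by rewrite mulr_gt0// moment2_gt0.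
have VL := supvar_linear_cvg.
have h1 : \forall t \near +oo, supvar pi b t / t <= 2 * L.
  by apply: (cvgr_le _ VL); rewrite -/L; lra.
have h2 : \forall t \near +oo, L / 2 <= supvar pi b t / t.
  by apply: (cvgr_ge _ VL); rewrite -/L; lra.
have [M [_ HM]] : \forall t \near +oo, [/\ 0 < t, supvar pi b t / t <= 2 * L & L / 2 <= supvar pi b t / t].
  by near=> t; split; near: t => //; exact: nbhs_pinfty_gt.
exists (M + 1) => s t Ms st.
have [s0 _ s2] := HM s (lt_le_trans (ltr_pwDr ltr01 (lexx M)) Ms).
have [t0 t1 _] := HM t (lt_le_trans (ltr_pwDr ltr01 (lexx M)) (le_trans Ms st)).
rewrite (_ : 2 - 1 = 1 :> R); last by ring.
rewrite powRr1; last by rewrite divr_ge0// ltW.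
move: s2 t1; rewrite ler_pdivlMr// ler_pdivrMr// => s2 t1.
apply: le_trans t1 _; rewrite -mulrA mulrAC -mulrA.
apply: (@le_trans _ _ (4 * (t * s^-1 * (L / 2 * s)))).
  by rewrite le_eqVlt; apply/orP; left; apply/eqP; field; rewrite gt_eqF.
by rewrite ler_pM2l// ler_wpM2l// divr_ge0// ltW.
Unshelve. all: end_near. Qed.

End finite_second_moment.

(** * Asymptotics under a regularly varying density *)

Section affine_change_of_variable.
Context {R : realType}.
Local Notation mu := (@lebesgue_measure R).

Definition affine (a c : R) (x : measurableTypeR R) : measurableTypeR R := a * x + c.

Lemma measurable_affine a c : measurable_fun setT (affine a c).
Proof. by apply: measurable_funD => //; exact: measurable_funM. Qed.

HB.instance Definition _ a c :=
  isMeasurableFun.Build _ _ _ _ (affine a c) (measurable_affine a c).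

(** The image measure multiplied by [a] gives half-open intervals their length, and this determines
    Lebesgue measure. *)
Lemma lebesgue_measure_affine (a c : R) (A : set R) : 0 < a -> measurable A ->
  (pushforward mu (affine a c) A = (a^-1)%:E * mu A)%E.
Proof.
move=> a0 mA.
have a0' : 0 <= a by exact: ltW.
have E : mu A = mscale (NngNum a0') (pushforward mu (affine a c)) A.
  move=> m; apply: lebesgue_measure_unique => //= _ [[l r]] _ <-.
  rewrite /mscale/= /pushforward.
  rewrite (_ : affine a c @^-1` _ = `](l - c) / a, (r - c) / a]%classic); last first.
    apply/seteqP; split=> x /=; rewrite !in_itv/= /affine.
      by rewrite ltr_pdivrMr// ler_pdivlMr// ltrBlDr lerBrDr [x * a]mulrC.
    by rewrite ltr_pdivrMr// ler_pdivlMr// ltrBlDr lerBrDr [x * a]mulrC.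
  rewrite !lebesgue_measure_itv/= !lte_fin ltr_pM2r ?invr_gt0// ltrD2r.
  case: ifP => // lr; last by rewrite mule0.
  by rewrite -!EFinB -EFinM; congr EFin; field; rewrite gt_eqF.
by rewrite (E (measurable_affine a c)) /mscale/= muleA -EFinM mulVf ?gt_eqF// mul1e.
Qed.

Lemma ge0_integral_affine (a c : R) (D : set R) (f : R -> \bar R) : 0 < a ->
  measurable D -> measurable_fun D f -> (forall x, D x -> (0 <= f x)%E) ->
  (\int[mu]_(x in affine a c @^-1` D) f (a * x + c)%R =
   (a^-1)%:E * \int[mu]_(x in D) f x)%E.
Proof.
move=> a0 mD mf f0.
have := @ge0_integral_pushforward _ _ _ _ R (affine a c) (measurable_affine a c) mu D f mD mf.
move=> /(_ ltac:(by move=> x /[!inE]; exact: f0)) <-.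
have ai0 : 0 <= a^-1 by rewrite invr_ge0 ltW.
rewrite -(@ge0_integral_mscale _ _ _ mu D mD (NngNum ai0) f mf f0).
by apply: eq_measure_integral => A mA _; rewrite [LHS](lebesgue_measure_affine c a0 mA).
Qed.

End affine_change_of_variable.

Lemma powRD_gt0 (R : realType) (y p q : R) : 0 < y -> y `^ (p + q) = y `^ p * y `^ q.
Proof. by move=> y0; rewrite powRD// (gt_eqF y0) implybT. Qed.

Lemma powR_subM (R : realType) (y p : R) n : 0 < y -> y `^ (p - n%:R) * y ^+ n = y `^ p.
Proof. by move=> y0; rewrite -powR_mulrn ?(ltW y0)// -powRD_gt0// subrK. Qed.

Lemma norm_lincomb_le (R : realType) (be u v e w : R) : 0 < be < 1 ->
  `|u| <= w -> `|v| <= w -> 0 <= e ->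
  `|- ((1 - be) * be) * u - be * v + e| <= 2 * w + e.
Proof.
move=> /andP[b0 b1] uw vw e0; have w0 := le_trans (normr_ge0 u) uw.
apply: le_trans (ler_normD _ _) _; rewrite (ger0_norm e0) lerD2r.
apply: le_trans (ler_normB _ _) _; rewrite mulr_natl mulr2n; apply: lerD.
  rewrite normrM normrN (@ger0_norm _ ((1 - be) * be)); last by rewrite mulr_ge0 ?subr_ge0// ltW.
  rewrite -[leRHS]mul1r ler_pM ?mulr_ge0 ?subr_ge0 ?(ltW b0) ?(ltW b1)//.
  by move: b0 b1; clear; nra.
by rewrite normrM (gtr0_norm b0) -[leRHS]mul1r ler_pM ?(ltW b0) ?(ltW b1).
Qed.

(** * The Gamma function as a moment of the kernel *)

Section kernel_moment.
Context {R : realType}.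
Variable be : R.
Hypothesis be01 : 0 < be < 1.
Local Notation mu := (@lebesgue_measure R).
Local Notation D := (`]0, +oo[%classic : set R).

Let be0 : 0 < be. Proof. by case/andP: be01. Qed.
Let be1 : be < 1. Proof. by case/andP: be01. Qed.

Let E (n : nat) : set R := `[n.+1%:R^-1, n.+1%:R]%classic.

Let E_bigcup : \bigcup_n E n = D.
Proof.
apply/seteqP; split => [x [n _]|x].
  rewrite /E /= !in_itv/= andbT => /andP[h _]; apply: lt_le_trans h.
  by rewrite invr_gt0.
rewrite /= in_itv/= andbT => x0; exists (Num.truncn (x + x^-1)) => //.
have h := ltW (truncnS_gt (x + x^-1)).
rewrite /E /= in_itv/=; apply/andP; split.
  rewrite -[leRHS]invrK lef_pV2 ?posrE ?invr_gt0//; apply: le_trans h.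
  by rewrite lerDr ltW.
by apply: le_trans h; rewrite lerDl invr_ge0 ltW.
Qed.

Let E_cvg (f : R -> R) : measurable_fun D f -> (forall x, D x -> 0 <= f x) ->
  (\int[mu]_(x in E n) (f x)%:E @[n --> \oo] --> \int[mu]_(x in D) (f x)%:E)%E.
Proof.
move=> mf f0; rewrite -E_bigcup.
have sub n : E n `<=` D by rewrite -E_bigcup; exact: bigcup_sup.
apply: ge0_nondecreasing_set_cvg_integral => //.
- move=> m n mn; apply/subsetPset => x; rewrite /E /= !in_itv/= => /andP[h1 h2].
  have mn' : m.+1%:R <= n.+1%:R :> R by rewrite ler_nat.
  rewrite (le_trans h2)// andbT; apply: le_trans h1.
  by rewrite lef_pV2 ?posrE.
- by move=> n; exact: measurable_itv.
- by move=> n; apply/measurable_EFinP; apply: measurable_funS mf => //; exact: sub.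
- by move=> n x /sub; rewrite lee_fin; exact: f0.
Qed.

(* Its derivative is a multiple of [y^(be - 3) kern y] minus the Gamma integrand. *)
Definition kernel_primitive (y : R) :=
  - ((1 - be) * be) * (y `^ (be - 2) * kern y)
  - be * (y `^ (be - 1) * (1 - expR (- y))) + y `^ be * expR (- y).

Let deriv_powR (p y : R) : 0 < y -> has_deriv (fun u => u `^ p) y (p * y `^ (p - 1)).
Proof. by move=> y0; exact: is_derive1_powR. Qed.

Let deriv_kern (y : R) : has_deriv kern y (1 - expR (- y)).
Proof.
apply: deriv_ext (derivD (derivB (deriv_id y) (deriv_cst 1 y)) (deriv_expR (derivN (deriv_id y)))) _ _ => //.
by ring.
Qed.

Let deriv_primitive (y : R) : 0 < y -> has_deriv kernel_primitive y
  ((2 - be) * (1 - be) * be * (y `^ (be - 3) * kern y) - y `^ be * expR (- y)).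
Proof.
move=> y0.
have dE : has_deriv (fun u : R => expR (- u)) y (expR (- y) * -1).
  exact: deriv_expR (derivN (deriv_id y)).
apply: deriv_ext (derivD (derivB
  (derivZ (- ((1 - be) * be)) (derivM (deriv_powR (be - 2) y0) (deriv_kern y)))
  (derivZ be (derivM (deriv_powR (be - 1) y0) (derivB (deriv_cst 1 y) dE))))
  (derivM (deriv_powR be y0) dE)) _ _ => //.
rewrite (_ : be - 2 - 1 = be - 3); last by ring.
rewrite (_ : be - 1 - 1 = be - 2); last by ring.
by ring.
Qed.

Let cpow (p y : R) : 0 < y -> {for y, continuous (fun u => u `^ p)}.
Proof. by move=> y0; apply: deriv_continuous (deriv_powR p y0). Qed.

Let ckern (y : R) : {for y, continuous (@kern R)}.
Proof. exact: deriv_continuous (deriv_kern y). Qed.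

Let cexpN (y : R) : {for y, continuous (fun u : R => expR (- u))}.
Proof. exact: deriv_continuous (deriv_expR (derivN (deriv_id y))). Qed.

Let En_gt0 n x : E n x -> 0 < x.
Proof. by rewrite /E /= in_itv/= => /andP[h _]; apply: lt_le_trans h; rewrite invr_gt0. Qed.

Let a_le_B n : n.+1%:R^-1 <= n.+1%:R :> R.
Proof. by apply: (@le_trans _ _ 1); rewrite ?ler1n// invf_le1// ler1n. Qed.

Let primitive_large n : `|kernel_primitive n.+1%:R| <=
  2 * n.+1%:R `^ (be - 1) + n.+1%:R `^ be * expR (- n.+1%:R).
Proof.
rewrite /kernel_primitive; set y := n.+1%:R.
have y0 : 0 < y by rewrite /y.
have h1 : `|y `^ (be - 2) * kern y| <= y `^ (be - 1).
  rewrite ger0_norm ?mulr_ge0 ?powR_ge0 ?kern_ge0//.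
  rewrite -[leRHS](@powR_subM _ y (be - 1) 1 y0) (_ : be - 1 - 1%:R = be - 2); last by ring.
  by rewrite expr1 ler_wpM2l ?powR_ge0// kern_le// ltW.
have h2 : `|y `^ (be - 1) * (1 - expR (- y))| <= y `^ (be - 1).
  rewrite ger0_norm; last by rewrite mulr_ge0 ?powR_ge0// subr_ge0 expR_le1 oppr_le0 ltW.
  by rewrite ler_piMr ?powR_ge0// gerBl expR_ge0.
by apply: norm_lincomb_le => //; rewrite mulr_ge0 ?powR_ge0 ?expR_ge0.
Qed.

Let primitive_small (y : R) : 0 < y -> `|kernel_primitive y| <= 3 * y `^ be.
Proof.
move=> y0; rewrite /kernel_primitive.
have h1 : `|y `^ (be - 2) * kern y| <= y `^ be.
  rewrite ger0_norm ?mulr_ge0 ?powR_ge0 ?kern_ge0//.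
  by rewrite -[leRHS](@powR_subM _ y be 2 y0) ler_wpM2l ?powR_ge0// kern_le_sqr// ltW.
have h2 : `|y `^ (be - 1) * (1 - expR (- y))| <= y `^ be.
  rewrite ger0_norm; last by rewrite mulr_ge0 ?powR_ge0// subr_ge0 expR_le1 oppr_le0 ltW.
  rewrite -[leRHS](@powR_subM _ y be 1 y0) expr1 ler_wpM2l ?powR_ge0//.
  by have /andP[] := onem_expRN_bound (ltW y0).
apply: le_trans (norm_lincomb_le be01 h1 h2 _) _; first by rewrite mulr_ge0 ?powR_ge0 ?expR_ge0.
rewrite (_ : 3 * _ = 2 * y `^ be + y `^ be * 1); last by ring.
by rewrite lerD2l ler_wpM2l ?powR_ge0// expR_le1 oppr_le0 ltW.
Qed.

Let powR_neg_cvg (p : R) : p < 0 -> n.+1%:R `^ p @[n --> \oo] --> (0 : R).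
Proof.
move=> p0; apply/cvgrPdist_le => e e0.
have [N HN] : exists N : nat, (e `^ p^-1) <= N%:R.
  by exists (Num.truncn (e `^ p^-1)).+1; rewrite ltW// truncnS_gt.
exists N => // n /= Nn; rewrite sub0r normrN ger0_norm ?powR_ge0//.
have h : e `^ p^-1 <= n.+1%:R by rewrite (le_trans HN)// ler_nat leqW.
have : (e `^ p^-1) `^ (- p) <= n.+1%:R `^ (- p).
  by rewrite ge0_ler_powR ?nnegrE ?powR_ge0// oppr_ge0 ltW.
rewrite -powRrM mulrN mulVf ?lt_eqF// !powRN powRr1 ?(ltW e0)//.
by rewrite lef_pV2 ?posrE ?powR_gt0.
Qed.

(** At [n + 1] the linear bound on [kern] leaves the power [be - 1 < 0]; at [1 / (n + 1)] the
    quadratic bound leaves the power [be > 0]. So both boundary terms vanish. *)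
Let primitive_cvg : kernel_primitive n.+1%:R - kernel_primitive n.+1%:R^-1
  @[n --> \oo] --> (0 : R).
Proof.
pose u n := 2 * n.+1%:R `^ (be - 1) + 2 * n.+1%:R `^ (be - 1) + 3 * n.+1%:R `^ (- be) : R.
have u0 : u n @[n --> \oo] --> (0 : R).
  rewrite -[X in _ --> X](_ : 2 * 0 + 2 * 0 + 3 * 0 = 0 :> R); last by ring.
  apply: cvgD; first apply: cvgD.
  - by apply: cvgM; [exact: cvg_cst|apply: powR_neg_cvg; rewrite subr_lt0].
  - by apply: cvgM; [exact: cvg_cst|apply: powR_neg_cvg; rewrite subr_lt0].
  - by apply: cvgM; [exact: cvg_cst|apply: powR_neg_cvg; rewrite oppr_lt0].
apply/norm_cvg0P; apply: (@squeeze_cvgr _ _ _ _ (fun=> 0) u) => //; last exact: cvg_cst.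
near=> n; rewrite normr_ge0/= /u; apply: le_trans (ler_normB _ _) _; apply: lerD.
- apply: le_trans (primitive_large n) _; rewrite lerD2l//.
  have y0 : 0 < n.+1%:R :> R by [].
  rewrite -(@powR_subM _ _ be 1 y0) expr1 -mulrA mulrC ler_wpM2r ?powR_ge0//.
  set y := n.+1%:R; have h : y * expR (- y) <= 1.
    rewrite -[leRHS](expRxMexpNx_1 y) ler_pM2r ?expR_gt0//.
    by apply: le_trans (expR_ge1Dx y); rewrite lerDr.
  by apply: le_trans h _; rewrite ler1n.
- have y0 : 0 < n.+1%:R^-1 :> R by rewrite invr_gt0.
  apply: le_trans (primitive_small y0) _.
  by rewrite -powR_inv1// -powRrM mulN1r.
Unshelve. all: end_near. Qed.

Let gint (y : R) := y `^ be * expR (- y).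
Let kint (y : R) := y `^ (be - 3) * kern y.
Let cc := (2 - be) * (1 - be) * be.

Let cc_gt0 : 0 < cc.
Proof. by rewrite !mulr_gt0 ?subr_gt0// (lt_trans be1) ?ltr1n. Qed.

Let cgint y : 0 < y -> {for y, continuous gint}.
Proof. by move=> y0; apply: cvgM; [exact: cpow|exact: cexpN]. Qed.

Let ckint y : 0 < y -> {for y, continuous kint}.
Proof. by move=> y0; apply: cvgM; [exact: cpow|exact: ckern]. Qed.

Let integrable_E n (f : R -> R) : (forall y, 0 < y -> {for y, continuous f}) ->
  mu.-integrable (E n) (EFin \o f).
Proof.
move=> cf; apply: continuous_compact_integrable; first exact: segment_compact.
apply: continuous_in_subspaceT => x /[!inE] /En_gt0; exact: cf.
Qed.

Let mgint : measurable_fun D gint.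
Proof.
apply: measurable_funM; first exact: measurable_funS (measurable_powR be).
have m : measurable_fun [set: R] (fun x : R => expR (- x)).
  by apply: measurableT_comp => //; exact: measurable_funN.
exact: measurable_funS m.
Qed.

Let mkint : measurable_fun D kint.
Proof.
apply: measurable_funM; first exact: measurable_funS (measurable_powR (be - 3)).
exact: measurable_funS measurable_kern.
Qed.

(** Since [y^be <= 1 + y] and [- (2 + y) exp (- y)] is a primitive of [(1 + y) exp (- y)], the bound
    is uniform in [n]; hence the Gamma integral is finite. *)
Let gint_E n : (\int[mu]_(y in E n) (gint y)%:E <= 3%:E)%E.
Proof.
have pw (y : R) : 0 < y -> y `^ be <= 1 + y.
  move=> y0; have [y1|y1] := leP y 1.
    apply: (@le_trans _ _ (1 `^ be)); last by rewrite powR1 lerDl ltW.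
    by rewrite ge0_ler_powR ?nnegrE// ltW.
  apply: (@le_trans _ _ (y `^ 1)); first by rewrite ler_powR// ltW.
  by rewrite powRr1 ?lerDr// ltW.
pose G (y : R) := - ((2 + y) * expR (- y)).
have dG (y : R) : has_deriv G y ((1 + y) * expR (- y)).
  apply: deriv_ext (derivN (derivM (derivD (deriv_cst 2 y) (deriv_id y)) (deriv_expR (derivN (deriv_id y))))) _ _ => //.
  by ring.
have cG (y : R) : {for y, continuous (fun y : R => (1 + y) * expR (- y))}.
  exact: deriv_continuous (derivM (derivD (deriv_cst 1 y) (deriv_id y)) (deriv_expR (derivN (deriv_id y)))).
apply: (@le_trans _ _ (\int[mu]_(y in E n) ((1 + y) * expR (- y))%:E)%E).
  apply: le_integral => //.
  - exact: measurable_itv.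
  - exact: integrable_E.
  - by apply: (@integrable_E n (fun y => (1 + y) * expR (- y))).
  - move=> y /[!inE] /En_gt0 y0; rewrite lee_fin ler_wpM2r ?expR_ge0//; exact: pw.
rewrite (FTC_deriv (a_le_B n) (fun y _ => dG y) (fun y _ => cG y)) lee_fin /G.
have h1 : 0 <= (2 + n.+1%:R) * expR (- n.+1%:R) :> R by rewrite mulr_ge0 ?expR_ge0// addr_ge0.
have h2 : (2 + n.+1%:R^-1) * expR (- n.+1%:R^-1) <= 3 * 1 :> R.
  apply: ler_pM; rewrite ?expR_ge0 ?addr_ge0 ?invr_ge0//.
    have : n.+1%:R^-1 <= 1 :> R by rewrite invf_le1// ler1n.
    by move: (n.+1%:R^-1) => z z1; rewrite (_ : 3 = 2 + 1 :> R) ?lerD2l//; ring.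
rewrite mulr1 in h2; move: h1 h2; move: ((2 + n.+1%:R) * _) ((2 + n.+1%:R^-1) * _) => p q; lra.
Qed.

Let gint_ge0 y : D y -> 0 <= gint y.
Proof. by move=> _; rewrite mulr_ge0 ?powR_ge0 ?expR_ge0. Qed.

Let kint_ge0 y : D y -> 0 <= kint y.
Proof. by move=> _; rewrite mulr_ge0 ?powR_ge0 ?kern_ge0. Qed.

Let gint_fin : (\int[mu]_(y in D) (gint y)%:E)%E \is a fin_num.
Proof.
rewrite ge0_fin_numE; last by apply: integral_ge0 => y Dy; rewrite lee_fin gint_ge0.
apply: (@le_lt_trans _ _ 3%:E); last exact: ltry.
apply: (cvge_to_le (E_cvg mgint gint_ge0)).
by apply: nearW => n; exact: gint_E.
Qed.

(** The fundamental theorem of calculus for [kernel_primitive] on [[1/(n+1), n+1]] relates the two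
    integrals up to boundary terms, which disappear in the limit. *)
Lemma kernel_moment : (\int[mu]_(y in D) (y `^ (be - 3) * kern y)%:E =
  (Gamma (1 + be) / ((2 - be) * (1 - be) * be))%:E)%E.
Proof.
have H n : (cc%:E * \int[mu]_(y in E n) (kint y)%:E = \int[mu]_(y in E n) (gint y)%:E +
   (kernel_primitive n.+1%:R - kernel_primitive n.+1%:R^-1)%:E)%E.
  have Ik := integrable_E n ckint.
  have Ig := integrable_E n cgint.
  have := FTC_deriv (a_le_B n) (fun y (h : _ <= y <= _) => deriv_primitive (En_gt0 (n:=n) h)).
  move=> <-; last first.
    move=> y h; have y0 := En_gt0 (n:=n) h.
    by apply: cvgB; [apply: cvgM; [exact: cvg_cst|exact: ckint]|exact: cgint].
  have mE : measurable (E n) by exact: measurable_itv.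
  rewrite -integralZl//.
  under [X in (_ + X)%E]eq_integral do rewrite EFinB EFinM.
  rewrite -integralD//; last by apply: integrableB => //; apply: integrableZl.
  by apply: eq_integral => y _ /=; rewrite addeC -EFinM -!EFinD subrK.
have L1 : (cc%:E * \int[mu]_(y in E n) (kint y)%:E @[n --> \oo] --> cc%:E * \int[mu]_(y in D) (kint y)%:E)%E.
  by apply: cvgeZl => //; exact: E_cvg.
have L2 : (\int[mu]_(y in E n) (gint y)%:E +
   (kernel_primitive n.+1%:R - kernel_primitive n.+1%:R^-1)%:E @[n --> \oo] -->
   \int[mu]_(y in D) (gint y)%:E + 0%:E)%E.
  apply: cvgeD; first by rewrite fin_num_adde_defl.
    exact: E_cvg mgint gint_ge0.
  by apply: cvg_EFin; [exact: nearW|exact: primitive_cvg].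
have E1 : (cc%:E * \int[mu]_(y in D) (kint y)%:E = \int[mu]_(y in D) (gint y)%:E)%E.
  rewrite -[RHS]adde0; apply: cvg_unique L2 => //.
  by move: L1; under eq_fun do rewrite H.
have G1 : (\int[mu]_(y in D) (gint y)%:E = (Gamma (1 + be))%:E)%E.
  rewrite /Gamma -(fineK gint_fin); congr EFin; congr fine.
  by apply: eq_integral => y _; rewrite addrAC subrr add0r.
rewrite -[LHS]/(\int[mu]_(y in D) (kint y)%:E)%E -/cc mulrC EFinM -G1 -E1 muleA -EFinM.
by rewrite mulVf ?gt_eqF// mul1e.
Qed.

End kernel_moment.

(** * Uniform bounds for slowly varying functions *)

Section slow_variation.
Context {R : realType}.
Variable ell : R -> R.
Hypothesis sv : slowly_varying ell.
Local Notation mu := (@lebesgue_measure R).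

(** In logarithmic coordinates slow variation says that [h (x + z) - h x] tends to 0 for each fixed
    [z]. *)
Let h x := ln (ell (expR x)).
Let g (v : R) := Num.min 1 `|v|.

Let g_ge0 v : 0 <= g v. Proof. by rewrite /g le_min ler01 normr_ge0. Qed.
Let g_le1 v : g v <= 1. Proof. by rewrite /g ge_min lexx. Qed.

Let sv_threshold : exists M, measurable_fun (`[M, +oo[ : set R) ell /\
  forall t, M <= t -> 0 < ell t.
Proof. by have [? _] := sv. Qed.

Let M := sval (cid sv_threshold).

Let mell : measurable_fun (`[M, +oo[ : set R) ell.
Proof. by case: (svalP (cid sv_threshold)). Qed.

Let ell_gt0 t : M <= t -> 0 < ell t.
Proof. by case: (svalP (cid sv_threshold)) => _; apply. Qed.

Let expR_geM x : M <= x -> M <= expR x.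
Proof. by move=> Mx; rewrite (le_trans Mx)// (le_trans _ (expR_ge1Dx x))// lerDr. Qed.

Let expR_pinfty : expR x @[x --> +oo] --> (+oo : set_system R).
Proof.
apply/cvgryPge => A; near=> x; apply: (@le_trans _ _ (1 + x)); last exact: expR_ge1Dx.
by rewrite -lerBlDl; near: x; apply: nbhs_pinfty_ge; rewrite ?num_real.
Unshelve. all: end_near. Qed.

Let log_increment_cvg z : h (x + z) - h x @[x --> +oo] --> (0 : R).
Proof.
have [_ /(_ _ (expR_gt0 z)) H] := sv.
have H1 : ell (expR z * expR x) / ell (expR x) @[x --> +oo] --> (1 : R).
  exact: (cvg_comp _ _ expR_pinfty H).
have : ln (ell (expR z * expR x) / ell (expR x)) @[x --> +oo] --> (0 : R).
  by rewrite -ln1; apply: (cvg_comp _ _ H1); apply: continuous_ln.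
apply: cvg_trans; apply: near_eq_cvg; near=> x.
have Mx : M <= x by near: x; apply: nbhs_pinfty_ge; rewrite ?num_real.
have Mxz : M <= x + z by rewrite -lerBlDr; near: x; apply: nbhs_pinfty_ge; rewrite ?num_real.
rewrite -expRD [z + x]addrC ln_div ?posrE ?ell_gt0 ?expR_geM//.
Unshelve. all: end_near. Qed.

Let osc (y u : R) := g (h (y + u) - h y).

Let measurable_osc y : M <= y -> measurable_fun (`[0, 3]%classic : set R) (osc y).
Proof.
move=> My.
have mh : measurable_fun (`[0, 3]%classic : set R) (fun u => h (y + u)).
  apply: (@measurable_comp _ _ _ _ _ _ setT (@ln R)) => //.
  apply: (@measurable_comp _ _ _ _ _ _ `[M, +oo[%classic ell) => //.
    move=> _ [u /= + <-]; rewrite !in_itv/= andbT => /andP[u0 _].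
    by apply: expR_geM; rewrite (le_trans My)// lerDl.
  by apply: measurableT_comp => //; exact: measurable_funD.
apply: measurable_minr => //; apply: measurableT_comp => //.
exact: measurable_funB.
Qed.

(* Dominated convergence replaces Egorov's theorem in the uniform convergence
   theorem: if [`|h (x + z) - h x| > 2], then for each [u] in [[1, 2]] one of
   [osc x u] and [osc (x + z) (u - z)] is 1, so that one of their
   integrals is at least 1/2. *)
Let osc_cvg : \int[mu]_(u in `[0, 3]) osc x u @[x --> +oo] --> (0 : R).
Proof.
rewrite -[X in _ --> X](_ : \int[mu]_(u in `[0, 3]) (fun=> 0) u = 0); last by rewrite Rintegral_cst// mul0r.
apply: (@Rdominated_cvg_pinfty _ _ _ mu `[0, 3]%classic osc (fun=> 0) (fun=> 1) M) => //.
- move=> u _; have := log_increment_cvg u => /cvgrPdist_le H.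
  apply/cvgrPdist_le => e e0; near=> x.
  rewrite sub0r normrN ger0_norm ?g_ge0// /osc /g ge_min; apply/orP; right.
  by have := near (H _ e0) x; rewrite sub0r normrN; apply.
- by apply: continuous_compact_integrable; [exact: segment_compact|apply: continuous_subspaceT => x; exact: cvg_cst].
- by move=> x u _ _; rewrite ger0_norm ?g_ge0 ?g_le1.
Unshelve. all: end_near. Qed.

Let log_increment_bounded : exists2 T, M <= T &
  forall x z, T <= x -> 0 <= z <= 1 -> `|h (x + z) - h x| <= 2.
Proof.
(* Two integrals of at most [1/3] cannot add up to 1. The window [[0, 3]] contains both [[1, 2]] and
   its translate [[1 - z, 2 - z]], which appears when the second oscillation is recentred. *)
have [T0 [_ HT]] : \forall x \near +oo, \int[mu]_(u in `[0, 3]) osc x u <= 3^-1.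
  by apply: (cvgr_le _ osc_cvg).
exists (Num.max M (T0 + 1)); first by rewrite le_max lexx.
move=> x z; rewrite ge_max => /andP[Mx Tx] /andP[z0 z1]; rewrite leNgt; apply/negP => big.
have S y : x <= y -> (\int[mu]_(u in `[0%R, 3%R]) (osc y u)%:E <= (3^-1)%:E)%E.
  move=> xy; have My := le_trans Mx xy.
  have Iy : mu.-integrable `[0, 3]%classic (EFin \o osc y).
    apply: (@le_integrable _ _ _ _ _ _ _ (EFin \o (fun=> 1))) => //.
    - by apply/measurable_EFinP; exact: measurable_osc.
    - by move=> u _; rewrite lee_fin /= normr1 ger0_norm ?g_ge0 ?g_le1.
    - by apply: continuous_compact_integrable; [exact: segment_compact|apply: continuous_subspaceT => ?; exact: cvg_cst].
  rewrite -(fineK (integrable_fin_num _ Iy))// lee_fin; apply: HT.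
  by rewrite (lt_le_trans _ xy)// (lt_le_trans _ Tx)// ltrDl.
have mox : measurable_fun (`[1, 2]%classic : set R) (osc x).
  apply: measurable_funS (measurable_osc Mx) => // u /=; rewrite !in_itv/= => /andP[u1 u2].
  by rewrite (le_trans _ u1)//= (le_trans u2)// ler_nat.
have sub : `[1 - z, 2 - z]%classic `<=` `[0, 3]%classic.
  by move=> u /=; rewrite !in_itv/= => /andP[]; lra.
have Mz : M <= x + z by rewrite (le_trans Mx)// lerDl.
have moz : measurable_fun `[1 - z, 2 - z]%classic (osc (x + z)).
  exact: measurable_funS sub (measurable_osc Mz).
have pre : affine 1 (- z) @^-1` `[1 - z, 2 - z]%classic = `[1, 2]%classic.
  by apply/seteqP; split=> u /=; rewrite /affine !in_itv/= mul1r !lerD2r.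
have mozu : measurable_fun (`[1, 2]%classic : set R) (fun u => osc (x + z) (1 * u + - z)).
  have mS : measurable_fun (`[1, 2]%classic : set R) (fun u : R => 1 * u + - z).
    exact: measurable_funS (measurable_affine 1 (- z)).
  apply: measurable_comp moz mS => //.
  by rewrite -pre => _ [u hu <-].
have E1 : (\int[mu]_(u in `[1%R, 2%R]) (osc x u)%:E <= (3^-1)%:E)%E.
  apply: le_trans (S x (lexx _)); apply: ge0_subset_integral => //.
  - by apply/measurable_EFinP; exact: measurable_osc.
  - by move=> u _; rewrite lee_fin g_ge0.
  - by move=> u /=; rewrite !in_itv/= => /andP[u1 u2]; rewrite (le_trans _ u1)//= (le_trans u2)// ler_nat.
have E2 : (\int[mu]_(u in `[1%R, 2%R]) (osc (x + z) (1 * u + - z))%:E <= (3^-1)%:E)%E.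
  have I := @ge0_integral_affine R 1 (- z) `[1 - z, 2 - z]%classic (EFin \o osc (x + z)) ltr01
    (measurable_itv _) (proj2 (measurable_EFinP _ _) moz) (fun u _ => g_ge0 _).
  rewrite pre in I; rewrite invr1 mul1e in I; apply: (@le_trans _ _ (\int[mu]_(u in `[(1 - z)%R, (2 - z)%R]) (osc (x + z) u)%:E)%E); first by rewrite -I.
  apply: le_trans (S (x + z) _); last by rewrite lerDl.
  apply: ge0_subset_integral; [exact: measurable_itv|exact: measurable_itv| | |exact: sub].
  - by apply/measurable_EFinP; exact: measurable_osc.
  - by move=> u _; rewrite lee_fin g_ge0.
have : (1%:E <= \int[mu]_(u in `[1%R, 2%R]) (osc x u + osc (x + z) (1 * u + - z))%:E)%E.
  have -> : 1%:E = (\int[mu]_(u in `[1%R, 2%R]) 1%:E)%E.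
    rewrite integral_cst//= lebesgue_measure_itv/= lte_fin ltr1n/=.
    by rewrite mul1e -EFinB; congr EFin; ring.
  apply: ge0_le_integral => //.
  - by apply/measurable_EFinP; exact: measurable_funD.
  - move=> u _; rewrite lee_fin /osc mul1r (_ : x + z + (u - z) = x + u); last by ring.
    have tri : `|h (x + z) - h x| <= `|h (x + u) - h x| + `|h (x + u) - h (x + z)|.
      rewrite -(normrN (h (x + u) - h (x + z))); apply: le_trans (ler_normD _ _).
      by rewrite le_eqVlt; apply/orP; left; apply/eqP; congr `| _ |; ring.
    rewrite /g; case: (leP 1 `|h (x + u) - h x|) => h1; first by rewrite lerDl le_min ler01 normr_ge0.
    case: (leP 1 `|h (x + u) - h (x + z)|) => h2; first by rewrite lerDr.
    by move: big tri h1 h2; lra.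
under eq_integral do rewrite EFinD.
rewrite ge0_integralD//; last 4 first.
- by move=> u _; rewrite lee_fin g_ge0.
- by apply/measurable_EFinP.
- by move=> u _; rewrite lee_fin g_ge0.
- by apply/measurable_EFinP.
move=> /le_trans /(_ (leeD E1 E2)); rewrite -EFinD lee_fin; lra.
Qed.

(** Far out, each unit step changes [h] by at most [e], and the fractional remainder of [z] costs at
    most 2. *)
Lemma log_increment_growth e : 0 < e -> exists2 T, M <= T &
  forall x z, T <= x -> 0 <= z -> `|h (x + z) - h x| <= 2 + e * z.
Proof.
move=> e0; have [T1 MT1 HT1] := log_increment_bounded.
have /cvgrPdist_le/(_ _ e0)[T2 [_ HT2]] := log_increment_cvg 1.
exists (Num.max T1 (T2 + 1)); first by rewrite le_max MT1.
move=> x z; rewrite ge_max => /andP[x1 x2] z0.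
have step n : `|h (x + n%:R) - h x| <= e * n%:R.
  elim: n => [|n IH]; first by rewrite addr0 subrr normr0 mulr0.
  have -> : h (x + n.+1%:R) - h x = (h (x + n%:R + 1) - h (x + n%:R)) + (h (x + n%:R) - h x).
    by rewrite -[n.+1%:R]natr1 addrA; ring.
  apply: le_trans (ler_normD _ _) _; rewrite -natr1 mulrDr mulr1 addrC; apply: lerD => //.
  have := HT2 (x + n%:R); rewrite sub0r normrN; apply.
  by rewrite (lt_le_trans _ (_ : x <= _)) ?lerDl// (lt_le_trans _ x2)// ltrDl.
pose n := Num.truncn z.
have /andP[nz zn] : n%:R <= z < n.+1%:R by exact: truncn_itv.
have -> : h (x + z) - h x = (h (x + n%:R + (z - n%:R)) - h (x + n%:R)) + (h (x + n%:R) - h x).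
  by rewrite (_ : x + n%:R + (z - n%:R) = x + z); ring.
apply: le_trans (ler_normD _ _) _; apply: lerD.
  apply: HT1; first by rewrite (le_trans x1)// lerDl.
  by rewrite subr_ge0 nz/= lerBlDl natr1 ltW.
by apply: le_trans (step n) _; rewrite ler_pM2l.
Qed.

(** Potter's bounds, by exponentiating [log_increment_growth]: [expR 2] is the bounded part, and the
    sum of the two powers covers [s >= t] and [s < t] at once. *)
Lemma slowly_varying_potter e : 0 < e -> exists2 s0, 0 < s0 &
  (forall s, s0 <= s -> 0 < ell s) /\
  forall s t, s0 <= s -> s0 <= t ->
    ell s / ell t <= expR 2 * ((s / t) `^ e + (s / t) `^ (- e)).
Proof.
move=> e0; have [T MT HT] := log_increment_growth e0.
exists (expR T); first exact: expR_gt0.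
have pos s : expR T <= s -> 0 < s by apply: lt_le_trans; exact: expR_gt0.
have epos s : expR T <= s -> 0 < ell s by move=> Ts; apply: ell_gt0; rewrite (le_trans _ Ts)// expR_geM.
split=> // s t Ts Tt.
have [s0 t0] := (pos s Ts, pos t Tt); have [es et] := (epos s Ts, epos t Tt).
have st0 : 0 < s / t by rewrite divr_gt0.
have lT u : expR T <= u -> T <= ln u by move=> Tu; rewrite -(expRK T) ler_ln ?posrE ?expR_gt0 ?pos.
have hE u : 0 < u -> h (ln u) = ln (ell u) by move=> u0; rewrite /h lnK.
have key : `|ln (ell s / ell t)| <= 2 + e * `|ln (s / t)|.
  rewrite !ln_div ?posrE// -!hE//.
  have [st|ts] := leP (ln t) (ln s).
    rewrite (ger0_norm (_ : 0 <= ln s - ln t)) ?subr_ge0//.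
    by have := HT (ln t) (ln s - ln t) (lT _ Tt); rewrite subr_ge0 (addrC (ln t)) subrK; apply.
  rewrite (ltr0_norm (_ : ln s - ln t < 0)) ?subr_lt0// opprB distrC.
  by have := HT (ln s) (ln t - ln s) (lT _ Ts); rewrite subr_ge0 (addrC (ln s)) subrK; apply; exact: ltW.
have r0 : 0 < ell s / ell t by rewrite divr_gt0.
rewrite -[leLHS]lnK ?posrE//.
apply: (@le_trans _ _ (expR (2 + e * `|ln (s / t)|))).
  by rewrite ler_expR (le_trans (ler_norm _)).
rewrite expRD ler_pM2l ?expR_gt0// /powR gt_eqF//.
have [l0|l0] := leP 0 (ln (s / t)); first by rewrite ger0_norm// lerDl expR_ge0.
by rewrite ltr0_norm// mulrN -mulNr lerDr expR_ge0.
Qed.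

End slow_variation.

Lemma powR_div_pos (R : realType) (y t a : R) : 0 < y -> 0 < t ->
  (y / t) `^ a = y `^ a / t `^ a.
Proof.
move=> y0 t0; rewrite powRM ?invr_ge0 ?(ltW y0) ?(ltW t0)//; congr (_ * _).
by rewrite -powR_inv1 ?(ltW t0)// -powRrM mulN1r powRN.
Qed.

Lemma powR_cvg0_pinfty (R : realType) (q : R) : q < 0 -> t `^ q @[t --> +oo] --> (0 : R).
Proof.
move=> q0; apply/cvgrPdist_le => e e0; near=> t.
have h : e `^ q^-1 <= t by near: t; apply: nbhs_pinfty_ge; rewrite ?num_real.
have t0 : 0 < t by apply: lt_le_trans h; rewrite powR_gt0.
rewrite sub0r normrN ger0_norm ?powR_ge0//.
have : (e `^ q^-1) `^ (- q) <= t `^ (- q).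
  by rewrite ge0_ler_powR ?nnegrE ?powR_ge0 ?(ltW t0)// oppr_ge0 ltW.
rewrite -powRrM mulrN mulVf ?lt_eqF// !powRN powRr1 ?(ltW e0)//.
by rewrite lef_pV2 ?posrE ?powR_gt0.
Unshelve. all: end_near. Qed.

Lemma integrable_kernel_moment (R : realType) (be : R) : 0 < be < 1 ->
  lebesgue_measure.-integrable (`]0, +oo[%classic : set R)
    (EFin \o (fun y : R => y `^ (be - 3) * kern y)).
Proof.
move=> b01; apply/integrableP; split.
  apply/measurable_EFinP; apply: measurable_funM.
    exact: measurable_funS (measurable_powR (be - 3)).
  exact: measurable_funS measurable_kern.
under eq_integral => y _ do
  rewrite /= ger0_norm ?mulr_ge0 ?powR_ge0 ?kern_ge0//.
by rewrite (kernel_moment b01) ltry.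
Qed.

Lemma sqrtr_prod4 (R : rcfType) (l e x z : R) : 0 <= l -> 0 <= e -> 0 <= x ->
  Num.sqrt (l * (e * x * z)) = Num.sqrt l * Num.sqrt e * Num.sqrt x * Num.sqrt z.
Proof. by move=> l0 e0 x0; rewrite sqrtrM// sqrtrM ?mulr_ge0// sqrtrM// !mulrA. Qed.

(** * Variance asymptotics for a regularly varying density *)

Section regularly_varying_density.
Context {R : realType}.
Variables (pi : {measure set R -> \bar R}) (b : R) (p ell : R -> R) (al : R).
Hypotheses (m1 : (moment pi (-1) < +oo)%E) (b0 : 0 < b).
Hypotheses (pi_p : has_density pi p) (al01 : 0 < al < 1) (sv : slowly_varying ell).
Hypothesis p_equiv : p ~_(0^'+) (fun x => (al * ell x^-1 * x `^ al)%R).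
Local Notation mu := (@lebesgue_measure R).
Local Notation D := (`]0, +oo[%classic : set R).

Let q x := al * ell x^-1 * x `^ al.
Let al0 : 0 < al. Proof. by case/andP: al01. Qed.
Let al1 : al < 1. Proof. by case/andP: al01. Qed.
(** Small enough that [al - ep] and [al + ep] stay in [(0, 1)], where [kernel_moment] applies, that
    [ep + al < 1], which the tail needs, and that [ep <= al / 2], which the growth bound needs. *)
Let ep := Num.min al (1 - al) / 2.

Let ep_gt0 : 0 < ep.
Proof. by rewrite divr_gt0// lt_min al0 subr_gt0. Qed.

Let ep_le1 : ep <= al / 2.
Proof. by rewrite ler_pM2r ?invr_gt0// ge_min lexx. Qed.

Let ep_le2 : ep <= (1 - al) / 2.
Proof. by rewrite ler_pM2r ?invr_gt0// ge_min lexx orbT. Qed.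

Let s0 := s2val (cid2 (slowly_varying_potter sv ep_gt0)).
Let s0_gt0 : 0 < s0 := s2valP (cid2 (slowly_varying_potter sv ep_gt0)).
Let potter : (forall s, s0 <= s -> 0 < ell s) /\
  forall s t, s0 <= s -> s0 <= t ->
    ell s / ell t <= expR 2 * ((s / t) `^ ep + (s / t) `^ (- ep)) :=
  s2valP' (cid2 (slowly_varying_potter sv ep_gt0)).

Let p_near e : 0 < e -> exists2 dl, 0 < dl & forall x, 0 < x <= dl -> `|p x - q x| <= e * `|q x|.
Proof.
move=> e0; have /eqaddoP/(_ e e0) := p_equiv.
case=> d0 /= d00 H.
exists (d0 / 2); first by rewrite divr_gt0.
move=> x /andP[x0 xdl]; apply: (H x _ x0).
by rewrite /ball_ /= sub0r normrN gtr0_norm// (le_lt_trans xdl)// gtr_pMr ?invf_lt1 ?ltr1n.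
Qed.

Let half := cid2 (p_near (@ltr01 R)).
(** On [(0, dl]] the density is at most [2 q x], and [x^-1] is in the range of the Potter bounds. *)
Let dl := Num.min (s2val half) s0^-1.

Let dl_gt0 : 0 < dl.
Proof. by rewrite lt_min (s2valP half) invr_gt0. Qed.

Let dl_inv x : 0 < x <= dl -> s0 <= x^-1.
Proof.
by move=> /andP[x0]; rewrite le_min => /andP[_ h]; rewrite -[leLHS]invrK lef_pV2 ?posrE ?invr_gt0.
Qed.

Let q_gt0 x : 0 < x <= dl -> 0 < q x.
Proof.
move=> xdl; have /andP[x0 _] := xdl.
by rewrite !mulr_gt0 ?powR_gt0// (proj1 potter)// dl_inv.
Qed.

Let p_ge0 x : 0 < x -> 0 <= p x.
Proof. by move=> x0; case: pi_p => _ + _; apply. Qed.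

Let mp : measurable_fun D p. Proof. by case: pi_p. Qed.

Let p_le x : 0 < x <= dl -> p x <= 2 * q x.
Proof.
move=> xdl; have /andP[x0] := xdl; rewrite le_min => /andP[h _].
have := s2valP' half x; rewrite x0 h => /(_ isT).
have q0 := q_gt0 xdl; rewrite mul1r (gtr0_norm q0) ler_norml => /andP[_]; lra.
Qed.

Let N t := ell t * t `^ (2 - al).

(** The integrand of the head divided by [N t], after the density has replaced [pi] and [x = y / t]
    has been substituted; it vanishes beyond the image of the cut-off [dl]. *)
Let F t y := if y <= dl * t then y^-1 ^+ 3 * kern y * (p (y / t) * (t `^ al / ell t)) else 0.

Let head_integral t : s0 <= t ->
  \int[pi]_(x in `]0, dl]) vint t x / N t = \int[mu]_(y in D) F t y.
Proof.
move=> st; have t0 := lt_le_trans s0_gt0 st; have et := proj1 potter t st.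
have sub : `]0, dl]%classic `<=` D.
  by move=> x /=; rewrite !in_itv/= andbT => /andP[].
have mD : measurable (`]0, dl]%classic : set R) by exact: measurable_itv.
have E1 : (\int[pi]_(x in `]0%R, dl]) (vint t x)%:E = \int[mu]_(x in `]0%R, dl]) (vint t x * p x)%:E)%E.
  (* Pushing [pi] forward by the identity only changes the measurable structure on [R] to the one
     that [mu] is typed with. *)
  have mi : measurable_fun [set: R] (idfun : R -> measurableTypeR R) by move=> _ A mA; rewrite setTI.
  rewrite -(@ge0_integral_pushforward _ _ _ _ R _ mi pi `]0, dl]%classic (fun x => (vint t x)%:E)) //; last 2 first.
  - by apply/measurable_EFinP; exact: measurable_funS sub (measurable_vint t).
  - by move=> x /[!inE] /sub; rewrite lee_fin; exact: vint_ge0.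
  apply: (@ge0_integral_density _ (measurableTypeR R) R mu _ `]0, dl]%classic p) => //.
  - exact: measurable_funS sub mp.
  - by move=> x /sub/half_line_gt0; exact: p_ge0.
  - by move=> A mA AD; case: pi_p => _ _; apply => //; exact: subset_trans sub.
  - exact: measurable_funS sub (measurable_vint t).
  - by move=> x /sub; exact: vint_ge0.
have mvp : measurable_fun (`]0, dl]%classic : set R) (fun x => vint t x * p x).
  by apply: measurable_funM; [exact: measurable_funS sub (measurable_vint t)|exact: measurable_funS sub mp].
have vp0 x : `]0, dl]%classic x -> (0 <= (vint t x * p x)%:E)%E.
  by move=> /sub Dx; rewrite lee_fin mulr_ge0 ?vint_ge0 ?p_ge0 ?half_line_gt0.
have ti0 : 0 < t^-1 by rewrite invr_gt0.
have := @ge0_integral_affine R t^-1 0 `]0, dl]%classic (fun x => (vint t x * p x)%:E) ti0 mD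
  (proj2 (measurable_EFinP _ _) mvp) vp0.
rewrite -E1 invrK.
rewrite (_ : affine t^-1 0 @^-1` _ = `]0, dl * t]%classic); last first.
  apply/seteqP; split=> x /=; by rewrite /affine !in_itv/= addr0 [t^-1 * x]mulrC pmulr_lgt0// ler_pdivrMr.
move=> E2.
have N0 : 0 < N t by rewrite mulr_gt0// powR_gt0.
have E3 : (\int[mu]_(y in D) (F t y)%:E = ((t * N t)^-1)%:E *
    \int[mu]_(x in `]0%R, (dl * t)%R]) (vint t (t^-1 * x + 0)%R * p (t^-1 * x + 0)%R)%:E)%E.
  rewrite -ge0_integralZl_EFin//; last 3 first.
  - move=> x /=; rewrite in_itv/= => /andP[x0 _]; rewrite addr0.
    have tx0 : 0 < t^-1 * x by rewrite mulr_gt0.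
    by rewrite lee_fin mulr_ge0 ?p_ge0//; exact: vint_ge0 (gt0_half_line tx0).
  - apply/measurable_EFinP.
    have mS : measurable_fun (`]0, dl * t]%classic : set R) (fun x : R => t^-1 * x + 0).
      exact: measurable_funS (measurable_affine t^-1 0).
    apply: measurable_comp mvp mS => //.
    by move=> _ [x /= + <-]; rewrite !in_itv/= addr0 [t^-1 * x]mulrC pmulr_lgt0// ler_pdivrMr.
  - by rewrite invr_ge0 mulr_ge0// ltW.
  rewrite (_ : `]0, dl * t]%classic = D `&` [set x | x <= dl * t]); last first.
    by apply/seteqP; split=> x /=; rewrite !in_itv/= andbT; [move=> /andP[]|move=> [-> ->]].
  rewrite integral_mkcondr; apply: eq_integral => y /[!inE] /half_line_gt0 y0.
  rewrite /F patchE; case: ifPn => yd; last by rewrite memNset//=; exact/negP.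
  rewrite mem_set//= -EFinM; congr EFin; rewrite addr0 /vint /N.
  have -> : t `^ (2 - al) = t ^+ 2 / t `^ al by rewrite powRD_gt0// powRN powR_mulrn// ltW.
  have -> : t^-1 * y * t = y by rewrite mulrC mulrA divff ?gt_eqF// mul1r.
  rewrite [t^-1 * y]mulrC.
  by field; rewrite !gt_eqF// powR_gt0.
rewrite /Rintegral E3 E2.
set I := (\int[pi]_(x in _) _)%E.
have If : I \is a fin_num.
  apply: integrable_fin_num => //.
  apply: integrableS (integrable_vint m1 (ltW t0)) => //.
rewrite -(fineK If) -!EFinM /=.
by field; rewrite !gt_eqF.
Qed.

Let F_measurable t : s0 <= t -> measurable_fun D (F t).
Proof.
move=> st; have t0 := lt_le_trans s0_gt0 st.
have mb : measurable_fun D (fun y : R => y <= dl * t) by apply: measurable_fun_ler.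
have mT : measurable_fun D (fun y : R => y^-1 ^+ 3 * kern y * (p (y / t) * (t `^ al / ell t))).
  apply: measurable_funM.
    apply: measurable_funM; first exact: measurable_half_lineX.
    exact: measurable_funS measurable_kern.
  apply: measurable_funM => //.
  have mS : measurable_fun D (fun x : R => x / t) by exact: measurable_funM.
  apply: measurable_comp mp mS => //.
  by move=> _ [x /= + <-]; rewrite !in_itv/= !andbT => x0; exact: divr_gt0.
have mC : measurable (D `&` (fun y : R => y <= dl * t) @^-1` [set true]) by exact: mb.
by apply: measurable_fun_if => //; apply: measurable_funS mT.
Qed.

Let dom y := 2 * al * expR 2 * (y `^ ((al - ep) - 3) * kern y + y `^ ((al + ep) - 3) * kern y).

Let dom_ge0 y : 0 <= dom y.
Proof.
by rewrite /dom !mulr_ge0 ?expR_ge0 ?(ltW al0)// addr_ge0// mulr_ge0 ?powR_ge0 ?kern_ge0.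
Qed.

Let dom_integrable : mu.-integrable D (EFin \o dom).
Proof.
have [h1 h2] : 0 < al - ep < 1 /\ 0 < al + ep < 1.
  move: al0 al1 ep_gt0 ep_le1 ep_le2; move: (ep) => e *; split; apply/andP; split; lra.
apply: integrableZR => //; apply: integrableDR => //; exact: integrable_kernel_moment.
Qed.

(** After [p <= 2 q] there remains [ell (t / y) / ell t], whose argument ratio is [y^-1]; Potter
    turns it into [y^ep + y^(- ep)], independently of [t]. *)
Let F_bound t y : s0 <= t -> D y -> `|F t y| <= dom y.
Proof.
move=> st /half_line_gt0 y0; have t0 := lt_le_trans s0_gt0 st; have et := proj1 potter t st.
rewrite /F; case: ifPn => yt; last by rewrite normr0.
have yt0 : 0 < y / t by rewrite divr_gt0.
have ytd : 0 < y / t <= dl by rewrite yt0 ler_pdivrMr.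
have pt0 := p_ge0 yt0; have c0 : 0 <= y^-1 ^+ 3 * kern y by rewrite mulr_ge0 ?kern_ge0// exprn_ge0// invr_ge0 ltW.
have r0 : 0 < t `^ al / ell t by rewrite divr_gt0// powR_gt0.
rewrite ger0_norm; last by rewrite mulr_ge0// mulr_ge0// ltW.
have := proj2 potter (y / t)^-1 t (dl_inv ytd) st.
rewrite invf_div => hp.
apply: (@le_trans _ _ (y^-1 ^+ 3 * kern y * (2 * al * y `^ al * (ell (t / y) / ell t)))).
  rewrite ler_wpM2l//; apply: (@le_trans _ _ (2 * q (y / t) * (t `^ al / ell t))).
    by rewrite ler_pM2r// p_le.
  rewrite /q powR_div_pos// invf_div le_eqVlt; apply/orP; left; apply/eqP; field.
  by rewrite !gt_eqF ?powR_gt0.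
have -> : dom y = y^-1 ^+ 3 * kern y * (2 * al * y `^ al * (expR 2 * (y `^ ep + y `^ (- ep)))).
  rewrite /dom !powRD_gt0// !powRN (_ : y `^ 3 = y ^+ 3); last by rewrite powR_mulrn// ltW.
  by field; rewrite !gt_eqF ?powR_gt0.
rewrite ler_wpM2l// ler_wpM2l//; first by rewrite !mulr_ge0 ?powR_ge0// ltW.
apply: le_trans hp _; rewrite le_eqVlt; apply/orP; left; apply/eqP; congr (_ * _).
have -> : t / y / t = y^-1 by field; rewrite !gt_eqF.
rewrite -powR_inv1 ?(ltW y0)// -!powRrM mulN1r mulNr mul1r opprK.
by rewrite addrC.
Qed.

Let N_gt0 t : s0 <= t -> 0 < N t.
Proof.
move=> st; have t0 := lt_le_trans s0_gt0 st.
by rewrite mulr_gt0 ?powR_gt0// (proj1 potter).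
Qed.

Let F_cvg y : D y -> F t y @[t --> +oo] --> al * (y `^ (al - 3) * kern y).
Proof.
move=> /half_line_gt0 y0.
have -> : al * (y `^ (al - 3) * kern y) = y^-1 ^+ 3 * kern y * (1 * (al * y `^ al * 1)).
  rewrite powRD_gt0// powRN (_ : y `^ 3 = y ^+ 3); last by rewrite powR_mulrn// ltW.
  by field; rewrite gt_eqF.
have pq : p (y / t) / q (y / t) @[t --> +oo] --> (1 : R).
  apply/cvgrPdist_le => e e0; have [d1 d10 H] := p_near e0.
  near=> t.
  have t0 : 0 < t by near: t; apply: nbhs_pinfty_gt; rewrite ?num_real.
  have yt0 : 0 < y / t by rewrite divr_gt0.
  have yd1 : y / t <= d1.
    rewrite ler_pdivrMr// -(ler_pdivrMl _ _ d10).
    by near: t; apply: nbhs_pinfty_ge; rewrite ?num_real.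
  have yd2 : y / t <= dl.
    rewrite ler_pdivrMr// -(ler_pdivrMl _ _ dl_gt0).
    by near: t; apply: nbhs_pinfty_ge; rewrite ?num_real.
  have yd : 0 < y / t <= dl by rewrite yt0 yd2.
  have q0 := q_gt0 yd.
  have := H (y / t); rewrite yt0 yd1 => /(_ isT); rewrite (gtr0_norm q0) => h.
  rewrite -[X in `|X - _|](@divff _ (q (y / t))) ?gt_eqF// -mulrBl normrM normfV (gtr0_norm q0).
  by rewrite ler_pdivrMr// distrC.
have lr : ell (y^-1 * t) / ell t @[t --> +oo] --> (1 : R).
  by case: sv => _; apply; rewrite invr_gt0.
have : y^-1 ^+ 3 * kern y * (p (y / t) / q (y / t) * (al * y `^ al * (ell (y^-1 * t) / ell t)))
    @[t --> +oo] --> y^-1 ^+ 3 * kern y * (1 * (al * y `^ al * 1)).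
  apply: cvgM; first exact: cvg_cst.
  by apply: cvgM => //; apply: cvgM => //; exact: cvg_cst.
apply: cvg_trans; apply: near_eq_cvg; near=> t.
have st : s0 <= t by near: t; apply: nbhs_pinfty_ge; rewrite ?num_real.
have t0 := lt_le_trans s0_gt0 st; have et := proj1 potter t st.
have yt0 : 0 < y / t by rewrite divr_gt0.
have yt : y <= dl * t.
  by rewrite mulrC -ler_pdivrMr//; near: t; apply: nbhs_pinfty_ge; rewrite ?num_real.
have ytd : 0 < y / t <= dl by rewrite yt0 ler_pdivrMr.
have ely : 0 < ell (t / y).
  by rewrite -[t / y]invf_div; apply: (proj1 potter); exact: dl_inv.
rewrite /F yt /q invf_div powR_div_pos// [y^-1 * t]mulrC; field.
by rewrite !gt_eqF ?powR_gt0.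
Unshelve. all: end_near. Qed.

(** Dominated convergence and [kernel_moment] at [be = al]; the factor [al] of the density cancels
    the one in the denominator there. *)
Let head_cvg : \int[pi]_(x in `]0, dl]) vint t x / N t @[t --> +oo] -->
  Gamma (1 + al) / ((2 - al) * (1 - al)).
Proof.
have E : Gamma (1 + al) / ((2 - al) * (1 - al)) = \int[mu]_(y in D) (al * (y `^ (al - 3) * kern y)).
  rewrite RintegralZl//; last exact: integrable_kernel_moment.
  by rewrite /Rintegral kernel_moment//=; field; rewrite !gt_eqF ?subr_gt0// (lt_trans al1)// ltr1n.
rewrite E.
have : \int[mu]_(y in D) F t y @[t --> +oo] --> \int[mu]_(y in D) (al * (y `^ (al - 3) * kern y)).
  apply: (@Rdominated_cvg_pinfty _ _ R mu D F _ dom s0) => //.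
  - apply: measurable_funM => //; apply: measurable_funM.
      exact: measurable_funS (measurable_powR (al - 3)).
    exact: measurable_funS measurable_kern.
apply: cvg_trans; apply: near_eq_cvg; near=> t; by rewrite -head_integral.
Unshelve. all: end_near. Qed.

Let ell_lower t : s0 <= t -> (ell t)^-1 <= 2 * expR 2 / ell s0 * (t / s0) `^ ep.
Proof.
move=> st; have t0 := lt_le_trans s0_gt0 st; have et := proj1 potter t st.
have es := proj1 potter s0 (lexx _).
have := proj2 potter s0 t (lexx _) st.
have r1 : 1 <= t / s0 by rewrite ler_pdivlMr// mul1r.
have r0 : 0 < t / s0 by rewrite divr_gt0.
have -> : s0 / t = (t / s0) `^ (-1) by rewrite powR_inv1 ?invf_div// ltW.
rewrite -!powRrM mulN1r mulrN mulN1r opprK => h.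
have : (t / s0) `^ (- ep) <= (t / s0) `^ ep by rewrite ler_powR// ge0_cp// ltW.
move=> h2.
have : ell s0 / ell t <= 2 * expR 2 * (t / s0) `^ ep.
  apply: le_trans h _; rewrite (_ : 2 * expR 2 * _ = expR 2 * ((t / s0) `^ ep + (t / s0) `^ ep)); last by ring.
  by rewrite ler_pM2l ?expR_gt0// lerD2r.
rewrite (_ : 2 * expR 2 / ell s0 * _ = (2 * expR 2 * (t / s0) `^ ep) / ell s0); last by ring.
by rewrite ler_pdivlMr// mulrC.
Qed.

Let tail_bound t : 0 < t -> \int[pi]_(x in `]dl, +oo[) vint t x <=
  t * (dl^-1 * \int[pi]_(x in D) x^-1).
Proof.
move=> t0.
have sub : `]dl, +oo[%classic `<=` D.
  by move=> x /=; rewrite !in_itv/= !andbT; exact: lt_trans dl_gt0.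
have mD : measurable (`]dl, +oo[%classic : set R) by exact: measurable_itv.
have IV := integrableV m1.
rewrite mulrA -RintegralZl//.
apply: (@le_trans _ _ (\int[pi]_(x in `]dl, +oo[) (t / dl * x^-1))).
  apply: le_Rintegral => //.
  - exact: integrableS sub (integrable_vint m1 (ltW t0)).
  - by apply: integrableZR => //; exact: integrableS sub IV.
  - move=> x /[dup] /sub Dx /=; rewrite in_itv/= andbT => dx.
    apply: le_trans (vint_le2 (ltW t0) Dx) _.
    have x0 := half_line_gt0 Dx.
    rewrite expr2 mulrA ler_pM2r ?invr_gt0// ler_pM2l// lef_pV2 ?posrE//; exact: ltW.
rewrite /Rintegral; apply: fine_le.
- apply: integrable_fin_num => //; apply: integrableZR => //; exact: integrableS sub IV.
- by apply: integrable_fin_num => //; exact: integrableZR.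
- apply: ge0_subset_integral => //.
  + by apply/measurable_EFinP; apply: measurable_funM => //; exact: measurable_half_lineV.
  + move=> x /half_line_gt0 x0; rewrite lee_fin mulr_ge0 ?invr_ge0 ?(ltW x0)//.
    by rewrite divr_ge0// ltW.
Qed.

(** The mass of [pi] beyond [dl] contributes [O(t)], while by [ell_lower] the normalization [N t] is
    at least a constant times [t^(2 - al - ep)], whose exponent exceeds 1. *)
Let tail_cvg : \int[pi]_(x in `]dl, +oo[) vint t x / N t @[t --> +oo] --> (0 : R).
Proof.
pose c := dl^-1 * \int[pi]_(x in D) x^-1.
have c0 : 0 <= c.
  rewrite mulr_ge0 ?invr_ge0 ?(ltW dl_gt0)//; apply: Rintegral_ge0 => x /half_line_gt0 x0.
  by rewrite invr_ge0 ltW.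
pose C := c * (2 * expR 2 / ell s0 * s0 `^ (- ep)).
have C0 : 0 <= C.
  have es := proj1 potter s0 (lexx _).
  by rewrite mulr_ge0// mulr_ge0 ?powR_ge0// divr_ge0 ?mulr_ge0 ?expR_ge0 ?(ltW es).
have q0 : ep + (al - 1) < 0.
  by move: ep_le2 al1; move: (ep) => e; lra.
apply: (@squeeze_cvgr _ _ _ _ (fun=> 0) (fun t => C * t `^ (ep + (al - 1)))); last 2 first.
- exact: cvg_cst.
- rewrite -[X in _ --> X](mulr0 C); apply: cvgM; first exact: cvg_cst.
  exact: powR_cvg0_pinfty.
near=> t.
have st : s0 <= t by near: t; apply: nbhs_pinfty_ge; rewrite ?num_real.
have t0 := lt_le_trans s0_gt0 st; have et := proj1 potter t st.
have Nt := N_gt0 st.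
apply/andP; split.
  rewrite divr_ge0 ?(ltW Nt)//; apply: Rintegral_ge0 => x /= h; apply: vint_ge0.
  by apply: gt0_half_line; move: h; rewrite in_itv/= andbT; exact: lt_trans dl_gt0.
rewrite ler_pdivrMr//; apply: le_trans (tail_bound t0) _; rewrite -/c.
apply: (@le_trans _ _ (t * c * ((ell t)^-1 * ell t))); first by rewrite mulVf ?mulr1// gt_eqF.
apply: (@le_trans _ _ (t * c * (2 * expR 2 / ell s0 * (t / s0) `^ ep * ell t))).
  rewrite ler_wpM2l//; first by rewrite mulr_ge0// ltW.
  by rewrite ler_wpM2r ?ell_lower// ltW.
rewrite le_eqVlt; apply/orP; left; apply/eqP.
rewrite /C /N powR_div_pos// powRN !powRD_gt0// !powRN powRr1 ?(ltW t0)//.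
by field; rewrite !gt_eqF ?powR_gt0// (proj1 potter).
Unshelve. all: end_near. Qed.

Lemma supvar_regvar_cvg : supvar pi b t / (ell t * t `^ (2 - al)) @[t --> +oo] -->
  b * (Gamma (1 + al) / ((2 - al) * (1 - al))).
Proof.
rewrite -[X in _ --> b * X]addr0.
have : b * (\int[pi]_(x in `]0, dl]) vint t x / N t + \int[pi]_(x in `]dl, +oo[) vint t x / N t)
    @[t --> +oo] --> b * (Gamma (1 + al) / ((2 - al) * (1 - al)) + 0).
  exact: cvgM (cvg_cst b) (cvgD head_cvg tail_cvg).
apply: cvg_trans.
apply: near_eq_cvg; near=> t; rewrite /= -/(N t).
have t0 : 0 < t by near: t; apply: nbhs_pinfty_gt; rewrite ?num_real.
rewrite -mulrDl mulrA; congr (_ / _); rewrite /supvar; congr (_ * _).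
have -> : D = `]0, dl]%classic `|` `]dl, +oo[%classic.
  apply/seteqP; split=> x /=; rewrite !in_itv/= !andbT.
    by move=> x0; have [xd|xd] := leP x dl; [left; rewrite x0|right].
  by move=> [/andP[]//|]; exact: lt_trans dl_gt0.
rewrite Rintegral_setU//; last first.
  apply/disj_setPS => x /=; rewrite !in_itv/= andbT => -[/andP[_ xd] dx].
  by have := le_lt_trans xd dx; rewrite ltxx.
have := integrable_vint m1 (ltW t0); apply: integrableS => //; first exact: measurableU.
by move=> x /=; rewrite !in_itv/= !andbT => -[/andP[]//|]; exact: lt_trans dl_gt0.
Unshelve. all: end_near. Qed.

(** Positivity of the Gamma value is read off [kernel_moment]: a zero integral of a positive
    function would make [(0, 1]] a null set. *)
Lemma regvar_const_gt0 : 0 < Gamma (1 + al) / ((2 - al) * (1 - al)).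
Proof.
pose kf (y : measurableTypeR R) : R := y `^ (al - 3) * kern y.
have [mK KE] : measurable_fun D (EFin \o kf) /\
    (\int[mu]_(y in D) `|(EFin \o kf) y| =
     (Gamma (1 + al) / ((2 - al) * (1 - al) * al))%:E)%E.
  split; first exact: measurable_int (integrable_kernel_moment al01).
  under eq_integral => y _ do
    rewrite /= ger0_norm ?mulr_ge0 ?powR_ge0 ?kern_ge0//.
  exact: kernel_moment.
have G0 : 0 <= Gamma (1 + al) / ((2 - al) * (1 - al) * al).
  by rewrite -lee_fin -KE integral_ge0.
have G1 : Gamma (1 + al) / ((2 - al) * (1 - al) * al) != 0.
  apply/eqP => E; move: KE; rewrite E => /(ae_eq_integral_abs mu (measurable_itv _) mK).
  case=> A [mA A0 HA].
  have : (mu (`]0%R, 1%R]%classic : set R) <= mu A)%E.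
    apply: le_measure; rewrite ?inE//.
    move=> x /=; rewrite in_itv/= => /andP[x0 _]; apply: HA => /= /(_ (gt0_half_line x0)) [] /eqP.
    by rewrite gt_eqF// mulr_gt0 ?powR_gt0// kern_gt0// gt_eqF.
  by rewrite lebesgue_measure_itv/= lte01 sube0 [X in (_ <= X)%E]A0 leNgt lte01.
have -> : Gamma (1 + al) / ((2 - al) * (1 - al)) = al * (Gamma (1 + al) / ((2 - al) * (1 - al) * al)).
  by field; rewrite !gt_eqF ?subr_gt0// (lt_trans al1)// ltr1n.
by rewrite mulr_gt0// lt0r G1.
Qed.

(** The two-sided bound by [L / 2] and [2 L] costs 4, Potter costs [2 expR 2], and [ep <= al / 2]
    raises the exponent from [2 - al] to [2 - al / 2]. *)
Lemma supvar_growth_regvar : exists t0 : R, forall s t, t0 <= s -> s <= t ->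
  supvar pi b t <= 8 * expR 2 * (t / s) `^ (2 - al / 2) * supvar pi b s.
Proof.
pose L := b * (Gamma (1 + al) / ((2 - al) * (1 - al))).
have L0 : 0 < L by rewrite mulr_gt0// regvar_const_gt0.
have VL : supvar pi b t / N t @[t --> +oo] --> L := supvar_regvar_cvg.
have h1 : \forall t \near +oo, supvar pi b t / N t <= 2 * L.
  by apply: (cvgr_le _ VL); move: L0; move: (L) => l; lra.
have h2 : \forall t \near +oo, L / 2 <= supvar pi b t / N t.
  by apply: (cvgr_ge _ VL); move: L0; move: (L) => l; lra.
have [M [_ HM]] : \forall t \near +oo, [/\ s0 <= t, supvar pi b t / N t <= 2 * L & L / 2 <= supvar pi b t / N t].
  by near=> t; split; near: t => //; apply: nbhs_pinfty_ge; rewrite ?num_real.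
exists (M + 1) => s t Ms st.
have [ss _ s2] := HM s (lt_le_trans (ltr_pwDr ltr01 (lexx M)) Ms).
have [tt t1 _] := HM t (lt_le_trans (ltr_pwDr ltr01 (lexx M)) (le_trans Ms st)).
have sp := lt_le_trans s0_gt0 ss; have tp := lt_le_trans s0_gt0 tt.
move: s2 t1; rewrite ler_pdivlMr ?N_gt0// ler_pdivrMr ?N_gt0// => s2 t1.
have r1 : 1 <= t / s by rewrite ler_pdivlMr// mul1r.
have r0 := lt_le_trans ltr01 r1.
have hN : N t <= 2 * expR 2 * (t / s) `^ (2 - al / 2) * N s.
  have es := proj1 potter s ss.
  have := proj2 potter t s tt ss; rewrite ler_pdivrMr// => h.
  have h3 : (t / s) `^ ep + (t / s) `^ (- ep) <= 2 * (t / s) `^ (al / 2).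
    have : (t / s) `^ ep <= (t / s) `^ (al / 2) by rewrite ler_powR.
    have : (t / s) `^ (- ep) <= (t / s) `^ (al / 2).
      by rewrite ler_powR//; move: ep_gt0 al0; move: (ep) => e; lra.
    lra.
  have h4 : ell t <= expR 2 * (2 * (t / s) `^ (al / 2)) * ell s.
    by apply: le_trans h _; rewrite ler_pM2r// ler_pM2l ?expR_gt0.
  rewrite /N (_ : t `^ (2 - al) = (t / s) `^ (2 - al) * s `^ (2 - al)); last first.
    by rewrite -powRM ?divfK ?gt_eqF// ltW.
  have -> : (t / s) `^ (2 - al / 2) = (t / s) `^ (al / 2) * (t / s) `^ (2 - al).
    by rewrite -powRD_gt0//; congr (_ `^ _); field.
  apply: (@le_trans _ _ (expR 2 * (2 * (t / s) `^ (al / 2)) * ell s * ((t / s) `^ (2 - al) * s `^ (2 - al)))).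
    by rewrite ler_wpM2r// mulr_ge0 ?powR_ge0.
  by rewrite le_eqVlt; apply/orP; left; apply/eqP; ring.
apply: le_trans t1 _; apply: (@le_trans _ _ (2 * L * (2 * expR 2 * (t / s) `^ (2 - al / 2) * N s))).
  by rewrite ler_pM2l// mulr_gt0.
have -> : 2 * L * (2 * expR 2 * (t / s) `^ (2 - al / 2) * N s) =
  8 * expR 2 * (t / s) `^ (2 - al / 2) * (L / 2 * N s) by field.
by rewrite ler_wpM2l// mulr_ge0 ?powR_ge0// mulr_ge0// expR_ge0.
Unshelve. all: end_near. Qed.

Lemma regvar_scaleE : \forall t \near +oo,
  Num.sqrt (2 * (b * (Gamma (1 + al) / ((2 - al) * (1 - al))) * N t) * ln (ln t)) =
  Num.sqrt (b * (Gamma (1 + al) / ((2 - al) * (1 - al)))) *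
    ell t `^ (1 / 2) * t `^ (1 - al / 2) * Num.sqrt (2 * ln (ln t)).
Proof.
near=> t; have st : s0 <= t by near: t; apply: nbhs_pinfty_ge; rewrite ?num_real.
have t0 := lt_le_trans s0_gt0 st; have et := proj1 potter t st.
have L0 : 0 < b * (Gamma (1 + al) / ((2 - al) * (1 - al))) by rewrite mulr_gt0// regvar_const_gt0.
move: L0; set L := b * _ => L0.
have -> : 2 * (L * N t) * ln (ln t) = L * (N t * (2 * ln (ln t))) by ring.
rewrite sqrtr_prod4 ?powR_ge0 ?(ltW L0) ?(ltW et)//.
have -> : t `^ (1 - al / 2) = Num.sqrt (t `^ (2 - al)).
  by rewrite -powR12_sqrt ?powR_ge0// -powRrM; congr (_ `^ _); field.
by rewrite div1r powR12_sqrt ?(ltW et).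
Unshelve. all: end_near. Qed.

Lemma regvar_norm_gt0 : \forall t \near +oo,
  0 < b * (Gamma (1 + al) / ((2 - al) * (1 - al))) * N t.
Proof.
near=> t; have st : s0 <= t by near: t; apply: nbhs_pinfty_ge; rewrite ?num_real.
by rewrite mulr_gt0 ?N_gt0// mulr_gt0// regvar_const_gt0.
Unshelve. all: end_near. Qed.

End regularly_varying_density.

(** * Integration of a Gaussian process *)

Section integrated_family.
Context d1 d2 (U : measurableType d1) (T : measurableType d2) (R : realType).
Variables (mu : {sigma_finite_measure set U -> \bar R}) (P : {sigma_finite_measure set T -> \bar R}).
Variables (I : set U) (g : U -> T -> R) (C : R).
Hypotheses (mI : measurable I) (muI : (mu I < +oo)%E).
Hypothesis mg : measurable_fun setT (fun z : U * T => g z.1 z.2).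

Let gI (z : U * T) : \bar R := (g z.1 z.2 * \1_I z.1)%:E.

Let mgI : measurable_fun setT gI.
Proof.
apply/measurable_EFinP; apply: measurable_funM => //.
by apply: (measurableT_comp (f := (\1_I : U -> R))) => //; exact: measurable_indic.
Qed.

Let gI_restrict w : (fun u => gI (u, w)) = (EFin \o g^~ w) \_ I.
Proof.
apply/funext => u; rewrite /gI /= patchE indicE; case: ifPn => uI.
  by rewrite mulr1.
by rewrite mulr0.
Qed.

Let gI_restrict_abs w : (fun u => `|gI (u, w)|)%E = (fun u => `|g u w|%:E) \_ I.
Proof.
apply/funext => u; rewrite /gI /= patchE indicE; case: ifPn => uI.
  by rewrite mulr1.
by rewrite mulr0 normr0.
Qed.

Lemma measurable_family_r u : measurable_fun setT (g u).
Proof. exact: (measurableT_comp mg (measurable_pair1 u)). Qed.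

(** Sections need not be integrable: the integral is the [fine] value of a difference of Tonelli
    integrals of the positive and negative parts, each measurable in [w]. *)
Lemma measurable_family_Rintegral : measurable_fun setT (fun w => \int[mu]_(u in I) g u w).
Proof.
have -> : (fun w => \int[mu]_(u in I) g u w) =
    fine \o (fun w => \int[mu]_u gI^\+ (u, w) - \int[mu]_u gI^\- (u, w))%E.
  apply/funext => w; rewrite /Rintegral integral_mkcond -gI_restrict /=; congr fine.
  rewrite [LHS]integralE; congr (_ - _)%E; apply: eq_integral => u _.
    by rewrite !funeposE.
  by rewrite !funenegE.
apply: measurableT_comp => //; apply: emeasurable_funB.
  by apply: measurable_fun_fubini_tonelli_G => //; exact: measurable_funepos.
by apply: measurable_fun_fubini_tonelli_G => //; exact: measurable_funeneg.
Qed.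

Lemma family_tonelli_abs : (\int[P]_w \int[mu]_(u in I) `|g u w|%:E =
  \int[mu]_(u in I) \int[P]_w `|g u w|%:E)%E.
Proof.
transitivity (\int[P]_w \int[mu]_u `|gI (u, w)|)%E.
  by apply: eq_integral => w _; rewrite gI_restrict_abs -integral_mkcond.
rewrite -(@fubini_tonelli _ _ _ _ _ mu P (fun z => `|gI z|)%E) => //; last exact: measurableT_comp.
rewrite [RHS]integral_mkcond; apply: eq_integral => u _; rewrite patchE.
case: ifPn => uI.
  by apply: eq_integral => w _; rewrite /gI /= indicE uI mulr1.
by rewrite integral0_eq// => w _; rewrite /gI/= indicE (negPf uI) mulr0 normr0.
Qed.

Hypothesis gC : forall u, I u -> (\int[P]_w `|g u w|%:E <= C%:E)%E.

Lemma family_tonelli_le : (\int[P]_w \int[mu]_(u in I) `|g u w|%:E <= C%:E * mu I)%E.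
Proof.
rewrite family_tonelli_abs -integral_cst//; apply: ge0_le_integral => //.
- by move=> u _; exact: integral_ge0.
- apply: measurable_funS (@measurable_fun_fubini_tonelli_F _ _ U T R P (fun z : U * T => `|g z.1 z.2|%:E) _ _) => //.
  by apply/measurable_EFinP; exact: measurableT_comp.
Qed.

Let gI_integrable : (mu \x P)%E.-integrable setT gI.
Proof.
apply/integrable21ltyP => //.
apply: (@le_lt_trans _ _ (C%:E * mu I)%E).
  apply: le_trans family_tonelli_le; rewrite le_eqVlt; apply/orP; left; apply/eqP.
  by apply: eq_integral => w _; rewrite gI_restrict_abs -integral_mkcond.
by rewrite ltey_eq fin_numM// ge0_fin_numE.
Qed.

Lemma family_ae_integrable : {ae P, forall w, mu.-integrable I (EFin \o g^~ w)}.
Proof.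
have := ae_integrable2 gI_integrable; apply: filterS => w.
by rewrite gI_restrict => Iw; exact/integrable_mkcond.
Qed.

Lemma family_Rintegral_le :
  (\int[P]_w `|\int[mu]_(u in I) g u w|%:E <= C%:E * mu I)%E.
Proof.
apply: le_trans family_tonelli_le.
apply: ae_ge0_le_integral => //.
- by apply/measurable_EFinP; apply: measurableT_comp => //; exact: measurable_family_Rintegral.
- by move=> w _; exact: integral_ge0.
- have := @measurable_fun_fubini_tonelli_G _ _ U T R mu (fun z => `|gI z|)%E.
  move=> /(_ (measurableT_comp _ mgI) (fun=> abse_ge0 _)).
  rewrite /fubini_G; under eq_fun do rewrite gI_restrict_abs -integral_mkcond; exact.
- have := family_ae_integrable; apply: filterS => w Iw _.
  have fi := integrable_fin_num mI Iw.
  have := le_abse_integral mu mI (measurable_int _ Iw).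
  by rewrite -(fineK fi).
Qed.

Lemma family_integrable_mean :
  mu.-integrable I (EFin \o (fun u => \int[P]_w g u w)).
Proof.
have := integrable_fubini_F gI_integrable.
rewrite (_ : fubini_F P gI = (EFin \o (fun u => \int[P]_w g u w)) \_ I).
  by move=> H; exact/integrable_mkcond.
apply/funext => u; rewrite /fubini_F patchE; case: ifPn => uI; last first.
  by rewrite integral0_eq// => w _; rewrite /gI/= indicE (negPf uI) mulr0.
rewrite /= /Rintegral fineK.
  by apply: eq_integral => w _; rewrite /gI /= indicE uI mulr1.
apply: integrable_fin_num => //; apply/integrableP; split.
  by apply/measurable_EFinP; exact: measurable_family_r.
apply: (@le_lt_trans _ _ C%:E); last exact: ltry.
by apply: gC; move: uI; rewrite inE.
Qed.

Lemma family_Fubini :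
  \int[P]_w (\int[mu]_(u in I) g u w) = \int[mu]_(u in I) (\int[P]_w g u w).
Proof.
have H := Fubini gI_integrable.
have E2 : (\int[P]_w \int[mu]_u gI (u, w) = \int[P]_w (\int[mu]_(u in I) g u w)%:E)%E.
  apply: ae_eq_integral => //.
  - exact: measurable_fubini_G gI_integrable.
  - by apply/measurable_EFinP; exact: measurable_family_Rintegral.
  - have := family_ae_integrable; apply: filterS => w Iw _.
    rewrite gI_restrict -integral_mkcond /Rintegral fineK//; exact: integrable_fin_num.
have E1 : (\int[mu]_u \int[P]_w gI (u, w) = \int[mu]_(u in I) (\int[P]_w g u w)%:E)%E.
  rewrite [RHS]integral_mkcond; apply: eq_integral => u _; rewrite patchE.
  case: ifPn => uI; last by rewrite integral0_eq// => w _; rewrite /gI/= indicE (negPf uI) mulr0.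
  rewrite /Rintegral fineK.
    by apply: eq_integral => w _; rewrite /gI /= indicE uI mulr1.
  apply: integrable_fin_num => //; apply/integrableP; split.
    by apply/measurable_EFinP; exact: measurable_family_r.
  apply: (@le_lt_trans _ _ C%:E); last exact: ltry.
  by apply: gC; move: uI; rewrite inE.
by rewrite {1}/Rintegral -E2 -H E1.
Qed.

End integrated_family.

(** * Gaussian variables under limits in probability and in mean *)

Section probability_limits.
Context d (T : measurableType d) (R : realType).
Variable P : probability T R.

(** No convergence of variances is assumed. At a frequency so small that the limiting transform is
    positive, the logarithm of the transform of [Y_ n] recovers [v_ n] and therefore its limit. *)
Lemma gauss_limit_exists (Y_ : nat -> T -> R) (v_ : nat -> R) (Y : T -> R) :
  (forall n, is_gauss P (Y_ n) (v_ n)) -> measurable_fun setT Y ->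
  cvg_in_probability P Y_ Y ->
  exists2 v, is_gauss P Y v & v_ n @[n --> \oo] --> v.
Proof.
move=> gY mY cY.
pose ph th := \int[P]_w cos (th * Y w + 0).
have ph1 : ph n.+1%:R^-1 @[n --> \oo] --> (1 : R).
  rewrite -[X in _ --> X](Rintegral_cstT P 1).
  apply: (@Rdominated_cvg _ _ _ P setT _ (fun=> 1) (fun=> 1)) => //.
  - by move=> n; exact: measurable_cos_aff.
  - move=> w _; rewrite -[X in _ --> X]cos0; have H : n.+1%:R^-1 * Y w + 0 @[n --> \oo] --> (0 : R).
      rewrite -[X in _ --> X](_ : 0 * Y w + 0 = 0); last by rewrite mul0r addr0.
      apply: cvgD; last exact: cvg_cst.
      by apply: cvgM; [exact: cvg_harmonic|exact: cvg_cst].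
    by apply: (cvg_comp _ _ H); exact: continuous_cos.
  - by apply: (@bounded_integrable _ _ _ P _ 1) => // w; rewrite normr1.
  - by move=> n w _; exact: cos_norm_le1.
have [n0 h0] : exists n, 0 < ph n.+1%:R^-1.
  have : \forall n \near \oo, 0 < ph n.+1%:R^-1 by exact: (cvgr_gt (1 : R) ph1).
  by case=> N _ HN; exists N; exact: HN (leqnn N).
pose th : R := n0.+1%:R^-1; have th0 : 0 < th by rewrite invr_gt0.
have C1 : expR (- (v_ n * th ^+ 2 / 2)) @[n --> \oo] --> ph th.
  have := @cvg_in_probability_cos _ _ _ P _ _ th 0 (fun n => (gY n).1) mY cY.
  by under eq_fun do rewrite (gY _).2 cos0 mul1r.
have C2 : - (2 / th ^+ 2) * ln (expR (- (v_ n * th ^+ 2 / 2))) @[n --> \oo] --> - (2 / th ^+ 2) * ln (ph th).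
  apply: cvgM; first exact: cvg_cst.
  by apply: (cvg_comp _ _ C1); exact: continuous_ln.
exists (- (2 / th ^+ 2) * ln (ph th)).
  apply: (gauss_cvg_in_probability gY mY cY); apply: cvg_trans C2; apply: near_eq_cvg.
  by apply: nearW => n; rewrite expRK; field; rewrite gt_eqF.
apply: cvg_trans C2; apply: near_eq_cvg.
by apply: nearW => n; rewrite expRK; field; rewrite gt_eqF.
Qed.

(** AM-GM in the form [|Y| <= e / 2 + Y^2 / (2 e)], integrated. *)
Lemma gauss_abs_le (Y : T -> R) (v e : R) : is_gauss P Y v -> 0 < e -> v <= e ^+ 2 ->
  (\int[P]_w `|Y w|%:E <= e%:E)%E.
Proof.
move=> gY e0 ve; have [mY _] := gY.
have Is := gauss_integrable_sqr gY.
have Ig : P.-integrable setT (EFin \o (fun w => e / 2 + (2 * e)^-1 * Y w ^+ 2)).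
  apply: integrableDR => //; last exact: integrableZR.
  by apply: (@bounded_integrable _ _ _ P _ `|e / 2|).
apply: (@le_trans _ _ (\int[P]_w (e / 2 + (2 * e)^-1 * Y w ^+ 2)%:E)%E).
  apply: ge0_le_integral => //.
  - by apply/measurable_EFinP; exact: measurableT_comp.
  - exact: measurable_int Ig.
  - move=> w _; rewrite lee_fin -subr_ge0.
    have -> : e / 2 + (2 * e)^-1 * Y w ^+ 2 - `|Y w| = (2 * e)^-1 * (`|Y w| - e) ^+ 2.
      by rewrite sqrrB real_normK ?num_real//; field; rewrite gt_eqF.
    by rewrite mulr_ge0 ?sqr_ge0// invr_ge0 mulr_ge0// ltW.
rewrite -(fineK (integrable_fin_num _ Ig))// lee_fin -[X in X <= _]/(\int[P]_w (e / 2 + (2 * e)^-1 * Y w ^+ 2)).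
rewrite RintegralD//; last 2 first.
- by apply: (@bounded_integrable _ _ _ P _ `|e / 2|).
- exact: integrableZR.
rewrite Rintegral_cstT RintegralZl// (gauss_variance gY).
have : (2 * e)^-1 * v <= (2 * e)^-1 * e ^+ 2 by rewrite ler_wpM2l// invr_ge0 mulr_ge0// ltW.
have -> : (2 * e)^-1 * e ^+ 2 = e / 2 by field; rewrite gt_eqF.
lra.
Qed.

Lemma L1_cvg_in_probability (Y_ : nat -> T -> R) (Y : T -> R) :
  (forall n, measurable_fun setT (Y_ n)) -> measurable_fun setT Y ->
  (forall e : R, 0 < e -> \forall n \near \oo, (\int[P]_w `|Y_ n w - Y w|%:E <= e%:E)%E) ->
  cvg_in_probability P Y_ Y.
Proof.
move=> mY_ mY uY e e0.
have mD n : measurable_fun setT (fun w => Y_ n w - Y w) by exact: measurable_funB.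
have Pf n : P [set w | e <= `|Y_ n w - Y w|] \is a fin_num.
  by apply: fin_num_measure; exact: measurable_norm_ge.
apply/fine_cvgP; split; first by apply: nearW => n; exact: Pf.
apply/cvgr0Pnorm_le => h h0; have := uY _ (mulr_gt0 e0 h0); apply: filterS => n hn.
rewrite /= ger0_norm; last by rewrite fine_ge0.
have := @le_integral_abse _ _ _ P setT measurableT (fun w => (Y_ n w - Y w)%:E) e.
move=> /(_ (proj2 (measurable_EFinP _ _) (mD n)) e0); rewrite setTI => H.
have {H} : (e%:E * P [set w | (e <= `|Y_ n w - Y w|)%R] <= (e * h)%:E)%E := le_trans H hn.
by rewrite -(fineK (Pf n)) -EFinM lee_fin ler_pM2l.
Qed.

Lemma gauss_mul_integrable (Y Z : T -> R) (v v' : R) : is_gauss P Y v -> is_gauss P Z v' ->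
  P.-integrable setT (EFin \o (fun w => Y w * Z w)) /\
  (\int[P]_w `|Y w * Z w|%:E <= (v + v')%:E)%E.
Proof.
move=> gY gZ; have [mY _] := gY; have [mZ _] := gZ.
have IY := gauss_integrable_sqr gY; have IZ := gauss_integrable_sqr gZ.
have IS := integrableDR measurableT IY IZ.
have le w : `|Y w * Z w| <= Y w ^+ 2 + Z w ^+ 2.
  by rewrite ler_norml; apply/andP; split; nra.
split.
  apply: le_integrable IS => //; first by apply/measurable_EFinP; exact: measurable_funM.
  by move=> w _; rewrite lee_fin (le_trans (le w))// ler_norm.
apply: (@le_trans _ _ (\int[P]_w (Y w ^+ 2 + Z w ^+ 2)%:E)%E).
  apply: ge0_le_integral => //.
  - by apply/measurable_EFinP; apply: measurableT_comp => //; exact: measurable_funM.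
  - exact: measurable_int IS.
  - by move=> w _; rewrite lee_fin.
rewrite -(fineK (integrable_fin_num measurableT IS)) lee_fin.
by rewrite -[X in X <= _]/(\int[P]_w (Y w ^+ 2 + Z w ^+ 2)) RintegralD// (gauss_variance gY) (gauss_variance gZ).
Qed.

Lemma ae_eq_Rintegral (f g : T -> R) : measurable_fun setT f -> measurable_fun setT g ->
  {ae P, forall w, f w = g w} -> \int[P]_w f w = \int[P]_w g w.
Proof.
move=> mf mg fg; congr fine; apply: ae_eq_integral => //.
- exact/measurable_EFinP.
- exact/measurable_EFinP.
- by apply: filterS fg => w /= -> _.
Qed.

End probability_limits.

Section itv_integral.
Context {R : realType}.
Local Notation mu := (@lebesgue_measure R).

Lemma Rintegral_itv_cat (f : R -> R) (a x c : R) : a <= x -> x <= c ->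
  mu.-integrable `[a, c] (EFin \o f) ->
  \int[mu]_(u in `[a, c]) f u = \int[mu]_(u in `[a, x]) f u + \int[mu]_(u in `[x, c]) f u.
Proof.
move=> ax xc If.
have := @Rintegral_itvB R f (BLeft a) (BRight c) x If.
rewrite !bnd_simp => /(_ ax xc) H.
rewrite -[LHS](subrK (\int[mu]_(u in `[a, x]) f u)) H addrC; congr (_ + _).
apply: Rintegral_itv_obnd_cbnd; apply: integrableS If => // u /=.
by rewrite !in_itv/= => /andP[xu ->]; rewrite (le_trans ax (ltW xu)).
Qed.

(** Negative times give an empty interval, hence the [max]. Integrating from -1 makes 0 an interior
    point, where continuity of the parameterized integral is available. *)
Lemma Rintegral_itv_continuous (f : R -> R) :
  (forall a c : R, mu.-integrable `[a, c] (EFin \o f)) ->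
  continuous (fun t : R => \int[mu]_(u in `[0%R, t]) f u).
Proof.
move=> If t; pose H (s : R) := parameterized_integral mu (-1) s f.
have E : (fun s : R => \int[mu]_(u in `[0, s]) f u) = (fun s => H (Num.max 0 s) - H 0).
  apply/funext => s; have [s0|s0] := leP 0 s.
    rewrite /H /parameterized_integral (@Rintegral_itv_cat f (-1) 0 s)//.
    by rewrite addrC addKr.
  by rewrite subrr set_itv_ge ?Rintegral_set0// bnd_simp -ltNge.
rewrite E; apply: cvgB; last exact: cvg_cst.
have cmax : {for t, continuous (fun s : R => Num.max 0 s)}.
  by apply: (@continuous_max _ _ (fun=> 0) (fun s => s)); [exact: cvg_cst|exact: cvg_id].
have m0 : 0 <= Num.max 0 t by rewrite le_max lexx.
apply: (@continuous_comp _ _ _ (fun s : R => Num.max 0 s) H) => //.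
have ab : -1 < Num.max 0 t + 1 by move: m0; lra.
have := @parameterized_integral_continuous R (-1) (Num.max 0 t + 1) f (ltW ab) (If _ _).
move=> /(continuous_within_itvP _ ab)[+ _ _]; apply.
by rewrite in_itv/= ltrDl ltr01 andbT (lt_le_trans _ m0)// ltrN10.
Qed.

End itv_integral.

(** * Gaussianity and variance of the integrated process *)

Section integrated_gaussian_process.
Context d (T : measurableType d) (R : realType).
Variables (P : probability T R) (X : R -> T -> R) (r : R -> R).
Hypothesis mX : measurable_fun [set: R * T] (fun z => X z.1 z.2).
Hypothesis X_pair : forall u v a c, is_gauss P (fun w => a * X u w + c * X v w)
  (a ^+ 2 * r 0 + c ^+ 2 * r 0 + 2 * a * c * r (u - v)).
Hypothesis X_comb : forall s : seq (R * R),
  exists v, is_gauss P (fun w => \sum_(x <- s) x.1 * X x.2 w) v.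
Hypothesis r_cont : r h @[h --> (0 : R)] --> r 0.
Local Notation mu := (@lebesgue_measure R).
Local Notation Y := (integrated_process X).

Let mX' : measurable_fun setT (fun z : measurableTypeR R * T => X z.1 z.2).
Proof. exact: mX. Qed.

Let X_gauss u : is_gauss P (X u) (r 0).
Proof.
have := X_pair u u 1 0; rewrite expr1n mul1r expr0n/= mul0r mulr0 mul0r !addr0.
by under eq_fun do rewrite mul1r mul0r addr0.
Qed.

Let r0_ge0 : 0 <= r 0.
Proof. exact: gauss_ge0 (X_gauss 0). Qed.

Let X_meas u : measurable_fun setT (X u).
Proof. by case: (X_gauss u). Qed.

Let X_abs u : (\int[P]_w `|X u w|%:E <= (1 + r 0)%:E)%E.
Proof.
apply: gauss_abs_le (X_gauss u) _ _; first by rewrite ltr_pwDl.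
by move: r0_ge0; move: (r 0) => z; nra.
Qed.

Let X_incr u v e : 0 < e -> 2 * (r 0 - r (u - v)) <= e ^+ 2 ->
  (\int[P]_w `|X u w - X v w|%:E <= e%:E)%E.
Proof.
move=> e0 h; have := X_pair u v 1 (-1).
under eq_fun do rewrite mul1r mulN1r.
move=> g; apply: gauss_abs_le g e0 _; apply: le_trans h.
by rewrite le_eqVlt; apply/orP; left; apply/eqP; ring.
Qed.

Let itv_fin (a c : R) : (mu `[a, c]%classic < +oo)%E.
Proof. by rewrite lebesgue_measure_itv/=; case: ifP => _; rewrite ?ltry// -EFinB ltry. Qed.

(** One null set serves all bounded intervals, because the countably many [[-n, n]] suffice. *)
Lemma process_ae_locally_integrable :
  {ae P, forall w, forall a c : R, mu.-integrable `[a, c] (EFin \o X^~ w)}.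
Proof.
have : {ae P, forall w, forall n : nat, mu.-integrable `[- n%:R, n%:R] (EFin \o X^~ w)}.
  apply/ae_foralln => n.
  apply: (@family_ae_integrable _ _ _ T R mu P `[- n%:R, n%:R]%classic X (1 + r 0)) => //.
  exact: itv_fin.
apply: filterS => w H a c.
pose n := (Num.truncn (`|a| + `|c|)).+1.
have hn : `|a| + `|c| < n%:R by exact: truncnS_gt.
apply: integrableS (H n) => // x /=; rewrite !in_itv/= => /andP[ax xc].
move: hn; move: (n%:R) => m hm.
have := ler_norm c; have := ler_norm (- a); rewrite normrN.
have := normr_ge0 a; have := normr_ge0 c => *; apply/andP; split; lra.
Qed.

Lemma measurable_integrated_process t : measurable_fun setT (Y t).
Proof.
exact: (@measurable_family_Rintegral _ _ _ T R mu `[0, t]%classic X (measurable_itv _) mX').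
Qed.

Lemma integrated_process_continuous : {ae P, forall w, continuous (fun t => Y t w)}.
Proof.
have := process_ae_locally_integrable; apply: filterS => w Iw.
exact: Rintegral_itv_continuous.
Qed.

Let riemann (t : R) (n : nat) (k : nat) (w : T) : R :=
  \sum_(j < k) (t / n.+1%:R) * X (j%:R * (t / n.+1%:R)) w.

(** Each cell, with the process frozen at its left endpoint, adds an [L^1] error of at most [e]
    times its length. *)
Let riemann_step (t e : R) (n k : nat) : 0 < t -> 0 < e ->
  (forall h, 0 <= h <= t / n.+1%:R -> 2 * (r 0 - r h) <= e ^+ 2) ->
  (\int[P]_w `|Y (k%:R * (t / n.+1%:R)) w - riemann t n k w|%:E <= (e * (k%:R * (t / n.+1%:R)))%:E)%E.
Proof.
move=> t0 e0 he; set h := t / n.+1%:R; have h0 : 0 < h by rewrite divr_gt0.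
have mr j : measurable_fun setT (riemann t n j).
  by apply: measurable_sum => i; exact: measurable_funM.
have mD j : measurable_fun setT (fun w => `|Y (j%:R * h) w - riemann t n j w|%:E).
  apply/measurable_EFinP; apply: measurableT_comp => //; apply: measurable_funB => //.
  exact: measurable_integrated_process.
elim: k => [|k IH].
  rewrite !mul0r mulr0 integral0_eq// => w _.
  by rewrite /riemann big_ord0 /integrated_process set_itv1 Rintegral_set1 subrr normr0.
pose a : R := k%:R * h; pose c : R := k.+1%:R * h.
have ac : c - a = h by rewrite /c /a -natr1; ring.
have a0 : 0 <= a by rewrite mulr_ge0// ltW.
have a_c : a <= c by rewrite -subr_ge0 ac ltW.
pose g u w := X u w - X a w.
have mg : measurable_fun setT (fun z : measurableTypeR R * T => g z.1 z.2).
  apply: measurable_funB => //; exact: (measurableT_comp (X_meas a) measurable_snd).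
have muI : mu `[a, c]%classic = h%:E.
  rewrite lebesgue_measure_itv/= lte_fin -subr_gt0 ac h0 -EFinB ac//.
have gC u : `[a, c]%classic u -> (\int[P]_w `|g u w|%:E <= e%:E)%E.
  rewrite /= in_itv/= => /andP[au uc]; apply: X_incr => //; apply: he.
  by rewrite subr_ge0 au -/h -ac lerB.
have := @family_Rintegral_le _ _ _ T R mu P `[a, c]%classic g e (measurable_itv _) _ mg gC.
move=> /(_ (itv_fin _ _)) S0.
have S : (\int[P]_w `|\int[mu]_(u in `[a, c]) g u w|%:E <= e%:E * h%:E)%E by rewrite -muI; exact: S0.
apply: (@le_trans _ _ (\int[P]_w (`|Y a w - riemann t n k w|%:E + `|\int[mu]_(u in `[a, c]) g u w|%:E))%E).
  apply: ae_ge0_le_integral => //.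
  - by move=> w _; rewrite -EFinD lee_fin addr_ge0.
  - apply: emeasurable_funD; first exact: mD.
    apply/measurable_EFinP; apply: measurableT_comp => //.
    exact: (@measurable_family_Rintegral _ _ _ T R mu `[a, c]%classic g (measurable_itv _) mg).
  - have := process_ae_locally_integrable; apply: filterS => w Iw _.
    rewrite -EFinD lee_fin; apply: le_trans (ler_normD _ _).
    rewrite le_eqVlt; apply/orP; left; apply/eqP; congr `| _ |.
    rewrite /g RintegralB//; last first.
      apply: continuous_compact_integrable; first exact: segment_compact.
      by apply: continuous_subspaceT => ?; exact: cvg_cst.
    rewrite (_ : \int[mu]_(_ in `[a, c]) X a w = X a w * h); last first.
      by rewrite Rintegral_cst//; congr (_ * _); exact: (congr1 fine muI).
    rewrite /integrated_process (@Rintegral_itv_cat R _ 0 a c)//.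
    by rewrite /riemann big_ord_recr/= -/h -/a; ring.
rewrite ge0_integralD//; last 2 first.
- exact: mD.
- apply/measurable_EFinP; apply: measurableT_comp => //.
  exact: (@measurable_family_Rintegral _ _ _ T R mu `[a, c]%classic g (measurable_itv _) mg).
apply: le_trans (leeD IH S) _.
by rewrite -EFinM -EFinD lee_fin -/a -/c -ac -mulrDr addrC subrK.
Qed.

Let riemann_cvg t e : 0 <= t -> 0 < e -> \forall n \near \oo,
  (\int[P]_w `|Y t w - riemann t n n.+1 w|%:E <= e%:E)%E.
Proof.
rewrite le_eqVlt => /predU1P[<-|t0] e0.
  apply: nearW => n; rewrite integral0_eq ?lee_fin ?ltW// => w _.
  rewrite /integrated_process set_itv1 Rintegral_set1 sub0r normrN /riemann big1 ?normr0// => j _.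
  by rewrite !mul0r.
have e1 : 0 < (e / t) ^+ 2 / 2 by rewrite divr_gt0// exprn_gt0// divr_gt0.
have /cvgrPdist_le/(_ _ e1)[dl /= dl0 H] := r_cont.
near=> n.
have hn : t / n.+1%:R < dl.
  rewrite ltr_pdivrMr// mulrC -ltr_pdivrMr//; near: n.
  exists (Num.truncn (t / dl)) => // m /= hm.
  by apply: lt_le_trans (truncnS_gt _) _; rewrite ler_nat ltnS.
have n0 : n.+1%:R != 0 :> R by rewrite pnatr_eq0.
have := @riemann_step t (e / t) n n.+1 t0 (divr_gt0 e0 t0).
rewrite [n.+1%:R * _]mulrC divfK// divfK ?gt_eqF//; apply => h /andP[h0 ht].
have := H h; rewrite /ball_/= sub0r normrN ger0_norm// => /(_ (le_lt_trans ht hn)).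
by move=> /(le_trans (ler_norm _)); lra.
Unshelve. all: end_near. Qed.

Let measurable_riemann t n k : measurable_fun setT (riemann t n k).
Proof. by apply: measurable_sum => i; exact: measurable_funM. Qed.

Let Y_meas := measurable_integrated_process.

(** Two Riemann sums concatenated form one finite combination of values of the process. Only some
    variance is obtained here; [Y_le_gauss] computes it. *)
Let Y_comb_gauss s t a c : 0 <= s -> 0 <= t ->
  exists v, is_gauss P (fun w => a * Y s w + c * Y t w) v.
Proof.
move=> s0 t0.
pose S n w := a * riemann s n n.+1 w + c * riemann t n n.+1 w.
have gS n : exists v, is_gauss P (S n) v.
  pose hs := s / n.+1%:R; pose ht := t / n.+1%:R.
  have [v] := X_comb ([seq (a * hs, i%:R * hs) | i : 'I_n.+1 <- index_enum 'I_n.+1] ++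
                     [seq (c * ht, i%:R * ht) | i : 'I_n.+1 <- index_enum 'I_n.+1]).
  under eq_fun do rewrite big_cat !big_map /=.
  move=> g; exists v; suff -> : S n = (fun w => \sum_(j < n.+1) a * hs * X (j%:R * hs) w +
    \sum_(j < n.+1) c * ht * X (j%:R * ht) w) by [].
  apply/funext => w; rewrite /S /riemann !mulr_sumr.
  by congr (_ + _); apply: eq_bigr => i _; rewrite mulrA.
have mYY : measurable_fun setT (fun w => a * Y s w + c * Y t w).
  by apply: measurable_funD; exact: measurable_funM.
have cS : cvg_in_probability P S (fun w => a * Y s w + c * Y t w).
  apply: L1_cvg_in_probability => //.
    by move=> n; apply: measurable_funD; exact: measurable_funM.
  move=> e e0; pose K := `|a| + `|c| + 1.
  have K0 : 0 < K by rewrite ltr_wpDl// addr_ge0.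
  have H1 := riemann_cvg s0 (divr_gt0 e0 K0).
  have H2 := riemann_cvg t0 (divr_gt0 e0 K0).
  near=> n.
  have h1 : (\int[P]_w `|Y s w - riemann s n n.+1 w|%:E <= (e / K)%:E)%E by near: n.
  have h2 : (\int[P]_w `|Y t w - riemann t n n.+1 w|%:E <= (e / K)%:E)%E by near: n.
  have mm u : measurable_fun setT (fun w => `|Y u w - riemann u n n.+1 w|%:E).
    by apply/measurable_EFinP; apply: measurableT_comp => //; exact: measurable_funB.
  apply: (@le_trans _ _ (\int[P]_w (`|a|%:E * `|Y s w - riemann s n n.+1 w|%:E +
     `|c|%:E * `|Y t w - riemann t n n.+1 w|%:E))%E).
    apply: ge0_le_integral => //.
    - apply/measurable_EFinP; apply: measurableT_comp => //; apply: measurable_funB => //.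
      by apply: measurable_funD; exact: measurable_funM.
    - by apply: emeasurable_funD; exact: emeasurable_funM.
    - move=> w _; rewrite -!EFinM -EFinD lee_fin -!normrM.
      apply: le_trans (ler_normD _ _); rewrite -normrN.
      by rewrite le_eqVlt; apply/orP; left; apply/eqP; congr `| _ |; rewrite /S; ring.
  rewrite ge0_integralD//; last 2 first.
  - exact: emeasurable_funM.
  - exact: emeasurable_funM.
  rewrite !ge0_integralZl_EFin//.
  apply: (@le_trans _ _ (`|a|%:E * (e / K)%:E + `|c|%:E * (e / K)%:E)%E).
    by apply: leeD; apply: lee_wpmul2l.
  rewrite -!EFinM -EFinD lee_fin -mulrDl mulrA ler_pdivrMr// mulrC ler_pM2l//.
  by rewrite /K lerDl.
pose v_ n := sval (cid (gS n)).
have [v gv _] := @gauss_limit_exists _ _ _ P S v_ _ (fun n => svalP (cid (gS n))) mYY cS.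
by exists v.
Unshelve. all: end_near. Qed.

Let X_cov u v : \int[P]_w (X u w * X v w) = r (u - v).
Proof.
have g1 := X_pair u v 1 1; have Is := gauss_integrable_sqr g1.
have Iu := gauss_integrable_sqr (X_gauss u); have Iv := gauss_integrable_sqr (X_gauss v).
transitivity (\int[P]_w (2^-1 * ((1 * X u w + 1 * X v w) ^+ 2 - (X u w ^+ 2 + X v w ^+ 2)))).
  by apply: eq_Rintegral => w _; field.
have Id := integrableDR measurableT Iu Iv.
rewrite RintegralZl//; last exact: integrableBR.
rewrite RintegralB// RintegralD// (gauss_variance g1) !(gauss_variance (X_gauss _)).
by field.
Qed.

(** The increment is almost surely [D], the integral of the process over [[s, t]]. Expectation and
    integral are exchanged for one factor [D] at a time, so that products of two Gaussian variables
    suffice as dominating functions. *)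
Let Y_incr_sqr s t : 0 <= s -> s <= t ->
  \int[P]_w ((Y t w - Y s w) ^+ 2) = \int[mu]_(u in `[s, t]) \int[mu]_(v in `[s, t]) r (v - u).
Proof.
move=> s0 st; have t0 := le_trans s0 st.
pose Z w := -1 * Y s w + 1 * Y t w.
have [vZ gZ] : exists v, is_gauss P Z v by exact: Y_comb_gauss.
have [mZ _] := gZ.
pose D w := \int[mu]_(u in `[s, t]) X u w.
have mD : measurable_fun setT D.
  exact: (@measurable_family_Rintegral _ _ _ T R mu `[s, t]%classic X (measurable_itv _) mX').
have ZD : {ae P, forall w, Z w = D w}.
  have := process_ae_locally_integrable; apply: filterS => w Iw.
  by rewrite /Z /D /integrated_process (@Rintegral_itv_cat R _ 0 s t)//; ring.
have swap (W : T -> R) vW : is_gauss P W vW ->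
    \int[P]_w (W w * D w) = \int[mu]_(u in `[s, t]) \int[P]_w (W w * X u w).
  move=> gW; have [mW _] := gW; pose g u w := W w * X u w.
  have mg : measurable_fun setT (fun z : measurableTypeR R * T => g z.1 z.2).
    by apply: measurable_funM => //; exact: (measurableT_comp mW measurable_snd).
  have gC u : `[s, t]%classic u -> (\int[P]_w `|g u w|%:E <= (vW + r 0)%:E)%E.
    by move=> _; exact: (gauss_mul_integrable gW (X_gauss u)).2.
  have E := @family_Fubini _ _ _ T R mu P `[s, t]%classic g _ (measurable_itv _) (itv_fin _ _) mg gC.
  rewrite -E; apply: ae_eq_Rintegral.
  - exact: measurable_funM.
  - exact: (@measurable_family_Rintegral _ _ _ T R mu `[s, t]%classic g (measurable_itv _) mg).
  - have := process_ae_locally_integrable; apply: filterS => w Iw.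
    by rewrite /g /D RintegralZl.
transitivity (\int[P]_w (Z w * D w)).
  apply: ae_eq_Rintegral.
  - by apply: measurable_funX; exact: measurable_funB.
  - exact: measurable_funM.
  - by apply: filterS ZD => w <-; rewrite /Z; ring.
rewrite (swap _ _ gZ); apply: eq_Rintegral => u _.
transitivity (\int[P]_w (X u w * D w)).
  apply: ae_eq_Rintegral; [exact: measurable_funM|exact: measurable_funM|].
  by apply: filterS ZD => w <-; rewrite mulrC.
rewrite (swap _ _ (X_gauss u)); apply: eq_Rintegral => v _.
by under eq_Rintegral do rewrite mulrC; exact: X_cov.
Qed.

Variable V : R -> R.
Hypothesis r_V : forall s t, 0 <= s -> s <= t ->
  \int[mu]_(u in `[s, t]) \int[mu]_(v in `[s, t]) r (v - u) = V (t - s).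

(** The square of the combination equals [(a^2 + a c) Y_s^2 + (c^2 + a c) Y_t^2 - a c (Y_t -
    Y_s)^2], so variances of increments determine everything. *)
Let Y_le_gauss s t a c : 0 <= s -> s <= t ->
  is_gauss P (fun w => a * Y s w + c * Y t w)
    (a ^+ 2 * V s + c ^+ 2 * V t + a * c * (V s + V t - V (t - s))).
Proof.
move=> s0 st; have t0 := le_trans s0 st.
have Y00 w : Y 0 w = 0 by rewrite /integrated_process set_itv1 Rintegral_set1.
have var u : 0 <= u -> \int[P]_w (Y u w ^+ 2) = V u.
  move=> u0; have := Y_incr_sqr (lexx 0) u0; rewrite r_V// subr0 => <-.
  by apply: eq_Rintegral => w _; rewrite Y00 subr0.
have Isq u : 0 <= u -> P.-integrable setT (EFin \o (fun w => Y u w ^+ 2)).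
  move=> u0; have [v g] := Y_comb_gauss 0 1 u0 u0; have := gauss_integrable_sqr g.
  by rewrite /comp; under eq_fun do rewrite mul0r add0r mul1r.
have [vD gD] := Y_comb_gauss (-1) 1 s0 t0.
have ID : P.-integrable setT (EFin \o (fun w => (Y t w - Y s w) ^+ 2)).
  have := gauss_integrable_sqr gD; rewrite /comp.
  by under eq_fun do rewrite mulN1r mul1r addrC.
have [v g] := Y_comb_gauss a c s0 t0.
suff -> : a ^+ 2 * V s + c ^+ 2 * V t + a * c * (V s + V t - V (t - s)) = v by [].
rewrite -(gauss_variance g) -(var s s0) -(var t t0) -(r_V s0 st) -(Y_incr_sqr s0 st).
transitivity (\int[P]_w ((a ^+ 2 + a * c) * Y s w ^+ 2 + (c ^+ 2 + a * c) * Y t w ^+ 2 -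
    a * c * (Y t w - Y s w) ^+ 2)); last by apply: eq_Rintegral => w _; ring.
have I1 := Isq _ s0; have I2 := Isq _ t0.
have J1 := integrableZR measurableT (a ^+ 2 + a * c) I1.
have J2 := integrableZR measurableT (c ^+ 2 + a * c) I2.
have J3 := integrableZR measurableT (a * c) ID.
rewrite RintegralB//; last exact: integrableDR.
rewrite RintegralD// (RintegralZl _ _ I1)// (RintegralZl _ _ I2)// (RintegralZl _ _ ID)//.
move: (Rintegral P setT (fun w => Y s w ^+ 2)) (Rintegral P setT (fun w => Y t w ^+ 2))
  (Rintegral P setT (fun w => (Y t w - Y s w) ^+ 2)) => x y z.
by ring.
Qed.

Lemma integrated_process_gauss s t a c : 0 <= s -> 0 <= t ->
  is_gauss P (fun w => a * Y s w + c * Y t w)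
    (a ^+ 2 * V s + c ^+ 2 * V t + a * c * (V s + V t - V `|t - s|)).
Proof.
move=> s0 t0; have [st|/ltW ts] := leP s t.
  by rewrite ger0_norm ?subr_ge0//; exact: Y_le_gauss.
rewrite distrC ger0_norm ?subr_ge0//.
have := Y_le_gauss c a t0 ts.
under eq_fun do rewrite addrC.
by rewrite (_ : c ^+ 2 * V t + _ + _ = a ^+ 2 * V s + c ^+ 2 * V t + a * c * (V s + V t - V (s - t)))//; ring.
Qed.

End integrated_gaussian_process.

(** * From the covariance of the supOU process to the variance function *)

Section covariance_function.
Context {R : realType}.
Variables (pi : {sigma_finite_measure set R -> \bar R}) (b : R).
Hypotheses (m1 : (moment pi (-1) < +oo)%E).
Local Notation mu := (@lebesgue_measure R).
Local Notation D := (`]0, +oo[%classic : set R).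

(* The covariance of [X t] and [X (t + h)]. *)
Definition supou_cov (h : R) := b / 2 * \int[pi]_(x in D) (x^-1 * expR (- (x * `|h|))).

Lemma measurable_cov_kernel (h : R) : measurable_fun D (fun x : R => x^-1 * expR (- (x * `|h|))).
Proof.
apply: measurable_funM; first exact: measurable_half_lineV.
have m : measurable_fun [set: R] (fun x : R => expR (- (x * `|h|))).
  by apply: measurableT_comp => //; apply: measurable_funN; exact: measurable_funM.
exact: measurable_funS m.
Qed.

Lemma cov_kernel_le (h x : R) : D x -> `|x^-1 * expR (- (x * `|h|))| <= x^-1.
Proof.
move=> /half_line_gt0 x0; rewrite ger0_norm; last by rewrite mulr_ge0 ?expR_ge0// invr_ge0 ltW.
rewrite -[leRHS]mulr1 ler_pM2l ?invr_gt0// expR_le1 oppr_le0 mulr_ge0// ltW//.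
Qed.

Lemma integrable_cov_kernel (h : R) : pi.-integrable D (EFin \o (fun x => x^-1 * expR (- (x * `|h|)))).
Proof.
apply: le_integrable (integrableV m1) => //.
  by apply/measurable_EFinP; exact: measurable_cov_kernel.
move=> x Dx; rewrite lee_fin (le_trans (cov_kernel_le h Dx))// ler_norm//.
Qed.

Lemma supou_cov_cvg0 : supou_cov h @[h --> (0 : R)] --> supou_cov 0.
Proof.
apply/(@cvg_nbhsP _ R^o) => u u0; apply: cvgM; first exact: cvg_cst.
apply: (@Rdominated_cvg _ _ _ pi D (fun n x => x^-1 * expR (- (x * `|u n|))) _ (fun x => x^-1)) => //.
- by move=> n; exact: measurable_cov_kernel.
- exact: measurable_cov_kernel.
- move=> x _; apply: cvgM; first exact: cvg_cst.
  apply: cvgn_expR; apply: cvgN; apply: cvgM; first exact: cvg_cst.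
  exact: cvg_norm.
- exact: integrableV.
- by move=> n x Dx; exact: cov_kernel_le.
Qed.

Lemma FTC_Rintegral (f F : R -> R) (a c : R) : a <= c ->
  (forall x, a <= x <= c -> has_deriv F x (f x)) ->
  (forall x, a <= x <= c -> {for x, continuous f}) ->
  \int[mu]_(x in `[a, c]) f x = F c - F a.
Proof. by move=> ac dF cf; rewrite /Rintegral (FTC_deriv ac dF cf). Qed.

Let deriv_expR_aff (k c y : R) : has_deriv (fun v : R => expR (k * v + c)) y (expR (k * y + c) * k).
Proof.
apply: deriv_ext (deriv_expR (derivD (derivZ k (deriv_id y)) (deriv_cst c y))) _ _ => //.
by rewrite mulr1 addr0.
Qed.

Let Rintegral_expR_aff (k c s t : R) : k != 0 -> s <= t ->
  \int[mu]_(v in `[s, t]) expR (k * v + c) = (expR (k * t + c) - expR (k * s + c)) / k.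
Proof.
move=> k0 st.
rewrite (@FTC_Rintegral _ (fun v => expR (k * v + c) * k^-1) _ _ st); first by rewrite mulrBl.
- by move=> y _; apply: deriv_ext (derivZr k^-1 (deriv_expR_aff k c y)) _ _ => //; rewrite mulfK.
- by move=> y _; exact: deriv_continuous (deriv_expR_aff k c y).
Qed.

Let continuous_integrable (f : R -> R) (s t : R) : continuous f -> mu.-integrable `[s, t] (EFin \o f).
Proof.
move=> cf; apply: continuous_compact_integrable; first exact: segment_compact.
exact: continuous_subspaceT.
Qed.

Let expR_aff_continuous (k c : R) : continuous (fun v : R => expR (k * v + c)).
Proof. by move=> y; exact: deriv_continuous (deriv_expR_aff k c y). Qed.

Let exp_abs_continuous (x u : R) : continuous (fun v : R => expR (- (x * `|v - u|))).
Proof.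
move=> v; apply: (@continuous_comp _ _ _ (fun v : R => - (x * `|v - u|)) expR); last exact: continuous_expR.
apply: cvgN; apply: cvgM; first exact: cvg_cst.
by apply: cvg_norm; apply: cvgB; [exact: cvg_id|exact: cvg_cst].
Qed.

Let inner_integral (x s t u : R) : 0 < x -> s <= u <= t ->
  \int[mu]_(v in `[s, t]) expR (- (x * `|v - u|)) =
  (2 - expR (- (x * (u - s))) - expR (- (x * (t - u)))) / x.
Proof.
move=> x0 /andP[su ut].
rewrite (@Rintegral_itv_cat R _ s u t)//; last exact: continuous_integrable.
have -> : \int[mu]_(v in `[s, u]) expR (- (x * `|v - u|)) = (1 - expR (- (x * (u - s)))) / x.
  transitivity (\int[mu]_(v in `[s, u]) expR (x * v + - (x * u))).
    apply: eq_Rintegral => v; rewrite inE/= in_itv/= => /andP[_ vu].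
    by rewrite distrC ger0_norm ?subr_ge0//; congr expR; ring.
  rewrite Rintegral_expR_aff ?gt_eqF// subrr expR0; congr ((_ - expR _) / _); ring.
have -> : \int[mu]_(v in `[u, t]) expR (- (x * `|v - u|)) = (1 - expR (- (x * (t - u)))) / x.
  transitivity (\int[mu]_(v in `[u, t]) expR (- x * v + x * u)).
    apply: eq_Rintegral => v; rewrite inE/= in_itv/= => /andP[uv _].
    by rewrite ger0_norm ?subr_ge0//; congr expR; ring.
  rewrite Rintegral_expR_aff ?oppr_eq0 ?gt_eqF//.
  rewrite (_ : - x * u + x * u = 0) ?expR0; last by ring.
  rewrite (_ : - x * t + x * u = - (x * (t - u))); last by ring.
  by rewrite invrN mulrN -mulNr opprB.
by rewrite -mulrDl; congr (_ / _); ring.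
Qed.

Let outer_integral (x s t : R) : 0 < x -> s <= t ->
  \int[mu]_(u in `[s, t]) (2 - expR (- (x * (u - s))) - expR (- (x * (t - u)))) =
  2 * kern (x * (t - s)) / x.
Proof.
move=> x0 st.
have xn0 : x != 0 by rewrite gt_eqF.
transitivity (\int[mu]_(u in `[s, t]) (2 - expR (- x * u + x * s) - expR (x * u + - (x * t)))).
  by apply: eq_Rintegral => u _; congr (2 - expR _ - expR _); ring.
have I1 := continuous_integrable s t (@expR_aff_continuous (- x) (x * s)).
have I2 := continuous_integrable s t (@expR_aff_continuous x (- (x * t))).
have I0 : mu.-integrable `[s, t] (EFin \o (fun=> 2)).
  by apply: continuous_integrable => ?; exact: cvg_cst.
rewrite RintegralB//; last exact: integrableBR.
rewrite RintegralB// Rintegral_cst// !Rintegral_expR_aff ?oppr_eq0//.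
have -> : fine (mu `[s, t]%classic) = t - s.
  rewrite lebesgue_measure_itv/= lte_fin; case: ltP => h //=.
  by rewrite (le_anti (introT andP (conj st h))) subrr.
rewrite (_ : x * t + - (x * t) = 0) ?expR0; last by ring.
rewrite (_ : - x * s + x * s = 0) ?expR0; last by ring.
rewrite (_ : - x * t + x * s = - (x * (t - s))); last by ring.
rewrite (_ : x * s + - (x * t) = - (x * (t - s))); last by ring.
by rewrite /kern; field.
Qed.

Let mV : measurable_fun [set: R] (fun x : R => x^-1 * \1_D x).
Proof.
have := (measurable_restrictT (fun x : R => x^-1) (measurable_itv _)).1 (@measurable_half_lineV R).
congr measurable_fun; apply/funext => x; rewrite patchE indicE.
by case: ifPn => _; rewrite ?mulr1// mulr0.
Qed.

Let indic_Rintegral (f : R -> R) : \int[pi]_x (f x * \1_D x) = \int[pi]_(x in D) f x.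
Proof.
rewrite [RHS]Rintegral_mkcond; apply: eq_Rintegral => x _; rewrite patchE indicE.
by case: ifPn => _; rewrite ?mulr1// mulr0.
Qed.

Let indic_integral_abs (f : R -> R) : (\int[pi]_x `|f x * \1_D x|%:E = \int[pi]_(x in D) `|f x|%:E)%E.
Proof.
rewrite [RHS]integral_mkcond; apply: eq_integral => x _; rewrite patchE indicE.
by case: ifPn => _; rewrite ?mulr1// mulr0 normr0.
Qed.

Let moment1 : (\int[pi]_(x in D) (x^-1)%:E = (fine (moment pi (-1)))%:E)%E.
Proof.
have I := integrable_fin_num (measurable_itv _) (integrableV m1).
by rewrite -(fineK I) (moment_natN pi 1).
Qed.

Let itv_fin (s t : R) : (mu `[s, t]%classic < +oo)%E.
Proof. by rewrite lebesgue_measure_itv/=; case: ifP => _; rewrite ?ltry// -EFinB ltry. Qed.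

Let cov_inner s t u : s <= u <= t ->
  \int[mu]_(v in `[s, t]) supou_cov (v - u) =
  b / 2 * \int[pi]_(x in D) (x^-1 ^+ 2 * (2 - expR (- (x * (u - s))) - expR (- (x * (t - u))))).
Proof.
move=> sut; pose g (v x : R) := x^-1 * expR (- (x * `|v - u|)) * \1_D x.
have mg : measurable_fun setT (fun z : measurableTypeR R * R => g z.1 z.2).
  rewrite /g (_ : (fun z => _) = (fun z : measurableTypeR R * R =>
      (z.2^-1 * \1_D z.2) * expR (- (z.2 * `|z.1 - u|)))); last by apply/funext => z; ring.
  apply: measurable_funM; first exact: (measurableT_comp mV measurable_snd).
  apply: measurableT_comp => //; apply: measurable_funN; apply: measurable_funM => //.
  apply: measurableT_comp => //; exact: measurable_funB.
have gC v : `[s, t]%classic v -> (\int[pi]_x `|g v x|%:E <= (fine (moment pi (-1)))%:E)%E.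
  move=> _; rewrite /g indic_integral_abs -moment1; apply: ge0_le_integral => //.
  - by apply/measurable_EFinP; apply: measurableT_comp => //; exact: measurable_cov_kernel.
  - by apply/measurable_EFinP; exact: measurable_half_lineV.
  - by move=> x Dx; rewrite lee_fin; exact: cov_kernel_le.
have E := @family_Fubini _ _ _ R R mu pi `[s, t]%classic g _ (measurable_itv _) (itv_fin _ _) mg gC.
have Im := @family_integrable_mean _ _ _ R R mu pi `[s, t]%classic g _ (measurable_itv _) (itv_fin _ _) mg gC.
transitivity (b / 2 * \int[mu]_(v in `[s, t]) \int[pi]_x g v x).
  rewrite -RintegralZl//.
  by apply: eq_Rintegral => v _; rewrite /g indic_Rintegral.
rewrite -E; congr (_ * _); rewrite -[RHS]indic_Rintegral; apply: eq_Rintegral => x _.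
rewrite indicE; case: (boolP (x \in D)) => xD; last first.
  rewrite mulr0 /g indicE (negPf xD) (@eq_Rintegral _ _ _ mu _ (fun=> 0)); last by move=> v _; rewrite mulr0.
  by rewrite Rintegral_cst// mul0r.
have x0 : 0 < x by apply: half_line_gt0; move: xD; rewrite inE.
rewrite mulr1 /g indicE xD; under eq_Rintegral do rewrite mulr1.
rewrite RintegralZl//; last exact: continuous_integrable.
by rewrite inner_integral//; field; rewrite gt_eqF.
Qed.

(** For fixed [x] the double integral of [exp (- x |v - u|)] over the square is
    [2 kern (x (t - s)) / x^2]; the factor [1 / (2 x)] turns this into [vint]. *)
Lemma supou_cov_double_integral s t : s <= t ->
  \int[mu]_(u in `[s, t]) \int[mu]_(v in `[s, t]) supou_cov (v - u) = supvar pi b (t - s).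
Proof.
move=> st.
pose g (u x : R) := x^-1 ^+ 2 * (2 - expR (- (x * (u - s))) - expR (- (x * (t - u)))) * \1_D x.
have mg : measurable_fun setT (fun z : measurableTypeR R * R => g z.1 z.2).
  rewrite /g (_ : (fun z => _) = (fun z : measurableTypeR R * R =>
      (z.2^-1 * \1_D z.2) * (z.2^-1 * \1_D z.2) * (2 - expR (- (z.2 * (z.1 - s))) - expR (- (z.2 * (t - z.1)))))).
    apply: measurable_funM.
      by apply: measurable_funM; exact: (measurableT_comp mV measurable_snd).
    apply: measurable_funB; first apply: measurable_funB => //.
      apply: measurableT_comp => //; apply: measurable_funN; apply: measurable_funM => //.
      exact: measurable_funB.
    apply: measurableT_comp => //; apply: measurable_funN; apply: measurable_funM => //.
    exact: measurable_funB.
  apply/funext => z; rewrite indicE; case: (_ \in _); rewrite ?mulr1 ?mulr0 ?mul0r//.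
(* The factor [x^-2] is not integrable in general; [1 - exp (- y) <= y] for both exponentials gains
   a factor [x (t - s)]. *)
have gC u : `[s, t]%classic u -> (\int[pi]_x `|g u x|%:E <= ((t - s) * fine (moment pi (-1)))%:E)%E.
  rewrite /= in_itv/= => /andP[su ut].
  have ts0 : 0 <= t - s by rewrite subr_ge0.
  rewrite /g indic_integral_abs EFinM -moment1 -ge0_integralZl_EFin//; last 2 first.
  - by move=> x /half_line_gt0 x0; rewrite lee_fin invr_ge0 ltW.
  - by apply/measurable_EFinP; exact: measurable_half_lineV.
  apply: ge0_le_integral => //.
  - apply/measurable_EFinP; apply: measurableT_comp => //; apply: measurable_funM; first exact: measurable_half_lineX.
    have m k : measurable_fun [set: R] (fun x : R => expR (- (x * k))).
      by apply: measurableT_comp => //; apply: measurable_funN; exact: measurable_funM.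
    by apply: measurable_funB; [apply: measurable_funB => //|]; exact: measurable_funS (m _).
  - apply: emeasurable_funM => //; apply/measurable_EFinP; exact: measurable_half_lineV.
  - move=> x /half_line_gt0 x0; rewrite -EFinM lee_fin.
    have e1 : 0 <= x * (u - s) by rewrite mulr_ge0 ?subr_ge0// ltW.
    have e2 : 0 <= x * (t - u) by rewrite mulr_ge0 ?subr_ge0// ltW.
    have /andP[_ h1] := onem_expRN_bound e1; have /andP[_ h2] := onem_expRN_bound e2.
    have l1 : expR (- (x * (u - s))) <= 1 by rewrite expR_le1 oppr_le0.
    have l2 : expR (- (x * (t - u))) <= 1 by rewrite expR_le1 oppr_le0.
    rewrite ger0_norm; last first.
      rewrite mulr_ge0//; first by rewrite exprn_ge0// invr_ge0 ltW.
      by move: l1 l2; lra.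
    apply: (@le_trans _ _ (x^-1 ^+ 2 * (x * (t - s)))).
      rewrite ler_wpM2l//; first by rewrite exprn_ge0// invr_ge0 ltW.
      by move: h1 h2; lra.
    by rewrite le_eqVlt; apply/orP; left; apply/eqP; field; rewrite gt_eqF.
have E := @family_Fubini _ _ _ R R mu pi `[s, t]%classic g _ (measurable_itv _) (itv_fin _ _) mg gC.
have Im := @family_integrable_mean _ _ _ R R mu pi `[s, t]%classic g _ (measurable_itv _) (itv_fin _ _) mg gC.
transitivity (b / 2 * \int[mu]_(u in `[s, t]) \int[pi]_x g u x).
  rewrite -RintegralZl//; apply: eq_Rintegral => u; rewrite inE/= in_itv/= => sut.
  by rewrite /g indic_Rintegral cov_inner.
rewrite -E /supvar -mulrA; congr (_ * _).
rewrite -[X in _ = X]indic_Rintegral.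
have I3 := integrable_vint m1 (_ : 0 <= t - s).
transitivity (2^-1 * \int[pi]_x (2 * vint (t - s) x * \1_D x)).
  congr (_ * _); apply: eq_Rintegral => x _.
  rewrite indicE; case: (boolP (x \in D)) => xD; last first.
    rewrite mulr0 /g indicE (negPf xD) (@eq_Rintegral _ _ _ mu _ (fun=> 0)); last by move=> v _; rewrite mulr0.
    by rewrite Rintegral_cst// mul0r.
  have x0 : 0 < x by apply: half_line_gt0; move: xD; rewrite inE.
  rewrite mulr1 /g indicE xD; under eq_Rintegral do rewrite mulr1.
  rewrite RintegralZl//.
    by rewrite outer_integral// /vint; field; rewrite gt_eqF.
  apply: continuous_integrable => u.
  apply: cvgB; first apply: cvgB; first exact: cvg_cst.
    exact: deriv_continuous (deriv_expR (derivN (derivZ x (derivB (deriv_id u) (deriv_cst s u))))).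
  exact: deriv_continuous (deriv_expR (derivN (derivZ x (derivB (deriv_cst t u) (deriv_id u))))).
rewrite !indic_Rintegral RintegralZl//; last by apply: I3; rewrite subr_ge0.
by rewrite mulrA mulVf// mul1r.
Qed.

End covariance_function.

(** * Gaussian random measures and their integrals *)

Section product_rule.
Context d (T : measurableType d) (R : realType).
Variable P : probability T R.

Lemma Rintegral_sum (I : Type) (s : seq I) (f : I -> T -> R) :
  (forall i, P.-integrable setT (EFin \o f i)) ->
  \int[P]_w (\sum_(i <- s) f i w) = \sum_(i <- s) \int[P]_w f i w.
Proof.
move=> If; elim: s => [|i s IH].
  by under eq_Rintegral do rewrite big_nil; rewrite Rintegral_cstT big_nil.
under eq_Rintegral do rewrite big_cons; rewrite RintegralD//.
  by rewrite IH big_cons.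
rewrite (_ : EFin \o _ = (fun w => \sum_(j <- s) (EFin \o f j) w)%E); last first.
  by apply/funext => w; rewrite /= sumEFin.
exact: integrable_sum.
Qed.

Lemma integrable_indic_comp (Y : T -> R) (B : set R) : measurable_fun setT Y -> measurable B ->
  P.-integrable setT (EFin \o (fun w => (\1_B (Y w) : R))).
Proof.
move=> mY mB; apply: (@bounded_integrable _ _ _ P _ 1).
  by apply: (measurableT_comp (f := (\1_B : R -> R))) => //; exact: measurable_indic.
by move=> w; rewrite indicE; case: (_ \in _); rewrite ?normr1 ?normr0.
Qed.

(* The levels k/n of [ps], truncated downwards, exhaust [-1, 1]; both sides agree on
   the corresponding step function of [Y]. *)
Lemma bounded_product_rule (W Y : T -> R) (K : R) (ps : R -> R) :
  measurable_fun setT W -> measurable_fun setT Y -> measurable_fun setT ps ->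
  (forall w, `|W w| <= 1) -> (forall y, `|ps y| <= 1) ->
  (forall B : set R, measurable B ->
    \int[P]_w (W w * \1_B (Y w)) = K * \int[P]_w \1_B (Y w)) ->
  \int[P]_w (W w * ps (Y w)) = K * \int[P]_w ps (Y w).
Proof.
move=> mW mY mps W1 ps1 H.
pose lev (n : nat) (k : nat) : set R := ps @^-1` `[(k%:R / n.+1%:R - 1), (k.+1%:R / n.+1%:R - 1)[%classic.
have mlev n k : measurable (lev n k).
  by rewrite -[lev n k]setTI; apply: mps => //; exact: measurable_itv.
pose st (n : nat) (y : R) : R := \sum_(k < (2 * n.+1).+1) (k%:R / n.+1%:R - 1) * \1_(lev n k) y.
have st_close n y : `|ps y - st n y| <= n.+1%:R^-1.
  have n0 : 0 < n.+1%:R :> R by [].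
  have ny := ps1 y; rewrite ler_norml in ny; have /andP[y1 y2] := ny.
  have p0 : 0 <= (ps y + 1) * n.+1%:R by rewrite mulr_ge0// -lerBlDr sub0r.
  pose k0 := Num.truncn ((ps y + 1) * n.+1%:R).
  have /andP[k1 k2] : k0%:R <= (ps y + 1) * n.+1%:R < k0.+1%:R by exact: truncn_itv.
  have k0n : (k0 < (2 * n.+1).+1)%N.
    rewrite ltnS -(ler_nat R); apply: le_trans k1 _; rewrite natrM ler_pM2r//.
    by move: y2; lra.
  have levE k : \1_(lev n k) y = (k == k0)%:R :> R.
    rewrite indicE; congr (_%:R); congr nat_of_bool; apply/idP/eqP.
      rewrite inE /lev /= in_itv/= lerBlDr ltrBrDr ler_pdivrMr// ltr_pdivlMr// => /andP[h1 h2].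
      apply/eqP; rewrite eqn_leq -ltnS -(ltnS k0) -!(ltr_nat R).
      by rewrite (le_lt_trans h1 k2) (le_lt_trans k1 h2).
    move=> ->; rewrite inE /lev /= in_itv/= lerBlDr ltrBrDr ler_pdivrMr// ltr_pdivlMr//.
    by rewrite k1 k2.
  have -> : st n y = k0%:R / n.+1%:R - 1.
    rewrite /st (bigD1 (Ordinal k0n))//= levE eqxx mulr1 big1 ?addr0// => i ik.
    by rewrite levE (_ : _ == _ = false) ?mulr0//; apply: contraNF ik => /eqP ik; apply/eqP/val_inj.
  have c1 : k0%:R / n.+1%:R <= ps y + 1 by rewrite ler_pdivrMr.
  have c2 : ps y + 1 <= k0%:R / n.+1%:R + n.+1%:R^-1.
    rewrite (_ : _ + _ = k0.+1%:R / n.+1%:R); first by rewrite ler_pdivlMr// ltW.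
    by rewrite -[k0.+1%:R]natr1 mulrDl mul1r.
  rewrite ger0_norm; first by rewrite lerBlDr addrA lerBrDr [leRHS]addrC.
  by rewrite subr_ge0 lerBlDr.
have mst n : measurable_fun setT (st n).
  apply: measurable_sum => k; apply: measurable_funM => //; exact: measurable_indic.
have n1 n : n.+1%:R^-1 <= 1 :> R by rewrite invf_le1// ler1n.
have st2 n y : `|st n y| <= 2.
  rewrite (_ : st n y = ps y - (ps y - st n y)); last by ring.
  rewrite (_ : 2 = 1 + 1 :> R) // (le_trans (ler_normB _ _))// lerD//.
  exact: le_trans (st_close n y) (n1 n).
have E n : \int[P]_w (W w * st n (Y w)) = K * \int[P]_w st n (Y w).
  have I1 k := integrable_indic_comp mY (mlev n k).
  have I2 k : P.-integrable setT (EFin \o (fun w => W w * \1_(lev n k) (Y w))).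
    apply: (@bounded_integrable _ _ _ P _ 1).
      apply: measurable_funM => //.
      by apply: (measurableT_comp (f := (\1_(lev n k) : R -> R))) => //; exact: measurable_indic.
    by move=> w; rewrite indicE; case: (_ \in _); rewrite ?mulr1 ?mulr0 ?normr0.
  have Ist (F : 'I_(2 * n.+1).+1 -> T -> R) : (forall k, P.-integrable setT (EFin \o F k)) ->
      \int[P]_w (\sum_(k < (2 * n.+1).+1) (k%:R / n.+1%:R - 1) * F k w) =
      \sum_(k < (2 * n.+1).+1) (k%:R / n.+1%:R - 1) * \int[P]_w F k w.
    move=> IF; rewrite Rintegral_sum; last by move=> k; exact: integrableZR.
    by apply: eq_bigr => k _; rewrite RintegralZl.
  transitivity (\int[P]_w (\sum_(k < (2 * n.+1).+1) (k%:R / n.+1%:R - 1) * (W w * \1_(lev n k) (Y w)))).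
    by apply: eq_Rintegral => w _; rewrite mulr_sumr; apply: eq_bigr => k _; rewrite mulrCA.
  rewrite Ist// /st Ist// mulr_sumr; apply: eq_bigr => k _.
  by rewrite H// mulrCA.
have IW : P.-integrable setT (EFin \o (fun w => W w * ps (Y w))).
  apply: (@bounded_integrable _ _ _ P _ 1); first by apply: measurable_funM => //; exact: measurableT_comp.
  by move=> w; rewrite normrM -[leRHS]mulr1 ler_pM.
have Ip : P.-integrable setT (EFin \o (fun w => ps (Y w))).
  by apply: (@bounded_integrable _ _ _ P _ 1) => //; exact: measurableT_comp.
have mstY n : measurable_fun setT (fun w => st n (Y w)) by exact: measurableT_comp.
have IWs n : P.-integrable setT (EFin \o (fun w => W w * st n (Y w))).
  apply: (@bounded_integrable _ _ _ P _ 2); first exact: measurable_funM.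
  by move=> w; rewrite normrM -[leRHS]mul1r ler_pM.
have Is n : P.-integrable setT (EFin \o (fun w => st n (Y w))).
  by apply: (@bounded_integrable _ _ _ P _ 2).
apply/eqP; rewrite -subr_eq0 -normr_le0; apply/ler_addgt0Pr => e e0; rewrite add0r.
have K0 : 0 < (1 + `|K|) / e by rewrite divr_gt0// ltr_pwDl.
pose n := Num.truncn ((1 + `|K|) / e).
have hn : (1 + `|K|) * n.+1%:R^-1 <= e.
  rewrite ler_pdivrMr// mulrC -ler_pdivrMr//; exact: ltW (truncnS_gt _).
apply: le_trans hn.
have -> : \int[P]_w (W w * ps (Y w)) - K * \int[P]_w ps (Y w) =
  \int[P]_w (W w * (ps (Y w) - st n (Y w))) - K * \int[P]_w (ps (Y w) - st n (Y w)).
  rewrite RintegralB//; under [X in _ = X - _]eq_Rintegral do rewrite mulrBr.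
  by rewrite RintegralB// E; ring.
have mD : measurable_fun setT (fun w => ps (Y w) - st n (Y w)).
  by apply: measurable_funB => //; exact: measurableT_comp.
apply: le_trans (ler_normB _ _) _; rewrite mulrDl mul1r; apply: lerD.
  apply: Rintegral_bounded; first exact: measurable_funM.
  by move=> w; rewrite normrM -[leRHS]mul1r ler_pM.
by rewrite normrM ler_wpM2l//; apply: Rintegral_bounded.
Qed.

End product_rule.

(** * Joint law of the random measure on disjoint sets *)

Section gaussian_measure.
Context d (T : measurableType d) (R : realType).
Variables (P : probability T R) (pi : {sigma_finite_measure set R -> \bar R}) (b : R).
Variable Lambda : set (R * R) -> {RV P >-> R}.
Hypothesis LG : gaussian_random_measure pi b Lambda.
Local Notation mu2 := (pi \x @lebesgue_measure R)%E.

Lemma bounded_borelS (A B : set (R * R)) : measurable A -> A `<=` B ->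
  bounded_borel B -> bounded_borel A.
Proof.
move=> mA AB [mB BD bB]; split => //; first exact: subset_trans BD.
by case: bB => M [Mr HM]; exists M; split => // x Mx y /AB; exact: HM.
Qed.

Lemma bounded_borel0 : bounded_borel (set0 : set (R * R)).
Proof. by split => //; exists 0; split => // x _ y []. Qed.

Lemma random_measure_gauss A : bounded_borel A ->
  is_gauss P (Lambda A) (b * fine (mu2 A)).
Proof.
move=> bA; have mL : measurable_fun setT (Lambda A) by [].
split => // th c.
have Ic : P.-integrable setT (EFin \o (fun w => cos (th * Lambda A w))).
  by apply: integrable_cos; exact: measurable_funM.
have Is : P.-integrable setT (EFin \o (fun w => sin (th * Lambda A w))).
  apply: (@bounded_integrable _ _ _ P _ 1); last by move=> w; exact: sin_norm_le1.
  apply: measurableT_comp; first exact: continuous_measurable_fun (@continuous_sin R).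
  exact: measurable_funM.
have := LG.2 A bA th; rewrite /charfun => -[Ec Es].
under eq_Rintegral do rewrite cosD mulrC [sin _ * _]mulrC.
rewrite RintegralB//; [|exact: integrableZR|exact: integrableZR].
rewrite !RintegralZl// Ec Es mulr0 subr0; congr (_ * expR _).
by ring.
Qed.

(** Countable additivity along the constant family [set0]: a convergent series with constant terms
    has zero terms. *)
Lemma random_measure_set0 : {ae P, forall w, Lambda set0 w = 0}.
Proof.
have [_ SA] := LG.1.
have := SA (fun=> set0) (fun=> bounded_borel0) (@trivIset_set0 _ _ _).
rewrite bigcup0// => /(_ bounded_borel0); apply: filterS => w H.
have /cvg_series_cvg_0 H0 : cvgn [series Lambda set0 w]_n by apply/cvg_ex; eexists; exact: H.
by apply: (cvgn_unique _ H0); exact: cvg_cst.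
Qed.

Lemma random_measure_bigcup (A : nat -> set (R * R)) n :
  (forall k, bounded_borel (A k)) -> trivIset setT A ->
  bounded_borel (\bigcup_(k in [set k | (k < n)%N]) A k) ->
  {ae P, forall w, Lambda (\bigcup_(k in [set k | (k < n)%N]) A k) w =
    \sum_(k < n) Lambda (A k) w}.
Proof.
move=> bA tA bU; have [_ SA] := LG.1.
pose B k := if (k < n)%N then A k else set0.
have bB k : bounded_borel (B k) by rewrite /B; case: ifP => // _; exact: bounded_borel0.
have tB : trivIset setT B.
  move=> i j _ _; rewrite /B; case: ifP => hi; case: ifP => hj; rewrite ?set0I ?setI0;
    try by case.
  exact: tA.
have UE : \bigcup_k B k = \bigcup_(k in [set k | (k < n)%N]) A k.
  apply/seteqP; split => z [k].
    by rewrite /B; case: ifP => // kn _ Az; exists k.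
  by move=> /= kn Az; exists k => //; rewrite /B kn.
have := SA B bB tB; rewrite UE => /(_ bU); have := random_measure_set0.
apply: filterS2 => w L0 H; apply: (cvgn_unique H).
apply: cvg_near_cst.
near=> m; rewrite /series/=.
have nm : (n <= m)%N by near: m; exists n.
rewrite (big_cat_nat _ nm)//= [X in _ + X]big_nat_cond [X in _ + X]big1 ?addr0; last first.
  by move=> k /andP[/andP[nk _] _]; rewrite /B ltnNge nk.
by rewrite big_mkord; apply: eq_bigr => k _; rewrite /B ltn_ord.
Unshelve. all: end_near. Qed.

Section joint.
Variables (A : nat -> set (R * R)) (th : nat -> R).
Hypotheses (bA : forall k, bounded_borel (A k)) (tA : trivIset setT A).

Let S j w := \sum_(i < j) th i * Lambda (A i) w.
Let ev (J : {fset nat}) (B : nat -> set R) : set T :=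
  \bigcap_(i in [set` J]) Lambda (A i) @^-1` B i.

Let mS j : measurable_fun setT (S j).
Proof. by apply: measurable_sum => i; exact: measurable_funM. Qed.

Let mev J B : (forall i, measurable (B i)) -> measurable (ev J B).
Proof.
move=> mB; apply: fin_bigcap_measurable => // i _.
by rewrite -[_ @^-1` _]setTI; exact: (measurable_funP (Lambda (A i))).
Qed.

Let v i := b * fine (mu2 (A i)).

(* Induction on [j]; the indicator of [ev J B] keeps the independence hypothesis,
   which is about events, available for the next variable. *)
Let joint_step j : forall (J : {fset nat}) (B : nat -> set R) (c : R),
  (forall i, measurable (B i)) -> (forall i, i \in J -> (j <= i)%N) ->
  \int[P]_w (cos (S j w + c) * \1_(ev J B) w) =
  cos c * (\prod_(i < j) expR (- (v i * th i ^+ 2 / 2))) * fine (P (ev J B)).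
Proof.
have [MI _] := LG.1.
have ind (J : {fset nat}) (B : nat -> set R) : (forall i, measurable (B i)) ->
    \int[P]_w \1_(ev J B) w = fine (P (ev J B)).
  by move=> mB; rewrite /Rintegral integral_indic ?setIT//; exact: mev.
elim: j => [|j IH] J B c mB JB.
  rewrite big_ord0 mulr1; under eq_Rintegral do rewrite /S big_ord0 add0r.
  rewrite RintegralZl ?ind//.
  apply: (@bounded_integrable _ _ _ P _ 1); first by apply: measurable_indic; exact: mev.
  by move=> w; rewrite indicE; case: (_ \in _); rewrite ?normr1 ?normr0.
pose K c' := cos c' * (\prod_(i < j) expR (- (v i * th i ^+ 2 / 2))) * fine (P (ev J B)).
have jJ : j \notin J by apply/negP => /JB; rewrite ltnn.
have [mL gL] := random_measure_gauss (bA j).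
have m1 := measurable_indic (mev J mB).
have mW c' : measurable_fun setT (fun w => cos (S j w + c') * (\1_(ev J B) w : R)).
  by apply: measurable_funM => //; apply: measurable_cosf; exact: measurable_funD.
have W1 c' w : `|cos (S j w + c') * (\1_(ev J B) w : R)| <= 1.
  rewrite normrM -[leRHS]mulr1 ler_pM ?cos_norm_le1// indicE.
  by case: (_ \in _); rewrite ?normr1 ?normr0.
have H c' (C : set R) : measurable C ->
    \int[P]_w ((cos (S j w + c') * \1_(ev J B) w) * \1_C (Lambda (A j) w)) =
    K c' * \int[P]_w \1_C (Lambda (A j) w).
  move=> mC.
  have mpre : measurable (Lambda (A j) @^-1` C) by rewrite -[X in measurable X]setTI; exact: mL.
  (* Adjoining [j] with the constraint [C] turns the product of indicators into an event of the form
     [ev], to which the induction hypothesis applies. *)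
  pose B' i := if i == j then C else B i.
  have mB' i : measurable (B' i) by rewrite /B'; case: ifP.
  have evE : ev (j |` J)%fset B' = ev J B `&` (Lambda (A j) @^-1` C).
    apply/seteqP; split => w.
      move=> h; split.
        move=> i /= iJ; have /= := h i; rewrite /B' (_ : i == j = false); last first.
          by apply/negbTE; apply: contraNneq jJ => <-.
        by apply; rewrite !inE iJ orbT.
      by have /= := h j; rewrite /B' eqxx; apply; rewrite !inE eqxx.
    move=> [h1 h2] i /=; rewrite !inE /B' => /orP[/eqP ->|iJ]; first by rewrite eqxx.
    rewrite (_ : i == j = false); first exact: h1.
    by apply/negbTE; apply: contraNneq jJ => <-.
  have := IH (j |` J)%fset B' c' mB'.
  move=> /(_ _); rewrite evE => E.
  transitivity (\int[P]_w (cos (S j w + c') * \1_(ev J B `&` (Lambda (A j) @^-1` C)) w)).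
    by apply: eq_Rintegral => w _; rewrite -mulrA; congr (_ * _); rewrite indicI.
  rewrite E; last by move=> i; rewrite !inE => /orP[/eqP ->//|/JB/ltnW].
  rewrite /K -!mulrA; congr (_ * (_ * _)).
  have := MI A bA tA (j |` J)%fset B' mB'; rewrite -[\bigcap_(_ in _) _]/(ev _ _) evE => ->.
  rewrite big_fsetU1//= {1}/B' eqxx fineM; last 2 first.
  - exact: fin_num_measure.
  - apply: prode_fin_num => i _; apply: fin_num_measure.
    by rewrite -[_ @^-1` _]setTI; exact: (measurable_funP (Lambda (A i))).
  rewrite mulrC; congr (_ * _).
    rewrite (MI A bA tA J B mB); congr fine; rewrite big_seq [RHS]big_seq.
    apply: eq_bigr => i iJ; rewrite /B' (_ : i == j = false)//.
    by apply/negbTE; apply: contraNneq jJ => <-.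
  by rewrite /Rintegral (integral_indic _ measurableT mpre) setIT.
have mth (f : R -> R) : continuous f -> measurable_fun setT (fun y : R => f (th j * y)).
  move=> cf; apply: (measurableT_comp (f := f)); first exact: continuous_measurable_fun.
  exact: measurable_funM.
have Ec := bounded_product_rule (mW c) mL (mth _ (@continuous_cos R)) (W1 c)
  (fun y => cos_norm_le1 _) (H c).
(* In the addition formula for [cos (S j.+1 + c)] the sine of the partial sum is a cosine at phase
   [c - pi / 2], also covered by induction; its term vanishes because the new variable has
   [E sin = 0]. *)
have Es := bounded_product_rule (mW (c - trigo.pi / 2)) mL (mth _ (@continuous_sin R))
  (W1 (c - trigo.pi / 2)) (fun y => sin_norm_le1 _) (H (c - trigo.pi / 2)).
have cosE : \int[P]_w cos (th j * Lambda (A j) w) = expR (- (v j * th j ^+ 2 / 2)).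
  by have := gL (th j) 0; rewrite cos0 mul1r; under eq_Rintegral do rewrite addr0.
have sinE : \int[P]_w sin (th j * Lambda (A j) w) = 0.
  have := gL (th j) (- (trigo.pi / 2)); rewrite cosN cos_pihalf mul0r => <-.
  by apply: eq_Rintegral => w _; rewrite -cosBpihalf.
transitivity (\int[P]_w (cos (S j w + c) * \1_(ev J B) w * cos (th j * Lambda (A j) w) -
   cos (S j w + (c - trigo.pi / 2)) * \1_(ev J B) w * sin (th j * Lambda (A j) w))).
  apply: eq_Rintegral => w _.
  rewrite addrA cosBpihalf {1}/S big_ord_recr /= -/(S j w) addrAC cosD; ring.
have IB (f : R -> R) c' : continuous f -> (forall y, `|f y| <= 1) -> P.-integrable setT
   (EFin \o (fun w => cos (S j w + c') * (\1_(ev J B) w : R) * f (th j * Lambda (A j) w))).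
  move=> cf f1; apply: (@bounded_integrable _ _ _ P _ 1).
    apply: measurable_funM => //; exact: measurableT_comp (mth _ cf) mL.
  by move=> w; rewrite normrM -[leRHS]mulr1 ler_pM.
rewrite RintegralB//; last 2 first.
- by apply: IB; [exact: continuous_cos|exact: cos_norm_le1].
- by apply: IB; [exact: continuous_sin|exact: sin_norm_le1].
rewrite Ec Es cosE sinE mulr0 subr0 big_ord_recr /= /K; ring.
Qed.

Lemma random_measure_sum_charfun n c : \int[P]_w cos (S n w + c) =
  cos c * \prod_(i < n) expR (- (v i * th i ^+ 2 / 2)).
Proof.
have := @joint_step n fset0 (fun=> setT) c (fun=> measurableT).
rewrite /ev (_ : [set` fset0] = set0) ?bigcap_set0; last by apply/seteqP; split => x //=; rewrite inE.
rewrite (congr1 fine (probability_setT P)) mulr1 => <-; last by move=> i; rewrite inE.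
by apply: eq_Rintegral => w _; rewrite indicT mulr1.
Qed.

End joint.

Lemma random_measure_sum_gauss (A : nat -> set (R * R)) (a : nat -> R) n :
  (forall k, bounded_borel (A k)) -> trivIset setT A ->
  is_gauss P (fun w => \sum_(i < n) a i * Lambda (A i) w)
    (b * \sum_(i < n) a i ^+ 2 * fine (mu2 (A i))).
Proof.
move=> bA tA; split; first by apply: measurable_sum => i; exact: measurable_funM.
move=> u c; have := random_measure_sum_charfun (fun i => u * a i) bA tA n c.
under eq_Rintegral => w _.
  rewrite (_ : \sum_(i < n) u * a i * Lambda (A i) w = u * \sum_(i < n) a i * Lambda (A i) w); first over.
  by rewrite mulr_sumr; apply: eq_bigr => i _; rewrite mulrA.
move=> ->; congr (_ * _); rewrite -expR_sum; congr expR.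
rewrite mulr_sumr !mulr_suml -sumrN; apply: eq_bigr => i _; ring.
Qed.

End gaussian_measure.

Lemma ae_all_seq d (T : measurableType d) (R : realType) (P : {measure set T -> \bar R})
    (I : eqType) (s : seq I) (Q : I -> T -> Prop) :
  (forall i, i \in s -> {ae P, forall w, Q i w}) ->
  {ae P, forall w, forall i, i \in s -> Q i w}.
Proof.
elim: s => [|i s IH] H; first by apply: aeW => w j; rewrite in_nil.
have Hi := H i (mem_head _ _).
have Hs : {ae P, forall w, forall i, i \in s -> Q i w}.
  by apply: IH => j js; apply: H; rewrite in_cons js orbT.
by apply: filterS2 Hi Hs => w qi qs j; rewrite in_cons => /predU1P[->|/qs].
Qed.

(** Markov's inequality: [1 <= M / x] on [(0, M]]. *)
Lemma half_line_itv_lty (R : realType) (pi : {measure set R -> \bar R}) (M : R) :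
  (moment pi (-1) < +oo)%E -> 0 < M -> (pi (`]0%R, M]%classic : set R) < +oo)%E.
Proof.
move=> m1 M_gt0.
have moment1 : (\int[pi]_(x in `]0%R, +oo[) (x^-1)%:E < +oo)%E.
  by have := m1; rewrite (moment_natN pi 1).
apply: (@le_lt_trans _ _ (\int[pi]_(x in `]0%R, M]) (M * x^-1)%:E)%E).
  rewrite -[leLHS]mul1e -integral_cst//; apply: ge0_le_integral => //.
  - apply/measurable_EFinP; apply: measurable_funM => //.
    apply: measurable_funS (@measurable_half_lineV R) => // x /=.
    by rewrite !in_itv/= andbT => /andP[].
  - move=> x /=; rewrite in_itv/= => /andP[x0 xM]; rewrite lee_fin.
    by rewrite ler_pdivlMr// mul1r.
have -> : (\int[pi]_(x in `]0%R, M]) (M * x^-1)%:E = M%:E * \int[pi]_(x in `]0%R, M]) (x^-1)%:E)%E.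
  under eq_integral do rewrite EFinM.
  rewrite ge0_integralZl_EFin// ?ltW//.
    by move=> x /=; rewrite in_itv/= => /andP[x0 _]; rewrite lee_fin invr_ge0 ltW.
  apply/measurable_EFinP; apply: measurable_funS (@measurable_half_lineV R) => // x /=.
  by rewrite !in_itv/= andbT => /andP[].
apply: lte_mul_pinfty => //; first by rewrite lee_fin ltW.
apply: le_lt_trans moment1; apply: ge0_subset_integral => //.
- by apply/measurable_EFinP; exact: measurable_half_lineV.
- by move=> x /half_line_gt0 x0; rewrite lee_fin invr_ge0 ltW.
- by move=> x /=; rewrite !in_itv/= andbT => /andP[].
Qed.

(** * Integrals of simple functions *)

Section simple_integral.
Context d (T : measurableType d) (R : realType).
Variables (P : probability T R) (pi : {sigma_finite_measure set R -> \bar R}) (b : R).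
Variable Lambda : set (R * R) -> {RV P >-> R}.
Hypothesis LG : gaussian_random_measure pi b Lambda.
Hypothesis m1 : (moment pi (-1) < +oo)%E.
Local Notation mu2 := (pi \x @lebesgue_measure R)%E.
Local Notation S f := (simple_stoch_integral Lambda f setT).

Lemma bounded_borelU (A B : set (R * R)) : bounded_borel A -> bounded_borel B ->
  bounded_borel (A `|` B).
Proof.
move=> [mA AD [M [Mr HM]]] [mB BD [N [Nr HN]]]; split; first exact: measurableU.
  by move=> z [/AD|/BD].
exists (Num.max M N); split; first by rewrite num_real.
by move=> x; rewrite gt_max => /andP[Mx Nx] z [Az|Bz]; [exact: HM Az|exact: HN Bz].
Qed.

Lemma random_measureU (A B : set (R * R)) : bounded_borel A -> bounded_borel B ->
  A `&` B = set0 -> {ae P, forall w, Lambda (A `|` B) w = Lambda A w + Lambda B w}.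
Proof.
move=> bA bB AB; pose F n := if n == 0%N then A else if n == 1%N then B else set0.
have bF n : bounded_borel (F n).
  by rewrite /F; case: ifP => // _; case: ifP => // _; exact: bounded_borel0.
have tF : trivIset setT F.
  by move=> [|[|i]] [|[|j]] _ _; rewrite /F/= ?AB ?(setIC B) ?AB ?set0I ?setI0 => -[].
have UE : \bigcup_(k in [set k | (k < 2)%N]) F k = A `|` B.
  apply/seteqP; split => z.
    by move=> [[|[|k]]] //= _; [left|right].
  by move=> [?|?]; [exists 0%N|exists 1%N].
have := @random_measure_bigcup _ _ _ _ _ _ _ LG F 2 bF tF; rewrite UE.
move=> /(_ (bounded_borelU bA bB)); apply: filterS => w ->.
by rewrite !big_ord_recl big_ord0 addr0.
Qed.

Lemma random_measure_labels (K : eqType) (L : seq K) (q : R * R -> K) (E : set (R * R)) :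
  uniq L -> bounded_borel E -> (forall k, k \in L -> measurable (E `&` q @^-1` [set k])) ->
  {ae P, forall w, Lambda (E `&` [set z | q z \in L]) w =
    \sum_(k <- L) Lambda (E `&` q @^-1` [set k]) w} /\
  measurable (E `&` [set z | q z \in L]).
Proof.
move=> + bE; elim: L => [|k L IH] /=.
  move=> _ _; rewrite (_ : E `&` _ = set0); last by apply/seteqP; split => z // -[].
  split => //; have := random_measure_set0 LG; apply: filterS => w ->.
  by rewrite big_nil.
move=> /andP[kL uL] mL.
have [IH1 IH2] := IH uL (fun j jL => mL j (mem_behead (s := k :: L) jL)).
have mk := mL k (mem_head _ _).
have UE : E `&` [set z | q z \in k :: L] = (E `&` q @^-1` [set k]) `|` (E `&` [set z | q z \in L]).
  rewrite -setIUr; congr (_ `&` _); apply/seteqP; split => z /=; rewrite in_cons.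
    by move=> /predU1P[->|]; [left|right].
  by move=> [->|->]; rewrite ?eqxx ?orbT.
split; last by rewrite UE; exact: measurableU.
have := @random_measureU (E `&` q @^-1` [set k]) (E `&` [set z | q z \in L]).
move=> /(_ (bounded_borelS mk (@subIsetl _ _ _) bE) (bounded_borelS IH2 (@subIsetl _ _ _) bE)).
have dj : E `&` q @^-1` [set k] `&` (E `&` [set z | q z \in L]) = set0.
  by apply/seteqP; split => z // -[[_ /= ->] [_ /=]]; rewrite (negPf kL).
move=> /(_ dj); apply: filterS2 IH1 => w h1 h2.
by rewrite UE h2 h1 big_cons.
Qed.

(** The integral is defined through the level sets of [f] itself, whereas linearity needs a
    partition common to several functions; the labels [q] provide any finer partition of the
    support. *)
Lemma simple_integral_labels (f : {sfun (R * R)%type >-> R}) (K : eqType) (L : seq K)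
    (q : R * R -> K) (ph : K -> R) (E : set (R * R)) :
  uniq L -> bounded_borel E -> (forall k, k \in L -> measurable (E `&` q @^-1` [set k])) ->
  (forall z, E z -> q z \in L) -> (forall z, E z -> f z = ph (q z)) ->
  (forall z, ~ E z -> f z = 0) ->
  {ae P, forall w, S f w = \sum_(k <- L) ph k * Lambda (E `&` q @^-1` [set k]) w}.
Proof.
move=> uL bE mL EL fq f0.
have frf : finite_set (range f) by exact: fimfunP.
(* Additivity is claimed for nonzero values only, since the level set of 0 may be unbounded; there
   the coefficient vanishes. *)
pose Rg := fset_set (range f).
have H1 : {ae P, forall w, forall c, c \in [seq c <- Rg | c != 0] ->
    Lambda (setT `&` f @^-1` [set c]) w =
    \sum_(k <- [seq k <- L | ph k == c]) Lambda (E `&` q @^-1` [set k]) w}.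
  apply: ae_all_seq => c; rewrite mem_filter => /andP[c0 _].
  have := @random_measure_labels K [seq k <- L | ph k == c] q E (filter_uniq _ uL) bE.
  move=> /(_ _)[k|H _]; first by rewrite mem_filter => /andP[_]; exact: mL.
  have -> : setT `&` f @^-1` [set c] = E `&` [set z | q z \in [seq k <- L | ph k == c]].
    rewrite setTI; apply/seteqP; split => z /=.
      move=> fz; have Ez : E z by apply: contrapT => /f0; rewrite fz => /eqP; rewrite (negPf c0).
      by split => //; rewrite mem_filter EL// andbT -fq// fz.
    by move=> [Ez]; rewrite mem_filter -fq// => /andP[/eqP].
  exact: H.
have H0 := random_measure_set0 LG.
apply: filterS2 H0 H1 => w L0 H; rewrite /simple_stoch_integral fsbig_finite//= -/Rg.
transitivity (\sum_(c <- Rg) \sum_(k <- L | ph k == c) ph k * Lambda (E `&` q @^-1` [set k]) w).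
  apply: eq_big_seq => c cR; have [->|c0] := eqVneq c 0.
    by rewrite mul0r big1// => k /eqP ->; rewrite mul0r.
  rewrite H ?mem_filter ?c0// big_filter mulr_sumr; apply: eq_bigr => k /eqP ->//.
rewrite (exchange_big_dep xpredT)//=; apply: eq_bigr => k _.
have [kR|kR] := boolP (ph k \in Rg).
  under eq_bigl do rewrite eq_sym.
  by rewrite -big_filter (filter_pred1_uniq (fset_uniq _) kR) big_seq1.
rewrite big_seq_cond big1 => [|c /andP[cR /eqP kc]]; last by rewrite kc cR in kR.
(* A label whose value [f] never takes has an empty cell, where [Lambda] vanishes almost surely. *)
rewrite (_ : E `&` _ = set0) ?L0 ?mulr0//.
apply/seteqP; split => z // -[Ez /= qz].
move/negP: kR; apply; rewrite in_fset_set// inE; exists z => //.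
by rewrite fq// qz.
Qed.

Lemma control_measure_lty (A : set (R * R)) : bounded_borel A -> (mu2 A < +oo)%E.
Proof.
move=> [mA AD [M0 [_ HM]]]; pose M := Num.max 1 (M0 + 1).
have M_gt0 : 0 < M by rewrite lt_max ltr01.
have AM : A `<=` `]0, M]%classic `*` `[- M, M]%classic.
  move=> z Az; have [z1 _] := AD z Az.
  have := HM (M0 + 1) _ z Az; rewrite ltrDl => /(_ ltr01).
  rewrite /= prod_normE ge_max => /andP[h1 h2].
  have MM : M0 + 1 <= M by rewrite /M le_max lexx orbT.
  move: z1; rewrite /= in_itv/= andbT => z1.
  split => /=; rewrite in_itv/=; first by rewrite z1 (le_trans _ (le_trans h1 MM))// ler_norm.
  by rewrite -ler_norml (le_trans h2).
have mp : measurable (`]0, M]%classic : set R) by exact: measurable_itv.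
have ml : measurable (`[- M, M]%classic : set (measurableTypeR R)) by exact: measurable_itv.
apply: (@le_lt_trans _ _ (mu2 (`]0, M]%classic `*` `[- M, M]%classic))).
  by apply: le_measure; rewrite ?inE//; exact: measurableX.
rewrite product_measure1E//= lebesgue_measure_itv/=.
have pf := half_line_itv_lty m1 M_gt0.
have pff : pi (`]0%R, M]%classic : set R) \is a fin_num by rewrite ge0_fin_numE.
by rewrite -(fineK pff); case: ifP => _; rewrite ?mule0 ?ltry// -EFinB -EFinM ltry.
Qed.

Lemma simple_integral_gauss (f : {sfun (R * R)%type >-> R}) :
  bounded_borel (f @^-1` [set~ 0]) ->
  exists2 v, is_gauss P (S f) (b * v) & (\int[mu2]_z ((f z) ^+ 2)%:E = v%:E)%E.
Proof.
move=> bE; set E := f @^-1` [set~ 0] in bE.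
have frf : finite_set (range f) by exact: fimfunP.
pose Rg : seq R := fset_set (range f).
have mf c : measurable (f @^-1` [set c]).
  by rewrite -[X in measurable X]setTI; exact: measurable_funP.
have mEc c : measurable (E `&` f @^-1` [set c]) by apply: measurableI => //; case: bE.
have RgP z : f z \in Rg by rewrite in_fset_set// inE; exists z.
pose A n := if (n < size Rg)%N then E `&` f @^-1` [set nth 0 Rg n] else set0.
have bA n : bounded_borel (A n).
  rewrite /A; case: ifP => _; last exact: bounded_borel0.
  exact: bounded_borelS (mEc _) (@subIsetl _ _ _) bE.
have tA : trivIset setT A.
  move=> i j _ _; rewrite /A; case: ifP => hi; case: ifP => hj; rewrite ?set0I ?setI0; try by case.
  move=> [z [[_ /= zi] [_ /= zj]]]; apply/eqP.
  by rewrite -(nth_uniq 0 hi hj (fset_uniq _)) -zi zj.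
have E1 : {ae P, forall w, S f w = \sum_(i < size Rg) nth 0 Rg i * Lambda (A i) w}.
  have nE0 z : ~ E z -> f z = 0 by move=> nE; apply: contrapT => fz; apply: nE; exact: fz.
  have H := @simple_integral_labels f R Rg f id E (fset_uniq _) bE (fun c _ => mEc c)
    (fun z _ => RgP z) (fun z _ => erefl) nE0.
  apply: filterS H => w ->; rewrite (big_nth 0) big_mkord; apply: eq_bigr => i _.
  by rewrite /A ltn_ord.
have [mg gg] := @random_measure_sum_gauss _ _ _ _ _ _ _ LG A (nth 0 Rg) (size Rg) bA tA.
have mS : measurable_fun setT (S f).
  rewrite /simple_stoch_integral; under eq_fun do rewrite fsbig_finite//.
  by apply: measurable_sum => c; exact: measurable_funM.
exists (\sum_(i < size Rg) nth 0 Rg i ^+ 2 * fine (mu2 (A i))).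
  split => // th c; rewrite -gg; apply: ae_eq_Rintegral.
  - by apply: measurable_cosf; apply: measurable_funD => //; exact: measurable_funM.
  - by apply: measurable_cosf; apply: measurable_funD => //; exact: measurable_funM.
  - by apply: filterS E1 => w ->.
have mA i : measurable (A i) by case: (bA i).
transitivity (\int[mu2]_z (\sum_(i < size Rg) (nth 0 Rg i ^+ 2)%:E * (\1_(A i) z)%:E))%E.
  apply: eq_integral => z _; have zR := RgP z.
  pose i0 := Ordinal (_ : (index (f z) Rg < size Rg)%N).
  have hi : (index (f z) Rg < size Rg)%N by rewrite index_mem.
  rewrite (bigD1 (Ordinal hi))//= nth_index// big1 ?adde0; last first.
    move=> i /eqP ne; rewrite indicE memNset ?mule0// /A ltn_ord => -[_ /= fz]; apply: ne.
    by apply: val_inj => /=; rewrite fz index_uniq ?fset_uniq.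
  have [fz0|fz0] := eqVneq (f z) 0; first by rewrite fz0 expr0n mul0e.
  rewrite indicE mem_set ?mule1// /A hi; split => /=; last by rewrite nth_index.
  by move/eqP: fz0.
rewrite ge0_integral_sum//; last 2 first.
- move=> i; apply: emeasurable_funM; first exact: measurable_cst.
  by apply/measurable_EFinP; exact: (measurable_indic (mA i)).
- by move=> i z _; rewrite -EFinM lee_fin mulr_ge0 ?sqr_ge0.
rewrite -sumEFin; apply: eq_bigr => i _.
rewrite ge0_integralZl_EFin ?sqr_ge0//; last first.
  by apply/measurable_EFinP; exact: (measurable_indic (mA i)).
have -> : (\int[mu2]_x (\1_(A i) x)%:E = mu2 (A i))%E.
  by apply: etrans (integral_indic mu2 measurableT (mA i)) _; rewrite setIT.
rewrite [RHS]EFinM fineK//  ge0_fin_numE//.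
exact: control_measure_lty.
Qed.

(** All three integrals are expanded over the common partition labelled by the pairs
    [(f z, g z)]. *)
Lemma simple_integral_linear (f g : {sfun (R * R)%type >-> R}) (a c : R) :
  bounded_borel (f @^-1` [set~ 0]) -> bounded_borel (g @^-1` [set~ 0]) ->
  exists h : {sfun (R * R)%type >-> R},
    [/\ forall z, h z = a * f z + c * g z, bounded_borel (h @^-1` [set~ 0])
      & {ae P, forall w, S h w = a * S f w + c * S g w}].
Proof.
move=> bf bg; exists (scale_sfun a f + scale_sfun c g).
set h := scale_sfun a f + scale_sfun c g.
have hE z : h z = a * f z + c * g z by rewrite [a * _]mulrC [c * _]mulrC.
have bE := bounded_borelU bf bg; set E := _ `|` _ in bE.
have nE z : ~ E z -> f z = 0 /\ g z = 0.
  by move=> nE; split; apply: contrapT => h0; apply: nE; [left|right].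
have bh : bounded_borel (h @^-1` [set~ 0]).
  apply: bounded_borelS bE.
    have mh : measurable_fun setT (h : R * R -> R) by exact: measurable_funP.
    by rewrite -[X in measurable X]setTI; apply: mh => //; exact: measurableC.
  move=> z /= hz; apply: contrapT => /nE[fz gz]; apply: hz.
  by apply: etrans (hE z) _; rewrite fz gz !mulr0 addr0.
split => //.
have frf : finite_set (range f) by exact: fimfunP.
have frg : finite_set (range g) by exact: fimfunP.
pose L : seq (R * R) := allpairs pair (fset_set (range f)) (fset_set (range g)).
pose q z := (f z, g z).
have uL : uniq L by apply: allpairs_uniq; rewrite ?fset_uniq// => -[x y] [x' y'] _ _ [-> ->].
have qL z : E z -> q z \in L.
  by move=> _; apply: allpairs_f; rewrite in_fset_set// inE; exists z.
have mE k : k \in L -> measurable (E `&` q @^-1` [set k]).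
  move=> _; apply: measurableI; first by case: bE.
  rewrite (_ : q @^-1` [set k] = f @^-1` [set k.1] `&` g @^-1` [set k.2]); last first.
    apply/seteqP; split => z /=; first by move=> <-.
    by move=> [f1 g1]; rewrite /q f1 g1 -surjective_pairing.
  by apply: measurableI; rewrite -[X in measurable X]setTI; exact: measurable_funP.
have Hf := @simple_integral_labels f _ L q fst E uL bE mE qL (fun z _ => erefl) (fun z h => (nE z h).1).
have Hg := @simple_integral_labels g _ L q snd E uL bE mE qL (fun z _ => erefl) (fun z h => (nE z h).2).
have Hh := @simple_integral_labels h _ L q (fun k => a * k.1 + c * k.2) E uL bE mE qL (fun z _ => hE z).
have {}Hh := Hh (fun z hz => ltac:(by rewrite hE (nE z hz).1 (nE z hz).2 !mulr0 addr0)).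
apply: filterS3 Hf Hg Hh => w -> -> ->.
rewrite !mulr_sumr -big_split/=; apply: eq_bigr => k _; ring.
Qed.

End simple_integral.

(** * Square-integrable limits *)

Section mean_square.
Context dU (U : measurableType dU) (R : realType).
Variable mu : {measure set U -> \bar R}.
Local Notation sqn f := (\int[mu]_z ((f z) ^+ 2)%:E)%E.

Let sqn_ge0 (f : U -> R) : (0 <= sqn f)%E.
Proof. by apply: integral_ge0 => z _; rewrite lee_fin sqr_ge0. Qed.

Let measurable_sqr (f : U -> R) : measurable_fun setT f ->
  measurable_fun setT (fun z => ((f z) ^+ 2)%:E).
Proof. by move=> mf; apply/measurable_EFinP; exact: measurable_funX. Qed.

Lemma mean_square_le (f g h : U -> R) (a c : R) : measurable_fun setT f ->
  measurable_fun setT g -> measurable_fun setT h -> 0 <= a -> 0 <= c ->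
  (forall z, f z ^+ 2 <= a * g z ^+ 2 + c * h z ^+ 2) ->
  (sqn f <= a%:E * sqn g + c%:E * sqn h)%E.
Proof.
move=> mf mg mh a0 c0 fgh.
rewrite -!ge0_integralZl_EFin//; try (by move=> z _; rewrite lee_fin sqr_ge0); try exact: measurable_sqr.
rewrite -ge0_integralD//.
- apply: ge0_le_integral => //.
  + by move=> z _; rewrite lee_fin sqr_ge0.
  + exact: measurable_sqr.
  + by apply: emeasurable_funD; apply: emeasurable_funM => //; exact: measurable_sqr.
  + by move=> z _; rewrite -!EFinM -EFinD lee_fin.
- by move=> z _; rewrite -EFinM lee_fin mulr_ge0 ?sqr_ge0.
- by apply: emeasurable_funM => //; exact: measurable_sqr.
- by move=> z _; rewrite -EFinM lee_fin mulr_ge0 ?sqr_ge0.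
- by apply: emeasurable_funM => //; exact: measurable_sqr.
Qed.

Lemma sqrD_le (x y e : R) : 0 < e -> (x + y) ^+ 2 <= (1 + e) * x ^+ 2 + (1 + e^-1) * y ^+ 2.
Proof.
move=> e0; rewrite -subr_ge0.
have -> : (1 + e) * x ^+ 2 + (1 + e^-1) * y ^+ 2 - (x + y) ^+ 2 = e^-1 * (e * x - y) ^+ 2.
  by field; rewrite gt_eqF.
by rewrite mulr_ge0 ?sqr_ge0// invr_ge0 ltW.
Qed.

(** The weights [1 + e] and [1 + 1 / e] replace the triangle inequality; applied in both directions,
    they first show that the limit has finite norm. *)
Lemma mean_square_limit (f_ : nat -> U -> R) (v_ : nat -> R) (f : U -> R) (v : R) :
  (forall n, measurable_fun setT (f_ n)) -> measurable_fun setT f ->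
  (forall n, sqn (f_ n) = (v_ n)%:E) -> v_ n @[n --> \oo] --> v ->
  (forall e : R, 0 < e -> \forall n \near \oo, (sqn (fun z => (f_ n z - f z)%R) <= e%:E)%E) ->
  sqn f = v%:E.
Proof.
move=> mf_ mf vE cv cf.
have mB n : measurable_fun setT (fun z => f_ n z - f z) by exact: measurable_funB.
have up (e : R) : 0 < e -> \forall n \near \oo, (sqn f <= ((1 + e) * v_ n + e)%:E)%E.
  move=> e0.
  have q0 : 0 < 1 + e^-1 by rewrite ltr_wpDr// invr_ge0 ltW.
  have e1 : 0 <= 1 + e by rewrite addr_ge0// ltW.
  near=> n.
  have h : (sqn (fun z => (f_ n z - f z)%R) <= (e / (1 + e^-1))%:E)%E.
    by near: n; apply: cf; rewrite divr_gt0.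
  have := @mean_square_le f (f_ n) (fun z => f_ n z - f z) (1 + e) (1 + e^-1) mf (mf_ n) (mB n) e1 (ltW q0).
  move=> /(_ _)/le_trans; apply.
    move=> z; have := @sqrD_le (f_ n z) (- (f_ n z - f z)) e e0.
    by rewrite sqrrN opprB addrCA subrr addr0.
  rewrite vE [in leRHS]EFinD [in leRHS]EFinM leeD2l//.
  apply: (@le_trans _ _ ((1 + e^-1)%:E * (e / (1 + e^-1))%:E)%E).
    by rewrite lee_wpmul2l// lee_fin ltW.
  by rewrite -EFinM lee_fin mulrC divfK// gt_eqF.
have low (e : R) : 0 < e -> \forall n \near \oo, ((v_ n)%:E <= (1 + e)%:E * sqn f + e%:E)%E.
  move=> e0.
  have q0 : 0 < 1 + e^-1 by rewrite ltr_wpDr// invr_ge0 ltW.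
  have e1 : 0 <= 1 + e by rewrite addr_ge0// ltW.
  near=> n.
  have h : (sqn (fun z => (f_ n z - f z)%R) <= (e / (1 + e^-1))%:E)%E.
    by near: n; apply: cf; rewrite divr_gt0.
  rewrite -vE.
  have := @mean_square_le (f_ n) f (fun z => f_ n z - f z) (1 + e) (1 + e^-1) (mf_ n) mf (mB n) e1 (ltW q0).
  move=> /(_ _)/le_trans; apply.
    move=> z; have := @sqrD_le (f z) (f_ n z - f z) e e0.
    by rewrite addrC subrK.
  rewrite leeD2l//.
  apply: (@le_trans _ _ ((1 + e^-1)%:E * (e / (1 + e^-1))%:E)%E).
    by rewrite lee_wpmul2l// lee_fin ltW.
  by rewrite -EFinM lee_fin mulrC divfK// gt_eqF.
have fin : sqn f \is a fin_num.
  rewrite ge0_fin_numE//; have [N _ /(_ N (leqnn N))] := up 1 ltr01.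
  by move=> /le_lt_trans; apply; rewrite ltry.
rewrite -(fineK fin); congr (_%:E); set u := fine _ in fin *.
have u_ge0 : 0 <= u by exact: fine_ge0.
have vn0 n : 0 <= v_ n by rewrite -lee_fin -vE.
have v0 : 0 <= v by apply: (cvgr_to_ge cv); exact: nearW.
apply/eqP; rewrite eq_le; apply/andP; split; apply/ler_addgt0Pr => e e0.
  have d0 : 0 < e / (v + 1) by rewrite divr_gt0// ltr_wpDl.
  have H : (1 + e / (v + 1)) * v_ n + e / (v + 1) @[n --> \oo] --> (1 + e / (v + 1)) * v + e / (v + 1).
    by apply: cvgD; [apply: cvgM => //; exact: cvg_cst|exact: cvg_cst].
  apply: (@le_trans _ _ ((1 + e / (v + 1)) * v + e / (v + 1))).
    apply: (cvgr_to_ge H); apply: filterS (up _ d0) => n.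
    by rewrite -(fineK fin) lee_fin.
  by rewrite le_eqVlt; apply/orP; left; apply/eqP; field; rewrite gt_eqF// ltr_wpDl.
have d0 : 0 < e / (u + 1) by rewrite divr_gt0// ltr_wpDl.
apply: (@le_trans _ _ ((1 + e / (u + 1)) * u + e / (u + 1))).
  apply: (cvgr_to_le cv); apply: filterS (low _ d0) => n.
  by rewrite -(fineK fin) -EFinM -EFinD lee_fin.
by rewrite le_eqVlt; apply/orP; left; apply/eqP; field; rewrite gt_eqF// ltr_wpDl.
Unshelve. all: end_near. Qed.

(** Fatou's lemma in the second index of the Cauchy condition. *)
Lemma mean_square_cauchy_cvg (f_ : nat -> U -> R) (f : U -> R) :
  (forall n, measurable_fun setT (f_ n)) -> measurable_fun setT f ->
  {ae mu, forall z, f_ n z @[n --> \oo] --> f z} ->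
  (forall e : R, 0 < e -> exists N, forall n m, (N <= n)%N -> (N <= m)%N ->
    (sqn (fun z => (f_ n z - f_ m z)%R) <= e%:E)%E) ->
  forall e : R, 0 < e -> \forall n \near \oo, (sqn (fun z => (f_ n z - f z)%R) <= e%:E)%E.
Proof.
move=> mf_ mf cf C e e0; have [N HN] := C e e0.
exists N => // n /= Nn.
have mq m : measurable_fun setT (fun z => ((f_ n z - f_ m z) ^+ 2)%:E).
  by apply: measurable_sqr; exact: measurable_funB.
have q0 m z : setT z -> (0 <= ((f_ n z - f_ m z) ^+ 2)%:E)%E by rewrite lee_fin sqr_ge0.
have F := fatou mu measurableT mq q0.
have nn (u : nat -> R) : (forall m, 0 <= u m) -> (0 <= limn_einf (fun m => (u m)%:E))%E.
  move=> u0; rewrite limn_einf_lim; apply: lime_ge; first exact: is_cvg_einfs.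
  by apply: nearW => m; apply: le_ereal_inf_tmp => _ [k _ <-]; rewrite lee_fin.
apply: le_trans (le_trans F _).
  apply: ae_ge0_le_integral => //.
  - by move=> z _; rewrite lee_fin sqr_ge0.
  - by apply: measurable_sqr; exact: measurable_funB.
  - by move=> z _; apply: nn => m; exact: sqr_ge0.
  - rewrite /limn_einf; apply: measurableT_comp => //; apply: measurable_fun_limn_esup => m.
    by apply: measurableT_comp => //; exact: mq.
  - apply: filterS cf => z cz _.
    have H : ((f_ n z - f_ m z) ^+ 2)%:E @[m --> \oo] --> ((f_ n z - f z) ^+ 2)%:E.
      apply: cvg_EFin; first exact: nearW.
      have D : f_ n z - f_ m z @[m --> \oo] --> f_ n z - f z by apply: cvgB => //; exact: cvg_cst.
      exact: (cvgM D D).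
    by rewrite (cvg_limn_einf_sup H).1.
rewrite limn_einf_lim; apply: lime_le; first exact: is_cvg_einfs.
exists N => // m /= Nm.
apply: (@le_trans _ _ (\int[mu]_z ((f_ n z - f_ m z) ^+ 2)%:E)%E); last exact: HN.
by apply: ereal_inf_lbound; exists m => //=.
Qed.

End mean_square.

Lemma cvg_in_probability_linear d (T : measurableType d) (R : realType) (P : probability T R)
    (F G H : nat -> T -> R) (Y Z : T -> R) (a c : R) :
  (forall n, measurable_fun setT (F n)) -> (forall n, measurable_fun setT (G n)) ->
  (forall n, measurable_fun setT (H n)) -> measurable_fun setT Y -> measurable_fun setT Z ->
  (forall n, {ae P, forall w, H n w = a * F n w + c * G n w}) ->
  cvg_in_probability P F Y -> cvg_in_probability P G Z ->
  cvg_in_probability P H (fun w => a * Y w + c * Z w).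
Proof.
move=> mF mG mH mY mZ HE cF cG e e0.
pose k : R := `|a| + `|c| + 1; have k0 : 0 < k by rewrite ltr_wpDl// addr_ge0.
have mA n : measurable [set w | e / k <= `|F n w - Y w|].
  by apply: (@measurable_norm_ge _ _ _ (fun w => F n w - Y w)); exact: measurable_funB.
have mB n : measurable [set w | e / k <= `|G n w - Z w|].
  by apply: (@measurable_norm_ge _ _ _ (fun w => G n w - Z w)); exact: measurable_funB.
have C : (P [set w | (e / k <= `|F n w - Y w|)%R] + P [set w | (e / k <= `|G n w - Z w|)%R])%E @[n --> \oo] --> 0%E.
  rewrite -[X in _ --> X]adde0; apply: cvgeD => //; [apply: cF|apply: cG]; exact: divr_gt0.
apply: (@squeeze_cvge _ _ _ _ (fun=> 0%E) _ _ _ _ _ C); last exact: cvg_cst.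
apply: nearW => n.
rewrite measure_ge0/=; have [N [mN N0 HN]] := HE n.
apply: (@le_trans _ _ (P ([set w | (e / k <= `|F n w - Y w|)%R] `|` [set w | (e / k <= `|G n w - Z w|)%R] `|` N))).
  apply: le_measure; rewrite ?inE.
  - apply: (@measurable_norm_ge _ _ _ (fun w => H n w - (a * Y w + c * Z w))).
    by apply: measurable_funB => //; apply: measurable_funD; exact: measurable_funM.
  - by apply: measurableU => //; exact: measurableU.
  move=> w /= ew; have [hw|hw] := pselect (H n w = a * F n w + c * G n w); last first.
    by right; apply: HN => /=; exact: hw.
  left; have [|h1] := leP (e / k) `|F n w - Y w|; first by left.
  have [|h2] := leP (e / k) `|G n w - Z w|; first by right.
  exfalso; move: ew; apply/negP; rewrite -ltNge hw.
  have -> : a * F n w + c * G n w - (a * Y w + c * Z w) = a * (F n w - Y w) + c * (G n w - Z w) by ring.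
  apply: le_lt_trans (ler_normD _ _) _; rewrite !normrM.
  apply: (@le_lt_trans _ _ (`|a| * (e / k) + `|c| * (e / k))).
    by apply: lerD; apply: ler_wpM2l => //; exact: ltW.
  rewrite -mulrDl mulrA ltr_pdivrMr// mulrC ltr_pM2l// /k ltrDl ltr01//.
apply: le_trans (measureU2 _ _ _) _ => //; first exact: measurableU.
rewrite -[leRHS]adde0; apply: leeD; first exact: measureU2.
by move/eqP: N0; rewrite eq_le => /andP[].
Qed.

(** * Mean-square stochastic integrals *)

Section mean_square_integral.
Context d (T : measurableType d) (R : realType).
Variables (P : probability T R) (pi : {sigma_finite_measure set R -> \bar R}) (b : R).
Variable Lambda : set (R * R) -> {RV P >-> R}.
Hypothesis LG : gaussian_random_measure pi b Lambda.
Hypothesis m1 : (moment pi (-1) < +oo)%E.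
Local Notation mu2 := (pi \x @lebesgue_measure R)%E.
Local Notation S f := (simple_stoch_integral Lambda f setT).

(* Unlike [is_stoch_integral], this notion is visibly closed under linear
   combinations and determines the variance. *)
Definition mean_square_integral (f : R * R -> R) (Y : T -> R) : Prop :=
  [/\ measurable_fun setT f, measurable_fun setT Y
    & exists f_ : nat -> {sfun (R * R)%type >-> R},
      [/\ forall n, bounded_borel (f_ n @^-1` [set~ 0]),
        cvg_in_probability P (fun n => S (f_ n)) Y
      & forall e : R, 0 < e ->
        \forall n \near \oo, (\int[mu2]_z ((f_ n z - f z) ^+ 2)%:E <= e%:E)%E]].

Let mS (f : {sfun (R * R)%type >-> R}) : bounded_borel (f @^-1` [set~ 0]) ->
  measurable_fun setT (S f).
Proof. by move=> /(simple_integral_gauss LG m1)[v []]. Qed.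

Lemma mean_square_integral_gauss f Y : 0 < b -> mean_square_integral f Y ->
  exists2 v, is_gauss P Y (b * v) & (\int[mu2]_z (f z ^+ 2)%:E = v%:E)%E.
Proof.
move=> b0 [mf mY [f_ [bf cY cf]]].
have /choice[v_ Hv] n : exists v, is_gauss P (S (f_ n)) (b * v) /\ (\int[mu2]_z (f_ n z ^+ 2)%:E = v%:E)%E.
  by have [v gv ve] := simple_integral_gauss LG m1 (bf n); exists v.
have [V gV cV] := gauss_limit_exists (fun n => (Hv n).1) mY cY.
exists (V / b); first by rewrite mulrC divfK// gt_eqF.
have ms (s : {sfun (R * R)%type >-> R}) : measurable_fun setT (s : R * R -> R) by exact: measurable_funP.
apply: (@mean_square_limit _ _ R mu2 (fun n => f_ n) v_ f).
- by move=> n; exact: ms.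
- exact: mf.
- by move=> n; exact: (Hv n).2.
- have : b * v_ n / b @[n --> \oo] --> V / b by apply: cvgM => //; exact: cvg_cst.
  by under eq_fun do rewrite mulrAC divff ?gt_eqF// mul1r.
- exact: cf.
Qed.

Lemma mean_square_integral0 : mean_square_integral (fun=> 0) (fun=> 0).
Proof.
split => //; exists (fun=> cst_sfun 0).
have S0 w : S (cst_sfun 0) w = 0.
  by rewrite /simple_stoch_integral fsbig1// => c [z _ <-]; rewrite mul0r.
split.
- move=> _; rewrite (_ : _ @^-1` _ = set0); first exact: bounded_borel0.
  by apply/seteqP; split => z //=.
- move=> e e0; apply: cvg_near_cst; apply: nearW => n.
  rewrite (_ : [set w | _] = set0) ?measure0//; apply/seteqP; split => w //=.
  by rewrite S0 subrr normr0 leNgt e0.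
- move=> e e0; apply: nearW => n; rewrite integral0_eq ?lee_fin ?ltW// => z _ /=.
  by rewrite subrr expr0n.
Qed.

Lemma mean_square_integral_linear f g Y Z a c :
  mean_square_integral f Y -> mean_square_integral g Z ->
  mean_square_integral (fun z => a * f z + c * g z) (fun w => a * Y w + c * Z w).
Proof.
move=> [mf mY [f_ [bf cY cf]]] [mg mZ [g_ [bg cZ cg]]]; split.
- by apply: measurable_funD; exact: measurable_funM.
- by apply: measurable_funD; exact: measurable_funM.
have /choice[h_ Hh] n := simple_integral_linear LG a c (bf n) (bg n).
exists h_; split.
- by move=> n; have [] := Hh n.
- apply: (@cvg_in_probability_linear _ _ _ P (fun n => S (f_ n)) (fun n => S (g_ n))) => //.
  + by move=> n; exact: mS.
  + by move=> n; exact: mS.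
  + by move=> n; apply: mS; have [] := Hh n.
  + by move=> n; have [] := Hh n.
- move=> e e0; pose k := 2 * (a ^+ 2 + c ^+ 2 + 1).
  have k0 : 0 < k by rewrite mulr_gt0// ltr_wpDl// addr_ge0 ?sqr_ge0.
  near=> n.
  have h1 : (\int[mu2]_z ((f_ n z - f z) ^+ 2)%:E <= (e / k)%:E)%E by near: n; apply: cf; exact: divr_gt0.
  have h2 : (\int[mu2]_z ((g_ n z - g z) ^+ 2)%:E <= (e / k)%:E)%E by near: n; apply: cg; exact: divr_gt0.
  have [hE _ _] := Hh n.
  have ms (s : {sfun (R * R)%type >-> R}) : measurable_fun setT (s : R * R -> R) by exact: measurable_funP.
  have := @mean_square_le _ _ R mu2 (fun z => h_ n z - (a * f z + c * g z)) (fun z => f_ n z - f z)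
    (fun z => g_ n z - g z) (2 * a ^+ 2) (2 * c ^+ 2).
  move=> /(_ (measurable_funB (ms (h_ n)) (measurable_funD (measurable_funM (measurable_cst _) mf) (measurable_funM (measurable_cst _) mg)))).
  move=> /(_ (measurable_funB (ms (f_ n)) mf) (measurable_funB (ms (g_ n)) mg)).
  have a0 : 0 <= 2 * a ^+ 2 by rewrite mulr_ge0 ?sqr_ge0.
  have c0 : 0 <= 2 * c ^+ 2 by rewrite mulr_ge0 ?sqr_ge0.
  move=> /(_ a0 c0 _)/le_trans; apply.
    move=> z; rewrite hE.
    set x := f_ n z - f z; set y := g_ n z - g z.
    have -> : a * f_ n z + c * g_ n z - (a * f z + c * g z) = a * x + c * y by rewrite /x /y; ring.
    rewrite -subr_ge0 (_ : _ - _ = (a * x - c * y) ^+ 2) ?sqr_ge0//; ring.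
  apply: (@le_trans _ _ ((2 * a ^+ 2)%:E * (e / k)%:E + (2 * c ^+ 2)%:E * (e / k)%:E)%E).
    by apply: leeD; apply: lee_wpmul2l => //; rewrite lee_fin.
  rewrite -!EFinM -EFinD lee_fin -mulrDl mulrA ler_pdivrMr// mulrC ler_wpM2l ?ltW// /k.
  by rewrite !mulrDr mulr1 ltrDl.
Unshelve. all: end_near. Qed.

Lemma cos_close (x y e : R) : 0 <= e -> `|x| < e -> `|y| < e -> 1 - cos (x - y) <= 2 * e.
Proof.
move=> e0 xe ye; have := cos_lip 0 (x - y); rewrite cos0 sub0r normrN => h.
apply: le_trans (le_trans (ler_norm _) h) _; apply: le_trans (ler_normB _ _) _.
by rewrite mulrDl mul1r lerD// ltW.
Qed.

(* [E cos (S f_n - S f_m) = exp (- b |f_n - f_m|^2 / 2)] tends to 1 by convergence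
   in probability, so the [f_n] are Cauchy in [L^2]; Fatou identifies the limit. *)
Lemma stoch_integral_mean_square f Y : 0 < b -> measurable_fun setT f -> measurable_fun setT Y ->
  is_stoch_integral pi Lambda f Y -> mean_square_integral f Y.
Proof.
move=> b0 mf mY [f_ [bf cf _ cY]]; split => //; exists f_; split => //.
have ms (s : {sfun (R * R)%type >-> R}) : measurable_fun setT (s : R * R -> R) by exact: measurable_funP.
apply: (@mean_square_cauchy_cvg _ _ R mu2 (fun n => f_ n) f); [by move=> n; exact: ms|exact: mf|exact: cf|move=> e e0].
(* The estimate [H] bounds [1 - E cos] by [2 h] plus twice two probabilities of at most [h] each,
   six times [h] in all. *)
pose h := (1 - expR (- (b * e / 2))) / 6.
have h0 : 0 < h.
  by rewrite divr_gt0// subr_gt0 expR_lt1 oppr_lt0 divr_gt0// mulr_gt0.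
have /fine_cvgP[_ /cvgr0Pnorm_le/(_ h h0)[N _ HN]] := cY h h0.
exists N => n m Nn Nm.
have [g [gE bg Sg]] := simple_integral_linear LG 1 (-1) (bf n) (bf m).
have [v [mv gv] ve] := simple_integral_gauss LG m1 bg.
have -> : (\int[mu2]_z ((f_ n z - f_ m z) ^+ 2)%:E = v%:E)%E.
  by rewrite -ve; apply: eq_integral => z _; rewrite gE mul1r mulN1r.
rewrite lee_fin.
pose A k := [set w | h <= `|S (f_ k) w - Y w|].
have mA k : measurable (A k).
  apply: (@measurable_norm_ge _ _ _ (fun w => S (f_ k) w - Y w)); apply: measurable_funB => //; exact: mS.
have E1 : expR (- (b * v / 2)) = \int[P]_w cos (S (f_ n) w - S (f_ m) w).
  have := gv 1 0; rewrite cos0 mul1r expr1n mulr1 => <-; apply: ae_eq_Rintegral.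
  - by apply: measurable_cosf; apply: measurable_funD => //; exact: measurable_funM.
  - by apply: measurable_cosf; apply: measurable_funB; exact: mS.
  - by apply: filterS Sg => w ->; rewrite addr0 !mul1r mulN1r.
have Ind k : P.-integrable setT (EFin \o (fun w => 2 * (\1_(A k) w : R))).
  apply: (@bounded_integrable _ _ _ P _ 2).
    by apply: measurable_funM => //; exact: measurable_indic.
  by move=> w; rewrite indicE; case: (_ \in _); rewrite ?mulr1 ?mulr0 ?normr0// ger0_norm.
have IndE k : \int[P]_w (2 * (\1_(A k) w : R)) = 2 * fine (P (A k)).
  rewrite RintegralZl//; first by rewrite /Rintegral (integral_indic _ measurableT (mA k)) setIT.
  apply: (@bounded_integrable _ _ _ P _ 1); first exact: measurable_indic.
  by move=> w; rewrite indicE; case: (_ \in _); rewrite ?normr1 ?normr0.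
have Ic : P.-integrable setT (EFin \o (fun w => cos (S (f_ n) w - S (f_ m) w))).
  by apply: integrable_cos; apply: measurable_funB; exact: mS.
have I1 (c : R) : P.-integrable setT (EFin \o (fun _ : T => c)).
  by apply: (@bounded_integrable _ _ _ P _ `|c|).
have H : 1 - expR (- (b * v / 2)) <= 2 * h + (2 * fine (P (A n)) + 2 * fine (P (A m))).
  rewrite E1 -(IndE n) -(IndE m) -{1}(Rintegral_cstT P 1) -(Rintegral_cstT P (2 * h)).
  rewrite -RintegralB// -RintegralD// -RintegralD//; last exact: integrableDR.
  apply: le_Rintegral => //.
  - exact: integrableBR.
  - by apply: integrableDR => //; exact: integrableDR.
  move=> w _; rewrite !indicE.
  have c1 := cos_norm_le1 (S (f_ n) w - S (f_ m) w); rewrite ler_norml in c1; have /andP[c2 _] := c1.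
  have hh := ltW h0.
  have [_|wn] := boolP (w \in A n).
    rewrite mulr1n.
    by have : 0 <= (w \in A m)%:R :> R by []; move: c2 hh; lra.
  have [_|wm] := boolP (w \in A m); first by rewrite mulr1n mulr0n; move: c2 hh; lra.
  rewrite !mulr0 !addr0.
  have -> : S (f_ n) w - S (f_ m) w = (S (f_ n) w - Y w) - (S (f_ m) w - Y w) by ring.
  apply: cos_close => //; rewrite ltNge; [move: wn|move: wm]; apply: contraNN; rewrite inE; exact: id.
have Pk k : (N <= k)%N -> fine (P (A k)) <= h.
  by move=> /HN; exact: le_trans (ler_norm _).
have := Pk n Nn; have := Pk m Nm => p1 p2.
have H2 : expR (- (b * e / 2)) <= expR (- (b * v / 2)).
  have E6 : 6 * h = 1 - expR (- (b * e / 2)) by rewrite /h mulrC divfK.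
  by move: H p1 p2 E6; lra.
by move: H2; rewrite ler_expR lerN2 ler_pM2r ?invr_gt0// ler_pM2l.
Qed.

End mean_square_integral.

Lemma integral_expR_Ny (R : realType) (k c m : R) : 0 < k ->
  (\int[@lebesgue_measure R]_(s in `]-oo, m]) (expR (k * s + c))%:E = (expR (k * m + c) / k)%:E)%E.
Proof.
move=> k0; rewrite -[m]opprK.
have cG : continuous (fun s : R => expR (k * s + c)).
  move=> y; exact: deriv_continuous (deriv_expR (derivD (derivZ k (deriv_id y)) (deriv_cst c y))).
rewrite ge0_integration_by_substitutionNy; last 2 first.
- exact: continuous_subspaceT.
- by move=> s _; exact: expR_ge0.
pose F (y : R) := - (expR c / k) * expR (- (k * y)).
have dF (y : R) : has_deriv F y (expR (k * - y + c)).
  apply: deriv_ext (derivZ (- (expR c / k)) (deriv_expR (derivN (derivZ k (deriv_id y))))) _ _ => //.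
  by rewrite (mulrN k y) expRD; field; rewrite gt_eqF.
have cf : continuous (fun y : R => expR (k * - y + c)).
  move=> y; exact: deriv_continuous (deriv_expR (derivD (derivZ k (derivN (deriv_id y))) (deriv_cst c y))).
rewrite (@ge0_continuous_FTC2y _ (fun y => expR (k * - y + c)) F (- m) 0).
- by rewrite /F sub0e -EFinN mulNr opprK mulrN !opprK expRD mulrC mulrA.
- by move=> x _; exact: expR_ge0.
- exact: continuous_subspaceT.
- rewrite -[X in _ --> X](mulr0 (- (expR c / k))); apply: cvgM; first exact: cvg_cst.
  apply: (cvg_comp (fun y : R => k * y) (fun y => expR (- y)) _ (@cvgr_expR R)).
  by apply: gt0_cvgMry => //; exact: cvg_id.
- by move=> x _; apply: ex_derive; exact: dF.
- by apply: cvg_at_right_filter; exact: deriv_continuous (dF _).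
- by move=> x _; rewrite derive1E; apply: (@derive_val _ _ _ _ _ _ _ (dF x)).
Qed.

(** * The supOU process as a Gaussian process *)

Section kernel_covariance.
Context d (T : measurableType d) (R : realType).
Variables (P : probability T R) (pi : {sigma_finite_measure set R -> \bar R}) (b : R).
Variable Lambda : set (R * R) -> {RV P >-> R}.
Hypothesis LG : gaussian_random_measure pi b Lambda.
Hypothesis m1 : (moment pi (-1) < +oo)%E.
Hypothesis b0 : 0 < b.
Local Notation mu := (@lebesgue_measure R).
Local Notation mu2 := (pi \x mu)%E.
Local Notation D := (`]0%R, +oo[%classic : set R).
Local Notation kern2 u v := (fun z => supOU_kernel u z * supOU_kernel v z).

Lemma measurable_supOU_kernel (t : R) : measurable_fun [set: R * R] (supOU_kernel t).
Proof.
apply: measurable_funM.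
  apply: measurableT_comp => //; apply: measurable_funN; apply: measurable_funM => //.
  exact: measurable_funB.
by apply: measurable_indic; apply: measurableX; exact: measurable_itv.
Qed.

Lemma supOU_kernel_ge0 (t : R) z : 0 <= supOU_kernel t z.
Proof. by rewrite mulr_ge0 ?expR_ge0. Qed.

Let section_integral (u v x : R) : D x -> u <= v ->
  (\int[mu]_s (supOU_kernel u (x, s) * supOU_kernel v (x, s))%:E =
   (2^-1 * (x^-1 * expR (- (x * `|u - v|))))%:E)%E.
Proof.
move=> Dx uv; have x0 := half_line_gt0 Dx.
transitivity (\int[mu]_(s in `]-oo, u]) (expR (2 * x * s + - (x * (u + v))))%:E)%E.
  rewrite [RHS]integral_mkcond; apply: eq_integral => s _; rewrite patchE /supOU_kernel/= !indicE.
  have -> : ((x, s) \in D `*` `]-oo, v]%classic) = (s <= v).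
    by apply/idP/idP; rewrite inE/= !in_itv/= x0; [case|move=> h; split].
  have -> : ((x, s) \in D `*` `]-oo, u]%classic) = (s <= u).
    by apply/idP/idP; rewrite inE/= !in_itv/= x0; [case|move=> h; split].
  have -> : (s \in `]-oo, u]%classic) = (s <= u) by apply/idP/idP; rewrite inE/= in_itv.
  case: ifPn => su; last by rewrite mulr0 mul0r.
  by rewrite (le_trans su uv) !mulr1 -expRD; congr (expR _)%:E; ring.
rewrite integral_expR_Ny ?mulr_gt0//; congr EFin.
rewrite distrC ger0_norm ?subr_ge0//.
rewrite (_ : 2 * x * u + _ = - (x * (v - u))); last by ring.
by field; rewrite gt_eqF.
Qed.

Lemma supOU_kernel_product (u v : R) :
  (\int[mu2]_z (supOU_kernel u z * supOU_kernel v z)%:E = (supou_cov pi b (u - v) / b)%:E)%E.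
Proof.
wlog uv : u v / u <= v.
  move=> H; have [|vu] := leP u v; first exact: H.
  under eq_integral do rewrite mulrC.
  by rewrite H ?ltW// /supou_cov distrC.
rewrite (@fubini_tonelli1 _ _ _ _ _ pi mu); last 2 first.
- by apply/measurable_EFinP; apply: measurable_funM; exact: measurable_supOU_kernel.
- by move=> z; rewrite lee_fin mulr_ge0 ?supOU_kernel_ge0.
rewrite /fubini_F.
transitivity (\int[pi]_(x in D) (2^-1 * (x^-1 * expR (- (x * `|u - v|))))%:E)%E.
  rewrite [RHS]integral_mkcond; apply: eq_integral => x _; rewrite patchE.
  case: ifPn => xD; first by move: xD; rewrite inE => Dx; exact: section_integral Dx uv.
  rewrite integral0_eq// => s _; rewrite /supOU_kernel indicE (_ : _ \in _ = false) ?mulr0 ?mul0r//.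
  by apply/negbTE; apply: contraNN xD; rewrite !inE => -[].
have If := integrable_cov_kernel m1 (u - v).
under eq_integral do rewrite EFinM.
rewrite integralZl//.
have ff := integrable_fin_num (measurable_itv _) If.
rewrite -(fineK ff) -EFinM /supou_cov /Rintegral; congr EFin.
by field; rewrite gt_eqF.
Qed.

Let r := supou_cov pi b.

Lemma supOU_kernel_combination (u v a c : R) :
  (\int[mu2]_z ((a * supOU_kernel u z + c * supOU_kernel v z) ^+ 2)%:E =
   ((a ^+ 2 * r 0 + c ^+ 2 * r 0 + 2 * a * c * r (u - v)) / b)%:E)%E.
Proof.
have I (x y : R) : mu2.-integrable setT (fun z => (supOU_kernel x z * supOU_kernel y z)%:E).
  apply/integrableP; split.
    by apply/measurable_EFinP; apply: measurable_funM; exact: measurable_supOU_kernel.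
  under eq_integral do rewrite /= ger0_norm ?mulr_ge0 ?supOU_kernel_ge0//.
  by rewrite supOU_kernel_product ltry.
have IZ (k x y : R) : mu2.-integrable setT (fun z => (k%:E * (supOU_kernel x z * supOU_kernel y z)%:E)%E).
  exact: integrableZl.
have E (k x y : R) : (\int[mu2]_z (k%:E * (supOU_kernel x z * supOU_kernel y z)%:E) = (k * (r (x - y) / b))%:E)%E.
  by rewrite integralZl// supOU_kernel_product -EFinM.
transitivity (\int[mu2]_z (((a ^+ 2)%:E * (supOU_kernel u z * supOU_kernel u z)%:E +
   (c ^+ 2)%:E * (supOU_kernel v z * supOU_kernel v z)%:E) +
   (2 * a * c)%:E * (supOU_kernel u z * supOU_kernel v z)%:E))%E.
  by apply: eq_integral => z _; rewrite -!EFinM -!EFinD; congr EFin; ring.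
rewrite integralD//; last exact: integrableD.
rewrite integralD// !E -!EFinD !subrr; congr EFin; ring.
Qed.

Variable X : R -> T -> R.
Hypothesis X_supOU : supOU pi Lambda X.

Let mX t : measurable_fun setT (X t).
Proof. exact: (measurableT_comp X_supOU.1 (measurable_pair1 t)). Qed.

Let X_ms t : mean_square_integral pi Lambda (supOU_kernel t) (X t).
Proof.
apply: (stoch_integral_mean_square LG m1 b0) (X_supOU.2 t) => //.
exact: measurable_supOU_kernel.
Qed.

Lemma supOU_pair u v a c : is_gauss P (fun w => a * X u w + c * X v w)
  (a ^+ 2 * r 0 + c ^+ 2 * r 0 + 2 * a * c * r (u - v)).
Proof.
have := mean_square_integral_linear LG m1 a c (X_ms u) (X_ms v).
move=> /(mean_square_integral_gauss LG m1 b0)[x gx]; rewrite supOU_kernel_combination => -[xE].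
by move: gx; rewrite -xE mulrC divfK// gt_eqF.
Qed.

Lemma supOU_combination (s : seq (R * R)) :
  exists v, is_gauss P (fun w => \sum_(x <- s) x.1 * X x.2 w) v.
Proof.
suff [f /(mean_square_integral_gauss LG m1 b0)[v gv _]] : exists f,
    mean_square_integral pi Lambda f (fun w => \sum_(x <- s) x.1 * X x.2 w) by exists (b * v).
elim: s => [|x s [f IH]].
  exists (fun=> 0); rewrite (_ : (fun w => _) = (fun=> 0)); first exact: mean_square_integral0.
  by apply/funext => w; rewrite big_nil.
exists (fun z => x.1 * supOU_kernel x.2 z + 1 * f z).
rewrite (_ : (fun w => _) = (fun w => x.1 * X x.2 w + 1 * \sum_(x <- s) x.1 * X x.2 w)); last first.
  by apply/funext => w; rewrite big_cons mul1r.
exact: (mean_square_integral_linear LG m1).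
Qed.

End kernel_covariance.

(** Product measures and Fubini need sigma-finiteness, which follows from the moment: [(-oo, 0]] is
    null and each [(0, n]] has finite mass. *)
Lemma half_line_sigma_finite (R : realType) (pi : {measure set R -> \bar R}) :
  on_half_line pi -> (moment pi (-1) < +oo)%E -> sigma_finite setT pi.
Proof.
move=> pi_half_line m1.
pose F n : set R := if n is n'.+1 then `]0, n'.+1%:R]%classic else [set x | x <= 0].
exists F.
  apply/seteqP; split => // x _; have [x0|x0] := leP x 0; first by exists 0%N.
  exists (Num.truncn x).+1 => //=; rewrite in_itv/= x0 ltW//.
  exact: truncnS_gt.
move=> [|n] /=; last first.
  split; first exact: measurable_itv.
  exact: half_line_itv_lty.
split; last by rewrite -[X in (X < _)%E]/(pi [set x : R | x <= 0]) pi_half_line.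
rewrite (_ : [set x : R | x <= 0] = `]-oo, 0]%classic); first exact: measurable_itv.
by apply/seteqP; split => x /=; rewrite in_itv.
Qed.

(** The part common to both cases; what remains for each is the growth bound and the equivalence of
    the normalizations. *)
Lemma integrated_supOU_lil d (T : measurableType d) (R : realType)
    (P : probability T R) (pi : {sigma_finite_measure set R -> \bar R}) (b : R)
    (Lambda : set (R * R) -> {RV P >-> R}) (X : R -> T -> R) (gam C0 : R) (psi : R -> R) :
  0 < b -> on_half_line pi -> pi [set: R] <> 0%E -> (moment pi (-1) < +oo)%E ->
  gaussian_random_measure pi b Lambda -> supOU pi Lambda X ->
  0 < gam -> 0 < C0 ->
  (exists t0 : R, forall s t, t0 <= s -> s <= t ->
    supvar pi b t <= C0 * (t / s) `^ (2 - gam) * supvar pi b s) ->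
  (\forall t \near +oo, 0 < psi t) ->
  Num.sqrt (2 * supvar pi b t * ln (ln t)) / psi t @[t --> +oo] --> (1 : R) ->
  {ae P, forall w, limsup_pinfty (fun t => `|integrated_process X t w| / psi t) = 1%E}.
Proof.
move=> b0 pi_half_line pi_neq0 m1 LG XS g0 C00 [t0 V_growth] psi0 psi1.
have X_pair := supOU_pair LG m1 b0 XS; have X_comb := supOU_combination LG m1 b0 XS.
have r_cont := @supou_cov_cvg0 _ pi b m1.
have Y_gauss := integrated_process_gauss XS.1 X_pair X_comb r_cont
  (fun s t _ => @supou_cov_double_integral _ pi b m1 s t).
have Y_cont := integrated_process_continuous XS.1 X_pair.
exact: (gaussian_lil Y_gauss (supvar_gt0 pi_half_line pi_neq0 m1 b0)
  (supvar_scale m1 b0) (supvar_incr m1 b0) g0 C00 V_growth Y_cont).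
Qed.

Theorem theorem3 (R : realType) (d : measure_display) (T : measurableType d)
    (P : probability T R) (b : R)
    (pi : {measure set R -> \bar R})
    (Lambda : set (R * R) -> {RV P >-> R}) (X : R -> T -> R)
    (b_gt0 : 0 < b) (pi_half_line : on_half_line pi)
    (pi_neq0 : pi [set: R] <> 0%E)
    (moment_finite : (moment pi (-1) < +oo)%E)
    (Lambda_gaussian : gaussian_random_measure pi b Lambda)
    (X_supOU : supOU pi Lambda X) :
  ((moment pi (-2) < +oo)%E ->
     {ae P, forall w,
       limsup_pinfty (fun t => `|integrated_process X t w| /
         Num.sqrt (2 * b * fine (moment pi (-2)) * t * ln (ln t))) = 1%E}) /\
  (forall (p ell : R -> R) (alpha : R),
     has_density pi p -> 0 < alpha < 1 -> slowly_varying ell ->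
     p ~_(0^'+) (fun x => (alpha * ell x^-1 * x `^ alpha)%R) ->
     {ae P, forall w,
       limsup_pinfty (fun t => `|integrated_process X t w| /
         (Num.sqrt (b * (Gamma (1 + alpha) / ((2 - alpha) * (1 - alpha)))) *
          ell t `^ (1 / 2) * t `^ (1 - alpha / 2) *
          Num.sqrt (2 * ln (ln t)))) = 1%E}).
Proof.
have sf := half_line_sigma_finite pi_half_line moment_finite.
(* [pis] is the same set function as [pi], packed with its sigma-finiteness. *)
pose Hs := isSFinite.Build _ _ _ _ (sfinite_measure_sigma_finite sf).
pose Hf := isSigmaFinite.Build _ _ _ _ sf.
pose pis : {sigma_finite_measure set R -> \bar R} :=
  HB.pack_for (SigmaFiniteMeasure.type R R) (Measure.sort pi) Hs Hf.
have lil := @integrated_supOU_lil _ T R P pis b Lambda X.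
split.
- move=> m2.
  have L0 : 0 < b * fine (moment pi (-2)) by rewrite mulr_gt0// moment2_gt0.
  pose A t := b * fine (moment pi (-2)) * t.
  have psiE t : Num.sqrt (2 * b * fine (moment pi (-2)) * t * ln (ln t)) =
      Num.sqrt (2 * A t * ln (ln t)) by congr (Num.sqrt (_ * _)); rewrite /A !mulrA.
  have A0 : \forall t \near +oo, 0 < A t.
    near=> t; rewrite mulr_gt0//; near: t; exact: nbhs_pinfty_gt.
  have VA : supvar pi b t / A t @[t --> +oo] --> (1 : R).
    have H : supvar pi b t / t / (b * fine (moment pi (-2))) @[t --> +oo] --> (1 : R).
      rewrite -[X in _ --> X](divff (lt0r_neq0 L0)); apply: cvgM; last exact: cvg_cst.
      exact: supvar_linear_cvg.
    under eq_fun do rewrite /A invfM [_^-1 * _]mulrC mulrA.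
    exact: H.
  apply: (lil 1 4) => //.
  + exact: supvar_growth_linear.
  + by have := lil_scale_gt0 A0; apply: filterS => t; rewrite psiE.
  + by under eq_fun do rewrite psiE; exact: lil_scale_cvg.
- move=> p ell al pi_p al01 sv p_equiv.
  have scE := regvar_scaleE b_gt0 al01 sv.
  have A0 := regvar_norm_gt0 b_gt0 al01 sv.
  have VA := @supvar_regvar_cvg _ pi b p ell al moment_finite pi_p al01 sv p_equiv.
  have [al0 _] := andP al01.
  apply: (lil (al / 2) (8 * expR 2)) => //.
  + by rewrite divr_gt0.
  + exact: (supvar_growth_regvar moment_finite b_gt0 pi_p al01 sv p_equiv).
  + have At0 := lil_scale_gt0 A0.
    by apply: filterS2 scE At0 => t ->.
  + pose A t := b * (Gamma (1 + al) / ((2 - al) * (1 - al))) * (ell t * t `^ (2 - al)).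
    have L0 : 0 < b * (Gamma (1 + al) / ((2 - al) * (1 - al))).
      by rewrite mulr_gt0//; exact: regvar_const_gt0.
    have VA1 : supvar pi b t / A t @[t --> +oo] --> (1 : R).
      rewrite -[X in _ --> X](divff (lt0r_neq0 L0)).
      have : supvar pi b t / (ell t * t `^ (2 - al)) /
          (b * (Gamma (1 + al) / ((2 - al) * (1 - al)))) @[t --> +oo] -->
          b * (Gamma (1 + al) / ((2 - al) * (1 - al))) / (b * (Gamma (1 + al) / ((2 - al) * (1 - al)))).
        by apply: cvgM => //; exact: cvg_cst.
      by under eq_fun do rewrite -mulrA -invfM [_ * (b * _)]mulrC.
    have := lil_scale_cvg A0 VA1; apply: cvg_trans; apply: near_eq_cvg.
    by apply: filterS scE => t <-.
Unshelve. all: end_near. Qed.
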